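(* Let $K$ be a number field and let $\rho=\{\rho_v\}_{v\in M_K}$ be an adelic measure. Let $\{F_n\}_{n\ge0}$ be a sequence of pairwise distinct finite $\mathrm{Gal}(\overline K/K)$-invariant subsets of $\mathbb P^1(\overline K)$ such that $\lim_{n\to\infty}h_\rho(F_n)=0$. Then for every place $v\in M_K$, the measures $[F_n]$ converge weakly to $\rho_v$ on $\mathsf P^1(\mathbb C_v)$ as $n\to\infty$.
   Context: Places. $K$ is a number field with algebraic closure $\overline K$. $M_K$ is the set of absolute values $|\cdot|_v$ on $K$ extending the usual absolute value ($v$ infinite) or some $p$-adic absolute value with $|p|_p=p^{-1}$ ($v$ finite) of $\mathbb Q$. $K_v$ is the completion, $\mathbb Q_v$ the closure of $\mathbb Q$ in $K_v$, $N_v=[K_v:\mathbb Q_v]/[K:\mathbb Q]$, and $\mathbb C_v$ is the completion of an algebraic closure of $K_v$. Berkovich line. If $v$ is infinite, $\mathsf P^1(\mathbb C_v)=\mathbb P^1(\mathbb C_v)$ (Riemann sphere). If $v$ is finite, $\mathsf A^1(\mathbb C_v)$ is the set of multiplicative seminorms on $\mathbb C_v[T]$ extending $|\cdot|_v$, and $\mathsf P^1(\mathbb C_v)=\mathsf A^1(\mathbb C_v)\cup\{\infty\}$ is the Berkovich projective line (compact); it contains $\mathbb P^1(\mathbb C_v)$, a point $z\in\mathbb C_v$ being identified with the seminorm $P\mapsto|P(z)|_v$; $\mathbb H_v=\mathsf P^1(\mathbb C_v)\setminus\mathbb P^1(\mathbb C_v)$. Order: $\mathcal S\le\mathcal S'$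 iff $\mathcal S(P)\le\mathcal S'(P)$ for all $P$; $\mathcal S\wedge\mathcal S'$ is the least upper bound; $\mathrm{diam}(\mathcal S)=\inf_{z\in\mathbb C_v}\mathcal S(T-z)$; $\sup\{\mathcal S,\mathcal S'\}=\mathrm{diam}(\mathcal S\wedge\mathcal S')$ (equal to $|z-z'|_v$ on $\mathbb C_v$). $\mathcal S_{\rm can}$ is the Gauss norm (sup norm on the closed unit ball). $d(\mathcal S,\mathcal S')=2\log\sup\{\mathcal S,\mathcal S'\}-\log\mathrm{diam}(\mathcal S)-\log\mathrm{diam}(\mathcal S')$ is a distance on $\mathbb H_v$. $\mathsf P^1(\mathbb C_v)$ is uniquely path connected; for $\mathcal S,\mathcal S'$ let $\mathcal S''$ be the unique point common to the three segments joining pairwise $\mathcal S,\mathcal S',\mathcal S_{\rm can}$, and put $\langle\mathcal S,\mathcal S'\rangle=d(\mathcal S'',\mathcal S_{\rm can})$ if $\mathcal S''\in\mathbb H_v$, $\infty$ otherwise. Laplacian. If $v$ is infinite, $\Delta=dd^c=\frac1{2\pi}(\partial_x^2+\partial_y^2)\,dx\wedge dy$ in the sense of distributions on $\mathbb P^1(\mathbb C_v)$. If $v$ is finite and $\mu$ is a finite signed Borel measure of total mass $0$, $\Delta g=\mu$ means that $g(\mathcal S)=c-\int\langle\mathcal S,\mathcal S'\rangle\,d\mu(\mathcal S')$ on $\mathbb H_v$ for some constant $c$; saying that $g$ is continuous means it extends to a continuous real function on $\mathsf P^1(\mathbb C_v)$. Energy. Let $\mathrm{Diag}_v=\{(z,z):z\in\mathbb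 C_v\}$. When the integrand is integrable, $(\mu,\nu)_v=-\int\log|z-w|_v\,d\mu(z)\otimes d\nu(w)$ over $\mathbb C_v\times\mathbb C_v\setminus\mathrm{Diag}_v$ for $v$ infinite, and $(\mu,\nu)_v=-\int\log\sup\{\mathcal S,\mathcal S'\}\,d\mu(\mathcal S)\otimes d\nu(\mathcal S')$ over $\mathsf A^1(\mathbb C_v)\times\mathsf A^1(\mathbb C_v)\setminus\mathrm{Diag}_v$ for $v$ finite. Put $(\!(\mu,\nu)\!)_v=N_v(\mu,\nu)_v$. Adelic measures and heights. $\lambda_v$ is the normalized Lebesgue measure on the unit circle for $v$ infinite, and the Dirac mass at $\mathcal S_{\rm can}$ for $v$ finite. An adelic measure $\rho=\{\rho_v\}_{v\in M_K}$ is the data, for each $v\in M_K$, of a probability measure $\rho_v$ on $\mathsf P^1(\mathbb C_v)$ such that $\rho_v=\lambda_v$ for all but finitely many $v$, and $\rho_v=\lambda_v+\Delta g_v$ with $g_v$ continuous for every $v$. For a finite nonempty set $F$, $[F]=|F|^{-1}\sum_{\alpha\in F}[\alpha]$, where $[\alpha]$ is the Dirac mass (all sets $F_n$ are nonempty). A $\mathrm{Gal}(\overline K/K)$-invariant finite $F\subset\mathbb P^1(\overline K)$ is viewed in $\mathbb P^1(\mathbb C_v)$ through any $K$-embedding $\overline K\to\mathbb C_v$. For such $F$, $h_\rho(F)=\frac12\sum_{v\in M_K}(\!([F]-\rho_v,[F]-\rho_v)\!)_v$ (only finitely many terms are nonzero). *)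

(* Defs.v *)
From HB Require Import structures.
From mathcomp Require Import all_boot all_order all_algebra all_field.
From mathcomp Require Import finmap.
From mathcomp Require Import all_classical all_reals all_analysis.
From mathcomp Require Import measurable_realfun complex lra.

Set Implicit Arguments.
Unset Strict Implicit.
Unset Printing Implicit Defensive.

Import Order.TTheory GRing.Theory Num.Theory.
Import numFieldNormedType.Exports.

Local Open Scope classical_set_scope.
Local Open Scope ring_scope.

(* ** Borel measures and signed measures *)

Notation borel T := (g_sigma_algebraType (@open T)).

Section signed_measures.
Context {d : measure_display} {T : measurableType d} {R : realType}.
Implicit Types (mu nu : {charge set T -> \bar R}).

Definition hahn_pos mu : set T := projT1 (cid (Hahn_decomposition mu)).

Definition hahn_neg mu : set T :=
  projT1 (cid (projT2 (cid (Hahn_decomposition mu)))).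

Lemma hahnP mu : hahn_decomposition mu (hahn_pos mu) (hahn_neg mu).
Proof. exact: projT2 (cid (projT2 (cid (Hahn_decomposition mu)))). Qed.

Definition pos_part mu : {finite_measure set T -> \bar R} :=
  jordan_pos (hahnP mu).

Definition neg_part mu : {finite_measure set T -> \bar R} :=
  jordan_neg (hahnP mu).

Definition charge_integral mu (f : T -> \bar R) : \bar R :=
  (\int[pos_part mu]_x f x - \int[neg_part mu]_x f x)%E.

(* The integral of f over D for the signed measure mu (x) nu, whose Jordan parts
   are built from those of mu and nu; it is meaningful when f is integrable over
   D for |mu| (x) |nu|. *)
Definition charge_prod_integral mu nu (D : set (T * T)) (f : T * T -> R) : R :=
  Rintegral (pos_part mu \x pos_part nu)%E D f
  + Rintegral (neg_part mu \x neg_part nu)%E D f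
  - Rintegral (pos_part mu \x neg_part nu)%E D f
  - Rintegral (neg_part mu \x pos_part nu)%E D f.

Definition measure_diff (m1 m2 : {finite_measure set T -> \bar R}) :
    {charge set T -> \bar R} :=
  cadd (charge_of_finite_measure m1) (copp (charge_of_finite_measure m2)).

End signed_measures.

(* The measure |F|^-1 * sum_(a in F) [f a]. *)
Section empirical_measure.
Context {d : measure_display} {T : measurableType d} {R : realType}.
Context {A : choiceType}.
Variables (f : A -> T) (F : {fset A}).

Definition empirical : set T -> \bar R :=
  mscale ((#|` F|)%:R^-1 : R)%:nng
    (msum (fun i => dirac (nth point [seq f a | a <- enum_fset F] i)) #|` F|).

HB.instance Definition _ := Measure.on empirical.

Let empirical_finite : fin_num_fun empirical.
Proof.
move=> U mU; rewrite /empirical /mscale /= fin_numM// /msum.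
by rewrite sum_fin_num; apply/allP => _ /mapP[i _ ->]; exact: fin_num_measure.
Qed.

HB.instance Definition _ :=
  @Measure_isFinite.Build _ _ _ empirical empirical_finite.

End empirical_measure.

(* ** Absolute values, places and local degrees *)

Section absolute_values.
Variable R : realType.

Definition is_absval (F : fieldType) (v : F -> R) : Prop :=
  [/\ forall x, 0 <= v x,
      forall x, v x = 0 <-> x = 0,
      forall x y, v (x * y) = v x * v y
    & forall x y, v (x + y) <= v x + v y].

Definition padic_absval (p : nat) (q : rat) : R :=
  if q == 0 then 0
  else p%:R ^+ logn p `|denq q|%N / p%:R ^+ logn p `|numq q|%N.

Definition absval_closure (F : fieldType) (v : F -> R) (A : set F) : set F :=
  [set x | forall e : R, 0 < e -> exists2 y, A y & v (x - y) < e].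

Definition absval_complete (F : fieldType) (v : F -> R) : Prop :=
  forall u : nat -> F,
    (forall e : R, 0 < e -> exists N, forall m n, (N <= m)%N -> (N <= n)%N ->
       v (u m - u n) < e) ->
  exists l, forall e : R, 0 < e -> exists N, forall n, (N <= n)%N ->
       v (u n - l) < e.

End absolute_values.

Definition poly_over (F : fieldType) (A : set F) (p : {poly F}) : Prop :=
  forall i, A p`_i.

Definition algebraic_elements (F : fieldType) (A : set F) : set F :=
  [set x | exists p : {poly F}, [/\ poly_over A p, p != 0 & root p x]].

(* b is a basis of the subfield L over the subfield k of F. *)
Definition is_basis (F : fieldType) (k L : set F) n (b : 'I_n -> F) : Prop :=
  (forall i, L (b i)) /\
  (forall x, L x -> exists! c : {ffun 'I_n -> F},
     (forall i, k (c i)) /\ x = \sum_i c i * b i).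

(* The dimension of L over k, 0 if it is infinite. *)
Definition subfield_degree (F : fieldType) (k L : set F) : nat :=
  xget 0%N [set n | exists b : 'I_n -> F, is_basis k L b].

Section places.
Variables (R : realType) (K : fieldExtType rat).

Definition arch_place : choiceType :=
  set_type [set v : K -> R |
    is_absval v /\ forall q : rat, v q%:A = `|ratr q|].

Definition nonarch_place : choiceType :=
  set_type [set v : K -> R | is_absval v /\
    exists2 p, prime p & forall q : rat, v q%:A = padic_absval R p q].

Definition place : choiceType := (arch_place + nonarch_place)%type.

(* At an archimedean place C_v is the field of complex numbers, K being embedded
   in such a way that the modulus induces v. *)
Record arch_model (v : arch_place) := ArchModel {
  arch_emb : {rmorphism K -> R[i]};
  arch_embP : forall x, Normc.normc (arch_emb x) = \val v x }.

(* C_v is a completion of an algebraic closure of K_v: it is complete, the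
   closure of K in it is K_v, and the elements which are algebraic over K_v form
   a dense, algebraically closed subfield. *)
Record nonarch_model (v : nonarch_place) := NonarchModel {
  na_field : fieldType;
  na_abs : na_field -> R;
  na_emb : {rmorphism K -> na_field};
  na_absP : is_absval na_abs;
  na_embP : forall x, na_abs (na_emb x) = \val v x;
  na_complete : absval_complete na_abs;
  na_algebraic : set na_field :=
    algebraic_elements (absval_closure na_abs (range na_emb));
  na_closed : forall p : {poly na_field}, poly_over na_algebraic p ->
    (1 < size p)%N -> exists2 x, na_algebraic x & root p x;
  na_dense : absval_closure na_abs na_algebraic = setT }.

Definition local_model (v : place) : Type :=
  match v with inl w => arch_model w | inr w => nonarch_model w end.

Definition local_field (v : place) : local_model v -> fieldType :=
  match v return local_model v -> fieldType with
  | inl _ => fun=> (R[i] : fieldType)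
  | inr _ => fun M => na_field M
  end.

Definition local_abs (v : place) :
    forall M : local_model v, local_field M -> R :=
  match v return forall M : local_model v, local_field M -> R with
  | inl _ => fun=> @Normc.normc R
  | inr _ => fun M => @na_abs _ M
  end.

Definition local_emb (v : place) :
    forall M : local_model v, {rmorphism K -> local_field M} :=
  match v return forall M : local_model v, {rmorphism K -> local_field M} with
  | inl _ => fun M => arch_emb M
  | inr _ => fun M => na_emb M
  end.

(* [K_v : Q_v] / [K : Q] *)
Definition local_weight (v : place) (M : local_model v) : R :=
  (subfield_degree
     (absval_closure (@local_abs v M) [set local_emb M q%:A | q in @setT rat])
     (absval_closure (@local_abs v M) (range (local_emb M))))%:R
  / (\dim {: K})%:R.

End places.

(* ** The Riemann sphere *)

Section riemann_sphere.
Variable R : realType.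

Definition sphere : ptopologicalType := one_point_compactification R[i]^o.

Definition sphere_point (z : option R[i]) : sphere := z.

Definition circle_map (t : measurableTypeR R) : borel sphere :=
  Some (cos t +i* sin t)%C.

Lemma circle_continuous :
  continuous ((fun t => (cos t +i* sin t)%C) : R -> R[i]^o).
Proof.
move=> t; apply/(@cvgrPdist_lt _ R[i]^o) => -[e e'].
rewrite ltcE /= => /andP[/eqP -> e0].
near=> s.
rewrite normc_def ltcR /= -(ltr_pXn2r (n := 2)) ?nnegrE ?sqrtr_ge0 ?(ltW e0)//.
rewrite sqr_sqrtr ?addr_ge0 ?sqr_ge0//.
have Hc : `|cos t - cos s| < e / 2.
  near: s; apply: (cvgr_dist_lt (V := R^o)); last by rewrite divr_gt0.
  exact: continuous_cos.
have Hs : `|sin t - sin s| < e / 2.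
  near: s; apply: (cvgr_dist_lt (V := R^o)); last by rewrite divr_gt0.
  exact: continuous_sin.
rewrite -[X in X + _]real_normK ?num_real// -[X in _ + X]real_normK ?num_real//.
have := normr_ge0 (cos t - cos s); have := normr_ge0 (sin t - sin s); nra.
Unshelve. all: by end_near. Qed.

Lemma measurable_circle_map : measurable_fun setT circle_map.
Proof.
apply: (@measurability _ _ _ (borel sphere) _ _ (@open sphere)) => //.
move=> _ [U oU <-]; rewrite setTI.
apply: open_measurable.
have /continuousP : continuous (circle_map : R -> sphere) by
  move=> t; exact: (continuous_comp (@circle_continuous t)
    (@one_point_compactification_some_continuous R[i]^o _)).
exact.
Qed.

HB.instance Definition _ :=
  isMeasurableFun.Build _ _ _ _ circle_map measurable_circle_map.

Lemma two_pi_gt0 : (0 : R) < 2 * pi.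
Proof. by rewrite mulr_gt0// pi_gt0. Qed.

Definition arch_lambda : probability (borel sphere) R :=
  distribution (uniform_prob two_pi_gt0) circle_map.

Definition dir_x : R * R := (1, 0).
Definition dir_y : R * R := (0, 1).

Fixpoint Cn (n : nat) (f : R * R -> R) : Prop :=
  continuous f /\
  if n is m.+1 then
    [/\ forall p, derivable f p dir_x, forall p, derivable f p dir_y,
        Cn m ('D_dir_x f) & Cn m ('D_dir_y f)]
  else True.

Definition chart0 (p : R * R) : sphere := Some (p.1 +i* p.2)%C.

(* the chart z |-> 1 / z at infinity *)
Definition chart_oo (p : R * R) : sphere :=
  if p == 0 then None else Some ((p.1 +i* p.2)%C^-1).

Definition sphere_smooth (phi : sphere -> R) : Prop :=
  forall n, Cn n (phi \o chart0) /\ Cn n (phi \o chart_oo).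

(* the density of dd^c phi with respect to dx /\ dy *)
Definition ddc (phi : sphere -> R) (p : R * R) : R :=
  (2 * pi)^-1 * ('D_dir_x ('D_dir_x (phi \o chart0)) p
                 + 'D_dir_y ('D_dir_y (phi \o chart0)) p).

(* Delta g = mu in the sense of distributions on the sphere; infinity is
   negligible for dx /\ dy. *)
Definition arch_laplacian (g : sphere -> R)
    (mu : {charge set (borel sphere) -> \bar R}) : Prop :=
  forall phi : sphere -> R, sphere_smooth phi ->
    charge_integral mu (EFin \o phi) =
    (Rintegral (lebesgue_measure \x lebesgue_measure)%E setT
       (fun p => g (chart0 p) * ddc phi p))%:E.

Definition arch_offdiag : set (sphere * sphere) :=
  [set p | exists z w : R[i],
     p = (sphere_point (Some z), sphere_point (Some w)) /\ z <> w].

Definition arch_log (p : sphere * sphere) : R :=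
  match p with
  | (Some z, Some w) => ln (Normc.normc (z - w))
  | _ => 0
  end.

End riemann_sphere.

(* ** The Berkovich projective line *)

Section segments.
Variables (R : realType) (T : topologicalType).

(* The segment joining x and y in a uniquely path connected space. *)
Definition segment (x y : T) : set T :=
  [set z | (x = y /\ z = x) \/
    exists gamma : R -> T,
      [/\ {within `[0, 1], continuous gamma}, gamma 0 = x, gamma 1 = y,
          {in `[0, 1] &, injective gamma} & (gamma @` `[0, 1]) z]].

End segments.

Section berkovich_line.
Variables (R : realType) (C : fieldType) (abs : C -> R).
Hypothesis absP : is_absval abs.

Definition mult_seminorm (S : prod_topology (fun _ : {poly C} => R)) : Prop :=
  [/\ forall P, 0 <= S P,
      forall P Q, S (P * Q) = S P * S Q,
      forall P Q, S (P + Q) <= S P + S Q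
    & forall c, S c%:P = abs c].

(* The topology is that of pointwise convergence. *)
Definition berkA1 : topologicalType :=
  set_type [set S : prod_topology (fun _ : {poly C} => R) | mult_seminorm S].

Definition berkP1 : ptopologicalType := one_point_compactification berkA1.

Definition berk_point (S : option berkA1) : berkP1 := S.

Implicit Types S U W : berkA1.

Definition snorm S (P : {poly C}) : R := \val S P.

Lemma mult_seminorm_eval (z : C) : mult_seminorm (fun P => abs P.[z]).
Proof.
case: absP => abs0 _ absM absD; split => // [P Q|P Q|c].
- by rewrite hornerM absM.
- by rewrite hornerD absD.
- by rewrite hornerC.
Qed.

Definition eval_point (z : C) : berkA1 :=
  exist _ (fun P => abs P.[z]) (mem_set (mult_seminorm_eval z)).

(* H_v, the points of the line which do not lie in P^1(C_v) *)
Definition hyperbolic : set berkA1 := ~` range eval_point.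

Definition snorm_le S U : Prop := forall P, snorm S P <= snorm U P.

Definition is_join S U W : Prop :=
  [/\ snorm_le S W, snorm_le U W &
      forall W', snorm_le S W' -> snorm_le U W' -> snorm_le W W'].

(* The least upper bound exists in A^1, so that the default value is not used. *)
Definition join S U : berkA1 := xget S [set W | is_join S U W].

Definition diam S : R := inf (range (fun z : C => snorm S ('X - z%:P))).

(* sup {S, U}; it is |z - w| when S and U are points z and w of C_v. *)
Definition sup_berk S U : R := diam (join S U).

(* The sup norm on the closed unit ball. *)
Definition is_gauss S : Prop :=
  forall P, snorm S P = sup [set abs P.[z] | z in [set z | abs z <= 1]].

(* The sup norm is multiplicative since the residue field of C_v is infinite, so
   that the default value is not used. *)
Definition gauss_point : berkA1 := xget (eval_point 0) [set S | is_gauss S].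

Definition hyp_dist S U : R :=
  2 * ln (sup_berk S U) - ln (diam S) - ln (diam U).

(* The unique point common to the three segments. *)
Definition median (x y : berkP1) : berkP1 :=
  let can := berk_point (Some gauss_point) in
  xget point (segment R x y `&` segment R x can `&` segment R y can).

(* The pairing <x, y>. *)
Definition gromov (x y : berkP1) : \bar R :=
  if median x y is Some W then
    if `[< hyperbolic W >] then (hyp_dist W gauss_point)%:E else +oo%E
  else +oo%E.

Definition na_lambda : probability (borel berkP1) R :=
  dirac (berk_point (Some gauss_point) : borel berkP1).

(* g is defined on the whole line since only functions which extend continuously
   to it are considered; the formula is required on H_v only. *)
Definition na_laplacian (g : berkP1 -> R)
    (mu : {charge set (borel berkP1) -> \bar R}) : Prop :=
  mu setT = 0%E /\
  exists c : R, forall S, hyperbolic S ->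
    (g (berk_point (Some S)))%:E
    = (c%:E - charge_integral mu (gromov (berk_point (Some S))))%E.

(* Only the diagonal of C_v x C_v is removed, not that of H_v x H_v. *)
Definition na_offdiag : set (berkP1 * berkP1) :=
  [set p | exists S U : berkA1,
     p = (berk_point (Some S), berk_point (Some U)) /\
     ~ exists z, S = eval_point z /\ U = eval_point z].

Definition na_log (p : berkP1 * berkP1) : R :=
  match p with
  | (Some U, Some W) => ln (sup_berk U W)
  | _ => 0
  end.

End berkovich_line.

(* ** The projective line, Laplacian and energy at a place *)

Section local_theory.
Variables (R : realType) (K : fieldExtType rat).

Definition P1 (v : place R K) : local_model v -> ptopologicalType :=
  match v return local_model v -> ptopologicalType with
  | inl _ => fun=> sphere R
  | inr _ => fun M => berkP1 (@na_abs _ _ _ M)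
  end.

Definition classical_point (v : place R K) :
    forall M : local_model v, option (local_field M) -> P1 M :=
  match v return
    forall M : local_model v, option (local_field M) -> P1 M with
  | inl _ => fun M z => sphere_point z
  | inr _ => fun M z => berk_point (omap (eval_point (na_absP M)) z)
  end.

Definition lambda (v : place R K) :
    forall M : local_model v, probability (borel (P1 M)) R :=
  match v return
    forall M : local_model v, probability (borel (P1 M)) R with
  | inl _ => fun=> arch_lambda R
  | inr _ => fun M => na_lambda (na_absP M)
  end.

Definition has_laplacian (v : place R K) : forall M : local_model v,
    (P1 M -> R) -> {charge set (borel (P1 M)) -> \bar R} -> Prop :=
  match v return forall M : local_model v,
    (P1 M -> R) -> {charge set (borel (P1 M)) -> \bar R} -> Prop with
  | inl _ => fun=> @arch_laplacian R
  | inr _ => fun M => na_laplacian (na_absP M)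
  end.

Definition offdiag (v : place R K) :
    forall M : local_model v, set (P1 M * P1 M) :=
  match v return forall M : local_model v, set (P1 M * P1 M) with
  | inl _ => fun=> @arch_offdiag _
  | inr _ => fun M => @na_offdiag _ _ _ (na_absP M)
  end.

Definition log_kernel (v : place R K) :
    forall M : local_model v, P1 M * P1 M -> R :=
  match v return forall M : local_model v, P1 M * P1 M -> R with
  | inl _ => fun=> @arch_log _
  | inr _ => fun M => @na_log R _ (@na_abs _ _ _ M)
  end.

Definition energy (v : place R K) (M : local_model v)
    (mu nu : {charge set (borel (P1 M)) -> \bar R}) : R :=
  - charge_prod_integral mu nu (@offdiag v M) (@log_kernel v M).

Definition normalized_energy (v : place R K) (M : local_model v)
    (mu nu : {charge set (borel (P1 M)) -> \bar R}) : R :=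
  local_weight M * energy mu nu.

End local_theory.

(* ** Adelic measures and heights *)

Section adelic.
Variables (R : realType) (K : fieldExtType rat).
Variable M : forall v : place R K, local_model v.

Definition adelic_family : Type :=
  forall v : place R K, probability (borel (P1 (M v))) R.

(* Equality of measures is equality on Borel sets. *)
Definition is_adelic_measure (rho : adelic_family) : Prop :=
  finite_set [set v | ~ forall A, measurable A -> rho v A = lambda (M v) A] /\
  forall v, exists g : P1 (M v) -> R,
    continuous g /\ has_laplacian g (measure_diff (rho v) (lambda (M v))).

Variables (Kbar : fieldType) (iota : {rmorphism K -> Kbar}).

Record Kembedding (v : place R K) := KEmbedding {
  Kemb : {rmorphism Kbar -> local_field (M v)};
  KembP : forall x, Kemb (iota x) = local_emb (M v) x }.

Variable e : forall v, Kembedding v.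

(* The measure [F] on the projective line at v. *)
Definition point_measure (v : place R K) (F : {fset option Kbar}) :
    {finite_measure set (borel (P1 (M v))) -> \bar R} :=
  empirical
    (fun a => classical_point (M := M v) (omap (Kemb (e v)) a) : borel (P1 (M v)))
    F.

(* The terms which are not 0 are finite in number. *)
Definition height (rho : adelic_family) (F : {fset option Kbar}) : R :=
  2^-1 * \sum_(v \in [set: place R K])
    let nu := measure_diff (point_measure v F) (rho v) in
    normalized_energy nu nu.

End adelic.

Definition is_algebraic_closure (K Kbar : fieldType)
    (iota : {rmorphism K -> Kbar}) : Prop :=
  (forall x, algebraicOver iota x) /\
  (forall p : {poly Kbar}, (1 < size p)%N -> exists x, root p x).

(* Invariance of a subset of P^1(Kbar) = Kbar + {oo} under Gal(Kbar / K). *)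
Definition galois_invariant (K Kbar : fieldType)
    (iota : {rmorphism K -> Kbar}) (F : {fset option Kbar}) : Prop :=
  forall s : {rmorphism Kbar -> Kbar}, bijective s ->
    (forall x, s (iota x) = iota x) ->
    forall a, a \in F -> omap s a \in F.

Definition weak_cvg (R : realType) (T : ptopologicalType)
    (mu : nat -> {measure set (borel T) -> \bar R})
    (nu : {measure set (borel T) -> \bar R}) : Prop :=
  forall f : T -> R, continuous f ->
    Rintegral (mu n) setT f @[n --> \oo] --> Rintegral nu setT f.

(* Main.v *)
(* Let E_v denote the local energy of [F] - rho_v. At every place C_v carries a bounded chordal
   distance dl on P^1, and log|x - y|_v = log dl(x,y) - log dl(oo,x) - log dl(oo,y); hence E_v is
   the sum of the discrepancy, i.e. the energy of [F] - rho_v for the kernel -log dl off the diagonal,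
   and of 2/|F|^2 times the sum over F of the local heights -log dl(oo,a) >= 0. The kernel -log dl is
   the increasing limit of bounded positive semidefinite kernels G_k, whose potentials with respect to
   rho_v converge uniformly because g_v is continuous. Therefore the discrepancy is at least
   -eta - B/|F| for every eta > 0, and discrepancies tending to 0 along sets F with |F| -> oo make
   [F] - rho_v small on functions built from dl(a,.), which are dense by the Stone-Weierstrass
   theorem. Off a finite set of places E_v >= 0, and then
   E_v >= 2/|F|^2 log|x|_v for all x in F; so bounded height and cardinality bound the coefficients of
   the product of the X - x at all places, and Northcott's theorem gives |F_n| -> oo. *)

Require Import Defs.
From HB Require Import structures.
From mathcomp Require Import all_boot all_order all_algebra all_field.
From mathcomp Require Import finmap.
From mathcomp Require Import all_classical all_reals all_analysis.
From mathcomp Require Import complex.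
From mathcomp Require Import measurable_realfun ring lra zify.

Set Implicit Arguments.
Unset Strict Implicit.
Unset Printing Implicit Defensive.

Import Order.TTheory GRing.Theory Num.Theory.
Import numFieldNormedType.Exports.

Local Open Scope classical_set_scope.
Local Open Scope ring_scope.

(** * Algebras of continuous functions and empirical measures *)

(** The kernel -log dl is infinite on the diagonal, which the energy discards, so positivity cannot
    be applied to it directly. [G k] is finite on the diagonal: its form at [F] - rho is
    nonnegative, and the price is M k / |F| for the diagonal terms and err k for the potentials.
    Hence k is fixed before F, and the bound -eta - B/|F| is useful only once |F| is large; a cruder
    bound, valid for all F, starts Northcott's argument. The height controls a single place only if
    every weight is bounded below, and the local degree is 0 by default: closed finite spans in C_v
    give weights at least 1/[K:Q]. Places are mere absolute values and C_v is given by axioms.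
    Finiteness of the places above p therefore comes from weak approximation, a place where a
    nonintegral number is large comes from a maximal subring, and polynomials over C_v are
    approximated by polynomials over the image of Kbar, shown to be dense, countable and closed
    under roots. At finite places countability also makes the kernels measurable for the product of
    the Borel sigma-algebras. *)

Section stone_weierstrass.
Variables (R : realType) (X : ptopologicalType).
Hypothesis X_compact : compact [set: X].
Implicit Types f g h : X -> R.

Lemma continuous_bounded f : continuous f -> exists2 M, 0 < M & forall x, `|f x| <= M.
Proof.
move=> cf.
have /compact_bounded : compact (f @` setT) by apply: continuous_compact => //; apply: continuous_subspaceT.
rewrite /bounded_set /bounded_near => bf.
have [M [Mreal MP]] := bf.
exists (`|M| + 1) => [|x]; first by rewrite ltr_wpDl.
apply: MP; last by exists x.
by rewrite (le_lt_trans (ler_norm M))// ltrDl.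
Qed.

(** One half of the lattice form of Stone-Weierstrass: a strict inequality at a point persists on a
    neighbourhood, and finitely many neighbourhoods cover. It is used twice, for -f among the
    functions with a prescribed value at one point, then for f among the functions below f + e. *)
Lemma compact_local_minorant (P : set (X -> R)) f e :
  (forall g h, P g -> P h -> P (g \max h)) ->
  (forall g, P g -> continuous g) -> continuous f ->
  (forall x, exists2 g, P g & f x - e < g x) ->
  exists2 g, P g & forall x, f x - e < g x.
Proof.
move=> Pmax Pc cf loc.
pose G x := projT1 (cid2 (loc x)).
have GP x : P (G x) by rewrite /G; case: cid2.
have Gx x : f x - e < G x x by rewrite /G; case: cid2.
pose U x := [set y | 0 < G x y - (f y - e)].
have oU x : open (U x).
  have -> : U x = (fun y => G x y - (f y - e)) @^-1` [set r | 0 < r] by [].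
  apply: open_comp; last exact: open_gt.
  move=> y _; apply: continuousB; first exact: Pc.
  by apply: continuousB; [exact: cf | exact: cst_continuous].
have := X_compact; rewrite compact_cover => /(_ X setT U).
case=> [x _|x _|D _ cov]; first exact: oU.
  by exists x => //; rewrite /U /= subr_gt0.
have key (s : seq X) : exists2 g, P g & forall y, (exists2 x, x \in s & U x y) -> f y - e < g y.
  elim: s => [|a s [g Pg gP]]; first by exists (G point) => // y [].
  exists (G a \max g); first exact: Pmax.
  move=> y [x]; rewrite inE => /orP[/eqP ->|xs] Uxy /=; rewrite lt_max.
    by rewrite -subr_gt0 Uxy.
  by rewrite (gP y) ?orbT//; exists x.
have [g Pg gP] := key (enum_fset D).
exists g => // y; apply: gP.
by have [x xD Uxy] := cov y I; exists x.
Qed.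

Section closed_algebra.
Variable T : set (X -> R).
Hypotheses (T_cont : forall f, T f -> continuous f)
  (T_cst : forall c, T (cst c))
  (T_add : forall f g, T f -> T g -> T (f \+ g))
  (T_mul : forall f g, T f -> T g -> T (f \* g))
  (T_lim : forall f, (forall e : R, 0 < e -> exists2 g, T g & forall x, `|f x - g x| <= e) -> T f)
  (T_sep : forall x y, x <> y -> exists2 f, T f & f x != f y).

Let T_scale c f : T f -> T (fun x => c * f x).
Proof. by move=> Tf; have := T_mul (T_cst c) Tf. Qed.

(* The iteration converges to |f| when |f| <= 1, at a rate independent of the
   point. *)
Fixpoint sqrt_iter f (n : nat) : X -> R :=
  if n is m.+1 then fun x => sqrt_iter f m x + 2^-1 * (f x * f x - sqrt_iter f m x * sqrt_iter f m x)
  else cst 0.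

Lemma sqrt_iter_mem f n : T f -> T (sqrt_iter f n).
Proof.
move=> Tf; elim: n => [|n IH] /=; first exact: T_cst.
apply: (T_add IH); apply: T_scale.
have -> : (fun x => f x * f x - sqrt_iter f n x * sqrt_iter f n x) =
  (f \* f) \+ (fun x => -1 * (sqrt_iter f n \* sqrt_iter f n) x).
  by apply/funext => x /=; rewrite mulN1r.
by apply: T_add; [exact: T_mul | apply/T_scale/T_mul].
Qed.

(** The last bound is an invariant: with t = |f x| the error is multiplied by 1 - (t + p)/2 <= 1 -
    t/2, and (1 - t/2)(1 + (n + 1) t/2) <= 1 + n t/2. It bounds the error by 2/n whatever t is. *)
Lemma sqrt_iter_bound f n x : `|f x| <= 1 ->
  [/\ 0 <= sqrt_iter f n x, sqrt_iter f n x <= `|f x| &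
   (`|f x| - sqrt_iter f n x) * (1 + n%:R * (`|f x| / 2)) <= `|f x|].
Proof.
move=> f1; elim: n => [|n [p0 pt H]] /=.
  by rewrite subr0 mul0r addr0 mulr1 !lexx.
move: f1 p0 pt H; set p := sqrt_iter f n x; set t := `|f x| => f1 p0 pt H.
have -> : f x * f x = t * t by rewrite /t -normrM ger0_norm // sqr_ge0.
have t0 : 0 <= t by exact: normr_ge0.
have E : t - (p + 2^-1 * (t * t - p * p)) = (t - p) * (1 - (t + p) / 2) by field.
have pt2 : p * p <= t * t by exact: ler_pM.
split; first lra.
- rewrite -subr_ge0 E; apply: mulr_ge0; first by rewrite subr_ge0.
  nra.
rewrite E; apply: le_trans H.
rewrite -[leLHS]mulrA; apply: ler_wpM2l; first by rewrite subr_ge0.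
have : 0 <= n%:R * (t / 2) by rewrite mulr_ge0// divr_ge0.
have -> : n.+1%:R * (t / 2) = n%:R * (t / 2) + t / 2 by rewrite -[n.+1]addn1 natrD mulrDl mul1r.
move: (n%:R * (t/2)) => u u0.
nra.
Qed.

Lemma closed_algebra_norm f : T f -> T (fun x => `|f x|).
Proof.
move=> Tf; have [M M0 fM] := continuous_bounded (T_cont Tf).
pose g x := M^-1 * f x.
have Tg : T g by exact: T_scale.
have g1 x : `|g x| <= 1 by rewrite normrM gtr0_norm ?invr_gt0// ler_pdivrMl// mulr1.
have -> : (fun x => `|f x|) = (fun x => M * `|g x|).
  apply/funext => x; rewrite /g normrM gtr0_norm ?invr_gt0//.
  by rewrite mulrA divff ?mul1r ?gt_eqF.
apply: T_scale; apply: T_lim => e e0.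
pose n := Num.bound (2 / e).
have nP : 2 / e < n%:R by apply: le_lt_trans (archi_boundP _); rewrite ?ler_norm// divr_ge0// ltW.
exists (sqrt_iter g n); first exact: sqrt_iter_mem.
move=> x; have [p0 pt H] := sqrt_iter_bound n (g1 x).
rewrite (@ger0_norm _ (`|g x| - sqrt_iter g n x)) ?subr_ge0//.
move: p0 pt H; set t := `|g x|; set p := sqrt_iter g n x => p0 pt H.
rewrite ltr_pdivrMr// in nP.
have : (t - p) * (n%:R * (t / 2)) <= t by apply: (le_trans _ H); apply: ler_wpM2l; rewrite ?subr_ge0// lerDr.
rewrite leNgt => H2; rewrite leNgt; apply/negP => et.
move/negP : H2; apply.
have : 2 < (t - p) * n%:R by nra.
rewrite mulrA => h; rewrite (_ : _ * (t/2) = ((t-p) * n%:R) / 2 * t); last by field.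
by rewrite -[ltLHS]mul1r ltr_pM2r; lra.
Qed.

Lemma closed_algebra_max f g : T f -> T g -> T (f \max g).
Proof.
move=> Tf Tg.
have -> : f \max g = (fun x => 2^-1 * ((f \+ g) \+ (fun x => `|(f \+ (fun x => -1 * g x)) x|)) x).
  apply/funext => x /=; rewrite mulN1r.
  by rewrite maxr_absE mulrC.
apply: T_scale; apply: T_add; first exact: T_add.
by apply: closed_algebra_norm; apply: T_add => //; exact: T_scale.
Qed.

Lemma closed_algebra_interpolation f x y : exists2 h, T h & h x = f x /\ h y = f y.
Proof.
have [->|/eqP xy] := eqVneq x y; first by exists (cst (f y)) => //; exact: T_cst.
have [g Tg gxy] := T_sep xy.
exists (fun z => f x + ((f y - f x) / (g y - g x)) * (g z + (- g x))).
  apply: (T_add (T_cst _)); apply: T_scale; exact: (T_add Tg (T_cst _)).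
rewrite subrr mulr0 addr0 divfK ?subr_eq0 1?eq_sym//.
by split => //; rewrite addrC subrK.
Qed.

Lemma closed_algebra_full f : continuous f -> T f.
Proof.
move=> cf; apply: T_lim => e e0.
(* A minorant of -f up to e that equals -f at x; its opposite lies below f + e and passes through f
   x. *)
have upper x : exists2 g, (T g /\ forall z, g z < f z + e) & f x - e < g x.
  pose P := [set g | T g /\ g x = - f x].
  have [||||g [Tg gx] gP] := @compact_local_minorant P (fun z => - f z) e.
  - by move=> g h [Tg gx] [Th hx]; split; [exact: closed_algebra_max | rewrite /= gx hx maxxx].
  - by move=> g [/T_cont].
  - by move=> z; apply: continuousN; exact: cf.
  - move=> y; have [h Th [hx hy]] := closed_algebra_interpolation (fun z => - f z) x y.
    by exists h => //; rewrite hy ltrBlDr ltrDl.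
  exists (fun z => -1 * g z); last by rewrite gx; lra.
  split; first exact: T_scale.
  by move=> z; have := gP z; lra.
have [||||g [Tg gf] gP] := @compact_local_minorant
    [set g | T g /\ forall z, g z < f z + e] f e.
- move=> g h [Tg gx] [Th hx]; split; first exact: closed_algebra_max.
  by move=> z /=; rewrite gt_max gx hx.
- by move=> g [/T_cont].
- exact: cf.
- by move=> x; have [g ? ?] := upper x; exists g.
exists g => // x; rewrite ler_norml; have := gf x; have := gP x; lra.
Qed.

End closed_algebra.

(** [closed_algebra_full] is applied to the uniform closure of A inside the continuous functions,
    which is still an algebra. *)
Theorem stone_weierstrass (A : set (X -> R)) :
  (forall f, A f -> continuous f) -> (forall c, A (cst c)) ->
  (forall f g, A f -> A g -> A (f \+ g)) ->
  (forall f g, A f -> A g -> A (f \* g)) ->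
  (forall x y, x <> y -> exists2 f, A f & f x != f y) ->
  forall f, continuous f ->
  forall e : R, 0 < e -> exists2 g, A g & forall x, `|f x - g x| <= e.
Proof.
move=> Ac A1 AD AM As f cf.
pose T := [set f : X -> R | continuous f /\
  forall e : R, 0 < e -> exists2 g, A g & forall x, `|f x - g x| <= e].
have AT g : A g -> T g by move=> Ag; split=> [|e e0]; [exact: Ac | exists g => // x; rewrite subrr normr0 ltW].
suff [] : T f by [].
apply: (@closed_algebra_full T) => //.
- by move=> g [].
- by move=> c; apply: AT; exact: A1.
- move=> g h [cg Hg] [ch Hh]; split=> [|e e0]; first by move=> x; apply: continuousD; [exact: cg | exact: ch].
  have e2 : 0 < e / 2 by rewrite divr_gt0.
  have [g' Ag' gg'] := Hg _ e2; have [h' Ah' hh'] := Hh _ e2.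
  exists (g' \+ h'); first exact: AD.
  move=> x /=; rewrite opprD addrACA (splitr e).
  by rewrite (le_trans (ler_normD _ _))// lerD.
- move=> g h [cg Hg] [ch Hh]; split=> [|e e0].
    by move=> x; apply: continuousM; [exact: cg | exact: ch].
  have [M M0 gM] := continuous_bounded cg; have [N N0 hN] := continuous_bounded ch.
  (* The error is split as (g - g') h + g' (h - h'); the factor of the second term is g', bounded by
     M + e/(2N) rather than by M. *)
  have d0 : 0 < Num.min (e / (2 * N)) (e / (2 * (M + e / (2 * N)))).
    have eN : 0 < e / (2 * N) by rewrite divr_gt0// mulr_gt0.
    rewrite lt_min eN divr_gt0// mulr_gt0// addr_gt0//.
  have [g' Ag' gg'] := Hg _ d0; have [h' Ah' hh'] := Hh _ d0.
  exists (g' \* h'); first exact: AM.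
  move=> x /=.
  have -> : g x * h x - g' x * h' x = (g x - g' x) * h x + g' x * (h x - h' x) by ring.
  rewrite (le_trans (ler_normD _ _))// !normrM (splitr e).
  have g1 : `|g x - g' x| <= e / (2 * N) by rewrite (le_trans (gg' x))// ge_min lexx.
  have h1 : `|h x - h' x| <= e / (2 * (M + e / (2 * N))) by rewrite (le_trans (hh' x))// ge_min lexx orbT.
  have g'M : `|g' x| <= M + e / (2 * N).
    have -> : g' x = g x - (g x - g' x) by ring.
    by rewrite (le_trans (ler_normB _ _))// lerD.
  apply: lerD.
    have -> : e / 2 = e / (2 * N) * N by field; rewrite gt_eqF.
    by rewrite ler_pM.
  have -> : e / 2 = (M + e / (2 * N)) * (e / (2 * (M + e / (2 * N)))) by field; rewrite !gt_eqF//=; nra.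
  by rewrite ler_pM.
- move=> g Hg; split; last first.
    move=> e e0; have e2 : 0 < e / 2 by rewrite divr_gt0.
    have [h [_ Hh] gh] := Hg _ e2; have [k Ak hk] := Hh _ e2.
    exists k => // x; rewrite -(subrK (h x) (g x)) -addrA (splitr e).
    by rewrite (le_trans (ler_normD _ _))// lerD.
  move=> x; apply/cvgrPdist_lt => e e0.
  have e3 : 0 < e / 4 by rewrite divr_gt0.
  have [h [ch _] gh] := Hg _ e3.
  have := ch x; move/cvgrPdist_lt => /(_ _ e3); apply: filterS => y hxy.
  have -> : g x - g y = (g x - h x) + (h x - h y) - (g y - h y) by ring.
  rewrite (le_lt_trans (ler_normB _ _))//.
  rewrite (@le_lt_trans _ _ (e / 4 + `|h x - h y| + e / 4))//; last by lra.
  by rewrite lerD// (le_trans (ler_normD _ _))// lerD.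
- by move=> x y xy; have [g Ag gxy] := As _ _ xy; exists g => //; exact: AT.
Qed.

End stone_weierstrass.

(** * Empirical measures and the expansion of the energy of [F] - rho *)

Section empirical_integral.
Context {d : measure_display} {T : measurableType d} {R : realType} {A : choiceType}.
Variables (pt : A -> T) (F : {fset A}).
Let n := #|` F|.
Let em := empirical pt F : {finite_measure set T -> \bar R}.

Lemma ge0_empirical_integral (h : T -> \bar R) : (forall x, 0 <= h x)%E ->
  measurable_fun setT h ->
  (\int[em]_x h x = (n%:R^-1)%:E * \sum_(a <- F) h (pt a))%E.
Proof.
move=> h0 mh; rewrite /em /= /empirical.
rewrite (@ge0_integral_mscale _ _ _ _ _ measurableT)//; congr (_ * _)%E.
rewrite (@ge0_integral_measure_sum _ _ _ _ _ measurableT)//.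
rewrite -(big_map pt xpredT h) (big_nth point) size_map big_mkord.
by apply: eq_bigr => i _; rewrite integral_dirac// diracT mul1e.
Qed.

Lemma empirical_integrable (f : T -> R) : measurable_fun setT f ->
  em.-integrable setT (EFin \o f).
Proof.
move=> mf; apply/integrableP; split; first exact/measurable_EFinP.
rewrite ge0_empirical_integral => [|x|]; last 2 first.
- exact: abse_ge0.
- by apply/measurableT_comp => //; exact/measurable_EFinP.
by rewrite sumEFin ltry.
Qed.

Lemma empirical_Rintegral (f : T -> R) : measurable_fun setT f ->
  Rintegral em setT f = n%:R^-1 * \sum_(a <- F) f (pt a).
Proof.
move=> mf; have mf' : measurable_fun setT (EFin \o f) by exact/measurable_EFinP.
rewrite /Rintegral integralE.
rewrite !ge0_empirical_integral//; last 2 first.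
- exact: measurable_funeneg.
- exact: measurable_funepos.
have E (g : T -> R) : (\sum_(a <- F) (EFin \o g) (pt a) = (\sum_(a <- F) g (pt a))%:E)%E by rewrite sumEFin.
rewrite funerpos funerneg !E -!EFinM -EFinB /= -mulrBr -sumrB; congr (_ * _).
by apply: eq_bigr => a _; rewrite -[RHS](congr1 (@^~ (pt a)) (funrposBneg f)).
Qed.

Lemma ge0_empirical_prod_integral (m : {finite_measure set T -> \bar R})
    (h : T * T -> \bar R) : (forall x, 0 <= h x)%E -> measurable_fun setT h ->
  (\int[em \x m]_z h z = (n%:R^-1)%:E * \sum_(a <- F) \int[m]_y h (pt a, y))%E.
Proof.
move=> h0 mh; rewrite fubini_tonelli1// ge0_empirical_integral//.
  by move=> x; exact: integral_ge0.
exact: measurable_fun_fubini_tonelli_F.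
Qed.

Let fin_sum (u v : A -> \bar R) :
  (forall a, a \in F -> u a \is a fin_num) -> (forall a, a \in F -> v a \is a fin_num) ->
  fine ((n%:R^-1)%:E * \sum_(a <- F) u a -
        (n%:R^-1)%:E * \sum_(a <- F) v a)%E =
  n%:R^-1 * \sum_(a <- F) fine (u a - v a)%E.
Proof.
move=> uf vf.
have E (w : A -> \bar R) : (forall a, a \in F -> w a \is a fin_num) ->
    (\sum_(a <- F) w a = (\sum_(a <- F) fine (w a))%:E)%E.
  move=> wf; rewrite -sumEFin big_seq [RHS]big_seq; apply: eq_bigr => a aF.
  by rewrite fineK// wf.
rewrite !E// -!EFinM -EFinB /= -mulrBr -sumrB; congr (_ * _).
rewrite big_seq [RHS]big_seq; apply: eq_bigr => a aF.
by rewrite fineB ?uf ?vf.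
Qed.

Lemma empirical_prod_Rintegral (m : {finite_measure set T -> \bar R}) (f : T * T -> R) :
  measurable_fun setT f ->
  (forall a, a \in F -> m.-integrable setT (fun y => (f (pt a, y))%:E)) ->
  Rintegral (em \x m)%E setT f =
  n%:R^-1 * \sum_(a <- F) Rintegral m setT (fun y => f (pt a, y)).
Proof.
move=> mf fi; have mf' : measurable_fun setT (EFin \o f) by exact/measurable_EFinP.
rewrite /Rintegral integralE !ge0_empirical_prod_integral//; last 2 first.
- exact: measurable_funeneg.
- exact: measurable_funepos.
rewrite fin_sum.
- congr (_ * _); apply: eq_bigr => a _; rewrite [in RHS]integralE.
  by congr (fine (_ - _)%E); apply: eq_integral => y _; rewrite ?funeposE ?funenegE.
- move=> a aF; rewrite -[X in X \is a fin_num](_ : (\int[m]_y (fun y => (f (pt a, y))%:E)^\+ y)%E = _).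
    exact: integrable_pos_fin_num (fi a aF).
  by apply: eq_integral => y _; rewrite !funeposE.
- move=> a aF; rewrite -[X in X \is a fin_num](_ : (\int[m]_y (fun y => (f (pt a, y))%:E)^\- y)%E = _).
    exact: integrable_neg_fin_num (fi a aF).
  by apply: eq_integral => y _; rewrite !funenegE.
Qed.

Lemma symmetric_prod_Rintegral (m1 m2 : {finite_measure set T -> \bar R}) (f : T * T -> R) :
  measurable_fun setT f -> (forall x y, f (x, y) = f (y, x)) ->
  Rintegral (m1 \x m2)%E setT f = Rintegral (m2 \x m1)%E setT f.
Proof.
move=> mf fs; have mf' : measurable_fun setT (EFin \o f) by exact/measurable_EFinP.
have swap (h : T * T -> \bar R) : (forall p, 0 <= h p)%E -> measurable_fun setT h ->
    (forall x y, h (x, y) = h (y, x)) -> (\int[m1 \x m2]_p h p = \int[m2 \x m1]_p h p)%E.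
  move=> h0 mh hs; rewrite fubini_tonelli1// fubini_tonelli// [RHS]fubini_tonelli1//.
  by apply: eq_integral => y _; apply: eq_integral => x _; rewrite hs.
rewrite /Rintegral integralE [X in _ = fine X]integralE !swap//.
- exact: measurable_funeneg.
- by move=> x y; rewrite !funenegE /= fs.
- exact: measurable_funepos.
- by move=> x y; rewrite !funeposE /= fs.
Qed.

Lemma empirical_indic (U : set T) : measurable U ->
  em U = ((n%:R^-1 * \sum_(a <- F) \1_U (pt a))%:E)%E.
Proof.
move=> mU; rewrite -[em U](_ : (\int[em]_x (\1_U x)%:E = _)%E); last first.
  by rewrite integral_indic// setIT.
rewrite ge0_empirical_integral//; last exact/measurable_EFinP.
by rewrite sumEFin.
Qed.

Section jordan.
Variable rho : {finite_measure set T -> \bar R}.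
Hypothesis pt_meas : forall a, a \in F -> measurable [set pt a].
Hypothesis pt_null : forall a, a \in F -> rho [set pt a] = 0%E.
Let nu := measure_diff em rho.

Let supp_null (s : seq A) : {subset s <= F} ->
  measurable (pt @` [set x | x \in s]) /\ rho (pt @` [set x | x \in s]) = 0%E.
Proof.
elim: s => [|a s IH] sF.
  by rewrite (_ : pt @` _ = set0)//; rewrite -subset0 => x [].
have [|ms rs] := IH; first by move=> x xs; apply: sF; rewrite inE xs orbT.
have aF : a \in F by apply: sF; rewrite inE eqxx.
have E : pt @` [set x | x \in a :: s] = [set pt a] `|` pt @` [set x | x \in s].
  apply/seteqP; split => x /=.
    move=> [y]; rewrite inE => /orP[/eqP ->|ys] <-; [by left | by right; exists y].
  move=> [->|[y ys <-]]; first by exists a; rewrite ?inE ?eqxx.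
  by exists y => //; rewrite inE ys orbT.
rewrite E; split; first exact/measurableU/ms/pt_meas.
apply/eqP; rewrite eq_le measure_ge0 andbT.
rewrite (le_trans (measureU2 _ _ _))//; first exact: pt_meas.
by rewrite [X in (X + _)%E](pt_null aF) [X in (_ + X)%E]rs adde0.
Qed.

Let S := pt @` [set x | x \in enum_fset F].
Let mS : measurable S. Proof. by case: (@supp_null (enum_fset F)). Qed.
Let rS : rho S = 0%E. Proof. by case: (@supp_null (enum_fset F)). Qed.

Let rho_in U : measurable U -> rho (U `&` S) = 0%E.
Proof.
move=> mU; apply/eqP; rewrite eq_le measure_ge0 andbT -rS.
by apply: le_measure; rewrite ?inE//; exact: measurableI.
Qed.

Let em_out U : measurable U -> em (U `\` S) = 0%E.
Proof.
move=> mU; rewrite empirical_indic; last exact: measurableD.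
rewrite big_seq big1 ?mulr0// => a aF.
by rewrite indicE memNset//= => -[_]; apply; exists a.
Qed.

Let hahn := hahnP nu.

Let nuE U : nu U = (em U - rho U)%E. Proof. by []. Qed.

Let rho_pos U : measurable U -> rho (U `&` hahn_pos nu) = 0%E.
Proof.
move=> mU; have [[mP Pp] _ _ _] := hahn.
have mUP : measurable (U `&` hahn_pos nu) by exact: measurableI.
rewrite [LHS](measureDI rho mUP mS) [X in (_ + X)%E](rho_in mUP) adde0.
(* Off S the charge is -rho, yet it is nonnegative on the subsets of a positive set. *)
have mV : measurable (U `&` hahn_pos nu `\` S) by exact: measurableD.
have := Pp _ mV; rewrite nuE em_out// sub0e oppe_ge0 => H.
apply/eqP; rewrite eq_le measure_ge0 andbT; apply: H.
by move=> x [[]].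
Qed.

Let em_neg U : measurable U -> em (U `&` hahn_neg nu) = 0%E.
Proof.
move=> mU; have [_ [mN Nn] _ _] := hahn.
have mUN : measurable (U `&` hahn_neg nu) by exact: measurableI.
rewrite [LHS](measureDI em mUN mS) [X in (X + _)%E](em_out mUN) add0e.
have mV : measurable (U `&` hahn_neg nu `&` S) by exact: measurableI.
have := Nn _ mV; rewrite nuE rho_in// sube0 => H.
apply/eqP; rewrite eq_le measure_ge0 andbT; apply: H.
by move=> x [[]].
Qed.

Let split_hahn (m : {finite_measure set T -> \bar R}) U : measurable U ->
  m U = (m (U `&` hahn_neg nu) + m (U `&` hahn_pos nu))%E.
Proof.
move=> mU; have [[mP _] _ PN PN0] := hahn.
rewrite (measureDI m mU mP); congr (m _ + _)%E.
apply/seteqP; split => x /=.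
  by move=> [Ux nP]; split => //; have [] : (hahn_pos nu `|` hahn_neg nu) x by rewrite PN.
move=> [Ux Nx]; split => // Px.
by have : (hahn_pos nu `&` hahn_neg nu) x by []; rewrite PN0.
Qed.

(** [F] is carried by the finite set S, to which rho gives mass 0; the two measures are mutually
    singular, so any Hahn decomposition returns them as the Jordan parts. *)
Lemma pos_part_empirical U : measurable U -> pos_part nu U = em U.
Proof.
move=> mU; have [[mP _] _ _ _] := hahn.
rewrite /pos_part [LHS]jordan_posE cjordan_posE /crestr0 mem_set// /crestr /=.
by rewrite [LHS]nuE rho_pos// sube0 (split_hahn em mU) em_neg// add0e.
Qed.

Lemma neg_part_empirical U : measurable U -> neg_part nu U = rho U.
Proof.
move=> mU; have [_ [mN _] _ _] := hahn.
rewrite /neg_part [LHS]jordan_negE cjordan_negE /crestr0 mem_set// /crestr /=.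
rewrite [X in (- X)%E]nuE em_neg// sub0e oppeK.
by rewrite (split_hahn rho mU) rho_pos// adde0.
Qed.

Let prod_eq (m1 m2 m1' m2' : {finite_measure set T -> \bar R}) (f : T * T -> R) :
  (forall U, measurable U -> m1 U = m1' U) -> (forall U, measurable U -> m2 U = m2' U) ->
  Rintegral (m1 \x m2)%E setT f = Rintegral (m1' \x m2')%E setT f.
Proof.
move=> e1 e2; rewrite /Rintegral (eq_measure_integral (m1' \x m2')%E)// => U mU _.
transitivity (\int[m1]_x m2 (xsection U x))%E; first by [].
rewrite (eq_measure_integral m1')//; last by move=> V mV _; exact: e1.
by apply: eq_integral => x _ /=; apply: e2; exact: measurable_xsection.
Qed.

(** The domain D disappears because f vanishes off it. The Jordan parts being [F] and rho, the four
    integrals of the definition are the expansion of a quadratic form, whose two mixed terms agree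
    by symmetry. *)
Theorem empirical_energy (D : set (T * T)) (f : T * T -> R) :
  (forall p, ~ D p -> f p = 0) -> measurable_fun setT f ->
  (forall a, a \in F -> rho.-integrable setT (fun y => (f (pt a, y))%:E)) ->
  (forall x y, f (x, y) = f (y, x)) ->
  charge_prod_integral nu nu D f =
    n%:R^-1 * n%:R^-1 * (\sum_(a <- F) \sum_(b <- F) f (pt a, pt b))
    + Rintegral (rho \x rho)%E setT f
    - 2 * (n%:R^-1 * \sum_(a <- F) Rintegral rho setT (fun y => f (pt a, y))).
Proof.
move=> fD mf fi fs.
have fDE : f \_ D = f.
  apply/funext => p; rewrite patchE; case: ifPn => // /negP pD.
  by rewrite fD// => Dp; apply: pD; rewrite inE.
rewrite /charge_prod_integral !(Rintegral_mkcond _ D) fDE.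
have pe := pos_part_empirical; have ne := neg_part_empirical.
rewrite (prod_eq f pe pe) (prod_eq f ne ne) (prod_eq f pe ne) (prod_eq f ne pe).
have mfa a : measurable_fun setT (fun y => f (pt a, y)) by exact: measurableT_comp.
rewrite (symmetric_prod_Rintegral rho em mf fs) (empirical_prod_Rintegral mf fi).
rewrite [in RHS]mulr_natl mulr2n opprD addrA; congr (_ + _ - _ - _).
rewrite empirical_prod_Rintegral//; last by move=> a _; exact: empirical_integrable.
rewrite -[RHS]mulrA; congr (_ * _); rewrite mulr_sumr; apply: eq_bigr => a _.
by rewrite empirical_Rintegral.
Qed.

End jordan.
End empirical_integral.

(** * Energies of regularized Green kernels *)

Section monotone_log_limit.
Context {d : measure_display} {T : measurableType d} {R : realType}.
Variables (m : {measure set T -> \bar R}) (g : nat -> T -> R) (z : T -> R) (K : R).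
Hypotheses (mz : measurable_fun setT z) (z01 : forall x, 0 <= z x <= 1)
  (mg : forall k, measurable_fun setT (g k)) (g0 : forall k x, 0 <= g k x)
  (g_nd : forall x k l, (k <= l)%N -> g k x <= g l x)
  (g_cvg : forall x, z x != 0 -> g k x @[k --> \oo] --> - ln (z x))
  (g_div : forall x, z x = 0 -> forall B, exists k, B <= g k x)
  (gK : forall k, (\int[m]_x (g k x)%:E <= K%:E)%E).

(** The true limit of [g k]; where z vanishes, [- ln (z x)] is 0 by the convention on [ln]. *)
Let lim x : \bar R := if z x == 0 then +oo%E else (- ln (z x))%:E.

Let g_lim x : (g k x)%:E @[k --> \oo] --> lim x.
Proof.
rewrite /lim; case: ifPn => [/eqP z0|/g_cvg H]; last exact: cvg_EFin (nearW _ _) H.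
apply/cvgeyPge => B; have [k Bk] := g_div z0 B.
by exists k => // l /= kl; rewrite lee_fin (le_trans Bk)// g_nd.
Qed.

Let lim0 x : (0 <= lim x)%E.
Proof.
rewrite /lim; case: ifPn => // _; rewrite lee_fin oppr_ge0; apply: ln_le0.
by have /andP[] := z01 x.
Qed.

Let mlim : measurable_fun setT lim.
Proof.
apply: (emeasurable_fun_cvg (fun k x => (g k x)%:E)) => [k|x _]; last exact: g_lim.
exact/measurable_EFinP.
Qed.

Let int_cvg : (\int[m]_x (g k x)%:E @[k --> \oo] --> \int[m]_x lim x)%E.
Proof.
have E : (fun x => limn (fun k => (g k x)%:E)) = lim by apply/funext => x; apply/cvg_lim => //; exact: g_lim.
rewrite -E; apply: cvg_monotone_convergence => //.
- by move=> k; exact/measurable_EFinP.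
- by move=> k x _; rewrite lee_fin.
- by move=> x _ k l kl; rewrite lee_fin g_nd.
Qed.

Let intK : (\int[m]_x lim x <= K%:E)%E.
Proof.
rewrite -(cvg_lim _ int_cvg)//; apply: lime_le; last exact: nearW.
by apply/cvg_ex; eexists; exact: int_cvg.
Qed.

Let lim_int : m.-integrable setT lim.
Proof.
apply/integrableP; split => //.
under eq_integral do rewrite gee0_abs//.
by rewrite (le_lt_trans intK)// ltry.
Qed.

Let ae_lim : {ae m, forall x, lim x = (- ln (z x))%:E}.
Proof.
have := integrable_ae measurableT lim_int; apply: filterS => x /(_ I).
by rewrite /lim; case: ifP.
Qed.

Let log_singular_null : m [set x | z x = 0] = 0%E.
Proof.
have := integrable_ae measurableT lim_int => -[N [mN N0 sN]].
have mZ : measurable [set x | z x = 0] by have := mz measurableT (measurable_set1 (0 : R)); rewrite setTI.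
apply: (subset_measure0 mZ mN) => // x /= zx; apply: sN => /= /(_ I).
by rewrite /lim zx eqxx.
Qed.

Let int_eq : (\int[m]_x lim x = \int[m]_x (- ln (z x))%:E)%E.
Proof.
apply: ge0_ae_eq_integral => //.
- by apply/measurable_EFinP/measurable_funN; exact: measurableT_comp.
- move=> x _; rewrite lee_fin oppr_ge0; apply: ln_le0.
  by have /andP[] := z01 x.
- by move: ae_lim; apply: filterS => x ->.
Qed.

Let log_integrable : m.-integrable setT (fun x => (- ln (z x))%:E).
Proof.
apply/integrableP; split.
  by apply/measurable_EFinP/measurable_funN; exact: measurableT_comp.
rewrite (_ : (\int[m]_x _ = \int[m]_x (- ln (z x))%:E)%E); last first.
  apply: eq_integral => x _; rewrite gee0_abs// lee_fin oppr_ge0; apply: ln_le0.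
  by have /andP[] := z01 x.
by rewrite -int_eq (le_lt_trans intK)// ltry.
Qed.

Let mono_integrable k : m.-integrable setT (fun x => (g k x)%:E).
Proof.
apply/integrableP; split; first exact/measurable_EFinP.
under eq_integral do rewrite gee0_abs ?lee_fin//.
by rewrite (le_lt_trans (gK k))// ltry.
Qed.

Let log_integral_ge k : \int[m]_x g k x <= \int[m]_x (- ln (z x)).
Proof.
rewrite /Rintegral fine_le//.
- exact: integrable_fin_num (mono_integrable k).
- exact: integrable_fin_num log_integrable.
rewrite -int_eq; apply: ge0_le_integral => //.
- by move=> x _; rewrite lee_fin.
- exact/measurable_EFinP.
move=> x _; rewrite -(cvg_lim _ (@g_lim x))//.
apply: lime_ge; first by apply/cvg_ex; eexists; exact: g_lim.
by exists k => // l /= kl; rewrite lee_fin g_nd.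
Qed.

Let log_integral_le L : (forall k, \int[m]_x g k x <= L) -> \int[m]_x (- ln (z x)) <= L.
Proof.
move=> gL; rewrite -lee_fin /Rintegral fineK; last exact: integrable_fin_num log_integrable.
rewrite -int_eq -(cvg_lim _ int_cvg)//; apply: lime_le.
  by apply/cvg_ex; eexists; exact: int_cvg.
apply: nearW => k; rewrite -[leLHS]fineK ?lee_fin; first exact: gL.
exact: integrable_fin_num (mono_integrable k).
Qed.

(** Monotone convergence. The uniform bound K makes the true limit integrable, so that the set where
    z vanishes is negligible and the convention [ln 0 = 0] changes no integral. It serves both for
    the slices dl x and for dl on the product. *)
Lemma monotone_log_limit : [/\ m.-integrable setT (fun x => (- ln (z x))%:E), m [set x | z x = 0] = 0%E,
  forall k, \int[m]_x g k x <= \int[m]_x (- ln (z x)) &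
  forall L, (forall k, \int[m]_x g k x <= L) -> \int[m]_x (- ln (z x)) <= L].
Proof.
split; [exact: log_integrable | exact: log_singular_null | exact: log_integral_ge | exact: log_integral_le].
Qed.

End monotone_log_limit.

Lemma ae_eq_Rintegral {d} {T : measurableType d} {R : realType}
    (m : {measure set T -> \bar R}) (f g : T -> R) :
  m.-integrable setT (EFin \o f) -> measurable_fun setT g -> {ae m, forall x, g x = f x} ->
  m.-integrable setT (EFin \o g) /\ \int[m]_x g x = \int[m]_x f x.
Proof.
move=> fi mg gf; have mf := measurable_int _ fi.
have mg' : measurable_fun setT (EFin \o g) by exact/measurable_EFinP.
split; last first.
  rewrite /Rintegral (ae_eq_integral (EFin \o f))//.
  by apply: filterS gf => x /= ->.
apply/integrableP; split => //.
move/integrableP : fi => [_]; apply: le_lt_trans.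
rewrite le_eqVlt; apply/orP; left; apply/eqP.
apply: ge0_ae_eq_integral => //; try exact: measurableT_comp.
by apply: filterS gf => x /= ->.
Qed.

Section green_kernel.
Context {d : measure_display} {T : measurableType d} {R : realType} {A : choiceType}.
Variables (pt : A -> T) (oo : A) (rho : probability T R).

(* The chordal distance dl and the increasing regularizations G k of -ln dl,
   whose potentials with respect to rho converge uniformly on the classical
   points. *)
Record green_kernel (dl : T -> T -> R) (G : nat -> T -> T -> R) (M err : nat -> R) (K : R)
    : Prop := GreenKernel {
  gk_meas : measurable_fun setT (fun p : T * T => dl p.1 p.2);
  gk_bound : forall x y, 0 <= dl x y <= 1;
  gk_sym : forall x y, dl x y = dl y x;
  gk_pt : forall a y, dl (pt a) y = 0 <-> y = pt a;
  gk_inj : injective pt;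
  gk_Gmeas : forall k, measurable_fun setT (fun p : T * T => G k p.1 p.2);
  gk_Gbound : forall k x y, 0 <= G k x y <= M k;
  gk_Gnd : forall x y k l, (k <= l)%N -> G k x y <= G l x y;
  gk_Gcvg : forall x y, dl x y != 0 -> G k x y @[k --> \oo] --> - ln (dl x y);
  gk_Gdiv : forall x y, dl x y = 0 -> forall B, exists k, B <= G k x y;
  gk_K : forall k x, \int[rho]_y G k x y <= K;
  gk_err : forall a k l, (k <= l)%N ->
    \int[rho]_y G l (pt a) y <= \int[rho]_y G k (pt a) y + err k;
  gk_err0 : err k @[k --> \oo] --> (0 : R) }.

Variables (dl : T -> T -> R) (G : nat -> T -> T -> R) (M err : nat -> R) (K : R).
Hypothesis gk : green_kernel dl G M err K.

Let mdl x : measurable_fun setT (dl x).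
Proof. exact: (measurableT_comp (gk_meas gk) (measurable_pair1 x)). Qed.

Let mG k x : measurable_fun setT (G k x).
Proof. exact: (measurableT_comp (gk_Gmeas gk k) (measurable_pair1 x)). Qed.

Let G0 k x y : 0 <= G k x y. Proof. by have /andP[] := gk_Gbound gk k x y. Qed.

Lemma bounded_integrable d' (T' : measurableType d') (m : {finite_measure set T' -> \bar R})
    (f : T' -> R) (B : R) : measurable_fun setT f -> (forall x, `|f x| <= B) ->
  m.-integrable setT (EFin \o f).
Proof.
move=> mf fB; apply: (@le_integrable _ _ _ m _ measurableT _ (cst B%:E)).
- exact/measurable_EFinP.
- by move=> x _ /=; rewrite lee_fin (le_trans (fB x))// ler_norm.
- by apply: finite_measure_integrable_cst.
Qed.

Let G_int k x : rho.-integrable setT (EFin \o G k x).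
Proof.
apply: (@bounded_integrable _ _ _ _ (M k)) => // y.
by rewrite ger0_norm//; have /andP[] := gk_Gbound gk k x y.
Qed.

Let G_intE k x : (\int[rho]_y (G k x y)%:E = (\int[rho]_y G k x y)%:E)%E.
Proof. by rewrite /Rintegral fineK//; exact: integrable_fin_num (G_int k x). Qed.

Let GK k x : (\int[rho]_y (G k x y)%:E <= K%:E)%E.
Proof. by rewrite G_intE lee_fin (gk_K gk). Qed.

Let mGE k : measurable_fun setT (fun p : T * T => (G k p.1 p.2)%:E).
Proof. by have /measurable_EFinP H := gk_Gmeas gk k; exact: H. Qed.

Let GGE k : (\int[rho \x rho]_p (G k p.1 p.2)%:E = \int[rho]_x \int[rho]_y (G k x y)%:E)%E.
Proof.
by rewrite fubini_tonelli1//; last by move=> p; rewrite lee_fin.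
Qed.

Let GGK k : (\int[rho \x rho]_p (G k p.1 p.2)%:E <= K%:E)%E.
Proof.
rewrite GGE; apply: le_trans (_ : (\int[rho]_x (cst K%:E) x <= _)%E); last first.
  by rewrite integral_cst//= probability_setT mule1.
apply: ge0_le_integral => //.
- by move=> x _; apply: integral_ge0 => y _; rewrite lee_fin.
- apply: (measurable_fun_fubini_tonelli_F (fun p : T * T => (G k p.1 p.2)%:E)) => //.
  by move=> p; rewrite lee_fin.
Qed.

Definition potential k x := \int[rho]_y G k x y.
Definition pot0 x := \int[rho]_y (- ln (dl x y)).
Definition energy0 := \int[(rho \x rho)%E]_p (- ln (dl p.1 p.2)).
Definition energyk k := \int[(rho \x rho)%E]_p (G k p.1 p.2).

Let slice_log x := @monotone_log_limit _ _ _ rho (G ^~ x) (dl x) K (mdl x) (gk_bound gk x) (mG ^~ x)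
  (fun k => G0 k x) (gk_Gnd gk x) (@gk_Gcvg _ _ _ _ _ gk x) (@gk_Gdiv _ _ _ _ _ gk x) (GK ^~ x).

Lemma pot0_integrable x : rho.-integrable setT (fun y => (- ln (dl x y))%:E).
Proof. by have [] := slice_log x. Qed.

Lemma pot0_null x : rho [set y | dl x y = 0] = 0%E.
Proof. by have [] := slice_log x. Qed.

Lemma pot0_le x L : (forall k, potential k x <= L) -> pot0 x <= L.
Proof. by have [_ _ _ h] := slice_log x; exact: h. Qed.

Lemma pot0_err a k : pot0 (pt a) <= potential k (pt a) + err k.
Proof.
apply: pot0_le => l; have [kl|lk] := leqP k l; first exact: (gk_err gk).
(* For l < k the potential at l is below that at k by monotonicity; [gk_err] with l = k then says
   that err k is nonnegative. *)
apply: le_trans (_ : potential k (pt a) <= _).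
  rewrite /potential /Rintegral fine_le//.
  - exact: integrable_fin_num (G_int _ _).
  - exact: integrable_fin_num (G_int _ _).
  apply: ge0_le_integral => //.
  - by move=> y _; rewrite lee_fin.
  - exact/measurable_EFinP.
  - exact/measurable_EFinP.
  - by move=> y _; rewrite lee_fin; apply: (gk_Gnd gk); exact: ltnW.
exact: (gk_err gk a (leqnn k)).
Qed.

Let energy_log := @monotone_log_limit _ _ _ (rho \x rho)%E (fun k p => G k p.1 p.2) (fun p => dl p.1 p.2) K
  (gk_meas gk) (fun p => gk_bound gk p.1 p.2) (gk_Gmeas gk) (fun k p => G0 k p.1 p.2)
  (fun p => gk_Gnd gk p.1 p.2) (fun=> @gk_Gcvg _ _ _ _ _ gk _ _) (fun=> @gk_Gdiv _ _ _ _ _ gk _ _) GGK.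

Lemma energy0_integrable : (rho \x rho)%E.-integrable setT (fun p => (- ln (dl p.1 p.2))%:E).
Proof. by have [] := energy_log. Qed.

Lemma energy0_null : (rho \x rho)%E [set p | dl p.1 p.2 = 0] = 0%E.
Proof. by have [] := energy_log. Qed.

Lemma energy0_ge k : energyk k <= energy0.
Proof. by have [_ _ h _] := energy_log; exact: h. Qed.

Let n (F : {fset A}) : R := (#|` F|)%:R.
Let em (F : {fset A}) := empirical pt F : {finite_measure set T -> \bar R}.
Let g0 (a b : A) := - ln (dl (pt a) (pt b)).

Definition height_sum (F : {fset A}) := \sum_(a <- F) - ln (dl (pt oo) (pt a)).

(** The diagonal terms [g0 a a] are 0 since [ln 0 = 0]: this is the energy of [F] - rho for -ln dl
    with the diagonal of F removed. *)
Definition discrepancy0 (F : {fset A}) :=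
  (n F)^-1 * (n F)^-1 * (\sum_(a <- F) \sum_(b <- F) g0 a b)
  - 2 * ((n F)^-1 * \sum_(a <- F) pot0 (pt a)) + energy0.

(** Here the diagonal terms are genuine, as positivity of the form of [G k] requires. *)
Definition discrepancy k (F : {fset A}) :=
  (n F)^-1 * (n F)^-1 * (\sum_(a <- F) \sum_(b <- F) G k (pt a) (pt b))
  - 2 * ((n F)^-1 * \sum_(a <- F) potential k (pt a)) + energyk k.

Let g0_ge0 x y : 0 <= - ln (dl x y).
Proof. by rewrite oppr_ge0; apply: ln_le0; have /andP[] := gk_bound gk x y. Qed.

Let pot0_K x : pot0 x <= K.
Proof. by apply: pot0_le => k; exact: (gk_K gk). Qed.

Let energy0_ge0 : 0 <= energy0.
Proof. by apply: Rintegral_ge0 => p _. Qed.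

Let nF_gt0 F : F != fset0 -> 0 < n F.
Proof. by move=> F0; rewrite /n ltr0n cardfs_gt0. Qed.

(** A crude bound that does not depend on the cardinality of F; it is the one available when the
    cardinality is still to be shown to grow. *)
Lemma discrepancy0_ge F : F != fset0 -> - (2 * K) <= discrepancy0 F.
Proof.
move=> /nF_gt0 F0; rewrite /discrepancy0.
have h1 : 0 <= (n F)^-1 * (n F)^-1 * (\sum_(a <- F) \sum_(b <- F) g0 a b).
  rewrite mulr_ge0 ?mulr_ge0 ?invr_ge0 ?(ltW F0)//.
  by apply: sumr_ge0 => a _; apply: sumr_ge0 => b _; exact: g0_ge0.
have h2 : (n F)^-1 * \sum_(a <- F) pot0 (pt a) <= K.
  rewrite ler_pdivrMl//; apply: le_trans (ler_sum _ (fun a _ => pot0_K (pt a))) _.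
  by rewrite big_const_seq count_predT iter_addr_0 -mulr_natl.
have := energy0_ge0; lra.
Qed.

(** Replacing [G k] by its limit raises the off-diagonal sum and the energy of rho. The losses are
    the n diagonal terms, at most M k each against the factor 1/n^2, and the gap of the potentials
    at the points of F, at most err k. *)
Lemma discrepancy0_ge_reg k F : F != fset0 ->
  discrepancy k F - M k / n F - 2 * err k <= discrepancy0 F.
Proof.
move=> /nF_gt0 F0; rewrite /discrepancy0 /discrepancy.
have h2 : (n F)^-1 * \sum_(a <- F) pot0 (pt a) <=
    (n F)^-1 * (\sum_(a <- F) potential k (pt a)) + err k.
  rewrite ler_pdivrMl// mulrDr mulrA divff ?gt_eqF// mul1r.
  apply: le_trans (ler_sum _ (fun a _ => pot0_err a k)) _.
  by rewrite big_split /= lerD2l big_const_seq count_predT iter_addr_0 -mulr_natl.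
have h1 : \sum_(a <- F) \sum_(b <- F) G k (pt a) (pt b) - n F * M k <=
    \sum_(a <- F) \sum_(b <- F) g0 a b.
  have -> : n F * M k = \sum_(a <- F) M k by rewrite big_const_seq count_predT iter_addr_0 -mulr_natl.
  rewrite -sumrB; rewrite big_seq [leRHS]big_seq; apply: ler_sum => a aF.
  rewrite (bigD1_seq a)//= [leRHS](bigD1_seq a)//=.
  have Ga : G k (pt a) (pt a) <= M k by have /andP[] := gk_Gbound gk k (pt a) (pt a).
  have Hs : \sum_(b <- F | b != a) G k (pt a) (pt b) <=
      \sum_(b <- F | b != a) g0 a b.
    apply: ler_sum => b ba; rewrite /g0.
    have dab : dl (pt a) (pt b) != 0 by apply: contra_neq ba => /(gk_pt gk) /(gk_inj gk).
    rewrite -(cvg_lim _ (gk_Gcvg gk dab))//; apply: limr_ge; first by apply/cvg_ex; eexists; exact: (gk_Gcvg gk dab).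
    by exists k => // l /= kl; exact: (gk_Gnd gk).
  have := g0_ge0 (pt a) (pt a); rewrite -/(g0 a a); lra.
have := energy0_ge k.
have : (n F)^-1 * (n F)^-1 * (\sum_(a <- F) \sum_(b <- F) G k (pt a) (pt b)) - M k / n F <=
   (n F)^-1 * (n F)^-1 * \sum_(a <- F) \sum_(b <- F) g0 a b.
  rewrite (_ : M k / n F = (n F)^-1 * (n F)^-1 * (n F * M k)); last by field; rewrite gt_eqF.
  by rewrite -mulrBr ler_wpM2l// mulr_ge0// invr_ge0 ltW.
lra.
Qed.

Section log_kernel.
Variables (D : set (T * T)) (L : T * T -> R).
Hypotheses (LD : forall p, ~ D p -> L p = 0)
  (LE : forall x y, L (x, y) =
    if [|| dl x y == 0, dl (pt oo) x == 0 | dl (pt oo) y == 0] then 0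
    else - ln (dl (pt oo) x) - ln (dl (pt oo) y) + ln (dl x y)).

Let mL : measurable_fun setT L.
Proof.
have mlog (u : T * T -> R) : measurable_fun setT u -> measurable_fun setT (fun p => ln (u p)) by move=> mu; exact: measurableT_comp.
have md1 : measurable_fun setT (fun p : T * T => dl (pt oo) p.1) by exact: measurableT_comp.
have md2 : measurable_fun setT (fun p : T * T => dl (pt oo) p.2) by exact: measurableT_comp.
have md := gk_meas gk.
have -> : L = (fun p => if [|| dl p.1 p.2 == 0, dl (pt oo) p.1 == 0 | dl (pt oo) p.2 == 0] then 0
    else - ln (dl (pt oo) p.1) - ln (dl (pt oo) p.2) + ln (dl p.1 p.2)).
  by apply/funext => -[x y]; rewrite LE.
have meq (u : T * T -> R) : measurable_fun setT u -> measurable_fun setT (fun p => u p == 0) by move=> mu; apply: measurable_fun_eqr.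
apply: measurable_fun_if => //.
- by apply: measurable_or; [exact: meq | apply: measurable_or; exact: meq].
- apply: (@measurable_funS _ _ _ _ setT) => //.
  apply: measurable_funD; last exact: mlog.
  by apply: measurable_funB; [apply: measurable_funN|]; exact: mlog.
Qed.

Let Lsym x y : L (x, y) = L (y, x).
Proof.
rewrite !LE (gk_sym gk x y) [X in _ || X]orbC.
by case: ifP => // _; congr (_ + _); rewrite addrC.
Qed.

(** The formula also covers infinity, where L is 0 by convention: for a = oo it reads g0 oo b - g0
    oo b. *)
Let Lpt a b : L (pt a, pt b) = (a != b)%:R * (g0 oo a + g0 oo b) - g0 a b.
Proof.
have dE c e : (dl (pt c) (pt e) == 0) = (c == e).
  apply/eqP/eqP => [/(gk_pt gk) /(gk_inj gk) //|->]; exact/(gk_pt gk).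
have gE c : g0 c c = 0 by rewrite /g0; have /eqP -> : dl (pt c) (pt c) == 0; rewrite ?dE// ln0// oppr0.
rewrite LE !dE; have [->|ab] := eqVneq a b; first by rewrite gE mul0r subr0.
have [<-|oa] /= := eqVneq oo a; first by rewrite gE add0r mul1r subrr.
have [<-|ob] /= := eqVneq oo b.
  by rewrite gE addr0 mul1r /g0 (gk_sym gk) subrr.
by rewrite mul1r /g0 opprK.
Qed.

Let null_ae x : {ae rho, forall y, dl x y != 0}.
Proof.
exists [set y | dl x y = 0]; split.
- by have := mdl x measurableT (measurable_set1 (0 : R)); rewrite setTI.
- exact: pot0_null.
- by move=> y /= /negP; rewrite negbK => /eqP.
Qed.

Let Lpt_ae a : {ae rho, forall y, L (pt a, y) = g0 oo a - ln (dl (pt oo) y) + ln (dl (pt a) y)}.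
Proof.
have := null_ae (pt a); have := null_ae (pt oo); apply: filterS2 => y oy ay.
rewrite LE (negbTE oy) (negbTE ay) orbF /=.
have [->|oa] := eqVneq oo a.
  have E : dl (pt a) (pt a) = 0 by apply/(gk_pt gk).
  by rewrite E eqxx /g0 E ln0// oppr0 add0r addNr.
have -> : (dl (pt oo) (pt a) == 0) = false.
  by apply/eqP => /(gk_pt gk) /(gk_inj gk) /esym /eqP; rewrite (negbTE oa).
by [].
Qed.

Let R_int x : rho.-integrable setT (EFin \o (fun y => - ln (dl x y))).
Proof. exact: pot0_integrable. Qed.

Let c_int a : rho.-integrable setT (EFin \o (fun=> g0 oo a)).
Proof. exact: finite_measure_integrable_cst. Qed.

Let gap_int a : rho.-integrable setT (EFin \o (fun y => g0 oo a - ln (dl (pt oo) y))).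
Proof. exact: (integrableD measurableT (c_int a) (R_int (pt oo))). Qed.

Let rhsE a : (fun y => g0 oo a - ln (dl (pt oo) y) + ln (dl (pt a) y)) =
  (fun y => (g0 oo a - ln (dl (pt oo) y)) - (- ln (dl (pt a) y))).
Proof. by apply/funext => y; rewrite opprK. Qed.

Let rhs_int a : rho.-integrable setT
  (EFin \o (fun y => g0 oo a - ln (dl (pt oo) y) + ln (dl (pt a) y))).
Proof. by rewrite rhsE; exact: (integrableB measurableT (gap_int a) (R_int (pt a))). Qed.

Let mLa a : measurable_fun setT (fun y => L (pt a, y)).
Proof. exact: (measurableT_comp mL (measurable_pair1 (pt a))). Qed.

Let Lpt_aeP a := ae_eq_Rintegral (rhs_int a) (mLa a) (Lpt_ae a).

Let rho1 : fine (rho setT) = 1. Proof. by rewrite probability_setT. Qed.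

Let Lpt_val a : \int[rho]_y L (pt a, y) = g0 oo a + pot0 (pt oo) - pot0 (pt a).
Proof.
have [_ ->] := Lpt_aeP a; rewrite rhsE (RintegralB _ (gap_int a) (R_int (pt a)))//.
by rewrite RintegralD// Rintegral_cst// rho1 mulr1.
Qed.

Let l1 (p : T * T) := - ln (dl (pt oo) p.1).
Let l2 (p : T * T) := - ln (dl (pt oo) p.2).
Let l12 (p : T * T) := - ln (dl p.1 p.2).

Let ml x : measurable_fun setT (fun y => - ln (dl x y)).
Proof. by apply: measurable_funN; exact: measurableT_comp. Qed.

Let mleft (u : T -> R) : measurable_fun setT u -> measurable_fun setT (fun p : T * T => u p.1).
Proof. by move=> mu; exact: measurableT_comp. Qed.

Let mright (u : T -> R) : measurable_fun setT u -> measurable_fun setT (fun p : T * T => u p.2).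
Proof. by move=> mu; exact: measurableT_comp. Qed.

Let int_cst1 (c : \bar R) : (\int[rho]_y cst c y = c)%E.
Proof. by rewrite integral_cst//= (@probability_setT _ _ _ rho) mule1. Qed.

Let l1_int : (\int[rho \x rho]_p (l1 p)%:E = \int[rho]_x (- ln (dl (pt oo) x))%:E)%E.
Proof.
have ml1 : measurable_fun setT (fun p => (l1 p)%:E) by apply/measurable_EFinP; exact: (mleft (ml (pt oo))).
rewrite fubini_tonelli1//; last by move=> p; rewrite lee_fin; exact: g0_ge0.
by apply: eq_integral => x _; rewrite /fubini_F /l1 /=; exact: int_cst1.
Qed.

Let l2_int : (\int[rho \x rho]_p (l2 p)%:E = \int[rho]_x (- ln (dl (pt oo) x))%:E)%E.
Proof.
have ml2 : measurable_fun setT (fun p => (l2 p)%:E) by apply/measurable_EFinP; exact: (mright (ml (pt oo))).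
rewrite fubini_tonelli1//; last by move=> p; rewrite lee_fin; exact: g0_ge0.
by rewrite /fubini_F /l2 /=; exact: int_cst1.
Qed.

Let nonneg_int (u : T * T -> R) : measurable_fun setT u -> (forall p, 0 <= u p) ->
  (\int[rho \x rho]_p (u p)%:E = \int[rho]_x (- ln (dl (pt oo) x))%:E)%E ->
  (rho \x rho)%E.-integrable setT (EFin \o u).
Proof.
move=> mu u0 H; apply/integrableP; split; first exact/measurable_EFinP.
under eq_integral do rewrite gee0_abs ?lee_fin//.
rewrite H; have := integrable_fin_num measurableT (R_int (pt oo)).
by rewrite ge0_fin_numE// integral_ge0// => x _; rewrite lee_fin.
Qed.

Let L_ae : {ae (rho \x rho)%E, forall p, L p = l1 p + l2 p - l12 p}.
Proof.
have mz : measurable [set y | dl (pt oo) y = 0] by have := mdl (pt oo) measurableT (measurable_set1 (0 : R)); rewrite setTI.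
have n1 : {ae (rho \x rho)%E, forall p, dl (pt oo) p.1 != 0}.
  exists ([set y | dl (pt oo) y = 0] `*` setT); split.
  - exact: measurableX.
  - by rewrite product_measure1E// [X in (X * _)%E](pot0_null (pt oo)) mul0e.
  - by move=> [x y] /= /negP; rewrite negbK => /eqP.
have n2 : {ae (rho \x rho)%E, forall p, dl (pt oo) p.2 != 0}.
  exists (setT `*` [set y | dl (pt oo) y = 0]); split.
  - exact: measurableX.
  - by rewrite product_measure1E// [X in (_ * X)%E](pot0_null (pt oo)) mule0.
  - by move=> [x y] /= /negP; rewrite negbK => /eqP.
have n3 : {ae (rho \x rho)%E, forall p, dl p.1 p.2 != 0}.
  exists [set p | dl p.1 p.2 = 0]; split.
  - by have := gk_meas gk measurableT (measurable_set1 (0 : R)); rewrite setTI.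
  - exact: energy0_null.
  - by move=> [x y] /= /negP; rewrite negbK => /eqP.
have n23 : {ae (rho \x rho)%E, forall p, dl (pt oo) p.2 != 0 /\ dl p.1 p.2 != 0} by apply: filterS2 n2 n3.
apply: filterS2 n1 n23 => -[x y] /= hx [hy hxy].
by rewrite LE (negbTE hx) (negbTE hy) (negbTE hxy) /l1 /l2 /l12 /= opprK.
Qed.

Let L_val : \int[(rho \x rho)%E]_p L p = 2 * pot0 (pt oo) - energy0.
Proof.
have i1 : (rho \x rho)%E.-integrable setT (EFin \o l1) by apply: nonneg_int => //; [exact: (mleft (ml (pt oo))) | move=> p; exact: g0_ge0].
have i2 : (rho \x rho)%E.-integrable setT (EFin \o l2) by apply: nonneg_int => //; [exact: (mright (ml (pt oo))) | move=> p; exact: g0_ge0].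
have i3 : (rho \x rho)%E.-integrable setT (EFin \o l12) by exact: energy0_integrable.
have i12 := integrableD measurableT i1 i2.
have [_ ->] := ae_eq_Rintegral (integrableB measurableT i12 i3) mL L_ae.
rewrite (RintegralB _ i12 i3)// (RintegralD _ i1 i2)//.
rewrite /energy0 -/(l12); congr (_ - _).
by rewrite {1 2}/Rintegral l1_int l2_int -/(Rintegral rho setT _) mulr2n mulrDl !mul1r.
Qed.

(** In the integral of L the height sum has the coefficient 2(n - 1)/n^2 from [F] x [F] and -2/n
    from the mixed terms. Because of the missing diagonal they do not cancel: -2/n^2 is left, and
    the sign is then reversed. The potential of rho at infinity cancels since [F] - rho has mass
    0. *)
Theorem energy_discrepancy F : F != fset0 ->
  - charge_prod_integral (measure_diff (em F) rho) (measure_diff (em F) rho) D L =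
  discrepancy0 F + 2 * ((n F)^-1 * (n F)^-1 * height_sum F).
Proof.
move=> /nF_gt0 F0.
have ptE a : [set y | dl (pt a) y = 0] = [set pt a] by apply/seteqP; split => y /= /(gk_pt gk).
have ptm a : measurable [set pt a] by have := mdl (pt a) measurableT (measurable_set1 (0 : R)); rewrite setTI -ptE.
have Li a : rho.-integrable setT (fun y => (L (pt a, y))%:E) by have [] := Lpt_aeP a.
have ptn a : rho [set pt a] = 0%E by rewrite -ptE; exact: pot0_null.
rewrite (@empirical_energy _ _ _ _ pt F rho (fun a _ => ptm a) (fun a _ => ptn a) D L LD mL
  (fun a _ => Li a) Lsym) L_val.
under [X in _ - 2 * (_ * X)]eq_bigr do rewrite Lpt_val.
rewrite -/(n F) !sumrB !big_split /= big_const_seq count_predT iter_addr_0 -mulr_natl -/(n F).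
rewrite -/(height_sum F).
have -> : \sum_(a <- F) \sum_(b <- F) L (pt a, pt b) =
   2 * (n F - 1) * height_sum F - \sum_(a <- F) \sum_(b <- F) g0 a b.
  under eq_bigr do under eq_bigr do rewrite Lpt.
  under eq_bigr do rewrite sumrB.
  rewrite sumrB; congr (_ - _).
  have E a : a \in F -> \sum_(b <- F) (a != b)%:R * (g0 oo a + g0 oo b) =
      (n F - 2) * g0 oo a + height_sum F.
    move=> aF; transitivity (\sum_(b <- F) (g0 oo a + g0 oo b) - 2 * g0 oo a).
      rewrite (bigD1_seq a)//= eqxx mul0r add0r [in RHS](bigD1_seq a)//=.
      rewrite addrAC -mulr2n mulr_natl subrr add0r.
      by apply: eq_bigr => b ba; rewrite eq_sym ba mul1r.
    rewrite big_split /= big_const_seq count_predT iter_addr_0 -mulr_natl -/(height_sum F).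
    rewrite -/(n F); ring.
  rewrite big_seq; under eq_bigr => a aF do rewrite E//.
  rewrite -big_seq big_split /= -mulr_sumr -/(height_sum F).
  rewrite big_const_seq count_predT iter_addr_0 -mulr_natl -/(n F); ring.
rewrite /discrepancy0; field; by rewrite gt_eqF.
Qed.

End log_kernel.

Definition testable (phi : T -> R) := forall eta, 0 < eta -> exists k0 : nat, exists2 C, 0 <= C &
  forall k F, (k0 <= k)%N -> F != fset0 ->
  ((n F)^-1 * (\sum_(a <- F) phi (pt a)) - \int[rho]_y phi y) ^+ 2 <=
    C * discrepancy k F + eta.

Lemma discrepancy0_lower : (forall k F, F != fset0 -> 0 <= discrepancy k F) ->
  forall eta, 0 < eta -> exists B, forall F, F != fset0 -> - eta - B / n F <= discrepancy0 F.
Proof.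
move=> psd eta eta0; have e2 : 0 < eta / 2 by rewrite divr_gt0.
have /cvgrPdist_lt /(_ _ e2) [k _ /(_ k (leqnn k))] := gk_err0 gk.
rewrite /= sub0r normrN => ek; exists (M k) => F F0.
have := discrepancy0_ge_reg k F0; have := psd k F F0.
have := ler_norm (err k); lra.
Qed.

Theorem discrepancy_equidistribution (Fs : nat -> {fset A}) (phi : T -> R) :
  (forall i, Fs i != fset0) ->
  (forall B, \forall i \near \oo, B <= n (Fs i)) ->
  (forall eta, 0 < eta -> \forall i \near \oo, discrepancy0 (Fs i) <= eta) ->
  measurable_fun setT phi -> testable phi ->
  Rintegral (em (Fs i)) setT phi @[i --> \oo] --> \int[rho]_y phi y.
Proof.
move=> Fs0 card small mphi tphi; apply/cvgrPdist_lt => e e0.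
have e4 : 0 < e ^+ 2 / 4 by rewrite divr_gt0// exprn_gt0.
have [k0 [C C0 HC]] := tphi _ e4.
(* With err k < dt and then M k / n <= dt, [discrepancy k] is at most dt + dt + 2 dt, and 4 C dt <=
   e^2 / 4. *)
pose dt := e ^+ 2 / (16 * (C + 1)).
have C1 : 0 < C + 1 by rewrite ltr_wpDl.
have dt0 : 0 < dt by rewrite divr_gt0// ?exprn_gt0// mulr_gt0.
have /cvgrPdist_lt /(_ _ dt0) [k1 _ Hk1] := gk_err0 gk.
pose k := maxn k0 k1.
have /(_ (leq_maxr _ _)) := Hk1 k; rewrite /= sub0r normrN => ek.
have M0 : 0 <= M k.
  have /andP[h1 h2] := gk_Gbound gk k (pt oo) (pt oo); exact: le_trans h1 h2.
near=> i; have F0 := Fs0 i; have n0 := nF_gt0 F0.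
rewrite empirical_Rintegral// -/(n (Fs i)) distrC.
rewrite -(@ltr_pXn2r _ 2)// ?nnegrE ?(ltW e0)// real_normK ?num_real//.
apply: le_lt_trans (HC k _ (leq_maxl _ _) F0) _.
have D1 := discrepancy0_ge_reg k F0.
have D2 : discrepancy0 (Fs i) <= dt by near: i; exact: small.
have D3 : M k / n (Fs i) <= dt.
  rewrite ler_pdivrMr// mulrC -ler_pdivrMr//; near: i; exact: card.
have Ek := ler_norm (err k).
have D4 : discrepancy k (Fs i) <= 4 * dt by lra.
have E : e ^+ 2 = 16 * (C + 1) * dt by rewrite /dt; field; rewrite gt_eqF.
have : C * discrepancy k (Fs i) <= C * (4 * dt) by rewrite ler_wpM2l.
rewrite E; nra.
Unshelve. all: by end_near. Qed.

End green_kernel.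

(** * Absolute values and number fields *)

Section absolute_value_theory.
Variables (R : realType) (F : fieldType) (v : F -> R).
Hypothesis vP : is_absval v.

Lemma absval_ge0 x : 0 <= v x. Proof. by case: vP. Qed.
Lemma absval0 : v 0 = 0. Proof. by case: vP => _ h _ _; apply/h. Qed.
Lemma absval_eq0 x : (v x == 0) = (x == 0).
Proof. by case: vP => _ h _ _; apply/eqP/eqP => /h. Qed.
Lemma absvalM x y : v (x * y) = v x * v y. Proof. by case: vP. Qed.
Lemma absvalD x y : v (x + y) <= v x + v y. Proof. by case: vP. Qed.
Lemma absval_gt0 x : (0 < v x) = (x != 0).
Proof. by rewrite lt_def absval_eq0 absval_ge0 andbT. Qed.
Lemma absval1 : v 1 = 1.
Proof.
have v1 : v 1 != 0 by rewrite absval_eq0 oner_eq0.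
by apply: (mulfI v1); rewrite -absvalM !mulr1.
Qed.
Lemma absvalN x : v (- x) = v x.
Proof.
have : v (- x) ^+ 2 = v x ^+ 2 by rewrite !expr2 -!absvalM mulrNN.
by move/eqP; rewrite eqrXn2 ?absval_ge0// => /eqP.
Qed.
Lemma absvalB x y : v (x - y) <= v x + v y.
Proof. by rewrite -(absvalN y); exact: absvalD. Qed.
Lemma absvalC x y : v (x - y) = v (y - x).
Proof. by rewrite -absvalN opprB. Qed.
Lemma absvalX x n : v (x ^+ n) = v x ^+ n.
Proof. by elim: n => [|n IH]; rewrite ?expr0 ?absval1// !exprS absvalM IH. Qed.
Lemma absvalV x : v x^-1 = (v x)^-1.
Proof.
have [->|x0] := eqVneq x 0; first by rewrite invr0 absval0 invr0.
have vx : v x != 0 by rewrite absval_eq0.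
by apply: (mulfI vx); rewrite -absvalM !divff// absval1.
Qed.
Lemma absval_ge x y : v x - v y <= v (x - y).
Proof. by rewrite lerBlDr; apply: le_trans (absvalD _ _); rewrite subrK. Qed.
Lemma absval_geB x y : v x - v (x - y) <= v y.
Proof. by have := absval_ge x (x - y); rewrite opprB addrCA subrr addr0. Qed.
Lemma absval_sum (I : Type) (r : seq I) (P : pred I) (f : I -> F) :
  v (\sum_(i <- r | P i) f i) <= \sum_(i <- r | P i) v (f i).
Proof.
elim/big_ind2: _ => [|x a y b xa yb|//]; first by rewrite absval0.
by apply: le_trans (absvalD _ _) _; rewrite lerD.
Qed.
Lemma absval_prod (I : Type) (r : seq I) (P : pred I) (f : I -> F) :
  v (\prod_(i <- r | P i) f i) = \prod_(i <- r | P i) v (f i).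
Proof. by apply: (big_morph v absvalM absval1). Qed.
End absolute_value_theory.

Section closed_subfields.
Variables (R : realType) (F : fieldType) (v : F -> R) (A : set F).
Hypothesis vP : is_absval v.

Lemma sub_absval_closure : A `<=` absval_closure v A.
Proof. by move=> x Ax e e0; exists x => //; rewrite subrr absval0. Qed.

Lemma absval_closureS (B : set F) : A `<=` B -> absval_closure v A `<=` absval_closure v B.
Proof. by move=> AB x xA e /xA[y Ay h]; exists y => //; exact: AB. Qed.

Lemma absval_closure_closed : absval_closure v (absval_closure v A) `<=` absval_closure v A.
Proof.
move=> x xA e e0; have e2 : 0 < e / 2 by rewrite divr_gt0.
have [y Ay h] := xA _ e2; have [z Az h'] := Ay _ e2; exists z => //.
have -> : x - z = (x - y) + (y - z) by rewrite addrA subrK.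
by rewrite (splitr e) (le_lt_trans (absvalD vP _ _))// ltrD.
Qed.

Lemma absval_closureB : (forall x y, A x -> A y -> A (x - y)) ->
  forall x y, absval_closure v A x -> absval_closure v A y -> absval_closure v A (x - y).
Proof.
move=> AB x y xA yA e e0; have e2 : 0 < e / 2 by rewrite divr_gt0.
have [x' Ax hx] := xA _ e2; have [y' Ay hy] := yA _ e2; exists (x' - y'); first exact: AB.
have -> : x - y - (x' - y') = (x - x') - (y - y') by ring.
by rewrite (splitr e) (le_lt_trans (absvalB vP _ _))// ltrD.
Qed.

Lemma absval_closureM : (forall x y, A x -> A y -> A (x * y)) ->
  forall x y, absval_closure v A x -> absval_closure v A y -> absval_closure v A (x * y).
Proof.
move=> AM x y xA yA e e0; have vx := absval_ge0 vP x; have vy := absval_ge0 vP y.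
pose s := v x + v y + 1; have s0 : 0 < s by rewrite ltr_wpDl// addr_ge0.
pose a := Num.min 1 (e / s); have a0 : 0 < a by rewrite lt_min ltr01 divr_gt0.
have a1 : a <= 1 by rewrite ge_min lexx.
have as' : a * s <= e by rewrite -ler_pdivlMr// ge_min lexx orbT.
have [x' Ax hx] := xA _ a0; have [y' Ay hy] := yA _ a0; exists (x' * y'); first exact: AM.
have -> : x * y - x' * y' = x * (y - y') + (x - x') * y' by ring.
apply: le_lt_trans (absvalD vP _ _) _; rewrite !(absvalM vP).
have y'1 : v y' <= v y + 1.
  have := absval_geB vP y' y; rewrite absvalC//; lra.
apply: le_lt_trans (_ : v x * a + v (x - x') * (v y + 1) < _).
  by apply: lerD; apply: ler_wpM2l; rewrite ?absval_ge0// ltW.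
apply: lt_le_trans as'.
have -> : a * s = v x * a + a * (v y + 1) by rewrite /s; ring.
rewrite ltrD2l.
by rewrite ltr_pM2r// ltr_wpDl.
Qed.

Lemma absval_closureV : (forall x, A x -> A x^-1) ->
  forall x, absval_closure v A x -> absval_closure v A x^-1.
Proof.
move=> AV x xA; have [x0|x0] := eqVneq x 0; first by rewrite x0 invr0 -x0.
move=> e e0; have vx : 0 < v x by rewrite absval_gt0.
pose a := Num.min (v x / 2) (e * v x / 2 * v x).
have a0 : 0 < a by rewrite lt_min !(divr_gt0, mulr_gt0).
have a1 : a <= v x / 2 by rewrite ge_min lexx.
have a2 : a <= e * v x / 2 * v x by rewrite ge_min lexx orbT.
have [y Ay h] := xA _ a0; exists y^-1; first exact: AV.
have vy : v x / 2 < v y.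
  have := absval_geB vP x y; lra.
have vy0 : 0 < v y by apply: lt_trans vy; rewrite divr_gt0.
have y0 : y != 0 by rewrite -(absval_gt0 vP).
have -> : x^-1 - y^-1 = (y - x) * (x^-1 * y^-1) by field; rewrite x0 y0.
rewrite !(absvalM vP) !(absvalV vP) (absvalC vP) mulrA -!ltr_pdivlMr ?invr_gt0// !invrK.
apply: lt_le_trans h (le_trans a2 _); rewrite ler_wpM2r ?(ltW vx)// -mulrA ler_wpM2l ?(ltW e0)// ltW//.
Qed.

End closed_subfields.

Lemma near_seq (T : choiceType) (s : seq T) (P : T -> nat -> Prop) :
  (forall x, x \in s -> \forall m \near \oo, P x m) ->
  \forall m \near \oo, forall x, x \in s -> P x m.
Proof.
elim: s => [|a s IH] H; first by near=> m.
have Ha := H a (mem_head _ _).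
have Hs : \forall m \near \oo, forall x, x \in s -> P x m by apply: IH => x xs; apply: H; rewrite inE xs orbT.
by apply: filterS2 Ha Hs => m pa ps x; rewrite inE => /orP[/eqP ->|/ps].
Unshelve. all: by end_near. Qed.

Lemma expr_small (R : realType) (r e : R) : 0 <= r < 1 -> 0 < e -> \forall m \near \oo, r ^+ m < e.
Proof.
move=> /andP[r0 r1] e0.
have := @cvg_expr R r; rewrite ger0_norm// => /(_ r1) /cvgrPdist_lt /(_ _ e0).
by apply: filterS => m; rewrite sub0r normrN ger0_norm// exprn_ge0.
Qed.

Lemma expr_large (R : realType) (r B : R) : 1 < r -> \forall m \near \oo, B < r ^+ m.
Proof.
move=> r1; have r0 : 0 < r by exact: lt_trans ltr01 r1.
pose B' := `|B| + 1; have B0 : 0 < B' by rewrite ltr_wpDl.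
have h : 0 <= r^-1 < 1 by rewrite invr_ge0 (ltW r0) invf_lt1.
have iB : 0 < B'^-1 by rewrite invr_gt0.
apply: filterS (expr_small h iB) => m.
rewrite exprVn ltf_pV2 ?posrE ?exprn_gt0// => /(lt_trans _); apply.
by rewrite /B' (le_lt_trans (ler_norm B))// ltrDl.
Qed.

(** * Weak approximation: finitely many absolute values extend a given one *)

Section finitely_many_extensions.
Variables (R : realType) (K : fieldExtType rat) (v0 : rat -> R) (V : set (K -> R)).
Hypotheses (V_abs : forall v, V v -> is_absval v)
  (V_rat : forall v q, V v -> v q%:A = v0 q)
  (v0_nontrivial : exists q, 0 < v0 q < 1).

(** Both absolute values equal C > 1 at the rational Q. Once (w x / v x)^n > C, a power of Q
    separates v x^n from w x^n; the factor Q^k only serves to keep the exponent m + 1 a natural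
    number. *)
Let separate_lt v w x : V v -> V w -> v x < w x -> exists a, v a < 1 < w a.
Proof.
move=> Vv Vw vw; have av := V_abs Vv; have aw := V_abs Vw.
have [q /andP[q0 q1]] := v0_nontrivial; pose Q : K := (q%:A)^-1; pose C := (v0 q)^-1.
have [vQ wQ] : v Q = C /\ w Q = C by rewrite !absvalV// !V_rat.
have C1 : 1 < C by rewrite invf_gt1.
clearbody Q.
have vx : 0 < v x by rewrite absval_gt0// -(absval_gt0 aw) (le_lt_trans (absval_ge0 av x)).
have ex (r B : R) : 1 < r -> exists n, B < r ^+ n by move=> /(expr_large B)[N _ /(_ N (leqnn N))]; exists N.
have [|n nP] := ex (w x / v x) C; first by rewrite ltr_pdivlMr// mul1r.
have [k kP] := ex C (v x ^+ n)^-1 C1; pose A := v x ^+ n * C ^+ k.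
have A1 : 1 < A by rewrite -ltr_pdivrMl ?exprn_gt0// mulr1.
case: (ex_minnP (ex C A C1)) => -[|m] Am min; first by rewrite expr0 ltNge ltW in Am.
have mA : C ^+ m <= A by rewrite leNgt; apply/negP => /min; rewrite ltnn.
have C0 l : 0 < C ^+ l by rewrite exprn_gt0// (lt_trans ltr01).
exists (x ^+ n * Q ^+ k / Q ^+ m.+1).
rewrite !(absvalM av) !(absvalM aw) !(absvalV av, absvalV aw, absvalX av, absvalX aw) vQ wQ.
rewrite ltr_pdivrMr// mul1r Am ltr_pdivlMr// mul1r exprSr.
apply: le_lt_trans (_ : A * C < _); first by rewrite ler_pM2r ?(lt_trans ltr01).
by rewrite /A mulrAC ltr_pM2r// mulrC -ltr_pdivlMr ?exprn_gt0// -expr_div_n.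
Qed.

Let separate v w : V v -> V w -> v <> w -> exists a, 1 < v a /\ w a < 1.
Proof.
move=> Vv Vw vw; have av := V_abs Vv; have aw := V_abs Vw.
have [x vwx] : exists x, v x <> w x by apply: contrapT => /forallNP h; apply: vw; apply/funext => x; exact: contrapT (h x).
have [h|h|//] := ltgtP (v x) (w x).
  have [a /andP[va wa]] := separate_lt Vv Vw h.
  have a0 : a != 0 by rewrite -(absval_gt0 aw) (lt_trans ltr01).
  exists a^-1; rewrite !absvalV// invf_gt1 ?absval_gt0// va; split => //.
  by rewrite invf_lt1 ?absval_gt0.
by have [a /andP[wa va]] := separate_lt Vw Vv h; exists a.
Qed.

(** The elements x^m / (1 + x^m) tend to 0 where v x < 1 and, by [grow], to 1 where v x > 1. *)
Let shrink v x : V v -> v x < 1 -> forall e, 0 < e -> \forall m \near \oo, v (x ^+ m / (1 + x ^+ m)) < e.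
Proof.
move=> Vv vx e e0; have av := V_abs Vv.
have vx0 : 0 <= v x < 1 by rewrite absval_ge0.
have d0 : 0 < Num.min 2^-1 (e / 2) by rewrite lt_min invr_gt0 ltr0n divr_gt0.
apply: filterS (expr_small vx0 d0) => m; rewrite lt_min => /andP[h1 h2].
rewrite (absvalM av) (absvalV av) (absvalX av).
have h3 : 2^-1 < v (1 + x ^+ m).
  rewrite -[x ^+ m]opprK; apply: lt_le_trans (absval_ge av _ _).
  rewrite (absval1 av) (absvalN av) (absvalX av); lra.
rewrite ltr_pdivrMr; last by rewrite (lt_trans _ h3)// invr_gt0.
nra.
Qed.

Let grow v x : V v -> 1 < v x -> forall e, 0 < e -> \forall m \near \oo, v (1 - x ^+ m / (1 + x ^+ m)) < e.
Proof.
move=> Vv vx e e0; have av := V_abs Vv.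
apply: filterS (expr_large (1 + e^-1) vx) => m h.
have h3 : e^-1 < v (1 + x ^+ m).
  rewrite addrC -[1]opprK; apply: lt_le_trans (absval_ge av _ _).
  rewrite (absvalN av) (absval1 av) (absvalX av); lra.
have h4 : 0 < v (1 + x ^+ m) by rewrite (lt_trans _ h3)// invr_gt0.
have h5 : 1 + x ^+ m != 0 by rewrite -(absval_gt0 av).
have -> : 1 - x ^+ m / (1 + x ^+ m) = (1 + x ^+ m)^-1 by rewrite -[X in X - _](divff h5) -mulrBl addrK mul1r.
by rewrite absvalV// -[e]invrK ltf_pV2 ?posrE// invr_gt0.
Qed.

(** Artin-Whaples induction. For a new u, take y large at v and small at u: x itself works if u x <
    1, x^N y if u x = 1, and y x^m / (1 + x^m) if u x > 1, since the last factor tends to 1 at v and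
    u and to 0 along s. *)
Let separate_seq v (s : seq (K -> R)) : V v -> (forall w, w \in s -> V w) -> v \notin s ->
  exists x, 1 < v x /\ forall w, w \in s -> w x < 1.
Proof.
move=> Vv; have av := V_abs Vv; elim: s => [|u s IH] Vs vs.
  have [q /andP[q0 q1]] := v0_nontrivial.
  exists (q%:A)^-1; split => //; rewrite absvalV// V_rat//.
  by rewrite invf_gt1.
have Vu := Vs u (mem_head _ _); have au := V_abs Vu.
move: vs; rewrite inE negb_or => /andP[/eqP vu vs].
have [|x [vx sx]] := IH _ vs; first by move=> w ws; apply: Vs; rewrite inE ws orbT.
have aw w : w \in s -> is_absval w by move=> ws; apply/V_abs/Vs; rewrite inE ws orbT.
have Vw w : w \in s -> V w by move=> ws; apply/Vs; rewrite inE ws orbT.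
have [y [vy uy]] := separate Vv Vu vu.
have [ux|ux|ux] := ltgtP (u x) 1.
- by exists x; split => // w; rewrite inE => /orP[/eqP ->|/sx].
- pose t m := x ^+ m / (1 + x ^+ m).
  have e1 : 0 < (v y - 1) / v y by rewrite divr_gt0 ?subr_gt0// (lt_trans ltr01).
  have := grow Vv vx e1.
  have e2 : 0 < (1 - u y) by rewrite subr_gt0.
  have := grow Vu ux e2.
  have sm : \forall m \near \oo, forall w, w \in s -> w (y * t m) < 1.
    apply: near_seq => w ws.
    have ww := aw _ ws.
    have e3 : 0 < (w y + 1)^-1 by rewrite invr_gt0 ltr_wpDl ?absval_ge0.
    apply: filterS (shrink (Vw _ ws) (sx _ ws) e3) => m h.
    rewrite (absvalM ww); apply: le_lt_trans (_ : w y * (w y + 1)^-1 < 1).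
      by rewrite ler_wpM2l ?absval_ge0// ltW.
    by rewrite ltr_pdivrMr ?ltr_wpDl ?absval_ge0// mul1r ltrDl.
  move=> hu hv.
  have [m [[h1 h2] h3]] : exists m, (v (1 - t m) < (v y - 1) / v y /\ u (1 - t m) < 1 - u y) /\
      forall w, w \in s -> w (y * t m) < 1.
    have HH : \forall m \near \oo, (v (1 - t m) < (v y - 1) / v y /\ u (1 - t m) < 1 - u y) /\
      forall w, w \in s -> w (y * t m) < 1.
      by near=> m; split; [split|]; near: m.
    by have [N _ /(_ N (leqnn _))] := HH; exists N.
  exists (y * t m); split.
    rewrite absvalM//.
    have := absval_geB av 1 (t m); rewrite (absval1 av) => h4.
    move: h1; rewrite ltr_pdivlMr//; nra.
  move=> w; rewrite inE => /orP[/eqP ->|/h3//].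
  rewrite absvalM//.
  have h4 : u (t m) <= 1 + u (1 - t m) by have := absvalB au 1 (1 - t m); rewrite (absval1 au) opprB addrCA subrr addr0.
  have := absval_ge0 au y; have := absval_ge0 au (1 - t m); nra.
- have sm : \forall m \near \oo, forall w, w \in s -> w (x ^+ m * y) < 1.
    apply: near_seq => w ws; have ww := aw _ ws.
    have e3 : 0 < (w y + 1)^-1 by rewrite invr_gt0 ltr_wpDl ?absval_ge0.
    have wx : 0 <= w x < 1 by rewrite absval_ge0// sx.
    apply: filterS (expr_small wx e3) => m h.
    rewrite (absvalM ww) (absvalX ww) mulrC; apply: le_lt_trans (_ : w y * (w y + 1)^-1 < 1).
      by rewrite ler_wpM2l ?absval_ge0// ltW.
    by rewrite ltr_pdivrMr ?ltr_wpDl ?absval_ge0// mul1r ltrDl.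
  have [N _ /(_ N (leqnn _)) HN] := sm.
  exists (x ^+ N * y); split.
    rewrite (absvalM av) (absvalX av); have := exprn_ege1 N (ltW vx); nra.
  move=> w; rewrite inE => /orP[/eqP ->|/HN//].
  by rewrite absvalM// absvalX// ux expr1n mul1r.
Unshelve. all: by end_near. Qed.

Let approximate v (s : seq (K -> R)) : V v -> (forall w, w \in s -> V w) -> v \notin s ->
  forall e, 0 < e -> exists x, v (1 - x) < e /\ forall w, w \in s -> w x < e.
Proof.
move=> Vv Vs vs e e0; have [x [vx sx]] := separate_seq Vv Vs vs.
have h1 := grow Vv vx e0.
have h2 : \forall m \near \oo, forall w, w \in s -> w (x ^+ m / (1 + x ^+ m)) < e by apply: near_seq => w ws; apply: shrink => //; [exact: Vs | exact: sx].
have [N _ HN] : \forall m \near \oo, v (1 - x ^+ m / (1 + x ^+ m)) < e /\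
    forall w, w \in s -> w (x ^+ m / (1 + x ^+ m)) < e.
  by near=> m; split; near: m.
by exists (x ^+ N / (1 + x ^+ N)); exact: (HN N (leqnn _)).
Unshelve. all: by end_near. Qed.

(** Elements x i close to 1 at the i-th absolute value and small at the others are linearly
    independent over the rationals: in a relation, the term with the largest v0 (c i) cannot be
    balanced at the i-th absolute value. With e = 1/(2n) the other terms weigh at most n e - e < 1 -
    e. *)
Lemma absval_extensions_bound (s : seq (K -> R)) : uniq s -> (forall w, w \in s -> V w) ->
  (size s <= \dim {: K})%N.
Proof.
move=> us Vs; rewrite leqNgt; apply/negP => sK.
set n := size s in sK.
have n0 : (0 < n)%N by exact: leq_trans sK.
pose e : R := (2 * n%:R)^-1.
have e0 : 0 < e by rewrite invr_gt0 mulr_gt0// ltr0n.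
pose w0 : K -> R := nth (fun=> 0) s 0.
have Vn i : (i < n)%N -> V (nth w0 s i) by move=> ni; apply: Vs; rewrite mem_nth.
have ex (i : 'I_n) : exists x, nth w0 s i (1 - x) < e /\
    forall j : 'I_n, j != i -> nth w0 s j x < e.
  have [|||x [h1 h2]] := @approximate (nth w0 s i) (rem (nth w0 s i) s) _ _ _ e e0.
  - exact: Vn.
  - by move=> w /mem_rem; exact: Vs.
  - by rewrite mem_rem_uniqF.
  - exists x; split => // j ji; apply: h2.
    rewrite mem_rem_uniq// inE mem_nth// andbT nth_uniq//.
pose x i := projT1 (cid (ex i)).
have x1 (i : 'I_n) : nth w0 s i (1 - x i) < e by rewrite /x; case: cid => ? [].
have x2 (i j : 'I_n) : j != i -> nth w0 s j (x i) < e by move=> ji; have [_ h] := projT2 (cid (ex i)); exact: (h j ji).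
pose X := [tuple x i | i < n].
have : ~~ free X.
  apply/negP => fX; have := dimvS (subvf <<X>>); rewrite (eqP fX) size_tuple => h.
  by have := leq_ltn_trans h sK; rewrite ltnn.
apply/negP; rewrite negbK; apply/freeP => c c0.
apply: contrapT => /existsNP[i1 ci1].
have [i _ imax] := @arg_maxP _ _ _ i1 xpredT (fun i => v0 (c i)) isT.
have vi := Vn i (ltn_ord i); have ai := V_abs vi.
have vc j : nth w0 s i (c j *: x j) = v0 (c j) * nth w0 s i (x j) by rewrite -mulr_algl absvalM// V_rat.
have ci0 : 0 < v0 (c i).
  apply: lt_le_trans (imax i1 isT).
  rewrite -(V_rat _ vi) absval_gt0//; apply/eqP => h; apply: ci1.
  by apply/eqP; move/eqP: h; rewrite scaler_eq0 oner_eq0 orbF.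
have XE (j : 'I_n) : X`_j = x j by rewrite -(tnth_nth 0 X j) tnth_mktuple.
have H : c i *: x i = - \sum_(j | j != i) c j *: x j.
  apply/eqP; rewrite -addr_eq0; apply/eqP; rewrite -[RHS]c0 [RHS](bigD1 i)// XE.
  by congr (_ + _); apply: eq_bigr => j _; rewrite XE.
have : v0 (c i) * nth w0 s i (x i) <= v0 (c i) * (n%:R * e - e).
  rewrite -vc H (absvalN ai); apply: le_trans (absval_sum ai _ _ _) _.
  have -> : n%:R * e - e = \sum_(j < n | j != i) e.
    have -> : n%:R * e = \sum_(j < n) e by rewrite sumr_const card_ord mulr_natl.
    by rewrite (bigD1 i)//= addrAC subrr add0r.
  rewrite mulr_sumr; apply: ler_sum => j ji; rewrite vc.
  apply: ler_pM.
  - by rewrite -(V_rat _ vi) (absval_ge0 ai).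
  - exact: (absval_ge0 ai).
  - exact: imax.
  - by apply/ltW/x2; rewrite eq_sym.
rewrite ler_pM2l// => h.
have : 1 - e < nth w0 s i (x i).
  have := absval_geB ai 1 (x i); rewrite (absval1 ai) => h'.
  have := x1 i; lra.
have : n%:R * e = 2^-1 by rewrite /e invfM mulrCA divff ?mulr1// pnatr_eq0 gtn_eqF.
lra.
Qed.

Lemma absval_extensions_finite : finite_set V.
Proof.
apply: contrapT => /(infinite_set_fset (\dim {: K}).+1)[B BV].
apply/negP; rewrite -ltnNge ltnS; apply: absval_extensions_bound.
  exact: fset_uniq.
by move=> w wB; exact: BV.
Qed.

End finitely_many_extensions.

(** * Finite spans over a closed subfield of a complete field *)

Section finite_spans.
Variables (R : realType) (F : fieldType) (v : F -> R) (k : set F).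
Hypotheses (vP : is_absval v) (v_complete : absval_complete v)
  (kB : forall x y, k x -> k y -> k (x - y)) (kM : forall x y, k x -> k y -> k (x * y))
  (kV : forall x, k x -> k x^-1) (k1 : k 1)
  (k_closed : absval_closure v k `<=` k).

Let k0 : k 0. Proof. by rewrite -(subrr 1); exact: kB. Qed.
Let kN x : k x -> k (- x). Proof. by move=> kx; rewrite -sub0r; exact: kB. Qed.

Fixpoint span_of (s : seq F) : set F :=
  if s is b :: s' then [set x | exists c y, [/\ k c, span_of s' y & x = c * b + y]]
  else [set 0].

Lemma span_of0 s : span_of s 0.
Proof. by elim: s => //= b s IH; exists 0, 0; rewrite mul0r addr0. Qed.

Lemma span_ofB s x y : span_of s x -> span_of s y -> span_of s (x - y).
Proof.
elim: s x y => [x y -> ->|b s IH x y [c [x' [kc sx ->]]] [c' [y' [kc' sy ->]]]] /=.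
  by rewrite subrr.
exists (c - c'), (x' - y'); split; [exact: kB | exact: IH |].
by rewrite mulrBl opprD addrACA.
Qed.

Lemma span_ofZ s a x : k a -> span_of s x -> span_of s (a * x).
Proof.
move=> ka; elim: s x => [x ->|b s IH x [c [x' [kc sx ->]]]] /=; first by rewrite mulr0.
by exists (a * c), (a * x'); split; [exact: kM | exact: IH | rewrite mulrDr mulrA].
Qed.

Lemma span_ofD s x y : span_of s x -> span_of s y -> span_of s (x + y).
Proof.
move=> sx sy; rewrite -[y]opprK; apply: span_ofB => //.
by rewrite -mulN1r; apply: span_ofZ => //; exact: kN.
Qed.

Lemma inv_small (e : R) : 0 < e -> exists N : nat, forall n, (N <= n)%N -> n.+1%:R^-1 < e.
Proof.
move=> e0; exists (Num.bound e^-1) => n Nn.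
rewrite -[e]invrK ltf_pV2 ?posrE ?invr_gt0//.
apply: lt_le_trans (archi_boundP _) _; first by rewrite invr_ge0 ltW.
by rewrite ler_nat (leq_trans Nn).
Qed.

(** If b is outside the span of s, closed by induction, its distance d to that span is positive.
    Then the coefficient c of b satisfies d v(c) <= v(c b + y), so in an approximating sequence the
    coefficients of b are Cauchy and converge in k. *)
Lemma span_of_closed s : absval_closure v (span_of s) `<=` span_of s.
Proof.
elim: s => [|b s IH] x xs.
  rewrite /= in xs *; apply: contrapT => /eqP x0.
  have [|y -> ] := xs (v x); first by rewrite absval_gt0.
  by rewrite subr0 ltxx.
have [bs|bs] := pselect (span_of s b).
  exists 0, x; split => //; last by rewrite mul0r add0r.
  apply: IH => e e0; have [y [c [y' [kc sy ->]]] h] := xs e e0.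
  by exists (c * b + y') => //; apply: span_ofD => //; exact: span_ofZ.
have [d d0 dP] : exists2 d, 0 < d & forall y, span_of s y -> d <= v (b - y).
  apply: contrapT => H; apply: bs; apply: IH => e e0.
  apply: contrapT => H2; apply: H; exists e => // y sy; rewrite leNgt; apply/negP => h.
  by apply: H2; exists y.
have bnd c y : k c -> span_of s y -> d * v c <= v (c * b + y).
  move=> kc sy; have [->|c0] := eqVneq c 0; first by rewrite absval0// mulr0 absval_ge0.
  have -> : c * b + y = c * (b - - (c^-1 * y)) by rewrite opprK mulrDr mulrA divff// mul1r.
  rewrite absvalM// mulrC ler_wpM2l ?absval_ge0//; apply: dP.
  by rewrite -mulNr; apply: span_ofZ => //; exact/kN/kV.
have ex n : exists p : F * F, [/\ k p.1, span_of s p.2 & v (x - (p.1 * b + p.2)) < n.+1%:R^-1].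
  have [|y [c [y' [kc sy ->]]] h] := xs (n.+1%:R^-1); first by rewrite invr_gt0 ltr0n.
  by exists (c, y').
pose p n := projT1 (cid (ex n)).
have pP n : [/\ k (p n).1, span_of s (p n).2 & v (x - ((p n).1 * b + (p n).2)) < n.+1%:R^-1] by rewrite /p; case: cid.
have [l lP] : exists l, forall e, 0 < e -> exists N, forall n, (N <= n)%N -> v ((p n).1 - l) < e.
  apply: v_complete => e e0.
  have [N NP] : exists N : nat, forall n, (N <= n)%N -> n.+1%:R^-1 < d * e / 2 by apply: inv_small; rewrite divr_gt0// mulr_gt0.
  exists N => m n Nm Nn; have [km sm hm] := pP m; have [kn sn hn] := pP n.
  have H := bnd _ _ (kB km kn) (span_ofB sm sn).
  rewrite -(ltr_pM2l d0); apply: le_lt_trans H _.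
  have -> : ((p m).1 - (p n).1) * b + ((p m).2 - (p n).2) =
     (x - ((p n).1 * b + (p n).2)) - (x - ((p m).1 * b + (p m).2)) by ring.
  apply: le_lt_trans (absvalB vP _ _) _.
  by rewrite (splitr (d * e)) ltrD// ?(lt_trans hm (NP m Nm))// (lt_trans hn (NP n Nn)).
have kl : k l.
  apply: k_closed => e e0; have [N NP] := lP e e0.
  by exists (p N).1; [case: (pP N) | rewrite absvalC//; exact: NP].
exists l, (x - l * b); split => //; last by rewrite addrC subrK.
apply: IH => e e0.
have e2 : 0 < e / 2 by rewrite divr_gt0.
have eb : 0 < e / 2 / (v b + 1) by rewrite divr_gt0// ltr_wpDl// absval_ge0.
have [N1 NP1] := lP _ eb; have [N2 NP2] := inv_small e2.
pose N := maxn N1 N2; have [kN' sN hN] := pP N.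
exists (p N).2 => //.
have -> : x - l * b - (p N).2 = (x - ((p N).1 * b + (p N).2)) + ((p N).1 - l) * b by ring.
apply: le_lt_trans (absvalD vP _ _) _; rewrite (splitr e).
apply: ltr_leD.
  by apply: lt_trans hN _; apply: NP2; exact: leq_maxr.
rewrite absvalM//; have h := NP1 N (leq_maxl _ _).
apply: le_trans (_ : e / 2 / (v b + 1) * v b <= _).
  by rewrite ler_wpM2r ?absval_ge0// ltW.
rewrite -mulrA ler_piMr// ?(ltW e2)// mulrC ler_pdivrMr ?ltr_wpDl ?absval_ge0//.
by rewrite mul1r lerDl.
Qed.

Lemma span_of_mem s b : b \in s -> span_of s b.
Proof.
elim: s => //= a s IH; rewrite inE => /orP[/eqP ->|/IH sb].
  by exists 1, 0; rewrite mul1r addr0; split => //; exact: span_of0.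
by exists 0, b; rewrite mul0r add0r.
Qed.

Lemma span_of_basis s : exists n (b : 'I_n -> F), is_basis k (span_of s) b.
Proof.
elim: s => [|a s [n [b [bs bP]]]].
  exists 0%N, (fun=> 0); split; first by case.
  move=> x ->; exists [ffun=> 0]; split; first by split=> [[]//|]; rewrite big_ord0.
  by move=> c _; apply/ffunP => -[].
have [sa|sa] := pselect (span_of s a).
  exists n, b; suff -> : span_of (a :: s) = span_of s by [].
  apply/seteqP; split => x.
    by move=> [c [y [kc sy ->]]]; apply: span_ofD => //; exact: span_ofZ.
  by move=> sx; exists 0, x; rewrite mul0r add0r.
pose b' (i : 'I_n.+1) := if unlift ord0 i is Some j then b j else a.
have b'0 : b' ord0 = a by rewrite /b' unlift_none.
have b'S j : b' (lift ord0 j) = b j by rewrite /b' liftK.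
exists n.+1, b'; split.
  move=> i; case: (unliftP ord0 i) => [j|] ->; last by rewrite b'0; exact: span_of_mem (mem_head _ _).
  by rewrite b'S; exists 0, (b j); rewrite mul0r add0r; split => //; exact: bs.
move=> _ [c [y [kc sy ->]]].
have [f [[kf yE] fU]] := bP y sy.
exists [ffun i => if unlift ord0 i is Some j then f j else c]; split.
  split; first by move=> i; rewrite ffunE; case: unlift.
  rewrite big_ord_recl b'0 ffunE unlift_none yE; congr (_ + _).
  by apply: eq_bigr => j _; rewrite ffunE liftK b'S.
move=> g [kg]; rewrite big_ord_recl b'0 => H.
have sg : span_of s (\sum_(j < n) g (lift ord0 j) * b' (lift ord0 j)).
  elim/big_ind: _ => [|x z|j _]; [exact: span_of0 | exact: span_ofD |].
  by rewrite b'S; apply: span_ofZ => //; exact: bs.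
have cg : c = g ord0.
  apply/eqP; rewrite -subr_eq0; apply/eqP; apply: contrapT => /eqP cg0; apply: sa.
  have -> : a = (c - g ord0)^-1 * (\sum_(j < n) g (lift ord0 j) * b' (lift ord0 j) - y).
    apply: (mulfI cg0); rewrite mulrA divff// mul1r mulrBl.
    by apply: (addIr y); rewrite subrK addrAC H addrAC subrr add0r.
  by apply: span_ofZ; [exact/kV/kB | exact: span_ofB].
apply/ffunP => i; rewrite ffunE; case: (unliftP ord0 i) => [j|] -> //.
suff -> : f = [ffun j => g (lift ord0 j)] by rewrite ffunE.
apply: fU; split; first by move=> j'; rewrite ffunE.
move: H; rewrite cg => /addrI ->.
by apply: eq_bigr => j' _; rewrite ffunE b'S.
Qed.

(** [subfield_degree] is 0 when no finite basis exists. Here L is the closed span of s, so there is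
    one; and no basis is empty because L contains 1. *)
Lemma subfield_degree_gt0 (L : set F) s : L 1 ->
  (forall x y, L x -> L y -> L (x - y)) -> (forall x y, L x -> L y -> L (x * y)) ->
  k `<=` L -> (forall b, b \in s -> L b) -> L `<=` absval_closure v (span_of s) ->
  (0 < subfield_degree k L)%N.
Proof.
move=> L1 LB LM kL sL Ls.
have L0 : L 0 by rewrite -(subrr 1); exact: LB.
have LD x y : L x -> L y -> L (x + y) by move=> Lx Ly; rewrite -[y]opprK; apply: (LB _ _ Lx); rewrite -sub0r; exact: (LB).
have E : L = span_of s.
  apply/seteqP; split; first by move=> x /Ls /span_of_closed.
  elim: s sL {Ls} => [_ x ->//|b s IH sL x [c [y [kc sy ->]]]].
  apply: LD; first by apply: LM; [exact: kL | apply: sL; exact: mem_head].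
  by apply: IH sy => b' b's; apply: sL; rewrite inE b's orbT.
have [n0 [b0 b0P]] := span_of_basis s; rewrite -E in b0P.
rewrite /subfield_degree; case: xgetP => [n _ [b [bL bP]]|/(_ n0)]; last first.
  by case; exists b0.
rewrite lt0n; apply/eqP => n0'; subst n.
have [c [[_ /eqP]]] := bP 1 L1.
by rewrite big_ord0 oner_eq0.
Qed.

End finite_spans.

(** * Extensions of the p-adic absolute values *)

Lemma chain_pair (T : Type) (F : set (set T)) u v : total_on F subset ->
  (\bigcup_(A in F) A) u -> (\bigcup_(A in F) A) v -> exists A, [/\ F A, A u & A v].
Proof.
move=> Ft [A FA Au] [B FB Bv].
by have [AB|BA] := Ft _ _ FA FB; [exists B | exists A]; split => //; (exact: AB || exact: BA).
Qed.

(** [Zorn_bigcup] tests the union of every chain, the empty one included; the alternative A = set0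
    in [Q] accounts for it, and B is built into [Q] so that the maximal set contains it. *)
Lemma maximal_above (T : Type) (P : set (set T)) B : B !=set0 -> P B ->
  (forall F, F !=set0 -> F `<=` P -> total_on F subset -> P (\bigcup_(A in F) A)) ->
  exists2 A, P A & B `<=` A /\ forall A', P A' -> A `<=` A' -> A' `<=` A.
Proof.
move=> [b Bb] PB chain.
pose Q A := A = set0 \/ B `<=` A /\ P A.
have [F FQ Ft|A [[A0|[BA PA]] Amax]] := @Zorn_bigcup _ Q.
- have [[H [FH Hn]]|none] := pselect (exists H, F H /\ H !=set0); last first.
    by left; rewrite -subset0 => u [H FH Hu]; apply: none; exists H; split; last exists u.
  have FP A : F A /\ A !=set0 -> B `<=` A /\ P A.
    by case=> /FQ[->|//] [].
  have -> : \bigcup_(A in F) A = \bigcup_(A in [set A | F A /\ A !=set0]) A.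
    apply/seteqP; split => u [A]; last by case=> FA _ Au; exists A.
    by move=> FA Au; exists A => //; split; last exists u.
  right; split; first by move=> u /(FP H (conj FH Hn)).1 Hu; exists H.
  apply: chain; first by exists H.
    by move=> A /FP[].
  by move=> A A' [FA _] [FA' _]; exact: Ft.
- by exfalso; apply: (Amax B); [rewrite A0; split => // /(_ b Bb) | right; split].
- exists A => //; split => // A' PA' AA'; apply: contrapT => h; apply: (Amax A') => //.
  by right; split => //; exact: subset_trans AA'.
Qed.

(** * Extension of homomorphisms to an algebraic extension *)

Section hom_extension.
Variables (k E L : fieldType) (i : {rmorphism k -> E}) (j : {rmorphism k -> L}).
Hypothesis E_algebraic : forall x, algebraicOver i x.
Hypothesis L_closed : forall p : {poly L}, (1 < size p)%N -> exists x, root p x.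

(* The graph of a homomorphism of k-algebras from a subring of E to L. *)
Definition partial_hom (G : set (E * L)) : Prop :=
  [/\ forall u v, G u -> G v -> G (u - v), forall u v, G u -> G v -> G (u * v),
      forall c, G (i c, j c) & forall y, G (0, y) -> y = 0].

Section partial_hom_theory.
Variable G : set (E * L).
Hypothesis HG : partial_hom G.

Let GB u v : G u -> G v -> G (u - v). Proof. by case: HG => + _ _ _; exact. Qed.
Let GM u v : G u -> G v -> G (u * v). Proof. by case: HG => _ + _ _; exact. Qed.
Let Gk c : G (i c, j c). Proof. by case: HG. Qed.
Let Gf y : G (0, y) -> y = 0. Proof. by case: HG => _ _ _; exact. Qed.
Let G1 : G 1. Proof. by have := Gk 1; rewrite !rmorph1. Qed.
Let G0 : G 0. Proof. by rewrite -(subrr 1); exact: GB. Qed.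
Let GN u : G u -> G (- u). Proof. by move=> Gu; rewrite -sub0r; exact: GB. Qed.
Let GD u v : G u -> G v -> G (u + v). Proof. by move=> Gu Gv; rewrite -(opprK v); apply/GB/GN. Qed.

(** Polynomials over the product ring: one p carries both a polynomial over the domain of G and its
    image over L. *)
Definition coefs_in (p : {poly E * L}) : Prop := forall n, G p`_n.

Lemma coefs_inC c : G c -> coefs_in c%:P.
Proof. by move=> Gc n; rewrite coefC; case: ifP. Qed.

Lemma coefs_inB p q : coefs_in p -> coefs_in q -> coefs_in (p - q).
Proof. by move=> Gp Gq n; rewrite coefB; exact: GB. Qed.

Lemma coefs_inM p q : coefs_in p -> coefs_in q -> coefs_in (p * q).
Proof.
move=> Gp Gq n; rewrite coefM; elim/big_ind: _ => // a _; exact: GM.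
Qed.

Lemma coefs_inX : coefs_in 'X.
Proof. by move=> n; rewrite coefX; case: (n == 1%N). Qed.

Lemma coefs_inXn n : coefs_in 'X^n.
Proof. by move=> m; rewrite coefXn; case: (m == n). Qed.

Lemma partial_hom_horner (q : {poly k}) u : G u ->
  G ((map_poly i q).[u.1], (map_poly j q).[u.2]).
Proof.
move=> Gu; elim/poly_ind: q => [|q c IH]; first by rewrite !rmorph0 !horner0.
rewrite !rmorphD !rmorphM /= !map_polyX !map_polyC !hornerE.
by have := GD (GM IH Gu) (Gk c).
Qed.

(** The domain of G is a field because E is algebraic: a relation q(u) u + c = 0 over k with c
    nonzero gives the inverse -q(u)/c. The second components are inverse as well, since G (0, y)
    forces y = 0. *)
Lemma partial_hom_inverse u : G u -> u != 0 -> exists2 u', G u' & u * u' = 1.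
Proof.
move=> Gu u0; have u1 : u.1 != 0.
  apply: contraNneq u0; case: u Gu => a b /= Gab a0; rewrite a0 in Gab *.
  by rewrite (Gf Gab).
have [p p0] := E_algebraic u.1.
elim/poly_ind: p p0 => [|q c IH]; first by rewrite eqxx.
have [->|c0 _] := eqVneq c 0.
  rewrite addr0 mulf_eq0 polyX_eq0 orbF => q0.
  by rewrite rmorphM /= map_polyX rootM rootX (negbTE u1) orbF => /(IH q0).
rewrite /root rmorphD rmorphM /= map_polyX map_polyC !hornerE => /eqP H.
pose v := ((map_poly i q).[u.1], (map_poly j q).[u.2]).
pose u' : E * L := (i (- c^-1), j (- c^-1)) * v.
have Gu' : G u' by apply: (GM (Gk _)); exact: partial_hom_horner.
exists u' => //.
have E1 : (u * u' - 1).1 = 0.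
  have H1 : (map_poly i q).[u.1] * u.1 = - i c by apply/eqP; rewrite -addr_eq0 H.
  apply/eqP; rewrite subr_eq0; apply/eqP => /=; rewrite mulrCA [u.1 * _]mulrC H1.
  by rewrite rmorphN fmorphV mulrNN mulVf // fmorph_eq0.
have G2 : G (u * u' - 1) by apply: GB => //; exact: GM.
apply/eqP; rewrite -subr_eq0; move: E1 G2; case: (u * u' - 1) => a b /= -> /Gf ->.
by [].
Qed.

(** The minimal polynomial of x over the domain of G, together with its image. Being monic in the
    product ring, it can be divided by without leaving G. *)
Lemma partial_hom_minimal x : exists p : {poly E * L},
  [/\ coefs_in p, p \is monic, (map_poly fst p).[x] = 0 &
   forall q, coefs_in q -> (map_poly fst q).[x] = 0 -> q != 0 -> (size p <= size q)%N].
Proof.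
pose Q n := `[< exists p, [/\ coefs_in p, p != 0, (map_poly fst p).[x] = 0 & size p = n] >].
have exQ : exists n, Q n.
  have [p p0 px] := E_algebraic x.
  pose P : {poly E * L} := \poly_(n < size p) (i p`_n, j p`_n).
  have P1 : map_poly fst P = map_poly i p.
    apply/polyP => n; rewrite coef_map coef_poly /= coef_map; case: ltnP => //= h.
    by rewrite nth_default// rmorph0.
  exists (size P); apply/asboolP; exists P; split => //.
  - by move=> n; rewrite coef_poly; case: ifP.
  - apply: contra_neq p0 => P0; apply/eqP; rewrite -(map_poly_eq0 i) -P1 P0 rmorph0 //.
  - by rewrite P1; exact/eqP.
case: (ex_minnP exQ) => m /asboolP[p [Gp p0 px sp]] mmin.
have c0 : lead_coef p != 0 by rewrite lead_coef_eq0.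
have [c Gc pc] := partial_hom_inverse (Gp _ : G (lead_coef p)) c0.
have lc : (c%:P * p)`_(size p).-1 = 1 by rewrite coefCM mulrC.
have szp : size (c%:P * p) = size p.
  apply/eqP; rewrite eqn_leq; apply/andP; split.
    by apply/leq_sizeP => n hn; rewrite coefCM nth_default ?mulr0.
  rewrite -(prednK (_ : 0 < size p)%N) ?size_poly_gt0//.
  by rewrite ltnNge; apply/negP => /leq_sizeP /(_ _ (leqnn _)); rewrite lc => /eqP; rewrite oner_eq0.
exists (c%:P * p); split.
- exact/coefs_inM/Gp/coefs_inC.
- by rewrite monicE /lead_coef szp lc.
- by rewrite rmorphM /= hornerM px mulr0.
- move=> q Gq qx q0; rewrite szp sp; apply: mmin; apply/asboolP; exists q; split => //.
Qed.

(** The image y of x is a root of the image of p. Reduction modulo the monic p shows that every q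
    over G vanishing at x has an image vanishing at y; this is what makes the values of polynomials
    at (x, y) a graph. *)
Lemma partial_hom_extend x : exists2 G', partial_hom G' &
  G `<=` G' /\ exists y, G' (x, y).
Proof.
have [p [Gp pm px pmin]] := partial_hom_minimal x.
have p1 : (1 < size p)%N.
  rewrite ltnNge; apply/negP => sp; move: px.
  have -> : p = 1.
    rewrite (size1_polyC sp); move: pm; rewrite monicE /lead_coef.
    have -> : (size p).-1 = 0%N by case: (size p) sp => [|[]].
    by move=> /eqP ->.
  by rewrite rmorph1 hornerC => /eqP; rewrite oner_eq0.
have [y py] : exists y, root (map_poly snd p) y.
  apply: L_closed; rewrite size_map_poly_id0//.
  by rewrite (monicP pm) oner_eq0.
have key : forall n (q : {poly E * L}), (size q <= n)%N -> coefs_in q -> (map_poly fst q).[x] = 0 ->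
    (map_poly snd q).[y] = 0.
  elim=> [|n IH] q; first by rewrite leqn0 size_poly_eq0 => /eqP ->; rewrite !rmorph0 !horner0.
  move=> qn Gq qx; have [->|q0] := eqVneq q 0; first by rewrite rmorph0 horner0.
  have pq := pmin _ Gq qx q0.
  set d := (size q - size p)%N; set r := (lead_coef q)%:P * 'X^d * p.
  have Gr : coefs_in r by apply/coefs_inM/Gp/coefs_inM/coefs_inXn/coefs_inC/Gq.
  have s0 : (0 < size p)%N by exact: ltnW.
  have H := IH (q - r) _ (coefs_inB Gq Gr) _.
  have : (map_poly snd (q - r)).[y] = 0.
    apply: H; last first.
      by rewrite rmorphB !rmorphM /= !hornerE px qx !mulr0 subrr.
    apply: leq_trans (_ : (size q).-1 <= n)%N; last by rewrite -ltnS prednK ?size_poly_gt0.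
    apply/leq_sizeP => m hm; rewrite coefB /r -mulrA coefCM coefXnM.
    have dq : (d + (size p).-1 = (size q).-1)%N by rewrite /d; lia.
    have -> : (m < d)%N = false by lia.
    move: hm; rewrite leq_eqVlt => /orP[/eqP <-|hm].
      rewrite -dq addnC addnK; move: pm; rewrite monicE /lead_coef => /eqP ->.
      by rewrite mulr1 addnC dq subrr.
    by rewrite (nth_default _ (_ : size q <= m)%N) ?(nth_default _ (_ : size p <= m - d)%N) ?mulr0 ?subrr//; clear -hm dq s0 p1 pq; lia.
  by rewrite rmorphB !rmorphM /= !hornerE (rootP py) mulr0 subr0.
pose w : E * L := (x, y).
have ev (q : {poly E * L}) : q.[w] = ((map_poly fst q).[x], (map_poly snd q).[y]) by rewrite -[x]/(fst w) -[y]/(snd w) !horner_map -surjective_pairing.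
exists [set q.[w] | q in coefs_in].
  split.
  - move=> _ _ [q Gq <-] [r Gr <-]; exists (q - r); first exact: coefs_inB.
    by rewrite hornerD hornerN.
  - move=> _ _ [q Gq <-] [r Gr <-]; exists (q * r); first exact: coefs_inM.
    by rewrite hornerM.
  - by move=> c; exists (i c, j c)%:P; [exact/coefs_inC/Gk | rewrite hornerC].
  - move=> z [q Gq]; rewrite ev => -[qx <-].
    exact: key (leqnn _) Gq qx.
split; first by move=> u Gu; exists u%:P; [exact: coefs_inC | rewrite hornerC].
by exists y; exists 'X; [exact: coefs_inX | rewrite hornerX].
Qed.

End partial_hom_theory.

Theorem partial_hom_total G : partial_hom G ->
  exists s : {rmorphism E -> L}, forall x y, G (x, y) -> s x = y.
Proof.
move=> HG; have [||F [H FH] FP Ft|H HH [GH Hmax]] := @maximal_above _ partial_hom G => //.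
- by exists (i 0, j 0); case: HG.
- have two := chain_pair Ft; split.
  + by move=> u v Uu Uv; have [A [FA Au Av]] := two _ _ Uu Uv; have [AB _ _ _] := FP _ FA; exists A => //; exact: AB.
  + by move=> u v Uu Uv; have [A [FA Au Av]] := two _ _ Uu Uv; have [_ AM _ _] := FP _ FA; exists A => //; exact: AM.
  + by move=> c; exists H => //; case: (FP _ FH).
  + by move=> y [A FA Ay]; have [_ _ _] := FP _ FA; exact.
have tot x : exists y, H (x, y).
  have [G' HG' [HG'1 [y yP]]] := partial_hom_extend HH x.
  by exists y; exact: Hmax yP.
pose s x := projT1 (cid (tot x)).
have sP x : H (x, s x) by rewrite /s; case: cid.
have [HB HM Hk Hf] := HH.
have sU x y : H (x, y) -> s x = y.
  move=> Hxy; apply/eqP; rewrite -subr_eq0; apply/eqP/Hf.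
  by have := HB _ _ (sP x) Hxy; rewrite /GRing.add /GRing.opp /= /add_pair /= subrr.
have sB : zmod_morphism s by move=> x y; apply: sU; exact: (HB _ _ (sP x) (sP y)).
have sM : monoid_morphism s.
  split; last by move=> x y; apply: sU; exact: (HM _ _ (sP x) (sP y)).
  by apply: sU; have := Hk 1; rewrite !rmorph1.
pose sr : {rmorphism E -> L} := HB.pack s
  (GRing.isZmodMorphism.Build _ _ s sB) (GRing.isMonoidMorphism.Build _ _ s sM).
by exists sr => x y /GH /sU.
Qed.

(** The initial graph is that of k[x] with x sent to z. It yields the conjugates in Kbar as well as
    the complex embeddings of K. *)
Corollary hom_extension x z :
  (forall q : {poly k}, root (map_poly i q) x -> root (map_poly j q) z) ->
  exists s : {rmorphism E -> L}, s x = z /\ forall c, s (i c) = j c.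
Proof.
move=> xz; pose G := [set ((map_poly i q).[x], (map_poly j q).[z]) | q in @setT {poly k}].
have [|s sP] := @partial_hom_total G.
  split.
  - by move=> _ _ [p _ <-] [q _ <-]; exists (p - q) => //; rewrite !rmorphB /= !hornerE.
  - by move=> _ _ [p _ <-] [q _ <-]; exists (p * q) => //; rewrite !rmorphM /= !hornerE.
  - by move=> c; exists c%:P => //; rewrite !map_polyC !hornerC.
  - by move=> y [q _ [/eqP qx <-]]; apply/eqP/xz.
exists s; split=> [|c]; apply: sP.
  by exists 'X => //; rewrite !map_polyX !hornerX.
by exists c%:P => //; rewrite !map_polyC !hornerC.
Qed.

End hom_extension.

Section primitive_relation.
Variable K : fieldExtType rat.

Lemma map_intr_alg (f : {poly int}) :
  map_poly (in_alg K) (map_poly intr f) = map_poly intr f.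
Proof. by rewrite -map_poly_comp; apply: eq_map_poly => z /=; rewrite -(rmorph_int (in_alg K)). Qed.

(** The primitive multiple of the minimal polynomial. By Gauss's lemma divisibility over the
    rationals is divisibility over the integers, which makes its lead coefficient divide that of
    every integral relation. *)
Lemma primitive_minpoly (x : K) : exists f : {poly int},
  [/\ zcontents f = 1, root (map_poly intr f) x, (size f <= (\dim {: K}).+1)%N &
      forall g : {poly int}, root (map_poly intr g) x -> exists h, g = f * h].
Proof.
have /polyOver1P[q qE] := minPolyOver 1%AS x.
have [f [a a0 fE]] := rat_poly_scale q.
have aQ : a%:~R != 0 :> rat by rewrite intr_eq0.
have fq : map_poly intr f = a%:~R *: q by rewrite fE scalerA divff ?scale1r.
have q0 : q != 0 by rewrite -(map_poly_eq0 (in_alg K)) -qE; exact: monic_neq0 (monic_minPoly _ _).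
have f0 : f != 0 by apply: contraNneq q0 => f0; move: fE; rewrite f0 rmorph0 scaler0 => ->.
have fK : map_poly intr f = (a%:~R : K) *: minPoly 1%AS x by rewrite -map_intr_alg fq map_polyZ qE; congr (_ *: _); exact: (rmorph_int (in_alg K)).
have aK : a%:~R != 0 :> K by rewrite -(rmorph_int (in_alg K)) fmorph_eq0.
have zf : zcontents f != 0 by rewrite zcontents_eq0.
have fzK : map_poly intr f = ((zcontents f)%:~R : K) *: map_poly intr (zprimitive f) by rewrite {1}(zpolyEprim f) map_polyZ.
have zK : (zcontents f)%:~R != 0 :> K by rewrite -(rmorph_int (in_alg K)) fmorph_eq0 intr_eq0.
exists (zprimitive f); split.
- by rewrite zcontents_primitive f0.
- rewrite -(rootZ _ _ zK) -fzK fK rootZ//; exact: root_minPoly.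
- rewrite size_zprimitive -(size_map_inj_poly (@intr_inj rat))// fq size_scale//.
  rewrite -(size_map_poly (in_alg K)) -qE size_minPoly ltnS.
  by have := dim_Fadjoin 1%AS x; rewrite dimv1 muln1 => <-; exact: dimvS (subvf _).
- move=> g gx.
  have : minPoly 1%AS x %| map_poly intr g.
    apply: minPoly_dvdp => //; apply/polyOver1P; exists (map_poly intr g).
    by rewrite map_intr_alg.
  rewrite qE -map_intr_alg dvdp_map => qg.
  have : f %| g by rewrite -dvdp_rat_int fq dvdpZl.
  by move=> /dvdpP_int[h hE]; exists h.
Qed.

End primitive_relation.

(** * A p-adic place at which a nonintegral number is large *)

Section places_above.
Variables (R : realType) (K : fieldExtType rat) (p : nat).
Hypothesis p_prime : prime p.

Definition subring_set (B : set K) : Prop :=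
  [/\ B 1, forall x y, B x -> B y -> B (x - y) & forall x y, B x -> B y -> B (x * y)].

Section subring_set_theory.
Variable B : set K.
Hypothesis HB : subring_set B.
Lemma subring_set1 : B 1. Proof. by case: HB. Qed.
Lemma subring_setB x y : B x -> B y -> B (x - y). Proof. by case: HB => _ + _; exact. Qed.
Lemma subring_setM x y : B x -> B y -> B (x * y). Proof. by case: HB => _ _; exact. Qed.
Lemma subring_set0 : B 0. Proof. by rewrite -(subrr 1); exact: subring_setB subring_set1 subring_set1. Qed.
Lemma subring_setN x : B x -> B (- x).
Proof. by move=> Bx; rewrite -sub0r; exact: subring_setB subring_set0 Bx. Qed.
Lemma subring_setD x y : B x -> B y -> B (x + y).
Proof. by move=> Bx By; rewrite -[y]opprK; exact: subring_setB Bx (subring_setN By). Qed.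
Lemma subring_setX x n : B x -> B (x ^+ n).
Proof.
by move=> Bx; elim: n => [|n IH]; [exact: subring_set1 | rewrite exprS; exact: subring_setM].
Qed.
Lemma subring_set_nat n : B n%:R.
Proof. by elim: n => [|n IH]; [exact: subring_set0 | rewrite -natr1; exact: subring_setD IH subring_set1]. Qed.
Lemma subring_set_int (n : int) : B n%:~R.
Proof.
by case: n => n; [exact: subring_set_nat | rewrite NegzE mulrNz; exact/subring_setN/subring_set_nat].
Qed.
Lemma subring_set_sum (I : Type) (r : seq I) (P : pred I) (f : I -> K) :
  (forall i, P i -> B (f i)) -> B (\sum_(i <- r | P i) f i).
Proof. by move=> Bf; elim/big_ind: _ => //; [exact: subring_set0 | exact: subring_setD]. Qed.
End subring_set_theory.

Variable c : K.
Hypothesis c_neq0 : c != 0.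
Let y := c^-1.

Definition unit_ideal (B : set K) : Prop :=
  exists a b, [/\ B a, B b & 1 = p%:R * a + y * b].

(** A maximal such B is a valuation ring in which p and 1/c are non-units. The ideal is not part of
    the data: it is the one generated by p and 1/c. *)
Definition admissible (B : set K) : Prop := [/\ subring_set B, B y & ~ unit_ideal B].

Definition adjoin (B : set K) (x : K) : set K :=
  [set q.[x] | q in [set q : {poly K} | forall i, B q`_i]].

Lemma adjoin_subring B x : subring_set B -> subring_set (adjoin B x).
Proof.
move=> HB; split.
- exists 1; last by rewrite hornerC.
  by move=> i; rewrite coef1; case: eqP => _; [exact: subring_set1 | exact: subring_set0].
- move=> _ _ [q Bq <-] [r Br <-]; exists (q - r); last by rewrite !hornerE.
  by move=> i; rewrite coefB; exact: subring_setB.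
- move=> _ _ [q Bq <-] [r Br <-]; exists (q * r); last by rewrite !hornerE.
  by move=> i; rewrite coefM; apply: subring_set_sum => // j _; exact: subring_setM.
Qed.

Lemma sub_adjoin B x : subring_set B -> B `<=` adjoin B x.
Proof.
move=> HB b Bb; exists b%:P; last by rewrite hornerC.
by move=> i; rewrite coefC; case: eqP => _; [exact: Bb | exact: subring_set0].
Qed.

Lemma mem_adjoin B x : subring_set B -> adjoin B x x.
Proof.
move=> HB; exists 'X; last by rewrite hornerX.
by move=> i; rewrite coefX; case: eqP => _; [exact: subring_set1 | exact: subring_set0].
Qed.

Section maximal.
Variable B : set K.
Hypotheses (B_adm : admissible B)
  (B_max : forall B', admissible B' -> B `<=` B' -> B' = B).
Let HB : subring_set B. Proof. by case: B_adm. Qed.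
Let By : B y. Proof. by case: B_adm. Qed.
Let B1 := subring_set1 HB.
Let B0 := subring_set0 HB.

Let J : set K := [set x | exists a b, [/\ B a, B b & x = p%:R * a + y * b]].

Let JD x z : J x -> J z -> J (x + z).
Proof.
move=> [a [b [Ba Bb ->]]] [a' [b' [Ba' Bb' ->]]]; exists (a + a'), (b + b').
by split; [exact: subring_setD | exact: subring_setD | ring].
Qed.
Let JM x z : J x -> B z -> J (x * z).
Proof.
move=> [a [b [Ba Bb ->]]] Bz; exists (a * z), (b * z).
by split; [exact: subring_setM | exact: subring_setM | ring].
Qed.
Let J0 : J 0. Proof. by exists 0, 0; rewrite !mulr0 addr0. Qed.
Let J_B x : J x -> B x.
Proof.
move=> [a [b [Ba Bb ->]]]; apply: subring_setD => //; apply: subring_setM => //.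
exact: subring_set_nat.
Qed.
Let J1 : ~ J 1. Proof. by case: B_adm. Qed.
Let Jsum (I : Type) (r : seq I) (P : pred I) (f : I -> K) :
  (forall i, P i -> J (f i)) -> J (\sum_(i <- r | P i) f i).
Proof. by move=> Jf; elim/big_ind: _. Qed.

(** A relation 1 = q(x) with coefficients in J; n bounds the number of coefficients, so n = 0 is
    absurd. *)
Let Jpoly n x := exists q : {poly K}, [/\ forall i, J q`_i, (size q <= n)%N & q.[x] = 1].

Let not_mem_Jpoly x : ~ B x -> exists n, Jpoly n x.
Proof.
move=> nBx; have [nu|] := pselect (~ unit_ideal (adjoin B x)).
  exfalso; apply: nBx; rewrite -(B_max _ (sub_adjoin x HB)); first exact: mem_adjoin.
  split => //; first exact: adjoin_subring.
  exact: sub_adjoin.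
move=> /contrapT [_ [_ [[q Bq <-] [r Br <-] E]]].
exists (size (p%:R%:P * q + y%:P * r)), (p%:R%:P * q + y%:P * r); split => //.
  by move=> i; rewrite coefD !coefCM; exists q`_i, r`_i.
by rewrite !hornerE -E.
Qed.

(* The relation of degree n is shortened by means of one of degree m <= n in
   1/x. *)
Let shorten x n m : (m <= n)%N -> Jpoly n.+1 x -> Jpoly m.+1 x^-1 -> x != 0 -> Jpoly n x \/ J 1.
Proof.
move=> mn [q [Jq sq qx]] [r [Jr sr rx]] x0.
have [n0|n0] := posnP n.
  right; rewrite -qx; have sq1 : (size q <= 1)%N by rewrite n0 in sq.
  by rewrite (size1_polyC sq1) hornerC.
left.
have E : (1 - r`_0) = \sum_(j < m) r`_j.+1 * x^-1 ^+ j.+1.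
  rewrite -rx (horner_coef_wide _ sr) big_ord_recl expr0 mulr1 addrAC subrr add0r.
  by [].
pose q1 : {poly K} := \poly_(i < n) q`_i.
have qE : q.[x] = q1.[x] + q`_n * x ^+ n.
  rewrite (horner_coef_wide _ sq) big_ord_recr /=; congr (_ + _).
  by rewrite horner_poly.
pose s : {poly K} := \sum_(j < m) (q`_n * r`_j.+1) *: 'X^(n - j.+1).
exists ((1 - r`_0) *: q1 + s + (r`_0)%:P); split.
- move=> i; rewrite !coefD coefZ coefC; apply: JD; last by case: eqP.
  apply: JD.
    rewrite coef_poly; case: ifP => _; last by rewrite mulr0.
    rewrite mulrC; apply: JM => //; apply: subring_setB => //; exact: J_B.
  rewrite coef_sum; apply: Jsum => j _; rewrite coefZ coefXn.
  case: eqP => _; last by rewrite mulr0.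
  by rewrite mulr1; apply: JM => //; exact: J_B.
- apply: leq_trans (size_polyD _ _) _; rewrite geq_max; apply/andP; split; last first.
    by apply: leq_trans (size_polyC_leq1 _) _.
  apply: leq_trans (size_polyD _ _) _; rewrite geq_max; apply/andP; split.
    by apply: leq_trans (size_scale_leq _ _) (size_poly _ _).
  apply: leq_trans (size_sum _ _ _) _; apply/bigmax_leqP => j _.
  apply: leq_trans (size_scale_leq _ _) _; rewrite size_polyXn.
  have := ltn_ord j; lia.
- rewrite !hornerE horner_sum.
  have -> : \sum_(j < m) ((q`_n * r`_j.+1) *: 'X^(n - j.+1)).[x] = (1 - r`_0) * (q`_n * x ^+ n).
    rewrite E mulr_suml; apply: eq_bigr => j _; rewrite !hornerE.
    have jn : (j.+1 <= n)%N by apply: leq_trans mn; exact: ltn_ord.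
    have hx : x^-1 ^+ j.+1 * x ^+ j.+1 = 1 by rewrite -exprMn mulVf// expr1n.
    have xn : x ^+ n = x ^+ (n - j.+1) * x ^+ j.+1 by rewrite -exprD subnK.
    by rewrite /= xn -[LHS]mulr1 -hx; ring.
  rewrite -mulrDr -qE qx mulr1 subrK.
  by [].
Qed.

(** Chevalley's argument. If neither x nor 1/x lies in B, maximality gives a relation 1 = q(x) and
    one in 1/x, with coefficients in J; each shortens the longer of the two until one is empty or 1
    lies in J. *)
Lemma maximal_valuation x : B x \/ B x^-1.
Proof.
have [|nBx] := pselect (B x); first by left.
right; apply: contrapT => nBx'.
have x0 : x != 0 by apply/eqP => x0; apply: nBx; rewrite x0.
have nz z : ~ Jpoly 0 z.
  move=> [q [_]]; rewrite leqn0 size_poly_eq0 => /eqP ->.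
  by rewrite horner0 => /eqP; rewrite eq_sym oner_eq0.
have key : forall N n m z, (n + m <= N)%N -> z != 0 -> Jpoly n z -> Jpoly m z^-1 -> False.
  elim=> [|N IH] [|n] [|m] z nmN z0 Hn Hm; try by [exact: nz Hn | exact: nz Hm | ].
  have [mn|nm] := leqP m n.
    by have [H|//] := shorten mn Hn Hm z0; apply: (IH _ _ _ _ z0 H Hm); lia.
  have zV0 : z^-1 != 0 by rewrite invr_eq0.
  have Hn' : Jpoly n.+1 (z^-1)^-1 by rewrite invrK.
  have [H|//] := shorten (ltnW nm) Hm Hn' zV0.
  by apply: (IH _ _ _ _ z0 Hn H); lia.
have [n Hn] := not_mem_Jpoly nBx; have [m Hm] := not_mem_Jpoly nBx'.
exact: (key _ _ _ _ (leqnn _) x0 Hn Hm).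
Qed.

Let nonunit x := B x /\ ~ B x^-1.

Let J_nonunit x : J x -> x != 0 -> nonunit x.
Proof.
move=> Jx x0; split; first exact: J_B.
by move=> Bx; apply: J1; rewrite -(divff x0); exact: JM.
Qed.

Let p_neq0 : p%:R != 0 :> K.
Proof.
have := @fmorph_eq0 _ _ (in_alg K) p%:R; rewrite rmorph_nat => ->.
by rewrite pnatr_eq0 -lt0n prime_gt0.
Qed.

Let Jp : J p%:R. Proof. by exists 1, 0; rewrite mulr0 mulr1 addr0. Qed.
Let Jy : J y. Proof. by exists 0, 1; rewrite mulr0 mulr1 add0r. Qed.

Lemma maximal_p_nonunit n : ~ B (p%:R ^- n.+1).
Proof.
move=> H; have [_] := J_nonunit Jp p_neq0; apply.
have -> : (p%:R : K)^-1 = p%:R ^- n.+1 * p%:R ^+ n by rewrite exprSr invfM mulrAC mulVf ?expf_neq0// mul1r.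
by apply: subring_setM => //; apply: subring_setX => //; exact: subring_set_nat.
Qed.

(** Locality of the valuation ring, from the dichotomy applied to a / (1 - a). *)
Lemma maximal_unit_complement a : nonunit a -> B (1 - a)^-1.
Proof.
move=> [Ba nBa]; have [a1|a1] := eqVneq (1 - a) 0.
  exfalso; apply: nBa; have -> : a = 1 by apply/esym/eqP; rewrite -subr_eq0 a1.
  by rewrite invr1.
have [a0|a0] := eqVneq a 0; first by rewrite a0 subr0 invr1.
have [h|h] := maximal_valuation (a / (1 - a)).
  have -> : (1 - a)^-1 = 1 + a / (1 - a) by field.
  exact: subring_setD.
exfalso; apply: nBa; have -> : a^-1 = 1 + (a / (1 - a))^-1 by rewrite invf_div mulrBl mul1r divff// addrC subrK.
exact: subring_setD.
Qed.

Lemma maximal_int_unit (n : int) : ~~ (p %| `|n|)%N -> B (n%:~R)^-1.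
Proof.
move=> pn; have /coprimezP [[u w] /= E] : coprimez n p.
  by rewrite coprimezE coprime_sym prime_coprime.
have EK : u%:~R * n%:~R = 1 - p%:R * w%:~R :> K by rewrite -[p%:R]/((p%:Z)%:~R) -!intrM -[1]/(1%:~R) -intrB; congr _%:~R; rewrite -E mulrC; ring.
set a := p%:R * _ in EK; have Ja : J a by apply: JM Jp _; exact: subring_set_int.
have a1 : 1 - a != 0 by apply/eqP => h; apply: J1; rewrite -[1](subrK a) h add0r.
have := a1; rewrite -EK mulf_eq0 negb_or => /andP[u0 n0].
have -> : (n%:~R)^-1 = u%:~R * (1 - a)^-1 :> K by rewrite -EK invfM mulrA divff// mul1r.
apply: subring_setM => //; first exact: subring_set_int.
have [->|a0] := eqVneq a 0; first by rewrite subr0 invr1.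
by apply: maximal_unit_complement; exact: J_nonunit.
Qed.

Lemma primitive_coef (f : {poly int}) : zcontents f = 1 -> exists i, ~~ (p %| `|(f`_i)%R|)%N.
Proof.
move=> fz; apply: contrapT => /forallNP H.
have : (p%:Z %| zcontents f)%Z by rewrite dvdz_contents; apply/polyOverP => i; have /negP := H i; rewrite negbK.
by rewrite fz dvdz1 /= => /eqP p1; move: p_prime; rewrite p1.
Qed.

(** If 1/x lies in B, a primitive relation of x divided by a power of x shows that x times its lead
    coefficient lies in B; the prime-to-p part of that coefficient is a unit of B. *)
Lemma maximal_bounded x : exists k : nat, B (p%:R ^+ k * x).
Proof.
have [Bx|Bx'] := maximal_valuation x; first by exists 0%N; rewrite expr0 mul1r.
have [->|x0] := eqVneq x 0; first by exists 0%N; rewrite mulr0.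
have [f [fz fx _ _]] := primitive_minpoly x.
have f0 : f != 0 by apply: contra_eq_neq fz => ->; rewrite zcontents0.
have sf : (1 < size f)%N.
  rewrite ltnNge; apply/negP => h; move: fx f0; rewrite (size1_polyC h) map_polyC rootC /=.
  by rewrite -(rmorph_int (in_alg K)) fmorph_eq0 intr_eq0 polyC_eq0 => ->.
have H : B (x * (lead_coef f)%:~R).
  have := fx; rewrite /root horner_coef size_map_poly_id0; last first.
    by rewrite -(rmorph_int (in_alg K)) fmorph_eq0 intr_eq0 lead_coef_eq0.
  rewrite /lead_coef; case: (size f) sf => [//|[//|n]] _ /=.
  rewrite big_ord_recr /= addrC addr_eq0 coef_map /= => /eqP H.
  have -> : x * (f`_n.+1)%:~R = - \sum_(i < n.+1) (f`_i)%:~R * x^-1 ^+ (n - i).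
    have xn : x ^+ n != 0 by rewrite expf_neq0.
    apply: (mulIf xn); rewrite mulNr mulr_suml mulrAC -exprS mulrC H; congr (- _).
    apply: eq_bigr => i _; rewrite coef_map /= -mulrA; congr (_ * _).
    have ni : (i <= n)%N by rewrite -ltnS.
    have xE : x ^+ n = x ^+ (n - i) * x ^+ i by rewrite -exprD subnK.
    by rewrite xE mulrA -exprMn mulVf// expr1n mul1r.
  apply: subring_setN => //; apply: subring_set_sum => // i _; apply: subring_setM => //.
    exact: subring_set_int.
  exact: subring_setX.
set l := lead_coef f in H.
have l0 : (0 < `|l|)%N by rewrite absz_gt0 lead_coef_eq0.
have [m cm lE] := pfactor_coprime p_prime l0.
exists (logn p `|l|).
pose z : int := (-1) ^+ (l < 0)%R * m%:Z.
have zp : ~~ (p %| `|z|)%N by rewrite abszM absz_sign mul1n -prime_coprime.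
have zn : z%:~R != 0 :> K.
  by rewrite -(rmorph_int (in_alg K)) fmorph_eq0 intr_eq0; apply: contraNneq zp => ->; rewrite dvdn0.
have lK : l%:~R = z%:~R * p%:R ^+ logn p `|l| :> K.
  by rewrite -natrX pmulrn -intrM; congr _%:~R; rewrite {1}[l]intEsign {1}lE PoszM mulrA.
have -> : p%:R ^+ logn p `|l| * x = (x * l%:~R) * (z%:~R)^-1 by rewrite lK; field.
by apply: subring_setM => //; exact: maximal_int_unit.
Qed.

Let pz (m : int) := (p%:R : K) ^ m.
Let pzD m n : pz (m + n) = pz m * pz n. Proof. exact: expfzDr. Qed.
Let pz_ge0 m : B (pz m) -> (0 <= m)%R.
Proof. by case: m => // n; rewrite /pz => /maximal_p_nonunit. Qed.
Let pzX m n : pz m ^+ n = pz (m * n%:Z).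
Proof. by rewrite /pz -exprz_exp. Qed.

(** The rationals m/n such that x^n p^(-m) lies in B. Their supremum is the valuation of x
    normalized to be 1 at p, and [maximal_bounded], applied to 1/x, makes it finite. *)
Definition slopes (x : K) : set R :=
  [set q | exists n (m : int), [/\ (0 < n)%N, B (x ^+ n * pz (- m)) & q = m%:~R / n%:R]].

Definition exponent x : R := sup (slopes x).

Let slopes_ne x : slopes x !=set0.
Proof.
have [k Bk] := maximal_bounded x; exists ((- k%:Z)%:~R / 1%:R), 1%N, (- k%:Z); split => //.
by rewrite opprK expr1 mulrC.
Qed.

Let slopes_ub x : x != 0 -> exists k : nat, ubound (slopes x) k%:R.
Proof.
move=> x0; have [k Bk] := maximal_bounded x^-1; exists k => _ [n [m [n0 Bn ->]]].
rewrite ler_pdivrMr ?ltr0n// -natrM -[(k * n)%:R]/(((k * n)%N : int)%:~R) ler_int.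
rewrite -subr_ge0; apply: pz_ge0.
have -> : pz ((k * n)%N%:Z - m) = (p%:R ^+ k * x^-1) ^+ n * (x ^+ n * pz (- m)).
  rewrite exprMn mulrA -[_ * x ^+ n]mulrA -exprMn mulVf// expr1n mulr1.
  by rewrite pzD -exprM.
by apply: subring_setM => //; exact: subring_setX.
Qed.

Let slopes_hub x : x != 0 -> has_ubound (slopes x).
Proof. by move=> /slopes_ub[k kP]; exists k%:R. Qed.

Let val_ge x q : x != 0 -> slopes x q -> q <= exponent x.
Proof. by move=> x0 xq; apply: ub_le_sup => //; exact: slopes_hub. Qed.

Let val_mul_ge x z : x != 0 -> z != 0 -> exponent x + exponent z <= exponent (x * z).
Proof.
move=> x0 z0; rewrite -lerBrDr; apply: ge_sup => // q xq.
rewrite lerBrDr addrC -lerBrDr; apply: ge_sup => // q' zq'; rewrite lerBrDr.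
apply: val_ge; first by rewrite mulf_neq0.
have [n [m [n0 Bn ->]]] := xq; have [n' [m' [n0' Bn' ->]]] := zq'.
exists (n * n')%N, (m * n'%:Z + m' * n%:Z); split.
- by rewrite muln_gt0 n0.
- have -> : (x * z) ^+ (n * n') * pz (- (m * n'%:Z + m' * n%:Z)) =
     (x ^+ n * pz (- m)) ^+ n' * (z ^+ n' * pz (- m')) ^+ n.
    rewrite !exprMn !pzX -!exprM opprD pzD !mulNr [(n' * n)%N]mulnC; ring.
  by apply: subring_setM => //; exact: subring_setX.
- rewrite intrD !intrM natrM -!pmulrn; field.
  by rewrite !pnatr_eq0 -!lt0n n0 n0'.
Qed.

(** A rational m/d strictly between the exponent of x and the opposite of that of 1/x is impossible:
    x^d p^(-m) or its inverse lies in B, which makes m/d a slope of x or -m/d one of 1/x. *)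
Let val_inv x : x != 0 -> exponent x + exponent x^-1 = 0.
Proof.
move=> x0; have xV : x^-1 != 0 by rewrite invr_eq0.
have v1 : exponent 1 <= 0.
  have := val_mul_ge (oner_neq0 K) (oner_neq0 K); rewrite mulr1; lra.
apply/le_anti/andP; split.
  by apply: le_trans (val_mul_ge x0 xV) _; rewrite divff.
rewrite leNgt; apply/negP => h.
have /rat_in_itvoo[q] : exponent x < - exponent x^-1 by rewrite -subr_gt0; lra.
rewrite in_itv /= => /andP[h1 h2].
have [d dE d0] : exists2 d : nat, denq q = d%:Z & (0 < d)%N by exists `|denq q|%N; rewrite ?absz_gt0 ?denq_eq0// gez0_abs// ltW.
have qE : ratr q = (numq q)%:~R / d%:R :> R by rewrite /ratr dE.
have [H|H] := maximal_valuation (x ^+ d * pz (- numq q)).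
  have : ratr q <= exponent x by apply: val_ge => //; exists d, (numq q).
  by rewrite leNgt h1.
have : - ratr q <= exponent x^-1.
  apply: val_ge => //; exists d, (- numq q); split => //; last by rewrite qE mulrNz mulNr.
  by move: H; rewrite invfM /pz invr_expz exprVn.
move: h2; lra.
Qed.

Let valM x z : x != 0 -> z != 0 -> exponent (x * z) = exponent x + exponent z.
Proof.
move=> x0 z0; apply/eqP; rewrite eq_le (val_mul_ge x0 z0) andbT.
have xz0 : x * z != 0 by rewrite mulf_neq0.
have zV : z^-1 != 0 by rewrite invr_eq0.
have := val_mul_ge xz0 zV; rewrite mulfK//; have := val_inv z0; lra.
Qed.

Let val_ge0 x : x != 0 -> B x -> 0 <= exponent x.
Proof.
move=> x0 Bx; apply: val_ge => //; exists 1%N, 0; split => //; last by rewrite mul0r.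
by rewrite oppr0 expr1 /pz expr0z mulr1.
Qed.

Let lnp : 0 < ln p%:R :> R.
Proof. by apply: ln_gt0; rewrite ltr1n prime_gt1. Qed.

Definition val_abs (x : K) : R := if x == 0 then 0 else expR (- (exponent x * ln p%:R)).

Lemma val_abs_absval : is_absval val_abs.
Proof.
have v0 x : 0 <= val_abs x by rewrite /val_abs; case: ifP => // _; exact: expR_ge0.
have vM x z : val_abs (x * z) = val_abs x * val_abs z.
  rewrite /val_abs mulf_eq0; have [->|x0] := eqVneq x 0; first by rewrite /= mul0r.
  have [->|z0] /= := eqVneq z 0; first by rewrite mulr0.
  by rewrite valM// mulrDl opprD expRD.
split => //.
  move=> x; rewrite /val_abs; case: eqP => // x0; split => // /eqP.
  by rewrite gt_eqF// expR_gt0.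
have v1 x : B x -> val_abs (1 + x) <= 1.
  move=> Bx; rewrite /val_abs; case: eqP => // /eqP x0.
  rewrite -[leRHS]expR0 ler_expR oppr_le0; apply: mulr_ge0; last exact: (ltW lnp).
  by apply: val_ge0 => //; exact: subring_setD.
have key x z : z != 0 -> B (x / z) -> val_abs (x + z) <= val_abs x + val_abs z.
  move=> z0 Bxz; have -> : x + z = z * (1 + x / z).
    by rewrite mulrDr mulr1 mulrCA divff// mulr1 addrC.
  rewrite vM; apply: le_trans (_ : val_abs z * 1 <= _); first by rewrite ler_wpM2l// v1.
  by rewrite mulr1 lerDr.
move=> x z; have [->|z0] := eqVneq z 0; first by rewrite addr0 lerDl.
have [->|x0] := eqVneq x 0; first by rewrite add0r lerDr.
have [h|h] := maximal_valuation (x / z); first exact: key.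
rewrite addrC [leRHS]addrC; apply: key => //.
by move: h; rewrite invf_div.
Qed.

Let val_abs_nat n : (0 < n)%N -> val_abs n%:R = p%:R ^- logn p n.
Proof.
move=> n0; have [m cm nE] := pfactor_coprime p_prime n0.
have vM : forall x z, val_abs (x * z) = val_abs x * val_abs z by case: val_abs_absval.
have m0 : m%:R != 0 :> K.
  rewrite -(rmorph_nat (in_alg K)) fmorph_eq0 pnatr_eq0; apply: contraTneq n0 => m0.
  by rewrite nE m0.
have vm : exponent m%:R = 0.
  have mV : m%:R^-1 != 0 :> K by rewrite invr_eq0.
  have Bm : B (m%:R^-1) by apply: (@maximal_int_unit m); rewrite -prime_coprime.
  have := val_inv m0; have := val_ge0 m0 (subring_set_nat HB m).
  have := val_ge0 mV Bm; lra.
have vp : exponent p%:R = 1.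
  have pV : p%:R^-1 != 0 :> K by rewrite invr_eq0.
  have h1 : 1 <= exponent p%:R.
    apply: val_ge => //; exists 1%N, 1; split; rewrite ?divr1//.
    by rewrite expr1 /pz exprN1 mulfV.
  have h2 : -1 <= exponent p%:R^-1.
    apply: val_ge => //; exists 1%N, (-1); split; rewrite ?divr1//.
    by rewrite opprK expr1 /pz expr1z mulVf.
  have := val_inv p_neq0; lra.
have vpa : val_abs p%:R = p%:R^-1 by rewrite /val_abs (negbTE p_neq0) vp mul1r expRN lnK// posrE ltr0n prime_gt0.
rewrite {1}nE natrM vM natrX (absvalX val_abs_absval) vpa exprVn.
by rewrite {1}/val_abs (negbTE m0) vm mul0r oppr0 expR0 mul1r.
Qed.

Lemma val_abs_rat (q : rat) : val_abs q%:A = padic_absval R p q.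
Proof.
rewrite /padic_absval; case: eqP => [->|/eqP q0]; first by rewrite scale0r /val_abs eqxx.
have av := val_abs_absval.
have vint (z : int) : val_abs z%:~R = val_abs `|z|%N%:R by rewrite {1}[z]intEsign rmorphM /= rmorph_sign absvalM// absvalX// absvalN// absval1// expr1n mul1r.
have -> : q%:A = (numq q)%:~R / (denq q)%:~R :> K.
  rewrite -[LHS]/(in_alg K q) -{1}(divq_num_den q) fmorph_div.
  by congr (_ / _); exact: (rmorph_int (in_alg K)).
rewrite absvalM// absvalV// !vint !val_abs_nat ?absz_gt0 ?numq_eq0 ?denq_eq0//.
by rewrite invrK mulrC.
Qed.

(* Otherwise p c^n lies in B for all n, hence in the ideal of B generated by 1/c; so do then all
   terms but one of a primitive relation for 1/c, divided by that term. *)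
Lemma val_abs_big : 1 < val_abs c.
Proof.
have y0 : y != 0 by rewrite invr_eq0.
have pB : B p%:R by exact: subring_set_nat.
have [n nB] : exists n, ~ B (p%:R * c ^+ n).
  apply: contrapT => /forallNP H; have {}H n : B (p%:R * c ^+ n) by have /contrapT := H n.
  have [f [fz fy _ _]] := primitive_minpoly y.
  case: (ex_minnP (primitive_coef fz)) => j pj jmin.
  have jf : (j < size f)%N by rewrite ltnNge; apply/negP => h; move: pj; rewrite nth_default ?dvdn0.
  have ycX k l : (k <= l)%N -> y ^+ k * c ^+ l = c ^+ (l - k).
    by move=> kl; rewrite -(subnKC kl) exprD mulrA -exprMn mulVf// expr1n mul1r addKn.
  apply: J1; rewrite -(mulfV (_ : (f`_j)%:~R != 0 :> K)); last first.
    rewrite -(rmorph_int (in_alg K)) fmorph_eq0 intr_eq0; apply: contraNneq pj => ->.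
    by rewrite dvdn0.
  apply: JM (maximal_int_unit pj); have sz : (size (map_poly intr f : {poly K}) <= size f)%N by exact: size_poly.
  have := fy; rewrite /root (horner_coef_wide _ sz) (bigD1 (Ordinal jf))//= coef_map => /eqP.
  move=> /(congr1 ( *%R^~ (c ^+ j))); rewrite mul0r mulrDl -mulrA ycX// subnn expr0 mulr1.
  move=> /eqP; rewrite addr_eq0 => /eqP ->; rewrite -mulrN1 mulr_suml; apply: JM; last exact: subring_setN.
  apply: Jsum => i; rewrite -val_eqE /= coef_map /= -mulrA => ij.
  have JyM x : B x -> J (y * x) by exact: JM Jy.
  have zB (z : int) : B z%:~R by exact: subring_set_int.
  have [ji|ji] := ltnP i j; last first.
    have -> : y ^+ i * c ^+ j = y * y ^+ (i - j).-1.
      rewrite -exprS prednK ?subn_gt0 ?ltn_neqAle 1?eq_sym ?ij//.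
      by rewrite -{1}(subnK ji) exprD -mulrA ycX// subnn mulr1.
    rewrite mulrCA.
    by apply: JyM; apply: subring_setM => //; exact: subring_setX.
  have /dvdnP[z zE] : (p %| `|(f`_i)%R|)%N by apply: contraLR ji => h; rewrite -leqNgt; exact: jmin.
  rewrite (ycX _ _ (ltnW ji)) [f`_i]intEsign zE PoszM !rmorphM /= -!mulrA.
  rewrite (_ : (p%:Z)%:~R * c ^+ (j - i) = y * (p%:R * c ^+ (j - i).+1)); last first.
    by rewrite exprS mulrCA [y * _]mulrA mulVf// mul1r.
  by rewrite mulrA mulrCA; apply: JyM; do !apply: subring_setM => //; exact: H.
have n0 : (0 < n)%N by case: n nB => // nB; case: nB; rewrite expr0 mulr1.
have vy : n%:R^-1 <= exponent y.
  apply: val_ge => //; exists n, 1; split => //; last by rewrite mul1r.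
  by have [//|] := maximal_valuation (p%:R * c ^+ n); rewrite invfM -exprVn mulrC.
rewrite /val_abs (negbTE c_neq0) -[ltLHS]expR0 ltr_expR oppr_gt0 pmulr_llt0//.
have := val_inv c_neq0; rewrite -/y.
have : 0 < n%:R^-1 :> R by rewrite invr_gt0 ltr0n.
lra.
Qed.

End maximal.

Lemma admissible_maximal : (exists B, admissible B) -> exists2 B, admissible B &
  forall B', admissible B' -> B `<=` B' -> B' = B.
Proof.
move=> [B0 B0a]; have [||F [H FH] FP Ft|A Aa [_ Amax]] := @maximal_above _ admissible B0 => //.
- by exists 1; case: B0a => -[].
- have two := chain_pair Ft; have [[H1 _ _] Hy _] := FP _ FH; split; last 2 first.
  + by exists H.
  + move=> [a [b [Ua Ub E]]]; have [D [FD Da Db]] := two _ _ Ua Ub.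
    by have [_ _ nD] := FP _ FD; apply: nD; exists a, b.
  split; first by exists H.
    by move=> u v Uu Uv; have [D [FD Du Dv]] := two _ _ Uu Uv; have [[_ DB _] _ _] := FP _ FD; exists D => //; exact: DB.
  by move=> u v Uu Uv; have [D [FD Du Dv]] := two _ _ Uu Uv; have [[_ _ DM] _ _] := FP _ FD; exists D => //; exact: DM.
by exists A => // B' B'a AB'; apply/seteqP; split => //; exact: Amax.
Qed.

(** The ring Z[1/c] is admissible: from 1 = p q(1/c) + (1/c) r(1/c), reversing the coefficients of 1
    - p q - X r gives an integral relation for c whose lead coefficient is 1 modulo p. A maximal
    admissible ring above it defines v. *)
Theorem nonintegral_place :
  (forall f : {poly int}, root (map_poly intr f) c -> (p %| `|lead_coef f|)%N) ->
  exists v : K -> R, [/\ is_absval v, forall q : rat, v q%:A = padic_absval R p q & 1 < v c].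
Proof.
move=> Hc.
have [|B Ba Bmax] := admissible_maximal; last first.
  exists (val_abs B); split.
  - exact: val_abs_absval.
  - exact: val_abs_rat.
  - exact: val_abs_big.
pose Zs : set K := [set z%:~R | z in @setT int].
have HZ : subring_set Zs.
  split; first by exists 1.
    by move=> _ _ [a _ <-] [b _ <-]; exists (a - b) => //; rewrite intrB.
  by move=> _ _ [a _ <-] [b _ <-]; exists (a * b) => //; rewrite intrM.
have lift (q : {poly K}) : (forall i, Zs q`_i) -> exists q' : {poly int}, q = map_poly intr q'.
  move=> Zq; pose w i := projT1 (cid2 (Zq i)).
  have wE i : (w i)%:~R = q`_i by rewrite /w; case: cid2.
  exists (\poly_(i < size q) w i); apply/polyP => i; rewrite coef_map coef_poly.
  by case: ltnP => h; rewrite /= ?wE// nth_default.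
exists (adjoin Zs y); split; [exact: adjoin_subring | exact: mem_adjoin |].
move=> [_ [_ [[_ /lift[q ->] <-] [_ /lift[r ->] <-] E]]].
pose h : {poly int} := 1 - p%:Z%:P * q - 'X * r.
have h0 : ~~ (p %| `|(h`_0)%R|)%N.
  have -> : h`_0 = 1 - p%:Z * q`_0 by rewrite /h !coefB coef1 coefCM coefXM subr0.
  apply/negP => pd.
  have : (p%:Z %| 1)%Z.
    have -> : 1 = (1 - p%:Z * q`_0) + p%:Z * q`_0 :> int by rewrite subrK.
    by apply: rpredD => //; exact: dvdz_mulr.
  by rewrite dvdz1 /= => /eqP p1; move: p_prime; rewrite p1.
have hy : (map_poly intr h).[y] = 0.
  rewrite /h !rmorphB !rmorphM rmorph1 /= map_polyC map_polyX !hornerE /=.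
  by rewrite -[(Posz p)%:~R]/(p%:R) {1}E; ring.
have hn0 : h`_0 != 0 by apply: contraNneq h0 => ->; rewrite dvdn0.
have hh : h != 0 by apply: contra_neq hn0 => ->; rewrite coef0.
pose N := (size h).-1.
have sN : size h = N.+1 by rewrite /N prednK// size_poly_gt0.
pose g : {poly int} := \poly_(i < N.+1) h`_(N - i).
have gN : g`_N = h`_0 by rewrite coef_poly ltnSn subnn.
have sg : size g = N.+1 by rewrite size_poly_eq ?subnn.
have : root (map_poly intr g) c.
  have -> : map_poly intr g = \poly_(i < N.+1) (h`_(N - i))%:~R :> {poly K} by apply/polyP => i; rewrite coef_map !coef_poly; case: ifP.
  rewrite /root horner_poly; apply/eqP.
  transitivity (c ^+ N * (map_poly intr h).[y]); last by rewrite hy mulr0.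
  rewrite horner_coef size_map_poly_id0; last first.
    by rewrite -(rmorph_int (in_alg K)) fmorph_eq0 intr_eq0 lead_coef_eq0.
  rewrite sN mulr_sumr (reindex_inj rev_ord_inj) /=; apply: eq_bigr => i _.
  have iN : (i <= N)%N by rewrite -ltnS.
  rewrite coef_map /= subSS subKn// mulrCA; congr (_ * _).
  have cE : c ^+ N = c ^+ (N - i) * c ^+ i by rewrite -exprD subnK.
  by rewrite cE -mulrA -exprMn /y divff// expr1n mulr1.
by move=> /Hc; rewrite /lead_coef sg /= gN (negbTE h0).
Qed.

End places_above.

(** * Seminorms on polynomials *)

Section ultrametric_of_nat.
Variables (R : realType) (A : comNzRingType) (N : A -> R).
Hypotheses (N0 : forall x, 0 <= N x) (NM : forall x y, N (x * y) = N x * N y)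
  (ND : forall x y, N (x + y) <= N x + N y) (Nn : forall n : nat, N n%:R <= 1).

Lemma bernoulli_le (h : R) n : 0 <= h -> 1 + n%:R * h <= (1 + h) ^+ n.
Proof.
move=> h0; elim: n => [|n IH]; first by rewrite mul0r addr0 expr0.
rewrite exprS -natr1; apply: le_trans (_ : (1 + h) * (1 + n%:R * h) <= _).
  have : 0 <= n%:R * h * h by rewrite !mulr_ge0.
  nra.
by rewrite ler_wpM2l// addr_ge0.
Qed.

(** The binomial formula gives r^(n+1) <= (n+2) M^(n+1), and a linear factor cannot follow
    (r/M)^(n+1) when r > M. A ring is enough for A since the lemma serves for fields and for
    seminorms on polynomials. *)
Lemma ultrametric_of_nat x y : N (x + y) <= Num.max (N x) (N y).
Proof.
set M := Num.max _ _; set r := N (x + y).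
have Mx : N x <= M by rewrite le_max lexx.
have My : N y <= M by rewrite le_max lexx orbT.
have M0 : 0 <= M by exact: le_trans (N0 x) Mx.
have NX z n : N (z ^+ n) <= N z ^+ n.
  elim: n => [|n IH]; first by rewrite !expr0; exact: (Nn 1).
  by rewrite !exprS NM ler_wpM2l.
have NXr n : N ((x + y) ^+ n.+1) = r ^+ n.+1 by elim: n => [|n IH]; rewrite ?expr1// exprS NM IH -exprS.
have Ns n (f : 'I_n.+1 -> A) : N (\sum_i f i) <= \sum_i N (f i).
  elim: n f => [|n IH] f; first by rewrite !big_ord1.
  by rewrite !(big_ord_recl n.+1); apply: le_trans (ND _ _) _; rewrite lerD2l.
have key n : r ^+ n.+1 <= n.+2%:R * M ^+ n.+1.
  rewrite -NXr exprDn; apply: le_trans (Ns _ _) _.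
  apply: le_trans (_ : \sum_(i < n.+2) M ^+ n.+1 <= _); last first.
    by rewrite sumr_const card_ord mulr_natl.
  apply: ler_sum => i _; rewrite -mulr_natr NM.
  apply: le_trans (_ : M ^+ n.+1 * 1 <= _); last by rewrite mulr1.
  apply: ler_pM => //; rewrite NM.
  have -> : M ^+ n.+1 = M ^+ (n.+1 - i) * M ^+ i by rewrite -exprD subnK// -ltnS.
  apply: ler_pM => //.
    by apply: le_trans (NX _ _) _; rewrite lerXn2r ?nnegrE.
  by apply: le_trans (NX _ _) _; rewrite lerXn2r ?nnegrE.
rewrite leNgt; apply/negP => Mr.
have [M00|Mn0] := eqVneq M 0.
  by have := key 0%N; rewrite M00 !expr1 mulr0 leNgt (le_lt_trans M0 Mr).
have Mp : 0 < M by rewrite lt_def Mn0.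
pose h := r / M - 1.
have h0 : 0 < h by rewrite subr_gt0 ltr_pdivlMr// mul1r.
have key2 n : (1 + h) ^+ n.+1 <= n.+2%:R by rewrite /h addrC subrK expr_div_n ler_pdivrMr ?exprn_gt0.
(* By Bernoulli (1 + h)^(2k) >= (1 + k h)^2 > k^2 h^2 > 3k >= 2k + 1, against [key2]. *)
pose k := (Num.bound (3 / h ^+ 2)).+1.
have kP : 3 < k%:R * h ^+ 2.
  rewrite -ltr_pdivrMr ?exprn_gt0//; apply: lt_trans (archi_boundP _) _.
    by rewrite divr_ge0// exprn_ge0// ltW.
  by rewrite ltr_nat.
have k1 : 1 <= k%:R :> R by rewrite ler1n.
have := key2 (2 * k).-1; rewrite prednK ?muln_gt0//.
rewrite mulnC exprM.
have := bernoulli_le k (ltW h0); set q := (1 + h) ^+ k => bq.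
have kh0 : 0 <= k%:R * h by rewrite mulr_ge0// ltW.
rewrite -natr1 natrM.
have : (1 + k%:R * h) * (1 + k%:R * h) <= q ^+ 2 by rewrite expr2 ler_pM// addr_ge0.
have : k%:R * 3 <= k%:R * (k%:R * h ^+ 2) by rewrite ler_wpM2l// ltW.
move: (k%:R) k1 kh0 => K k1 kh0; rewrite !expr2; nra.
Qed.
End ultrametric_of_nat.

Section split_roots.
Variables (C : fieldType) (D : set C).
Hypotheses (D1 : D 1) (DB : forall x y, D x -> D y -> D (x - y))
  (DM : forall x y, D x -> D y -> D (x * y))
  (D_root : forall p : {poly C}, poly_over D p -> (1 < size p)%N -> exists2 x, D x & root p x).

Let D0 : D 0. Proof. by rewrite -(subrr 1); exact: DB. Qed.
Let DD x y : D x -> D y -> D (x + y).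
Proof.
by move=> Dx Dy; rewrite -[y]opprK; apply: DB => //; rewrite -sub0r; exact: DB.
Qed.

Lemma split_roots p : poly_over D p -> p != 0 ->
  exists2 s : seq C, (forall a, a \in s -> D a) & p = lead_coef p *: \prod_(a <- s) ('X - a%:P).
Proof.
elim: {p}(size p) {-2}p (erefl (size p)) => [|n IH] p sp Dp p0.
  by move/eqP: sp p0; rewrite size_poly_eq0 => ->.
case: n IH sp => [|n] IH sp.
  exists [::] => //; rewrite big_nil (size1_polyC (_ : size p <= 1)%N) ?sp//.
  by rewrite lead_coefC alg_polyC.
have [|a Da /factor_theorem[q pE]] := D_root Dp; first by rewrite sp.
have q0 : q != 0 by apply: contraNneq p0 => q0; rewrite pE q0 mul0r.
have sq : size q = n.+1 by move: sp; rewrite pE size_Mmonic ?monicXsubC// size_XsubC addn2 /= => -[].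
have Dq : poly_over D q.
  have rec i : q`_i = p`_i.+1 + a * q`_i.+1 by rewrite pE mulrBr coefB coefMX coefMC /=; ring.
  (* Descending induction along Horner's scheme, starting from the zero coefficients beyond the size
     of q. *)
  have : forall k i, (size q <= i + k)%N -> D q`_i.
    elim=> [|k IHk] i h; first by rewrite addn0 in h; rewrite nth_default.
    rewrite rec; apply: DD; first exact: Dp.
    by apply: DM => //; apply: IHk; rewrite addSnnS.
  by move=> H i; apply: (H (size q)); exact: leq_addl.
have [s Ds sE] := IH q sq Dq q0.
exists (a :: s); first by move=> c; rewrite inE => /orP[/eqP ->|/Ds].
rewrite pE lead_coef_Mmonic ?monicXsubC// {1}sE big_cons.
by rewrite -scalerAl mulrC.
Qed.

End split_roots.

(* C stands for C_v and D for the algebraic closure of K in it. *)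
Record na_setting (R : realType) (C : fieldType) (abs : C -> R) (D : set C) : Prop := NaSetting {
  ns_um : forall x y, abs (x + y) <= Num.max (abs x) (abs y);
  ns_big : exists c, 1 < abs c;
  ns_dense : forall x e, 0 < e -> exists2 y, D y & abs (x - y) < e;
  ns_D1 : D 1;
  ns_DB : forall x y, D x -> D y -> D (x - y);
  ns_DM : forall x y, D x -> D y -> D (x * y);
  ns_root : forall p : {poly C}, poly_over D p -> (1 < size p)%N -> exists2 x, D x & root p x;
  ns_countable : countable D }.

Section seminorms.
Variables (R : realType) (C : fieldType) (abs : C -> R) (D : set C).
Hypotheses (absP : is_absval abs) (ns : na_setting abs D).
Local Notation X := (fun c : C => 'X - c%:P).
Implicit Types (S U W : berkA1 abs) (P Q : {poly C}).

Let um := ns_um ns.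
Let D1 := ns_D1 ns.
Let DB := ns_DB ns.
Let D0 : D 0. Proof. by rewrite -(subrr 1); exact: (DB D1 D1). Qed.
Let DN x : D x -> D (- x). Proof. by move=> Dx; rewrite -sub0r; exact: (DB D0 Dx). Qed.
Let DD x y : D x -> D y -> D (x + y).
Proof. by move=> Dx Dy; rewrite -[y]opprK; exact: (DB Dx (DN Dy)). Qed.

Lemma abs_nat_le1 n : abs n%:R <= 1.
Proof.
elim: n => [|n IH]; first by rewrite absval0// ler01.
by rewrite -natr1; apply: le_trans (um _ _) _; rewrite ge_max IH (absval1 absP) lexx.
Qed.

Lemma umB x y : abs (x - y) <= Num.max (abs x) (abs y).
Proof. by rewrite -(absvalN absP y); exact: um. Qed.

Lemma um_sum_lt (I : Type) (r : seq I) (P : pred I) (f : I -> C) M : 0 < M ->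
  (forall i, P i -> abs (f i) < M) -> abs (\sum_(i <- r | P i) f i) < M.
Proof.
move=> M0 fM; elim/big_ind: _ => //; first by rewrite absval0.
by move=> x y xM yM; rewrite (le_lt_trans (um _ _))// gt_max xM.
Qed.

Lemma um_sum_le (I : Type) (r : seq I) (P : pred I) (f : I -> C) M : 0 <= M ->
  (forall i, P i -> abs (f i) <= M) -> abs (\sum_(i <- r | P i) f i) <= M.
Proof.
move=> M0 fM; elim/big_ind: _ => //; first by rewrite absval0.
by move=> x y xM yM; rewrite (le_trans (um _ _))// ge_max xM.
Qed.

Lemma um_eq x y : abs y < abs x -> abs (x + y) = abs x.
Proof.
move=> yx; apply/le_anti/andP; split.
  by rewrite (le_trans (um _ _))// ge_max lexx ltW.
rewrite leNgt; apply/negP => h.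
have : abs x <= Num.max (abs (x + y)) (abs y) by rewrite -{1}(addrK y x) umB.
by rewrite leNgt gt_max h yx.
Qed.

Lemma snormP S : mult_seminorm abs (snorm S).
Proof. by have := valP S; rewrite inE. Qed.
Lemma snorm_ge0 S P : 0 <= snorm S P. Proof. by case: (snormP S). Qed.
Lemma snormM S P Q : snorm S (P * Q) = snorm S P * snorm S Q. Proof. by case: (snormP S). Qed.
Lemma snormD S P Q : snorm S (P + Q) <= snorm S P + snorm S Q. Proof. by case: (snormP S). Qed.
Lemma snormC S c : snorm S c%:P = abs c. Proof. by case: (snormP S). Qed.
Lemma snorm1 S : snorm S 1 = 1. Proof. by rewrite -polyC1 snormC absval1. Qed.
Lemma snormN S P : snorm S (- P) = snorm S P.
Proof. by rewrite -mulN1r -polyC1 -polyCN snormM snormC absvalN// absval1// mul1r. Qed.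
Lemma snormX S P n : snorm S (P ^+ n) = snorm S P ^+ n.
Proof. by elim: n => [|n IH]; rewrite ?expr0 ?snorm1// !exprS snormM IH. Qed.
Lemma snorm_um S P Q : snorm S (P + Q) <= Num.max (snorm S P) (snorm S Q).
Proof.
apply: ultrametric_of_nat; [exact: snorm_ge0 | exact: snormM | exact: snormD |].
by move=> n; rewrite -polyC_natr snormC abs_nat_le1.
Qed.
Lemma snorm_sum S (I : Type) (r : seq I) (P : pred I) (f : I -> {poly C}) :
  snorm S (\sum_(i <- r | P i) f i) <= \sum_(i <- r | P i) snorm S (f i).
Proof.
elim/big_ind2: _ => [|x a y b xa yb|//]; first by rewrite -polyC0 snormC absval0.
by apply: le_trans (snormD _ _ _) _; rewrite lerD.
Qed.
Lemma snorm_prod S (I : Type) (r : seq I) (f : I -> {poly C}) :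
  snorm S (\prod_(i <- r) f i) = \prod_(i <- r) snorm S (f i).
Proof. by apply: (big_morph (snorm S) (snormM S) (snorm1 S)). Qed.

Lemma snorm_lin S c c' : snorm S (X c) <= Num.max (snorm S (X c')) (abs (c - c')).
Proof.
have -> : X c = X c' + (c' - c)%:P by rewrite polyCB addrACA addrA; ring.
by apply: le_trans (snorm_um _ _ _) _; rewrite snormC absvalC.
Qed.
Lemma abs_snorm_lin S c c' : abs (c - c') <= Num.max (snorm S (X c)) (snorm S (X c')).
Proof.
rewrite -(snormC S) polyCB; have -> : c%:P - c'%:P = X c' - X c by ring.
by apply: le_trans (snorm_um _ _ _) _; rewrite snormN maxC.
Qed.

Lemma split_over p : poly_over D p -> p != 0 ->
  exists2 s : seq C, (forall a, a \in s -> D a) & p = lead_coef p *: \prod_(a <- s) (X a).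
Proof. exact: (split_roots (ns_D1 ns) (ns_DB ns) (ns_DM ns) (ns_root ns)). Qed.

Lemma poly_approx P e : 0 < e -> exists Q, [/\ poly_over D Q, (size Q <= size P)%N &
  forall i, abs (P`_i - Q`_i) <= e].
Proof.
move=> e0; pose w i := projT1 (cid2 (ns_dense ns P`_i e0)).
have [Dw we] : (forall i, D (w i)) /\ forall i, abs (P`_i - w i) < e by split => i; rewrite /w; case: cid2.
exists (\poly_(i < size P) w i); split; last 2 first.
- exact: size_poly.
- move=> i; rewrite coef_poly; case: ltnP => h; first exact: ltW.
  by rewrite nth_default// subr0 absval0// ltW.
by move=> i; rewrite coef_poly; case: ifP.
Qed.

Lemma snorm_coef_bound S P e n B : (size P <= n)%N -> 0 <= e -> (forall i, abs P`_i <= e) ->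
  snorm S 'X <= B -> 1 <= B -> snorm S P <= n%:R * e * B ^+ n.
Proof.
move=> sP e0 Pe SB B1; have B0 : 0 <= B by exact: le_trans ler01 B1.
rewrite -{1}(coefK P) poly_def; apply: le_trans (snorm_sum _ _ _ _) _.
apply: le_trans (_ : \sum_(i < size P) e * B ^+ n <= _).
  apply: ler_sum => i _; rewrite -mul_polyC snormM snormC snormX.
  apply: ler_pM => //; [exact: absval_ge0 | by rewrite exprn_ge0// snorm_ge0 |].
  apply: le_trans (_ : B ^+ i <= _); first by rewrite lerXn2r ?nnegrE// snorm_ge0.
  by rewrite ler_weXn2l// (leq_trans _ sP)// ltnW.
rewrite [leLHS](_ : _ = (size P)%:R * e * B ^+ n); last first.
  by rewrite sumr_const card_ord -mulrA mulr_natl.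
by apply: ler_wpM2r; [exact: exprn_ge0 | apply: ler_wpM2r; rewrite ?ler_nat].
Qed.

(** Polynomials over D split, and they approximate all polynomials coefficientwise; so seminorms are
    compared through their values at the X - c. The factorization takes place over D because closure
    under roots is given for D, not for C. *)
Lemma snorm_leP S U : (forall c, snorm S (X c) <= snorm U (X c)) -> snorm_le S U.
Proof.
move=> H P; apply/ler_addgt0Pr => e e0.
pose B := Num.max 1 (Num.max (snorm S 'X) (snorm U 'X)).
have B1 : 1 <= B by rewrite le_max lexx.
have SB : snorm S 'X <= B by rewrite !le_max lexx orbT.
have UB : snorm U 'X <= B by rewrite !le_max lexx !orbT.
set n := size P; pose k := 2 * (n%:R + 1) * B ^+ n.
have k0 : 0 < k by rewrite !mulr_gt0// ?exprn_gt0 ?(lt_le_trans ltr01)// ltr_wpDl.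
have d0 : 0 < e / k by rewrite divr_gt0.
have [Q [DQ sQ PQ]] := poly_approx P d0.
have QQ : snorm S Q <= snorm U Q.
  have [->|Q0] := eqVneq Q 0; first by rewrite -polyC0 !snormC.
  have [s _ ->] := split_over DQ Q0; rewrite -mul_polyC !snormM !snormC !snorm_prod.
  rewrite ler_wpM2l ?absval_ge0//; apply: ler_prod => a _.
  by rewrite snorm_ge0 H.
have bnd W : snorm W 'X <= B -> snorm W (P - Q) <= e / 2.
  move=> WB; apply: le_trans (@snorm_coef_bound W (P - Q) (e / k) n B _ _ _ WB B1) _.
  - apply: leq_trans (size_polyD _ _) _; rewrite size_polyN geq_max leqnn//.
  - exact: ltW.
  - by move=> i; rewrite coefB; exact: PQ.
  - have -> : n%:R * (e / k) * B ^+ n = (e / 2) * (n%:R / (n%:R + 1)).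
      rewrite /k; field; rewrite expf_neq0 ?gt_eqF ?ltr_wpDl//=.
      by rewrite (lt_le_trans ltr01).
    by rewrite ler_piMr ?divr_ge0 ?(ltW e0)// ler_pdivrMr ?ltr_wpDl// mul1r lerDl.
have -> : P = (P - Q) + Q by rewrite subrK.
apply: le_trans (snormD _ _ _) _.
have h1 := bnd S SB; have h2 := bnd U UB.
have h3 : snorm U Q <= snorm U ((P - Q) + Q) + snorm U (P - Q).
  have {1}-> : Q = ((P - Q) + Q) - (P - Q) by ring.
  by rewrite -(snormN U (P - Q)) snormD.
lra.
Qed.

Lemma snorm_inj S U : (forall P, snorm S P = snorm U P) -> S = U.
Proof. by move=> H; apply: val_inj; apply/funext => P; exact: H. Qed.

Lemma snorm_le_anti S U : snorm_le S U -> snorm_le U S -> S = U.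
Proof. by move=> SU US; apply: snorm_inj => P; apply/eqP; rewrite eq_le SU US. Qed.

Lemma snorm_lin_inj S U : (forall c, snorm S (X c) = snorm U (X c)) -> S = U.
Proof. by move=> H; apply: snorm_le_anti; apply: snorm_leP => c; rewrite H. Qed.

(** The Gauss norm of radius r about 0; translated to a, it is the seminorm of the disc of centre a
    and radius r. *)
Definition gnorm (r : R) P : R := \big[Num.max/0]_(i < size P) (abs P`_i * r ^+ i).

Section gauss_norm.
Variable r : R.
Hypothesis r0 : 0 < r.
Let rX n : 0 < r ^+ n. Proof. exact: exprn_gt0. Qed.
Let term_ge0 P i : 0 <= abs P`_i * r ^+ i.
Proof. by apply: mulr_ge0; [exact: absval_ge0 | exact: (ltW (rX i))]. Qed.

Lemma gnorm_ge P i : abs P`_i * r ^+ i <= gnorm r P.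
Proof.
have [h|h] := ltnP i (size P); first exact: (le_bigmax _ (fun i : 'I_(size P) => abs P`_i * r ^+ i) (Ordinal h)).
rewrite nth_default// absval0// mul0r /gnorm.
exact: bigmax_ge_id.
Qed.

Lemma gnorm_le P M : 0 <= M -> (forall i, abs P`_i * r ^+ i <= M) -> gnorm r P <= M.
Proof. by move=> M0 PM; apply: bigmax_le => // i _. Qed.

Lemma gnorm_ge0 P : 0 <= gnorm r P.
Proof. exact: le_trans (term_ge0 P 0) (gnorm_ge P 0). Qed.

Lemma gnorm_eq0 P : gnorm r P = 0 -> P = 0.
Proof.
move=> P0; apply/polyP => i; rewrite coef0; apply/eqP.
rewrite -(absval_eq0 absP) -(mulrI_eq0 _ (lregP (lt0r_neq0 (rX i)))) mulrC eq_le term_ge0 andbT.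
by rewrite -P0 gnorm_ge.
Qed.

Lemma gnorm_last P : P != 0 -> exists i, abs P`_i * r ^+ i = gnorm r P /\
  forall j, (i < j)%N -> abs P`_j * r ^+ j < gnorm r P.
Proof.
move=> P0; have g0 : 0 < gnorm r P.
  by rewrite lt_def gnorm_ge0 andbT; apply: contra_neq P0; exact: gnorm_eq0.
pose Q i := abs P`_i * r ^+ i == gnorm r P.
have exQ : exists i, Q i.
  have sP : (0 < size P)%N by rewrite size_poly_gt0.
  have [i _ iE] := @eq_bigmax _ R _ 0 (Ordinal sP) xpredT (fun i : 'I_(size P) => abs P`_i * r ^+ i) isT (fun i _ => term_ge0 P i).
  by exists i; rewrite /Q -iE.
have bQ i : Q i -> (i <= size P)%N.
  move=> /eqP Qi; rewrite leqNgt; apply/negP => h; move: g0; rewrite -Qi nth_default ?(ltnW h)//.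
  by rewrite absval0// mul0r ltxx.
case: (ex_maxnP exQ bQ) => i /eqP Qi imax; exists i; split => // j ij.
rewrite lt_neqAle gnorm_ge andbT; apply/negP => /imax.
by rewrite leqNgt ij.
Qed.

(** Gauss's argument: with i and j the last indices at which P and Q reach their norms, every other
    product contributing to the coefficient i + j is strictly smaller than P_i Q_j. *)
Lemma gnormM P Q : gnorm r (P * Q) = gnorm r P * gnorm r Q.
Proof.
have [->|P0] := eqVneq P 0.
  have z : gnorm r 0 = 0 by rewrite /gnorm size_poly0 big_ord0.
  by rewrite mul0r z mul0r.
have [->|Q0] := eqVneq Q 0.
  have z : gnorm r 0 = 0 by rewrite /gnorm size_poly0 big_ord0.
  by rewrite mulr0 z mulr0.
apply/le_anti/andP; split.
  apply: gnorm_le => [|n]; first by rewrite mulr_ge0// gnorm_ge0.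
  rewrite coefM -ler_pdivlMr//; apply: um_sum_le => [|i _].
    by rewrite divr_ge0 ?(ltW (rX n))// mulr_ge0// gnorm_ge0.
  have -> : r ^+ n = r ^+ i * r ^+ (n - i) by rewrite -exprD subnKC// -ltnS.
  rewrite ler_pdivlMr ?mulr_gt0// (absvalM absP).
  rewrite [leLHS](_ : _ = (abs P`_i * r ^+ i) * (abs Q`_(n - i) * r ^+ (n - i))); last by ring.
  by rewrite ler_pM// gnorm_ge.
have [i [iE il]] := gnorm_last P0; have [j [jE jl]] := gnorm_last Q0.
rewrite -{1}iE -{1}jE; apply: le_trans (gnorm_ge _ (i + j)).
have iij : (i < (i + j).+1)%N by rewrite ltnS leq_addr.
rewrite coefM (bigD1 (Ordinal iij))//= addKn um_eq; first by rewrite (absvalM absP) exprD mulrACA.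
have Pp : 0 < abs P`_i.
  rewrite -(pmulr_lgt0 _ (rX i)) iE lt_def gnorm_ge0 andbT.
  by apply: contra_neq P0; exact: gnorm_eq0.
have Qp : 0 < abs Q`_j.
  rewrite -(pmulr_lgt0 _ (rX j)) jE lt_def gnorm_ge0 andbT.
  by apply: contra_neq Q0; exact: gnorm_eq0.
rewrite (absvalM absP); apply: um_sum_lt => [|k ki]; first exact: mulr_gt0.
rewrite (absvalM absP) -(ltr_pM2r (rX (i + j))).
have kij : (k <= i + j)%N by rewrite -ltnS.
have rE : r ^+ (i + j) = r ^+ k * r ^+ (i + j - k) by rewrite -exprD subnKC.
rewrite {1}rE exprD.
rewrite [ltLHS](_ : _ = (abs P`_k * r ^+ k) * (abs Q`_(i + j - k) * r ^+ (i + j - k))); last by ring.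
rewrite [ltRHS](_ : _ = (abs P`_i * r ^+ i) * (abs Q`_j * r ^+ j)); last by ring.
rewrite iE jE.
have gP : 0 < gnorm r P by rewrite -iE mulr_gt0.
have gQ : 0 < gnorm r Q by rewrite -jE mulr_gt0.
have [h|h] := ltnP i k.
  apply: le_lt_trans (_ : (abs P`_k * r ^+ k) * gnorm r Q < _).
    by rewrite ler_wpM2l// gnorm_ge.
  by rewrite ltr_pM2r// il.
have h2 : (j < i + j - k)%N.
  move: ki h; rewrite -val_eqE /= => ki h.
  have : (k < i)%N by rewrite ltn_neqAle ki h.
  lia.
apply: le_lt_trans (_ : gnorm r P * (abs Q`_(i + j - k) * r ^+ (i + j - k)) < _).
  by rewrite ler_wpM2r// gnorm_ge.
by rewrite ltr_pM2l// jl.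
Qed.

Lemma ball_mult_seminorm (a : C) : mult_seminorm abs (fun P => gnorm r (P \Po ('X + a%:P))).
Proof.
split.
- by move=> P; exact: gnorm_ge0.
- by move=> P Q; rewrite comp_polyM gnormM.
- move=> P Q; rewrite comp_polyD; apply: gnorm_le => [|i]; first by rewrite addr_ge0// gnorm_ge0.
  rewrite coefD; apply: le_trans (_ : (abs (P \Po ('X + a%:P))`_i + abs (Q \Po ('X + a%:P))`_i) * r ^+ i <= _).
    by rewrite ler_wpM2r ?(ltW (rX i))// absvalD.
  by rewrite mulrDl lerD// gnorm_ge.
- move=> c; rewrite comp_polyC; apply/le_anti/andP; split.
    apply: gnorm_le => [|i]; first exact: absval_ge0.
    rewrite coefC; case: eqP => [->|_]; first by rewrite expr0 mulr1.
    by rewrite absval0// mul0r absval_ge0.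
  by have := gnorm_ge c%:P 0; rewrite coefC eqxx expr0 mulr1.
Qed.

Definition ball_point (a : C) : berkA1 abs :=
  exist _ (fun P => gnorm r (P \Po ('X + a%:P))) (mem_set (ball_mult_seminorm a)).

Lemma snorm_ball a c : snorm (ball_point a) (X c) = Num.max (abs (a - c)) r.
Proof.
rewrite /snorm /=.
have -> : (X c) \Po ('X + a%:P) = 'X + (a - c)%:P by rewrite comp_polyB comp_polyX comp_polyC polyCB addrA.
have co i : ('X + (a - c)%:P)`_i = if i == 0%N then a - c else if i == 1%N then 1 else 0.
  rewrite coefD coefX coefC; case: i => [|[|i]] /=; by rewrite ?add0r ?addr0.
apply/le_anti/andP; split.
  apply: gnorm_le => [|i]; first by rewrite le_max absval_ge0.
  rewrite co; case: i => [|[|i]] /=; rewrite ?expr0 ?expr1 ?mulr1 ?(absval1 absP) ?mul1r ?(absval0 absP) ?mul0r ?le_max ?lexx ?orbT//.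
  by rewrite (ltW r0) orbT.
rewrite ge_max; apply/andP; split.
  by have := gnorm_ge ('X + (a - c)%:P) 0; rewrite co /= expr0 mulr1.
by have := gnorm_ge ('X + (a - c)%:P) 1; rewrite co /= expr1 absval1// mul1r.
Qed.

End gauss_norm.

Lemma diam_le S c : diam S <= snorm S (X c).
Proof. by apply: ge_inf; [exists 0 => _ [c' _ <-]; exact: snorm_ge0 | exists c]. Qed.

Lemma le_diam S M : (forall c, M <= snorm S (X c)) -> M <= diam S.
Proof. by move=> H; apply: lb_le_inf => [|_ [c _ <-]//]; exists (snorm S (X 0)), 0. Qed.

Lemma diam_ge0 S : 0 <= diam S.
Proof. by apply: le_diam => c; exact: snorm_ge0. Qed.

Lemma diam_lt S t : diam S < t -> exists c, snorm S (X c) < t.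
Proof.
move=> h; apply: contrapT => /forallNP H; move: h; rewrite ltNge => /negP; apply.
by apply: le_diam => c; rewrite leNgt; apply/negP/H.
Qed.

(* The point at level t on the path from S to infinity; it is S itself as long
   as t <= diam S. *)
Definition raise S (t : R) : berkA1 abs :=
  match pselect (diam S < t) with
  | left h => ball_point (le_lt_trans (diam_ge0 S) h) (projT1 (cid (diam_lt h)))
  | right _ => S
  end.

Lemma snorm_raise S t c : snorm (raise S t) (X c) = Num.max (snorm S (X c)) t.
Proof.
rewrite /raise; case: pselect => [h|h]; last first.
  have ht : t <= snorm S (X c) by rewrite (le_trans _ (diam_le S c))// leNgt; apply/negP.
  by apply/esym/max_idPl.
case: cid => b /= bt; rewrite snorm_ball.
have H1 := abs_snorm_lin S b c; have H2 := snorm_lin S c b; rewrite absvalC// in H2.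
apply/eqP; rewrite eq_le !ge_max !le_max lexx !orbT !andbT; apply/andP; split.
  move: H1; rewrite le_max => /orP[h1|->//].
  by rewrite (le_trans h1 (ltW bt)) orbT.
move: H2; rewrite le_max => /orP[h1|->//].
by rewrite (le_trans h1 (ltW bt)) orbT.
Qed.

Lemma diam_raise S t : diam (raise S t) = Num.max (diam S) t.
Proof.
apply/le_anti/andP; split; last first.
  rewrite ge_max; apply/andP; split; apply: le_diam => c; rewrite snorm_raise le_max ?lexx ?orbT//.
  by rewrite diam_le.
apply/ler_addgt0Pr => e e0; have [|c h] := @diam_lt S (diam S + e); first by rewrite ltrDl.
apply: le_trans (diam_le _ c) _; rewrite snorm_raise ge_max; apply/andP; split.
  by apply: le_trans (ltW h) _; rewrite lerD2r le_max lexx.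
by apply: le_trans (_ : Num.max (diam S) t <= _); rewrite ?le_max ?lexx ?orbT// lerDl ltW.
Qed.

Lemma raise_id S t : t <= diam S -> raise S t = S.
Proof. by move=> h; rewrite /raise; case: pselect => // h'; exfalso; move: h'; rewrite ltNge h. Qed.

Lemma sub_raise S t : snorm_le S (raise S t).
Proof. by apply: snorm_leP => c; rewrite snorm_raise le_max lexx. Qed.

(** The radius at which the paths from S and U to infinity merge; [sup_berkE] identifies it with sup
    {S, U}. *)
Definition meet_level S U : R := inf (range (fun c => Num.max (snorm S (X c)) (snorm U (X c)))).

Lemma meet_level_le S U c : meet_level S U <= Num.max (snorm S (X c)) (snorm U (X c)).
Proof.
by apply: ge_inf; [exists 0 => _ [c' _ <-]; rewrite le_max snorm_ge0 | exists c].
Qed.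

Lemma le_meet_level S U M : (forall c, M <= Num.max (snorm S (X c)) (snorm U (X c))) -> M <= meet_level S U.
Proof. by move=> H; apply: lb_le_inf => [|_ [c _ <-]//]; exists (Num.max (snorm S (X 0)) (snorm U (X 0))), 0. Qed.

Lemma meet_levelC S U : meet_level S U = meet_level U S.
Proof. by congr inf; congr (_ @` _); apply/funext => c; rewrite maxC. Qed.

Lemma snorm_meet_level S U c : snorm U (X c) <= Num.max (snorm S (X c)) (meet_level S U).
Proof.
rewrite le_max leNgt; case: ltP => //= h; apply: le_meet_level => c'.
have := snorm_lin U c c'; rewrite le_max => /orP[h1|h1]; first by rewrite le_max h1 orbT.
have := abs_snorm_lin S c c'; rewrite le_max => /orP[h2|h2].
  by move: h; rewrite ltNge (le_trans h1 h2).
by rewrite le_max (le_trans h1 h2).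
Qed.

Lemma raise_meet S U : raise S (meet_level S U) = raise U (meet_level S U).
Proof.
apply: snorm_lin_inj => c; rewrite !snorm_raise; apply/eqP.
rewrite eq_le !ge_max !le_max lexx !orbT !andbT -!le_max.
by rewrite snorm_meet_level meet_levelC snorm_meet_level.
Qed.

Lemma join_raise S U : join S U = raise S (meet_level S U).
Proof.
have J : is_join S U (raise S (meet_level S U)).
  split; first exact: sub_raise.
    by rewrite raise_meet; exact: sub_raise.
  move=> W SW UW; apply: snorm_leP => c; rewrite snorm_raise ge_max SW /=.
  by apply: le_trans (meet_level_le S U c) _; rewrite ge_max SW UW.
rewrite /join; case: xgetP => [W _ [SW UW Wmin]|/(_ (raise S (meet_level S U)))//].
by apply: snorm_le_anti; [apply: Wmin; case: J | case: J => _ _; exact].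
Qed.

Lemma diam_le_meet S U : diam S <= meet_level S U.
Proof. by apply: le_meet_level => c; rewrite le_max diam_le. Qed.

Lemma sup_berkE S U : sup_berk S U = meet_level S U.
Proof. by rewrite /sup_berk join_raise diam_raise; apply/max_idPr/diam_le_meet. Qed.

Lemma snorm_eval c c' : snorm (eval_point absP c) (X c') = abs (c - c').
Proof. by rewrite /snorm /= !hornerE. Qed.

Lemma sup_berk_eval c U : sup_berk (eval_point absP c) U = snorm U (X c).
Proof.
rewrite sup_berkE; apply/le_anti/andP; split.
  apply: le_trans (meet_level_le _ _ c) _; rewrite snorm_eval subrr absval0//.
  by rewrite ge_max snorm_ge0 lexx.
by apply: le_meet_level => c'; rewrite snorm_eval maxC; exact: snorm_lin.
Qed.

Lemma diam_eval c : diam (eval_point absP c) = 0.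
Proof.
apply/eqP; rewrite eq_le diam_ge0 andbT; apply: le_trans (diam_le _ c) _.
by rewrite snorm_eval subrr absval0.
Qed.

Lemma hyperbolic_diam S : 0 < diam S -> hyperbolic absP S.
Proof. by move=> h [c _ cS]; rewrite -cS diam_eval ltxx in h. Qed.

End seminorms.

(** * Topology of the Berkovich line *)

Section closed_relations.
Variables (T : topologicalType) (R : realType) (f g : T -> R).
Hypotheses (cf : continuous f) (cg : continuous g).

Lemma closed_le_fun : closed [set x | f x <= g x].
Proof.
have -> : [set x | f x <= g x] = (fun x => f x - g x) @^-1` [set x | x <= 0] by apply/seteqP; split=> x /=; rewrite subr_le0.
apply: closed_comp => [x _|]; last exact: closed_le.
by apply: cvgB; [exact: cf | exact: cg].
Qed.

End closed_relations.

Lemma closed_eq_fun (T : topologicalType) (R : realType) (f g : T -> R) :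
  continuous f -> continuous g -> closed [set x | f x = g x].
Proof.
move=> cf cg; rewrite [X in closed X](_ : _ = [set x | f x <= g x] `&` [set x | g x <= f x]).
  by apply: closedI; exact: closed_le_fun.
apply/seteqP; split=> x /=; first by move=> ->.
by case=> h1 h2; apply/eqP; rewrite eq_le h1 h2.
Qed.

Section berkovich_topology.
Variables (R : realType) (C : fieldType) (abs : C -> R) (D : set C).
Hypotheses (absP : is_absval abs) (ns : na_setting abs D).
Local Notation X := (fun c : C => 'X - c%:P).
Implicit Types (S U W : berkA1 abs) (P Q : {poly C}).

Lemma snorm_continuous P : continuous (fun S : berkA1 abs => snorm S P).
Proof.
move=> S; apply: (@continuous_comp _ _ _ (fun S : berkA1 abs => \val S)
  (fun f : prod_topology (fun _ : {poly C} => R) => f P)).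
  exact: initial_continuous.
exact: (@proj_continuous _ (fun _ : {poly C} => R : topologicalType) P).
Qed.

Lemma berk_cvg (Z : Type) (F : set_system Z) (f : Z -> berkA1 abs) S : Filter F ->
  (forall P, snorm (f z) P @[z --> F] --> snorm S P) -> f z @[z --> F] --> S.
Proof.
move=> FF H A /=; rewrite nbhsE => -[B [[V oV <-] BS] BA].
have {}BA : f @^-1` ((fun S => \val S) @^-1` V) `<=` f @^-1` A by move=> z /BA.
apply: filterS BA _ => /=.
have : (\val (f z) : prod_topology (fun _ : {poly C} => R)) @[z --> F] --> \val S.
  apply/cvg_sup => P U /= [B0 [[V2 oV2 <-] V2S] V2U]; apply: filterS V2U _.
  by apply: (H P); apply: open_nbhs_nbhs.
by apply; apply: open_nbhs_nbhs.
Qed.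

(** As in [snorm_leP], split polynomials over D approximate P; the error is uniform near the limit
    because the value at X stays bounded. *)
Lemma berk_cvg_lin (Z : Type) (F : set_system Z) (f : Z -> berkA1 abs) S : Filter F ->
  (forall c, snorm (f z) (X c) @[z --> F] --> snorm S (X c)) -> f z @[z --> F] --> S.
Proof.
move=> FF H; apply: berk_cvg => P.
have HX : snorm (f z) 'X @[z --> F] --> snorm S 'X by have := H 0; rewrite subr0.
have HQ Q : poly_over D Q -> snorm (f z) Q @[z --> F] --> snorm S Q.
  move=> DQ; have [->|Q0] := eqVneq Q 0.
    have E U : snorm U 0 = 0 by rewrite -polyC0 snormC absval0.
    by rewrite E; under eq_fun do rewrite E; exact: cvg_cst.
  have [s _ ->] := split_over ns DQ Q0.
  have E U : snorm U (lead_coef Q *: \prod_(a <- s) X a) =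
      abs (lead_coef Q) * snorm U (\prod_(a <- s) X a).
    by rewrite -mul_polyC snormM snormC.
  rewrite E; under eq_fun do rewrite E; apply: cvgM; first exact: cvg_cst.
  elim: s {E} => [|a s IH].
    have E U : snorm U (\prod_(b <- [::]) X b) = 1 by rewrite big_nil snorm1.
    by rewrite E; under eq_fun do rewrite E; exact: cvg_cst.
  have E U : snorm U (\prod_(b <- a :: s) X b) = snorm U (X a) * snorm U (\prod_(b <- s) X b).
    by rewrite big_cons snormM.
  rewrite E; under eq_fun do rewrite E.
  by apply: cvgM => //; exact: H.
apply/cvgrPdist_le => e e0.
pose B := Num.max 1 (snorm S 'X + 1).
have B1 : 1 <= B by rewrite le_max lexx.
have B0 : 0 < B ^+ size P by rewrite exprn_gt0// (lt_le_trans ltr01).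
pose d := e / 3 / (((size P)%:R + 1) * B ^+ size P).
have d0 : 0 < d by rewrite !divr_gt0// mulr_gt0.
have [Q [DQ sQ PQ]] := poly_approx absP ns P d0.
have bnd U : snorm U 'X <= B -> `|snorm U P - snorm U Q| <= e / 3.
  move=> UB; have h : snorm U (P - Q) <= e / 3.
    have sPQ : (size (P - Q)%R <= size P)%N by rewrite (leq_trans (size_polyD _ _))// geq_max size_polyN leqnn sQ.
    apply: le_trans (snorm_coef_bound absP sPQ (ltW d0) _ UB B1) _ => [i|].
      by rewrite coefB; exact: PQ.
    rewrite [leLHS](_ : _ = e / 3 * ((size P)%:R / ((size P)%:R + 1))).
      by rewrite ler_piMr ?divr_ge0 ?(ltW e0)// ler_pdivrMr// mul1r lerDl.
    by rewrite /d; field; rewrite !gt_eqF.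
  rewrite ler_norml; apply/andP; split.
    have := snormD U (Q - P) P; rewrite subrK => h1.
    by have := snormN absP U (P - Q); rewrite opprB => h2; lra.
  by have := snormD U (P - Q) Q; rewrite subrK => h1; lra.
have e3 : 0 < e / 3 by rewrite divr_gt0.
have /cvgrPdist_le /(_ _ e3) HQe := HQ Q DQ.
have /cvgrPdist_le /(_ _ ltr01) HXe := HX.
near=> z.
have zQ : `|snorm S Q - snorm (f z) Q| <= e / 3 by near: z.
have zX : `|snorm S 'X - snorm (f z) 'X| <= 1 by near: z.
have b1 : `|snorm S P - snorm S Q| <= e / 3 by apply: bnd; rewrite le_max lerDl ler01 orbT.
have b2 : `|snorm (f z) P - snorm (f z) Q| <= e / 3.
  apply: bnd; rewrite le_max; apply/orP; right.
  by move: zX; rewrite distrC => /ler_normlP[_]; rewrite lerBlDl addrC.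
move: zQ b1 b2; rewrite !ler_norml => /andP[? ?] /andP[? ?] /andP[? ?]; apply/andP; lra.
Unshelve. all: by end_near. Qed.

Lemma snorm_le_closed P r : closed [set S : berkA1 abs | snorm S P <= r].
Proof.
have := @closed_comp _ _ (fun S => snorm S P) [set x : R | x <= r].
apply; last exact: closed_le.
by move=> S _; exact: snorm_continuous.
Qed.

Lemma mult_seminorm_closed (T : topologicalType) (ev : T -> {poly C} -> R) :
  (forall P, continuous (ev^~ P)) -> closed [set f | mult_seminorm abs (ev f)].
Proof.
move=> pc; have cc (r0 : R) : continuous (fun _ : T => r0) by exact: cst_continuous.
have cD P Q : continuous (fun f => ev f P + ev f Q) by move=> f; exact: (cvgD (@pc P f) (@pc Q f)).
have cM P Q : continuous (fun f => ev f P * ev f Q) by move=> f; exact: (cvgM (@pc P f) (@pc Q f)).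
have -> : [set f | mult_seminorm abs (ev f)] =
  (\bigcap_(P in setT) [set f | 0 <= ev f P]) `&`
  (\bigcap_(P in setT) \bigcap_(Q in setT) [set f | ev f (P * Q) = ev f P * ev f Q]) `&`
  (\bigcap_(P in setT) \bigcap_(Q in setT) [set f | ev f (P + Q) <= ev f P + ev f Q]) `&`
  (\bigcap_(c in setT) [set f | ev f c%:P = abs c]).
  apply/seteqP; split => f.
    case=> h1 h2 h3 h4; split; last by move=> c _; exact: h4.
    split; last by move=> P _ Q _; exact: h3.
    by split=> [P _|P _ Q _]; [exact: h1 | exact: h2].
  by case=> -[[h1 h2] h3] h4; split => *; [exact: h1 | exact: h2 | exact: h3 | exact: h4].
apply: closedI; last by apply: closed_bigI => c _; exact: (closed_eq_fun (pc _) (cc _)).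
apply: closedI; last first.
  by apply: closed_bigI => P _; apply: closed_bigI => Q _; exact: (closed_le_fun (pc _) (cD _ _)).
apply: closedI; last first.
  by apply: closed_bigI => P _; apply: closed_bigI => Q _; exact: (closed_eq_fun (pc _) (cM _ _)).
by apply: closed_bigI => P _; exact: (closed_le_fun (cc _) (pc _)).
Qed.

(** A bound at X bounds the value at every P by [b P], so Tychonoff's theorem applies to a closed
    subset of a product of segments. *)
Lemma snorm_le_compact r : compact [set S : berkA1 abs | snorm S 'X <= r].
Proof.
pose r1 := Num.max 1 r.
have r1g : 1 <= r1 by rewrite le_max lexx.
pose b P := \sum_(i < size P) abs P`_i * r1 ^+ i.
have Sb S P : snorm S 'X <= r1 -> snorm S P <= b P.
  move=> Sr; rewrite -{1}(coefK P) poly_def; apply: le_trans (snorm_sum absP _ _ _ _) _.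
  apply: ler_sum => i _; rewrite -mul_polyC snormM snormC snormX//.
  by rewrite ler_wpM2l ?absval_ge0// lerXn2r ?nnegrE ?snorm_ge0 ?(le_trans ler01).
pose T : topologicalType := prod_topology (fun _ : {poly C} => R).
have cT : compact [set f : T | forall P, [set x | x \in `[0, b P]] (f P)].
  exact: (@tychonoff _ (fun _ : {poly C} => R : topologicalType)
    (fun P => [set x : R | x \in `[0, b P]]) (fun P => @segment_compact R 0 (b P))).
have pc P : continuous (fun f : T => f P).
  exact: (@proj_continuous _ (fun _ : {poly C} => R : topologicalType) P).
have clM : closed [set f : T | mult_seminorm abs f] by exact: (mult_seminorm_closed pc).
have clX : closed [set f : T | f 'X <= r].
  exact: (closed_le_fun (pc _) (@cst_continuous _ _ r)).
have cK : compact ([set f : T | forall P, [set x | x \in `[0, b P]] (f P)] `&`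
    ([set f : T | mult_seminorm abs f] `&` [set f : T | f 'X <= r])).
  by apply: compact_closedI => //; exact: closedI.
move=> F FF FA.
pose G := (fun S : berkA1 abs => (\val S : T)) @ F.
have [|p [[pb [pM pX]] pG]] := cK G _.
  rewrite /G /=; apply: filterS FA => S /= SX; split; last by split=> //; exact: snormP.
  by move=> P /=; rewrite in_itv /= snorm_ge0 Sb// le_max SX orbT.
pose S : berkA1 abs := exist _ p (mem_set pM).
exists S; split => // A B FAA; rewrite nbhsE => -[_ [[V oV <-] VS] VB].
have [||_ [[U AU <-] VU]] := pG ((fun S : berkA1 abs => (\val S : T)) @` A) V.
- by rewrite /G /=; apply: filterS FAA => U AU; exists U.
- exact: open_nbhs_nbhs.
by exists U; split => //; apply: VB.
Qed.

Lemma nbhs_infinity r :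
  nbhs (None : berkP1 abs) [set y | if y is Some U then r < snorm U 'X else True].
Proof.
exists [set S : berkA1 abs | snorm S 'X <= r].
  by split; [exact: snorm_le_compact | exact: snorm_le_closed].
by move=> y [[S /= h <-]|->//]; rewrite ltNge; apply/negP.
Qed.

Lemma berkP1_continuous (f : berkP1 abs -> R) : continuous (fun S => f (Some S)) ->
  (forall e, 0 < e -> exists r, forall S, r < snorm S 'X -> `|f None - f (Some S)| < e) ->
  continuous f.
Proof.
move=> f1 f2 [S|]; first by move=> A /f1.
apply/(@cvgrPdist_lt _ _ _ (nbhs (None : berkP1 abs))) => e e0; have [r rP] := f2 e e0.
apply: filterS (nbhs_infinity r) => -[S|_]; first exact: rP.
by rewrite subrr normr0.
Qed.

Lemma cvg_infinity (Z : Type) (F : set_system Z) (f : Z -> berkP1 abs) : Filter F ->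
  (forall r, \forall z \near F, if f z is Some U then is_true (r < snorm U 'X) else True) ->
  f z @[z --> F] --> (None : berkP1 abs).
Proof.
move=> FF H A [K [cK _] KA].
have [r rK] : exists r, forall S, K S -> snorm S 'X <= r.
  have : compact ((fun S => snorm S 'X) @` K) by apply: continuous_compact => //; apply: continuous_subspaceT => S; exact: snorm_continuous.
  move/compact_bounded => [r [_ /(_ (r + 1))]]; rewrite ltrDl ltr01 => /(_ isT) rP.
  exists (r + 1) => S KS; apply: le_trans (ler_norm _) _.
  by apply: rP; exists S.
rewrite /= nbhs_simpl; apply: filterS (H r) => z /=; case: (f z) => [S h|_]; apply: KA.
  by left; exists S => // KS; move: h; rewrite ltNge rK.
by right.
Qed.

Lemma open_lin_lt c s : open [set y : berkP1 abs | if y is Some U then snorm U (X c) < s else False].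
Proof.
rewrite [X in open X](_ : _ = Some @` [set S | snorm S (X c) < s]).
  apply: one_point_compactification_open_some.
  apply: (@open_comp _ _ (fun S => snorm S (X c)) [set x : R | x < s]); last exact: open_lt.
  by move=> S _; exact: snorm_continuous.
by apply/seteqP; split=> [[S|]//= h|_ [S h <-]//]; exists S.
Qed.

Lemma open_lin_gt c s : open [set y : berkP1 abs | if y is Some U then s < snorm U (X c) else True].
Proof.
rewrite openE => -[S|] /= h.
  have : open [set U : berkA1 abs | s < snorm U (X c)].
    apply: (@open_comp _ _ (fun U => snorm U (X c)) [set x : R | s < x]); last exact: open_gt.
    by move=> U _; exact: snorm_continuous.
  by rewrite openE => /(_ S h).
apply: filterS (nbhs_infinity (Num.max s (abs c))) => -[S|]//=.
rewrite gt_max => /andP[sS cS]; rewrite ltNge; apply/negP => h1.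
have := snorm_lin absP ns S 0 c; rewrite subr0 sub0r absvalN//.
by rewrite leNgt gt_max cS (le_lt_trans h1 sS).
Qed.

End berkovich_topology.

Lemma continuous_min_cst (R : realType) (T : topologicalType) (f : T -> R) (m : R) :
  continuous f -> continuous (fun x => Num.min (f x) m).
Proof. by move=> cf x; exact: (@continuous_min R T f (cst m) x (cf x) (cvg_cst _)). Qed.

Lemma cvg_max_cst (R : realType) (Z : Type) (F : set_system Z) (FF : Filter F) (f : Z -> R) (m l : R) :
  f z @[z --> F] --> l -> Num.max m (f z) @[z --> F] --> Num.max m l.
Proof.
move=> cf; rewrite maxr_absE; under eq_fun do rewrite maxr_absE.
apply: cvgMl; apply: cvgD; first by apply: cvgD => //; exact: cvg_cst.
by apply: cvg_norm; apply: cvgB => //; exact: cvg_cst.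
Qed.

(** * The Gauss point as the point of the unit disc *)

Section gauss.
Variables (R : realType) (C : fieldType) (abs : C -> R) (D : set C).
Hypotheses (absP : is_absval abs) (ns : na_setting abs D).
Local Notation X := (fun c : C => 'X - c%:P).
Implicit Types (S U W : berkA1 abs) (P Q : {poly C}).

Let D0 : D 0.
Proof. by rewrite -(subrr 1); apply: (ns_DB ns); exact: (ns_D1 ns). Qed.

Lemma poly_over_prod (s : seq C) : (forall a, a \in s -> D a) ->
  poly_over D (\prod_(a <- s) X a).
Proof.
elim: s => [|a s IH] Ds i.
  by rewrite big_nil coef1; case: eqP => _; [exact: (ns_D1 ns) | exact: D0].
rewrite big_cons mulrBl coefB coefXM coefCM.
have Dp : poly_over D (\prod_(a <- s) X a) by apply: IH => b bs; apply: Ds; rewrite inE bs orbT.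
apply: (ns_DB ns); last by apply: (ns_DM ns) => //; apply: Ds; rewrite mem_head.
by case: eqP => _ //; exact: D0.
Qed.

(* A point of the unit ball in the residue class avoiding those of the a in s. *)
Lemma generic_point (s : seq C) : (forall a, a \in s -> D a) ->
  exists2 z, abs z <= 1 & forall a, a \in s -> abs (z - a) = Num.max (abs a) 1.
Proof.
move=> Ds; pose s' := 0 :: [seq a <- s | abs a <= 1].
have s'1 a : a \in s' -> abs a <= 1 by rewrite inE mem_filter => /orP[/eqP ->|/andP[]//]; rewrite absval0// ler01.
have Dp : poly_over D (\prod_(a <- s') X a - 1).
  move=> i; rewrite coefB; apply: (ns_DB ns).
    apply: poly_over_prod => a; rewrite inE mem_filter => /orP[/eqP -> //|/andP[_ /Ds//]].
  by rewrite coef1; case: eqP => _; [exact: (ns_D1 ns) | exact: D0].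
have sz : (1 < size (\prod_(a <- s') X a - 1)%R)%N.
  have sz' : size (\prod_(a <- s') X a) = (size s').+1 by rewrite size_prod_XsubC.
  by rewrite size_polyDl sz'// size_polyN size_poly1.
(* At this root the factors |z - a|, for a = 0 and the a of absolute value at most 1, are all at
   most 1 and have product 1; so each equals 1. *)
have [z Dz] := ns_root ns Dp sz.
rewrite rootE !hornerE subr_eq0 horner_prod => /eqP zE.
have zE1 : \prod_(a <- s') abs (z - a) = 1.
  rewrite -[RHS](absval1 absP) -zE (absval_prod absP).
  by apply: eq_bigr => a _; rewrite !hornerE.
have z1 : abs z <= 1.
  rewrite leNgt; apply/negP => z1; suff : 1 < \prod_(a <- s') abs (z - a) by rewrite zE1 ltxx.
  rewrite /s' big_cons subr0; apply: (lt_le_trans z1); rewrite ler_peMr ?absval_ge0//.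
  have : forall a, a \in [seq a <- s | abs a <= 1] -> abs a <= 1 by move=> a; rewrite mem_filter => /andP[].
  elim: [seq a <- s | _] => [|a t IH] Ht; first by rewrite big_nil.
  rewrite big_cons mulr_ege1//; last by apply: IH => b bt; apply: Ht; rewrite inE bt orbT.
  have a1 : abs a <= 1 by rewrite Ht// mem_head.
  have E : abs (z - a) = abs z by rewrite (um_eq absP ns)// absvalN// (le_lt_trans a1).
  by rewrite E ltW.
have zs a : a \in s' -> abs (z - a) = 1.
  move=> as'; have le1 b : b \in s' -> abs (z - b) <= 1.
    by move=> /s'1 b1; apply: le_trans (umB absP ns _ _) _; rewrite ge_max z1.
  apply/eqP; rewrite eq_le le1//= -{1}zE1 (big_rem a as') ler_piMr ?absval_ge0//.
  have {}le1 b : b \in rem a s' -> abs (z - b) <= 1 by move=> /mem_rem; exact: le1.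
  by rewrite big_seq prodr_ile1// => b /le1; rewrite absval_ge0.
exists z => // a as_; case: (leP (abs a) 1) => a1.
  by rewrite zs// inE mem_filter a1 as_ orbT.
by rewrite absvalC// (um_eq absP ns)// absvalN// (le_lt_trans z1).
Qed.

(** The sup norm on the unit ball is attained, for a polynomial split over D, at a generic point
    avoiding the residue classes of the roots; approximation extends the equality with the Gauss
    norm to all polynomials. *)
Lemma gauss_pointE : gauss_point absP = ball_point absP ns ltr01 0.
Proof.
set G := ball_point absP ns ltr01 0.
have GX c : snorm G (X c) = Num.max (abs c) 1 by rewrite snorm_ball sub0r absvalN.
have evG z : abs z <= 1 -> snorm_le (eval_point absP z) G.
  move=> z1; apply: (snorm_leP absP ns) => c; rewrite GX snorm_eval.
  apply: le_trans (umB absP ns _ _) _.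
  by rewrite ge_max !le_max lexx z1 orbT.
have eval_prod Q s z : Q = lead_coef Q *: \prod_(a <- s) (X a) ->
    (forall a, a \in s -> abs (z - a) = Num.max (abs a) 1) ->
    snorm (eval_point absP z) Q = snorm G Q.
  move=> -> Hs; rewrite -mul_polyC !snormM !snormC !(snorm_prod absP).
  by congr (_ * _); apply: eq_big_seq => a as_; rewrite GX snorm_eval Hs.
have approx P e : 0 < e -> exists2 z, abs z <= 1 & snorm G P <= abs P.[z] + e.
  move=> e0; pose d := e / 2 / ((size P)%:R + 1).
  have d0 : 0 < d by rewrite !divr_gt0.
  have [Q [DQ sQ PQ]] := poly_approx absP ns P d0.
  have [z z1 zQ] : exists2 z, abs z <= 1 & snorm (eval_point absP z) Q = snorm G Q.
    have [->|Q0] := eqVneq Q 0.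
      by exists 0; rewrite ?absval0// -polyC0 !snormC.
    have [s Ds Qs] := split_over ns DQ Q0.
    by have [z z1 zs] := generic_point Ds; exists z => //; exact: eval_prod Qs zs.
  have bnd U : snorm U 'X <= 1 -> snorm U (P - Q) <= e / 2.
    move=> UB; have sPQ : (size (P - Q)%R <= size P)%N.
      by rewrite (leq_trans (size_polyD _ _))// geq_max size_polyN leqnn sQ.
    apply: le_trans (snorm_coef_bound absP sPQ (ltW d0) _ UB (lexx 1)) _ => [i|].
      by rewrite coefB; exact: PQ.
    rewrite expr1n mulr1 [leLHS](_ : _ = e / 2 * ((size P)%:R / ((size P)%:R + 1))).
      by rewrite ler_piMr ?divr_ge0 ?(ltW e0)// ler_pdivrMr// mul1r lerDl.
    by rewrite /d; field; rewrite !gt_eqF.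
  exists z => //; rewrite -[abs P.[z]]/(snorm (eval_point absP z) P).
  have h1 : snorm G (P - Q) <= e / 2 by apply: bnd; have := GX 0; rewrite subr0 absval0// => ->; rewrite ge_max ler01 lexx.
  have h2 : snorm (eval_point absP z) (P - Q) <= e / 2 by apply: bnd; have := snorm_eval absP z 0; rewrite !subr0 => ->.
  have h3 := snormD G (P - Q) Q; rewrite subrK in h3.
  have h4 := snormD (eval_point absP z) (Q - P) P; rewrite subrK in h4.
  have h5 := snormN absP (eval_point absP z) (P - Q); rewrite opprB in h5.
  by lra.
have gG : is_gauss G.
  move=> P; set E := [set _ | _ in _].
  have Eub : ubound E (snorm G P) by move=> _ [z z1 <-]; exact: evG.
  have E0 : E !=set0 by exists (abs P.[0]), 0; rewrite /= ?absval0 ?ler01.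
  apply/le_anti/andP; split; last exact: ge_sup.
  apply/ler_addgt0Pr => e e0; have [z z1 zP] := approx P e e0.
  apply: le_trans zP _; rewrite lerD2r; apply: ub_le_sup; last by exists z.
  by exists (snorm G P).
rewrite /gauss_point; case: xgetP => [S _ gS|/(_ G)//].
by apply: snorm_inj => P; rewrite gS gG.
Qed.

End gauss.

(** * Joins, paths and Gromov products *)

Section median.
Variables (R : realType) (C : fieldType) (abs : C -> R) (D : set C).
Hypotheses (absP : is_absval abs) (ns : na_setting abs D).
Local Notation X := (fun c : C => 'X - c%:P).
Local Notation rz := (raise absP ns).
Implicit Types (S U W P Q : berkA1 abs).

Lemma meet_level_ltP P Q t : meet_level P Q < t ->
  exists c, snorm P (X c) < t /\ snorm Q (X c) < t.
Proof.
move=> h; apply: contrapT => /forallNP H; move: h; rewrite ltNge => /negP; apply.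
apply: le_meet_level => c; rewrite leNgt gt_max; apply/negP => /andP[h1 h2].
by apply: (H c).
Qed.

Lemma meet_tri P Q S : meet_level P Q <= Num.max (meet_level P S) (meet_level S Q).
Proof.
rewrite leNgt; apply/negP; rewrite gt_max => /andP[/meet_level_ltP[c [Pc Sc]] /meet_level_ltP[c' [Sc' Qc']]].
have cc : abs (c' - c) < meet_level P Q by apply: le_lt_trans (abs_snorm_lin absP ns S c' c) _; rewrite gt_max Sc Sc'.
have Qc : snorm Q (X c) < meet_level P Q by apply: le_lt_trans (snorm_lin absP ns Q c c') _; rewrite gt_max Qc' absvalC.
by have := meet_level_le P Q c; rewrite leNgt gt_max Pc Qc.
Qed.

Lemma meet_raise P Q t : meet_level (rz P t) Q = Num.max (meet_level P Q) t.
Proof.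
apply/le_anti/andP; split; last first.
  apply: le_meet_level => c; rewrite snorm_raise ge_max -maxA.
  apply/andP; split; last by rewrite !le_max lexx !orbT.
  by apply: le_trans (meet_level_le P Q c) _; rewrite ge_max !le_max !lexx !orbT.
apply/ler_addgt0Pr => e e0; have [|c [Pc Qc]] := @meet_level_ltP P Q (meet_level P Q + e).
  by rewrite ltrDl.
apply: le_trans (meet_level_le _ _ c) _; rewrite snorm_raise !ge_max.
have h : meet_level P Q + e <= Num.max (meet_level P Q) t + e by rewrite lerD2r le_max lexx.
have h2 : t <= Num.max (meet_level P Q) t + e by apply: le_trans (_ : Num.max (meet_level P Q) t <= _); rewrite ?lerDl ?(ltW e0)// le_max lexx orbT.
by rewrite h2 !(le_trans (ltW _) h).
Qed.

Lemma meet_ball r (r0 : 0 < r) a U :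
  meet_level (ball_point absP ns r0 a) U = Num.max (snorm U (X a)) r.
Proof.
apply/le_anti/andP; split.
  apply: le_trans (meet_level_le _ _ a) _; rewrite snorm_ball subrr absval0//.
  by rewrite (max_idPr (ltW r0)) maxC.
apply: le_meet_level => c; rewrite snorm_ball ge_max !le_max lexx !orbT andbT.
have := snorm_lin absP ns U a c; rewrite le_max => /orP[->|->]; rewrite ?orbT//.
Qed.

Lemma diam_ball r (r0 : 0 < r) a : diam (ball_point absP ns r0 a) = r.
Proof.
apply/le_anti/andP; split; last first.
  by apply: le_diam => c; rewrite snorm_ball le_max lexx orbT.
by apply: le_trans (diam_le _ a) _; rewrite snorm_ball subrr absval0// (max_idPr (ltW r0)).
Qed.

Lemma meet_levelxx P : meet_level P P = diam P.
Proof.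
apply/eqP; rewrite eq_le diam_le_meet andbT.
by apply: le_diam => c; have := meet_level_le P P c; rewrite maxxx.
Qed.

Lemma raise_eq_meet P Q t : rz P t = rz Q t -> meet_level P Q <= Num.max (diam P) t.
Proof.
move=> E; have := meet_levelxx (rz P t); rewrite {2}E meet_raise (meet_levelC P) meet_raise.
by rewrite diam_raise (meet_levelC Q) => <-; rewrite !le_max lexx.
Qed.

Lemma arc_segment (T : topologicalType) (g : R -> T) x y t : continuous g ->
  {in `[0, 1] &, injective g} -> g 0 = x -> g 1 = y -> t \in `[0, 1] ->
  segment R x y (g t) /\ segment R y x (g t).
Proof.
move=> cg ig g0 g1 t01; split; right.
  by exists g; split => //; exact: continuous_subspaceT.
exists (fun s => g (1 - s)); split => //.
- apply: continuous_subspaceT => s.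
  apply: (@continuous_comp _ _ _ (fun s : R => 1 - s) g); last exact: cg.
  by apply: cvgB; [exact: cvg_cst | exact: cvg_id].
- by rewrite subr0.
- by rewrite subrr.
- move=> s s' s01 s'01 /ig; rewrite !in_itv /= in s01 s'01 * => H.
  have : 1 - s = 1 - s' by apply: H; lra.
  lra.
exists (1 - t); last by congr g; ring.
by move: t01; rewrite /= !in_itv /=; lra.
Qed.

Lemma segmentxx (T : topologicalType) (x : T) : segment R x x x.
Proof. by left. Qed.

(** The explicit arc: up from P to the level where it merges with the path of Q, then down to Q. *)
Definition on_path W (p q : berkP1 abs) : Prop :=
  match p, q with
  | Some P, Some Q => exists2 t, t <= meet_level P Q & W = rz P t \/ W = rz Q t
  | Some P, None | None, Some P => exists t, W = rz P t
  | None, None => False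
  end.

Lemma raise_max P t : rz P t = rz P (Num.max (diam P) t).
Proof.
by case: (leP (diam P) t) => [//|/ltW h]; rewrite (raise_id absP ns h) raise_id.
Qed.

(** The arc is parametrized by the diameter, at constant speed L: up by a = m - diam P, then down by
    m - diam Q. Diameters distinguish points on the same branch, and [raise_eq_meet] distinguishes
    the branches below m. *)
Lemma segment_finite P Q t : t <= meet_level P Q ->
  segment R (Some P : berkP1 abs) (Some Q : berkP1 abs) (Some (rz P t)) /\
  segment R (Some Q : berkP1 abs) (Some P : berkP1 abs) (Some (rz P t)).
Proof.
move=> tm; have [PQ|PQ] := pselect (P = Q).
  subst Q; rewrite meet_levelxx in tm; rewrite raise_id//.
  by split; exact: segmentxx.
set m := meet_level P Q; pose a := m - diam P; pose L := a + (m - diam Q).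
have a0 : 0 <= a by rewrite subr_ge0 diam_le_meet.
have b0 : 0 <= m - diam Q by rewrite subr_ge0 /m meet_levelC diam_le_meet.
have L0 : 0 < L.
  rewrite lt_def addr_ge0// andbT; apply/eqP => LE; apply: PQ.
  have mP : m <= diam P by move: LE a0 b0; rewrite /L /a; lra.
  have mQ : m <= diam Q by move: LE a0 b0; rewrite /L /a; lra.
  by rewrite -(raise_id absP ns mP) -(raise_id absP ns mQ) raise_meet.
pose l1 s := Num.min (diam P + s * L) m; pose l2 s := Num.min (m + a - s * L) m.
pose g s : berkP1 abs := Some (if s * L <= a then rz P (l1 s) else rz Q (l2 s)).
have cL : continuous (fun s : R => s * L) by move=> s; apply: cvgMl; exact: cvg_id.
have cl1 : continuous l1.
  apply: continuous_min_cst => s.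
  by apply: cvgD; [exact: cvg_cst | exact: cL].
have cl2 : continuous l2.
  apply: continuous_min_cst => s.
  by apply: cvgB; [exact: cvg_cst | exact: cL].
have cg : continuous g.
  suff cg : continuous (fun s : R => if s * L <= a then rz P (l1 s) else rz Q (l2 s)).
    move=> s; have := continuous_comp (cg s) (@one_point_compactification_some_continuous (berkA1 abs) _).
    by apply.
  move=> s; apply: (berk_cvg_lin absP ns) => c.
  (* One formula valid on both branches, since l1 and l2 are capped at m and P and Q agree there;
     continuity then needs no gluing at the top. *)
  have E u : snorm (if u * L <= a then rz P (l1 u) else rz Q (l2 u)) (X c) =
      Num.max (snorm P (X c)) (l1 u) + Num.max (snorm Q (X c)) (l2 u)
      - Num.max (snorm P (X c)) m.
    have mPQ : Num.max (snorm P (X c)) m = Num.max (snorm Q (X c)) m by rewrite -!(snorm_raise absP ns) raise_meet.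
    case: leP => h; rewrite snorm_raise.
      have -> : l2 u = m by apply/min_idPr; lra.
      by rewrite mPQ; ring.
    have -> : l1 u = m by apply/min_idPr; move: h; rewrite /a; lra.
    by ring.
  rewrite E; under eq_fun do rewrite E.
  apply: cvgB; last exact: cvg_cst.
  apply: cvgD.
    by apply: cvg_max_cst; exact: cl1.
  by apply: cvg_max_cst; exact: cl2.
have dg1 s : s * L <= a -> 0 <= s -> diam (rz P (l1 s)) = diam P + s * L.
  move=> h s0; rewrite diam_raise /l1 (min_idPl _); last by move: h; rewrite /a; lra.
  by apply/max_idPr; rewrite lerDl mulr_ge0// ltW.
have sL s : s <= 1 -> s * L <= L by move=> s1; rewrite ler_piMl// ltW.
have dg2 s : a < s * L -> s <= 1 -> diam (rz Q (l2 s)) = m + a - s * L.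
  move=> h /sL s1; rewrite diam_raise /l2 (min_idPl _); last by lra.
  by apply/max_idPr; move: s1; rewrite /L; lra.
have cross s s' : 0 <= s -> s' <= 1 -> s * L <= a -> a < s' * L -> rz P (l1 s) <> rz Q (l2 s').
  move=> s0 s1 h h' E; have := congr1 (@diam _ _ _) E; rewrite dg1// dg2// => dE.
  have l1E : l1 s = diam P + s * L by apply/min_idPl; move: h; rewrite /a; lra.
  have l2E : l2 s' = m + a - s' * L by apply/min_idPl; lra.
  rewrite l1E l2E -dE in E; have := raise_eq_meet E; rewrite -/m le_max => /orP[h2|h2].
    have : 0 <= s * L by rewrite mulr_ge0// ltW.
    lra.
  by lra.
have g0 : g 0 = Some P by rewrite /g mul0r a0 /l1 mul0r addr0 (min_idPl (diam_le_meet _ _)) raise_id.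
have g1 : g 1 = Some Q.
  rewrite /g mul1r; case: leP => h; last first.
    rewrite /l2 mul1r (min_idPl _); last by move: h; lra.
    by rewrite raise_id// /L /a; lra.
  have mQ : m <= diam Q by move: h; rewrite /L; lra.
  rewrite /l1 mul1r (min_idPr _); last by move: h; rewrite /L /a; lra.
  by rewrite raise_meet raise_id.
have ig : {in `[0, 1] &, injective g}.
  move=> s s'; rewrite !in_itv /= => /andP[s0 s1] /andP[s'0 s'1] [].
  have inj : forall u : R, s * L = s' * L + 0 * u -> s = s' by move=> u; rewrite mul0r addr0 => /(mulIf (lt0r_neq0 L0)).
  case: (leP (s * L) a) => h; case: (leP (s' * L) a) => h'.
  - by move/(congr1 (@diam _ _ _)); rewrite !dg1// => E; apply: (inj 0); lra.
  - by move=> E; exfalso; exact: (cross s s' s0 s'1 h h' E).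
  - by move=> E; exfalso; exact: (cross s' s s'0 s1 h' h (esym E)).
  - by move/(congr1 (@diam _ _ _)); rewrite !dg2// => E; apply: (inj 0); lra.
pose t' := Num.max (diam P) t.
have t'm : t' <= m by rewrite ge_max diam_le_meet.
have t'd : diam P <= t' by rewrite le_max lexx.
have tg : g ((t' - diam P) / L) = Some (rz P t).
  rewrite /g divfK ?gt_eqF// lerB// /l1 divfK ?gt_eqF// addrC subrK (min_idPl t'm).
  by rewrite [in RHS]raise_max.
rewrite -tg; apply: arc_segment => //; rewrite in_itv /= divr_ge0 ?(ltW L0) ?subr_ge0//=.
by rewrite ler_pdivrMr// mul1r /L /a; lra.
Qed.

Lemma segment_infinity P t :
  segment R (Some P : berkP1 abs) (None : berkP1 abs) (Some (rz P t)) /\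
  segment R (None : berkP1 abs) (Some P : berkP1 abs) (Some (rz P t)).
Proof.
pose l s : R := diam P + ((1 - s)^-1 - 1).
pose g s : berkP1 abs := if s < 1 then Some (rz P (l s)) else None.
have l0 s : 0 <= s -> s < 1 -> diam P <= l s by move=> s0 s1; rewrite lerDl subr_ge0 invf_ge1 ?subr_gt0// lerBlDr lerDl.
have cg : continuous g.
  move=> s; have [s1|s1] := ltP s 1.
    have gE : \forall u \near s, (Some (rz P (l u)) : berkP1 abs) = g u by near=> u; rewrite /g ifT//; near: u; exact: lt_nbhsl.
    rewrite /continuous_at {2}/g s1; apply: cvg_trans (near_eq_cvg gE) _.
    apply: (@continuous_comp _ _ (berkP1 abs) (fun u => rz P (l u)) Some s); last first.
      exact: one_point_compactification_some_continuous.
    apply: (berk_cvg_lin absP ns) => c; rewrite snorm_raise.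
    under eq_fun do rewrite snorm_raise.
    apply: cvg_max_cst.
    apply: cvgD; first exact: cvg_cst.
    apply: cvgB; last exact: cvg_cst.
    apply: cvgV; first by rewrite subr_eq0 gt_eqF.
    by apply: cvgB; [exact: cvg_cst | exact: cvg_id].
  have gs : g s = None by rewrite /g ltNge s1.
  suff : g u @[u --> s] --> (None : berkP1 abs) by rewrite -gs; exact.
  apply: cvg_infinity => r.
  pose k : R := (`|r| + 2)^-1.
  have k0 : 0 < k by rewrite invr_gt0.
  near=> u; rewrite /g; case: ltP => // u1.
  have ku : 1 - k < u by near: u; apply: lt_nbhsr; lra.
  have := snorm_raise absP ns P (l u) 0; rewrite subr0 => ->.
  rewrite lt_max; apply/orP; right; rewrite /l.
  have : `|r| + 2 < (1 - u)^-1 by rewrite -[ltLHS]invrK ltf_pV2 ?posrE ?subr_gt0// -/k; lra.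
  have := ler_norm r; have := diam_ge0 P; lra.
have ig : {in `[0, 1] &, injective g}.
  move=> s s'; rewrite !in_itv /= => /andP[s0 s1] /andP[s'0 s'1]; rewrite /g.
  case: (ltP s 1) => h; case: (ltP s' 1) => h' //; last by move=> _; lra.
  case=> /(congr1 (@diam _ _ _)); rewrite !diam_raise (max_idPr (l0 _ s0 h)) (max_idPr (l0 _ s'0 h')).
  by rewrite /l => /addrI /(addIr _) /invr_inj; lra.
have g0 : g 0 = Some P by rewrite /g ltr01 /l subr0 invr1 subrr addr0 raise_id.
have g1 : g 1 = None by rewrite /g ltxx.
pose t' := Num.max (diam P) t - diam P.
have t'0 : 0 <= t' by rewrite subr_ge0 le_max lexx.
have t'1 : 0 < 1 + t' by rewrite ltr_pwDl.
have tg : g (1 - (1 + t')^-1) = Some (rz P t).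
  rewrite /g ifT; last by rewrite ltrBlDr ltrDl invr_gt0.
  rewrite [in RHS]raise_max /l; congr (Some (rz P _)).
  have -> : 1 - (1 - (1 + t')^-1) = (1 + t')^-1 by ring.
  by rewrite invrK /t'; ring.
rewrite -tg; apply: arc_segment => //; rewrite in_itv /= subr_ge0 invf_le1// lerDl t'0/=.
by rewrite lerBlDr lerDl invr_ge0 ltW.
Unshelve. all: by end_near. Qed.

Lemma on_path_segment W p q : on_path W p q -> segment R p q (Some W).
Proof.
case: p q => [P|] [Q|] //=.
- by case=> t tm [->|->]; [case: (segment_finite tm) | move: tm; rewrite meet_levelC => /segment_finite[]].
- by case=> t ->; case: (segment_infinity P t).
- by case=> t ->; case: (segment_infinity Q t).
Qed.

Section directions.
Variables (W : berkA1 abs) (b : C) (s : R).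
Hypothesis WE : forall c, snorm W (X c) = Num.max (abs (b - c)) s.
Implicit Types (d : option C) (x y p q : berkP1 abs).

(* The connected components of the complement of W: that of infinity, and
   the open balls of radius s contained in the closed ball of W. *)
Definition direction d : set (berkP1 abs) :=
  if d is Some c then [set y | if y is Some U then is_true (snorm U (X c) < s) else False]
  else [set y | if y is Some U then is_true (s < snorm U (X b)) else True].

Definition is_direction d := if d is Some c then abs (b - c) <= s else true.

Let diamW : diam W = s \/ s <= 0.
Proof.
have [s0|s0] := ltP 0 s; [left | by right].
by rewrite -(diam_ball s0 b); congr diam; apply: (snorm_lin_inj absP ns) => c; rewrite snorm_ball WE.
Qed.

Lemma direction_cover y : y <> Some W -> exists2 d, is_direction d & direction d y.
Proof.
case: y => [U|_]; last by exists None.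
move=> UW; have [h|h] := ltP s (snorm U (X b)); first by exists None.
have [c cU] : exists c, snorm U (X c) <> snorm W (X c).
  apply: contrapT => /forallNP H; apply: UW; congr Some; apply: (snorm_lin_inj absP ns) => c.
  by apply: contrapT; exact: H.
have Uc := snorm_lin absP ns U c b.
have cb := abs_snorm_lin absP ns U b c.
rewrite WE in cU; rewrite absvalC// in Uc.
have lt : snorm U (X c) < Num.max (abs (b - c)) s.
  rewrite lt_neqAle; apply/andP; split; first exact/eqP.
  apply: le_trans Uc _; rewrite ge_max !le_max lexx h !orbT //.
exists (Some c) => /=.
  rewrite leNgt; apply/negP => sc; move: lt; rewrite (max_idPl (ltW sc)) => lt.
  by move: cb; rewrite leNgt gt_max lt (le_lt_trans h sc).
case: (leP (abs (b - c)) s) lt => [//|sc lt].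
by move: cb; rewrite leNgt gt_max lt (le_lt_trans h sc).
Qed.

Lemma direction_sub d d' y : is_direction d -> is_direction d' -> direction d y ->
  direction d' y -> direction d `<=` direction d'.
Proof.
case: d d' y => [c|] [c'|] [U|] //= bc bc' h h'.
- have cc : abs (c' - c) < s by apply: le_lt_trans (abs_snorm_lin absP ns U c' c) _; rewrite gt_max h h'.
  move=> [V|]//= Vc; apply: le_lt_trans (snorm_lin absP ns V c' c) _.
  by rewrite gt_max Vc.
- exfalso; move: h'; rewrite ltNge => /negP; apply.
  apply: le_trans (snorm_lin absP ns U b c) _; rewrite ge_max (ltW h) //.
- exfalso; move: h; rewrite ltNge => /negP; apply.
  apply: le_trans (snorm_lin absP ns U b c') _; rewrite ge_max (ltW h') //.
- exact: subset_refl.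
- exact: subset_refl.
Qed.

Definition same_direction p q := exists2 d, is_direction d & direction d p /\ direction d q.

Lemma same_direction_open p : open [set q | same_direction p q].
Proof.
rewrite [X in open X](_ : _ = \bigcup_(d in [set d | is_direction d /\ direction d p]) direction d).
  apply: bigcup_open => -[c|] _.
    have := @open_lin_lt R C abs c s.
    by apply.
  exact: (@open_lin_gt R C abs D absP ns b s).
by apply/seteqP; split=> q [d]; [move=> dd [dp dq]; exists d | move=> [dd dp] dq; exists d].
Qed.

Lemma same_direction_trans p q r : same_direction p q -> same_direction q r -> same_direction p r.
Proof.
move=> [d dd [dp dq]] [d' dd' [d'q d'r]]; exists d' => //; split => //.
exact: (direction_sub dd dd' dq d'q).
Qed.

Lemma same_direction_sym p q : same_direction p q -> same_direction q p.
Proof. by move=> [d dd [dp dq]]; exists d. Qed.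

Lemma same_directionxx p : p <> Some W -> same_direction p p.
Proof. by move=> /direction_cover[d dd dp]; exists d. Qed.

(** Directions at W are open and any two that meet coincide, so a connected set avoiding W stays in
    one of them. *)
Lemma connected_same_direction (E : set (berkP1 abs)) p q : connected E -> ~ E (Some W) -> E p -> E q ->
  same_direction p q.
Proof.
move=> cE EW Ep Eq; have pW : p <> Some W by move=> h; apply: EW; rewrite -h.
pose V := [set y | same_direction p y].
pose V' := \bigcup_(y in [set y | y <> Some W /\ ~ same_direction p y]) [set z | same_direction y z].
have oV' : open V' by apply: bigcup_open => y _; exact: same_direction_open.
suff EE : E `&` V = E by move: Eq; rewrite -EE => -[].
apply: cE.
- by exists p; split => //; exact: same_directionxx.
- by exists V => //; exact: same_direction_open.
exists (~` V'); first exact: open_closedC.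
apply/seteqP; split => y [Ey] h; split => //.
  move=> [z [zW pz] zy]; apply: pz; apply: same_direction_trans h _.
  exact: same_direction_sym.
apply: contrapT => py; apply: h; exists y; last first.
  by apply: same_directionxx => yW; apply: EW; rewrite -yW.
by split => // yW; apply: EW; rewrite -yW.
Qed.

(** An injective path meets W at most once, so the part before z or the part after it avoids W. *)
Lemma segment_same_direction p q z : segment R p q z -> z <> Some W ->
  same_direction z p \/ same_direction z q.
Proof.
move=> [[<- ->] pW|[g [cg g0 g1 ig [t t01 gt]]] zW].
  by left; exact: same_directionxx.
have {t01}/andP[t0 t1] : 0 <= t <= 1 by move: t01; rewrite /= in_itv.
have conn u v : 0 <= u -> v <= 1 -> connected (g @` `[u, v]).
  move=> u0 v1; apply: connected_continuous_connected; first exact: segment_connected.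
  apply: continuous_subspaceW cg => x /=; rewrite !in_itv /= => /andP[h1 h2].
  by rewrite (le_trans u0 h1) (le_trans h2 v1).
have mem (u v x : R) : u <= x <= v -> (g @` `[u, v]) (g x) by move=> h; exists x => //=; rewrite in_itv.
have [h|h] := pselect ((g @` `[0, t]) (Some W)); last first.
  left; apply: (connected_same_direction (conn 0 t _ _) h) => //.
    by rewrite -gt; apply: mem; rewrite t0 lexx.
  by rewrite -g0; apply: mem; rewrite lexx.
right; apply: (@connected_same_direction (g @` `[t, 1])).
- exact: conn.
- move=> [u /= ut gu]; case: h => v /= vt gv.
  move: ut vt; rewrite !in_itv /= => /andP[tu u1] /andP[v0 vt].
  have uv : u = v by apply: ig; rewrite ?in_itv /= ?gu ?gv// ?u1 ?v0 ?(le_trans t0)// (le_trans vt).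
  have ut : u = t by apply/eqP; rewrite eq_le tu {1}uv vt.
  by apply: zW; rewrite -gt -ut.
- by rewrite -gt; apply: mem; rewrite t1 lexx.
- by rewrite -g1; apply: mem; rewrite t1 lexx.
Qed.

Lemma on_path_separates p q : 0 < s -> on_path W p q -> ~ same_direction p q.
Proof.
move=> s0; have dW : diam W = s by case: diamW => // h; move: s0; rewrite ltNge h.
have WI P t : W = rz P t -> ~ direction None (Some P).
  move=> WP /=; have := WE b; rewrite subrr absval0// (max_idPr (ltW s0)) => <-.
  by rewrite ltNge WP snorm_raise le_max lexx.
have lev P Q t c : t <= meet_level P Q -> W = rz P t -> snorm P (X c) < s -> snorm Q (X c) < s -> False.
  move=> tm WP Pc Qc; have : s <= meet_level P Q.
    by rewrite -dW WP diam_raise ge_max diam_le_meet.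
  by rewrite leNgt => /negP; apply; apply: le_lt_trans (meet_level_le P Q c) _; rewrite gt_max Pc.
case: p q => [P|] [Q|] //= H [d dd [dp dq]].
- case: H => t tm [WP|WQ].
    case: d dd dp dq => [c|] dd dp dq; [exact: (lev P Q t c) | exact: WI WP dp].
  case: d dd dp dq => [c|] dd dp dq; last exact: WI WQ dq.
  by apply: (lev Q P t c) => //; rewrite meet_levelC.
- by case: H => t WP; case: d dd dp dq => [c|] //= dd dp _; exact: WI WP dp.
- by case: H => t WQ; case: d dd dp dq => [c|] //= dd _ dq; exact: WI WQ dq.
Qed.

(** A point z of the three segments other than W would share its direction at W with an end of each
    segment, hence with two of x, y and [can]; but W lies on the path between any two of them and
    separates them. So the choice made by [xget] is forced. *)
Lemma medianE x y : 0 < s -> let can := Some (gauss_point absP) : berkP1 abs in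
  on_path W x y -> on_path W x can -> on_path W y can -> median absP x y = Some W.
Proof.
move=> s0 can xy xc yc; rewrite /median.
have Wm : (segment R x y `&` segment R x can `&` segment R y can) (Some W) by split; [split|]; exact: on_path_segment.
case: xgetP => [z _ [[zxy zxc] zyc]|/(_ (Some W))//].
apply: contrapT => zW.
have sep p q : on_path W p q -> same_direction z p -> ~ same_direction z q.
  move=> pq zp zq; apply: (on_path_separates s0 pq); apply: same_direction_trans zq.
  exact: same_direction_sym.
have [zx|zy] := segment_same_direction zxy zW.
  by have [/(sep _ _ xy zx)|/(sep _ _ xc zx)] := segment_same_direction zyc zW.
by have [/(sep _ _ xy)/(_ zy)|/(sep _ _ yc zy)] := segment_same_direction zxc zW.
Qed.

End directions.

Lemma raise_ball r (r0 : 0 < r) a t c :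
  snorm (rz (ball_point absP ns r0 a) t) (X c) = Num.max (abs (a - c)) (Num.max r t).
Proof. by rewrite snorm_raise snorm_ball maxA. Qed.

Local Notation can := (gauss_point absP).

(* The three joins of the points x, y and can occur at levels the largest two of
   which are equal; the median is the lowest join. *)
Lemma gromov_ball r (r0 : 0 < r) a (y : berkP1 abs) :
  let w := ball_point absP ns r0 a in
  gromov absP (Some w : berkP1 abs) y =
    (if y is Some U then ln (meet_level w can) + ln (meet_level U can) - ln (meet_level w U)
     else ln (meet_level w can))%:E.
Proof.
move=> w; set x := Some w : berkP1 abs.
have canE := gauss_pointE absP ns.
have mc U : meet_level U can = Num.max (snorm U (X 0)) 1 by rewrite meet_levelC canE meet_ball.
have mc1 U : 1 <= meet_level U can by rewrite mc le_max lexx orbT.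
have dcan : diam can = 1 by rewrite canE diam_ball.
have wcan t : 0 < t -> exists2 b, (forall c, snorm (rz w t) (X c) = Num.max (abs (b - c)) (Num.max r t))
    & 0 < Num.max r t.
  by move=> t0; exists a => [c|]; [exact: raise_ball | rewrite lt_max r0].
have final z W : median absP x z = Some W -> 0 < diam W ->
    gromov absP x z = (2 * ln (meet_level W can) - ln (diam W))%:E.
  move=> mE dW; rewrite /gromov mE asboolT; last exact: hyperbolic_diam.
  by rewrite /hyp_dist (sup_berkE absP ns) dcan ln1 subr0.
have gw m z : 0 < m -> diam w <= m -> on_path (rz w m) x z -> on_path (rz w m) x (Some can) ->
    on_path (rz w m) z (Some can) ->
    gromov absP x z = (2 * ln (Num.max (meet_level w can) m) - ln m)%:E.
  move=> m0 wm h1 h2 h3; have dm : diam (rz w m) = m by rewrite diam_raise; apply/max_idPr.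
  have [b WE sm] := wcan m m0.
  by rewrite (final z (rz w m)) ?dm// ?meet_raise//; apply: (medianE WE sm).
have wU U : 0 < meet_level w U by rewrite meet_ball lt_max r0 orbT.
case: y => [U|]; last first.
  set m := meet_level w can; have m0 : 0 < m by exact: wU.
  rewrite (gw m) ?diam_le_meet//.
  - by rewrite maxxx; congr EFin; ring.
  - by exists m.
  - by exists m => //; left.
  - by exists m; exact: raise_meet.
set mxy := meet_level w U; set mxc := meet_level w can; set myc := meet_level U can.
have t1 : mxy <= Num.max mxc myc by rewrite /myc meet_levelC; exact: meet_tri.
have t2 : mxc <= Num.max mxy myc by exact: meet_tri.
have t3 : myc <= Num.max mxy mxc by rewrite /mxy meet_levelC; exact: meet_tri.
have mxy0 : 0 < mxy by exact: wU.
have mxc0 : 0 < mxc by exact: wU.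
have [/andP[h1 h2]|[/andP[h1 h2]|/andP[h1 h2]]] :
    (mxy <= mxc) && (mxy <= myc) \/ (mxc <= mxy) && (mxc <= myc) \/ (myc <= mxy) && (myc <= mxc).
  by case: (leP mxy mxc) => p1; case: (leP mxy myc) => p2; case: (leP mxc myc) => p3;
    rewrite /= ?(ltW p1) ?(ltW p2) ?(ltW p3) //=; auto; left + right; lra.
- have E : mxc = myc by apply/eqP; rewrite eq_le; move: t2 t3; rewrite (max_idPr h1) (max_idPr h2) => -> ->.
  rewrite (gw mxy) ?diam_le_meet//.
  - by rewrite -/mxc (max_idPl h1) E; congr EFin; ring.
  - by exists mxy => //; left.
  - by exists mxy => //; left.
  - by exists mxy => //; left; exact: raise_meet.
- have E : mxy = myc by apply/eqP; rewrite eq_le; move: t1 t3; rewrite (max_idPr h2) (max_idPl h1) => -> ->.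
  rewrite (gw mxc) ?diam_le_meet//.
  - by rewrite maxxx E; congr EFin; ring.
  - by exists mxc => //; left.
  - by exists mxc => //; left.
  - by exists mxc => //; right; exact: raise_meet.
have E : mxy = mxc by apply/eqP; rewrite eq_le; move: t1 t2; rewrite (max_idPl h2) (max_idPl h1) => -> ->.
have myc1 : 1 <= myc by exact: mc1.
have dm : diam (rz can myc) = myc by rewrite diam_raise dcan; apply/max_idPr.
rewrite (final _ (rz can myc)) ?dm ?(lt_le_trans ltr01)//.
  by rewrite meet_raise meet_levelxx dcan (max_idPr myc1) E; congr EFin; ring.
apply: (@medianE _ 0 (Num.max 1 myc)).
- by move=> c; rewrite canE raise_ball.
- by rewrite lt_max ltr01.
- by exists myc => //; right; rewrite -raise_meet.
- by exists myc => //; right.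
- by exists myc => //; right.
Qed.

End median.

Definition bounded_mfun {d} {T : measurableType d} {R : realType} (f : T -> R) : Prop :=
  measurable_fun setT f /\ exists B, forall x, `|f x| <= B.

(** * Quadratic forms of bounded kernels *)

Section bounded_mfun.
Context {d : measure_display} {T : measurableType d} {R : realType}.
Implicit Types f g : T -> R.

Lemma bounded_mfun_cst (c : R) : bounded_mfun (cst c : T -> R).
Proof. by split; [exact: measurable_cst | exists `|c|]. Qed.

Lemma bounded_mfunD f g : bounded_mfun f -> bounded_mfun g ->
  bounded_mfun (fun x => f x + g x).
Proof.
move=> [mf [B fB]] [mg [B' gB]]; split; first exact: measurable_funD.
by exists (B + B') => x; apply: le_trans (ler_normD _ _) _; exact: lerD.
Qed.

Lemma bounded_mfunM f g : bounded_mfun f -> bounded_mfun g ->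
  bounded_mfun (fun x => f x * g x).
Proof.
move=> [mf [B fB]] [mg [B' gB]]; split; first exact: measurable_funM.
by exists (B * B') => x; rewrite normrM ler_pM.
Qed.

Lemma bounded_mfunZ c f : bounded_mfun f -> bounded_mfun (fun x => c * f x).
Proof. exact: bounded_mfunM (bounded_mfun_cst c). Qed.

Lemma bounded_mfunB f g : bounded_mfun f -> bounded_mfun g ->
  bounded_mfun (fun x => f x - g x).
Proof.
move=> bf /(bounded_mfunZ (-1)) bg; have := bounded_mfunD bf bg.
by under eq_fun do rewrite mulN1r.
Qed.

Lemma bounded_mfun_sum (I : Type) (r : seq I) (f : I -> T -> R) :
  (forall i, bounded_mfun (f i)) -> bounded_mfun (fun x => \sum_(i <- r) f i x).
Proof.
move=> bf; elim: r => [|i r IH].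
  by under eq_fun do rewrite big_nil; exact: bounded_mfun_cst.
by under eq_fun do rewrite big_cons; exact: bounded_mfunD.
Qed.

Lemma bounded_mfun_indic (E : set T) : measurable E -> bounded_mfun (\1_E : T -> R).
Proof.
move=> mE; split; first exact: measurable_indic.
by exists 1 => x; rewrite indicE ger0_norm ?ler0n//; case: (_ \in _).
Qed.

Section integral.
Variable m : {finite_measure set T -> \bar R}.

Lemma bounded_mfun_integrable f : bounded_mfun f -> m.-integrable setT (EFin \o f).
Proof. by move=> [mf [B fB]]; exact: bounded_integrable mf fB. Qed.

Lemma bm_integralD f g : bounded_mfun f -> bounded_mfun g ->
  \int[m]_x (f x + g x) = \int[m]_x f x + \int[m]_x g x.
Proof. by move=> bf bg; rewrite RintegralD//; exact: bounded_mfun_integrable. Qed.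

Lemma bm_integralZ c f : bounded_mfun f -> \int[m]_x (c * f x) = c * \int[m]_x f x.
Proof. by move=> bf; rewrite RintegralZl//; exact: bounded_mfun_integrable. Qed.

Hypothesis m1 : m setT = 1%E.

Lemma bm_integral_cst (c : R) : \int[m]_x c = c.
Proof. by rewrite Rintegral_cst// [X in c * fine X](_ : _ = 1%E) ?mulr1//; exact: m1. Qed.

Lemma bm_integral_le f c : bounded_mfun f -> (forall x, f x <= c) -> \int[m]_x f x <= c.
Proof.
move=> bf fc; rewrite -[leRHS]bm_integral_cst; apply: le_Rintegral => //.
- exact: bounded_mfun_integrable.
- by have := bounded_mfun_integrable (bounded_mfun_cst c).
Qed.

Lemma bm_integral_norm f e : bounded_mfun f -> (forall x, `|f x| <= e) ->
  `|\int[m]_x f x| <= e.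
Proof.
move=> bf fe; have Nf := bounded_mfunZ (-1) bf; rewrite ler_norml; apply/andP; split.
  rewrite -lerN2 opprK -mulN1r -bm_integralZ//; apply: bm_integral_le => // x.
  by rewrite mulN1r; apply: le_trans (ler_norm _) _; rewrite normrN.
by apply: bm_integral_le => // x; exact: le_trans (ler_norm _) _.
Qed.

End integral.
End bounded_mfun.

Section quadratic_form.
Context {d : measure_display} {T : measurableType d} {R : realType} {A : choiceType}.
Variables (pt : A -> T) (rho : probability T R) (F : {fset A}).
Hypothesis F0 : F != fset0.
Let n : R := (#|` F|)%:R.
Implicit Types (f g : T -> R) (H : T -> T -> R).

Let n_gt0 : 0 < n. Proof. by rewrite ltr0n cardfs_gt0. Qed.
Let n_neq0 : n != 0. Proof. by rewrite gt_eqF. Qed.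
Let rho1 : rho setT = 1%E. Proof. exact: probability_setT. Qed.
Let rr : probability (T * T)%type R := (rho \x rho)%E.
Let rr1 : rr setT = 1%E.
Proof.
exact: probability_setT.
Qed.

Definition deviation f := n^-1 * (\sum_(a <- F) f (pt a)) - \int[rho]_y f y.

(* The value of the quadratic form of the kernel H at the signed measure [F] - rho. *)
Definition quad H :=
  n^-1 * n^-1 * (\sum_(a <- F) \sum_(b <- F) H (pt a) (pt b))
  - 2 * (n^-1 * \sum_(a <- F) \int[rho]_y H (pt a) y)
  + \int[(rho \x rho)%E]_p H p.1 p.2.

Definition bounded_kernel H := bounded_mfun (fun p : T * T => H p.1 p.2).

Lemma bounded_kernel_slice H x : bounded_kernel H -> bounded_mfun (H x).
Proof.
move=> [mH [B HB]]; split; last by exists B => y; exact: (HB (x, y)).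
exact: (measurableT_comp mH (measurable_pair1 x)).
Qed.

Lemma deviationD f g : bounded_mfun f -> bounded_mfun g ->
  deviation (fun x => f x + g x) = deviation f + deviation g.
Proof. by move=> bf bg; rewrite /deviation bm_integralD// big_split/= mulrDr; ring. Qed.

Lemma deviationZ c f : bounded_mfun f -> deviation (fun x => c * f x) = c * deviation f.
Proof. by move=> bf; rewrite /deviation bm_integralZ// -mulr_sumr; ring. Qed.

Lemma avg_cst (c : R) : n^-1 * (\sum_(a <- F) c) = c.
Proof. by rewrite big_const_seq count_predT iter_addr_0 -mulr_natr mulrCA mulVf// mulr1. Qed.

Lemma deviation_cst (c : R) : deviation (cst c) = 0.
Proof. by rewrite /deviation avg_cst bm_integral_cst// subrr. Qed.

Lemma deviation_sum (I : Type) (r : seq I) (f : I -> T -> R) :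
  (forall i, bounded_mfun (f i)) ->
  deviation (fun x => \sum_(i <- r) f i x) = \sum_(i <- r) deviation (f i).
Proof.
move=> bf; elim: r => [|i r IH].
  by rewrite big_nil -[RHS](deviation_cst 0); congr deviation; apply/funext => x; rewrite big_nil.
rewrite big_cons -IH -deviationD//; last exact: bounded_mfun_sum.
by congr deviation; apply/funext => x; rewrite big_cons.
Qed.

Lemma avg_norm (f : A -> R) e : (forall a, `|f a| <= e) ->
  `|n^-1 * (\sum_(a <- F) f a)| <= e.
Proof.
move=> fe; rewrite normrM ger0_norm ?invr_ge0 ?(ltW n_gt0)//.
rewrite -[leRHS]avg_cst ler_wpM2l ?invr_ge0 ?(ltW n_gt0)//.
by apply: le_trans (ler_norm_sum _ _ _) _; apply: ler_sum.
Qed.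

Lemma deviation_norm f e : bounded_mfun f -> (forall x, `|f x| <= e) ->
  `|deviation f| <= 2 * e.
Proof.
move=> bf fe; apply: le_trans (ler_normB _ _) _; rewrite mulr_natl mulr2n.
by apply: lerD; [exact: avg_norm | exact: bm_integral_norm].
Qed.

Lemma quadD H H' : bounded_kernel H -> bounded_kernel H' ->
  quad (fun x y => H x y + H' x y) = quad H + quad H'.
Proof.
move=> bH bH'; rewrite /quad (bm_integralD rr bH bH').
under eq_bigr do rewrite big_split/=.
have E a : \int[rho]_y (H (pt a) y + H' (pt a) y) =
    \int[rho]_y H (pt a) y + \int[rho]_y H' (pt a) y.
  by rewrite bm_integralD//; exact: bounded_kernel_slice.
under [X in _ - 2 * (_ * X)]eq_bigr do rewrite E.
by rewrite !big_split/=; ring.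
Qed.

Lemma quadZ c H : bounded_kernel H -> quad (fun x y => c * H x y) = c * quad H.
Proof.
move=> bH; rewrite /quad (bm_integralZ rr c bH).
under eq_bigr do rewrite -mulr_sumr.
have E a : \int[rho]_y (c * H (pt a) y) = c * \int[rho]_y H (pt a) y by rewrite bm_integralZ//; exact: bounded_kernel_slice.
under [X in _ - 2 * (_ * X)]eq_bigr do rewrite E.
by rewrite -!mulr_sumr; ring.
Qed.

Lemma quad0 : quad (fun _ _ => 0) = 0.
Proof.
rewrite /quad (@bm_integral_cst _ _ _ rr rr1) (@bm_integral_cst _ _ _ rho rho1).
by rewrite !big1_eq !mulr0 subrr addr0.
Qed.

Lemma quadB H H' : bounded_kernel H -> bounded_kernel H' ->
  quad (fun x y => H x y - H' x y) = quad H - quad H'.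
Proof.
move=> bH bH'; have bN := bounded_mfunZ (-1) bH'.
rewrite -[in RHS](mulN1r (quad H')) -quadZ// -quadD//.
by congr quad; apply/funext => x; apply/funext => y; rewrite mulN1r.
Qed.

Lemma bounded_kernel_sum (I : Type) (r : seq I) (H : I -> T -> T -> R) :
  (forall i, bounded_kernel (H i)) -> bounded_kernel (fun x y => \sum_(i <- r) H i x y).
Proof. exact: bounded_mfun_sum. Qed.

Lemma quad_sum (I : Type) (r : seq I) (H : I -> T -> T -> R) :
  (forall i, bounded_kernel (H i)) ->
  quad (fun x y => \sum_(i <- r) H i x y) = \sum_(i <- r) quad (H i).
Proof.
move=> bH; elim: r => [|i r IH].
  rewrite big_nil -[RHS]quad0; congr quad.
  by apply/funext => x; apply/funext => y; rewrite big_nil.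
rewrite big_cons -IH -quadD//; last exact: bounded_kernel_sum.
by congr quad; apply/funext => x; apply/funext => y; rewrite big_cons.
Qed.

(** The factor 4 is the square of the mass 2 of [F] + rho. *)
Lemma quad_norm H e : bounded_kernel H -> (forall x y, `|H x y| <= e) -> `|quad H| <= 4 * e.
Proof.
move=> bH He; have h1 : `|n^-1 * n^-1 *
    (\sum_(a <- F) \sum_(b <- F) H (pt a) (pt b))| <= e.
  rewrite -mulrA mulr_sumr; apply: (avg_norm (f := fun a => _)) => a.
  exact: (avg_norm (f := fun b => _)).
have h2 : `|n^-1 * \sum_(a <- F) \int[rho]_y H (pt a) y| <= e.
  apply: (avg_norm (f := fun a => _)) => a.
  by apply: bm_integral_norm => //; exact: bounded_kernel_slice.
have h3 : `|\int[(rho \x rho)%E]_p H p.1 p.2| <= e by exact: (bm_integral_norm rr1 bH (fun p => He p.1 p.2)).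
rewrite /quad; move: (_ * (\sum_(a <- _) _)) (_ * (\sum_(a <- _) _)) (\int[_]_p _) h1 h2 h3.
by move=> u v w; rewrite !ler_norml => /andP[? ?] /andP[? ?] /andP[? ?]; apply/andP; split; lra.
Qed.

(** The source of all positivity: the Green kernels are compared with sums of such rank one kernels
    with nonnegative coefficients. *)
Lemma quad_tensor f : bounded_mfun f -> quad (fun x y => f x * f y) = deviation f ^+ 2.
Proof.
move=> bf; have bff : bounded_kernel (fun x y => f x * f y).
  have [mf [B fB]] := bf; split; last by exists (B * B) => p; rewrite normrM ler_pM.
  by apply: measurable_funM; [exact: (measurableT_comp mf measurable_fst) |
    exact: (measurableT_comp mf measurable_snd)].
have E a : \int[rho]_y (f (pt a) * f y) = f (pt a) * \int[rho]_y f y by rewrite bm_integralZ.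
have FF : \int[(rho \x rho)%E]_p (f p.1 * f p.2) = (\int[rho]_y f y) ^+ 2.
  rewrite /Rintegral -fubini1/=; last first.
    exact: (bounded_mfun_integrable rr bff).
  have Ex x : (\int[rho]_y (f x * f y)%:E = (f x * \int[rho]_y f y)%:E)%E.
    rewrite -bm_integralZ// /Rintegral fineK//; apply: integrable_fin_num => //.
    exact: (bounded_mfun_integrable rho (bounded_mfunZ (f x) bf)).
  rewrite [X in fine X = _](_ : _ = (\int[rho]_x (f x * \int[rho]_y f y)%:E)%E); last first.
    by apply: eq_integral => x _; exact: Ex.
  rewrite -[LHS]/(\int[rho]_x (f x * \int[rho]_y f y)).
  under eq_Rintegral do rewrite mulrC.
  by rewrite bm_integralZ// -expr2.
rewrite /quad FF /deviation; under eq_bigr do rewrite -mulr_sumr.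
under [X in _ - 2 * (_ * X)]eq_bigr do rewrite E.
rewrite -!mulr_suml.
by rewrite expr2; ring.
Qed.

End quadratic_form.

Lemma continuous_measurable_borel (R : realType) (X : ptopologicalType) (f : X -> R) :
  continuous f -> measurable_fun setT (f : borel X -> R).
Proof.
move=> cf; apply: (measurability _ (RGenInftyO.measurableE R)) => // _ [_ [u ->] <-].
rewrite setTI; apply: sub_sigma_algebra.
apply: (@open_comp _ _ f [set x : R | x < u]) => [x _|]; [exact: cf | exact: open_lt].
Qed.

Lemma continuous_bounded_mfun (R : realType) (X : ptopologicalType) (f : X -> R) :
  compact [set: X] -> continuous f -> bounded_mfun (f : borel X -> R).
Proof.
move=> cX cf; split; first exact: continuous_measurable_borel.
by have [B _ fB] := continuous_bounded cX cf; exists B.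
Qed.

(** * Test functions controlled by the discrepancy *)

Section testable.
Context {d : measure_display} {T : measurableType d} {R : realType} {A : choiceType}.
Variables (pt : A -> T) (rho : probability T R) (G : nat -> T -> T -> R).
Local Notation testable := (testable pt rho G).

(** From (u + v)^2 <= 2 u^2 + 2 v^2 with u^2 <= C D + eta/4 and |v| <= 2 e, the choice e = min(1,
    eta/16) leaves 2 C D + eta/2 + 8 e^2 <= 2 C D + eta. *)
Lemma testable_approx (phi : T -> R) : bounded_mfun (phi : T -> R) ->
  (forall e, 0 < e -> exists psi, [/\ bounded_mfun (psi : T -> R), testable psi &
    forall x, `|phi x - psi x| <= e]) -> testable phi.
Proof.
move=> bphi H eta eta0; pose e := Num.min 1 (eta / 16).
have e0 : 0 < e by rewrite lt_min ltr01 divr_gt0.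
have [psi [bpsi tpsi close]] := H e e0.
have e2 : 0 < eta / 4 by rewrite divr_gt0.
have [k0 [C C0 CH]] := tpsi _ e2.
exists k0, (2 * C); first by rewrite mulr_ge0.
move=> k F kk F0; have {}CH := CH k F kk F0.
have bd : bounded_mfun (fun x => phi x - psi x) by exact: bounded_mfunB.
have := deviation_norm pt rho F0 bd close.
have E : deviation pt rho F phi = deviation pt rho F psi + deviation pt rho F (fun x => phi x - psi x).
  rewrite -deviationD//; congr (deviation _ _ _); apply/funext => x.
  by rewrite addrC subrK.
rewrite -/(deviation pt rho F phi) E; rewrite -/(deviation pt rho F psi) in CH.
move: CH; set D := discrepancy _ _ _ _ _; set u := deviation _ _ _ (psi : T -> R).
set v := deviation _ _ _ _ => CH vd.
have v2 : v ^+ 2 <= (2 * e) ^+ 2 by rewrite -[leLHS]real_normK ?num_real// lerXn2r ?nnegrE ?mulr_ge0 ?(ltW e0).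
have ee : e * e <= eta / 16.
  apply: le_trans (_ : 1 * e <= _); first by rewrite ler_wpM2r ?(ltW e0)// ge_min lexx.
  by rewrite mul1r ge_min lexx orbT.
have := sqr_ge0 (u - v); rewrite !expr2 in v2 CH *; nra.
Qed.

Lemma testableD (phi psi : T -> R) : bounded_mfun (phi : T -> R) ->
  bounded_mfun (psi : T -> R) -> testable phi -> testable psi -> testable (phi \+ psi).
Proof.
move=> bphi bpsi tphi tpsi eta eta0; have e4 : 0 < eta / 4 by rewrite divr_gt0.
have [k1 [C1 C10 H1]] := tphi _ e4; have [k2 [C2 C20 H2]] := tpsi _ e4.
exists (maxn k1 k2), (2 * (C1 + C2)); first by rewrite mulr_ge0// addr_ge0.
move=> k F; rewrite geq_max => /andP[kk1 kk2] F0.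
have {}H1 := H1 k F kk1 F0; have {}H2 := H2 k F kk2 F0.
rewrite -/(deviation pt rho F (phi \+ psi)) deviationD//.
rewrite -/(deviation pt rho F phi) in H1; rewrite -/(deviation pt rho F psi) in H2.
move: H1 H2; set D := discrepancy _ _ _ _ _; set u := deviation _ _ _ (phi : T -> R).
set v := deviation _ _ _ (psi : T -> R) => H1 H2.
have := sqr_ge0 (u - v); rewrite !expr2 in H1 H2 *; nra.
Qed.

Lemma testableZ c (phi : T -> R) : bounded_mfun phi -> testable phi ->
  testable (fun x => c * phi x).
Proof.
move=> bphi tphi eta eta0; have c0 : 0 < c ^+ 2 + 1 by rewrite ltr_wpDl ?sqr_ge0.
have [k0 [C C0 H]] := tphi _ (divr_gt0 eta0 c0).
exists k0, (c ^+ 2 * C); first by rewrite mulr_ge0 ?sqr_ge0.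
move=> k F kk F0; have {}H := H k F kk F0.
rewrite -/(deviation pt rho F (fun x => c * phi x)) deviationZ// exprMn.
apply: le_trans (ler_wpM2l (sqr_ge0 c) H) _; rewrite mulrDr mulrA lerD2l.
by rewrite mulrCA ler_piMr ?(ltW eta0)// ler_pdivrMr// mul1r lerDl.
Qed.

Lemma testable_quad (phi : T -> R) k0 C : 0 <= C ->
  (forall k F, (k0 <= k)%N -> F != fset0 -> deviation pt rho F phi ^+ 2 <= C * discrepancy pt rho G k F) ->
  testable phi.
Proof.
by move=> C0 H eta eta0; exists k0, C => // k F kk F0; rewrite ler_wpDr ?(ltW eta0) ?H.
Qed.

End testable.

(** Layer-cake sum: the steps below t add up to t within h, up to the cap M h. For t = G k x y each
    step is the indicator of a chordal ball. *)
Lemma staircase_bound (R : realDomainType) (h t : R) M : 0 <= h -> 0 <= t ->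
  Num.min t (M%:R * h) <= \sum_(j < M) h * (j%:R * h < t)%R%:R <= Num.min (t + h) (M%:R * h).
Proof.
move=> h0 t0; elim: M => [|M IH].
  by rewrite big_ord0 mul0r !ge_min !le_min lexx orbT addr_ge0.
rewrite big_ord_recr /=; move: IH; set S := \sum_(j < M) _ => /andP[].
have E : M.+1%:R * h = M%:R * h + h by rewrite -natr1 mulrDl mul1r.
rewrite E ge_min !le_min => S1 /andP[S2 S3]; rewrite ge_min.
case: (ltP (M%:R * h) t) S1 => Mt S1.
  rewrite mulr1 !lerD2r S3 (le_trans S3 (ltW Mt)) !andbT.
  have MS : M%:R * h <= S by move: S1 => /orP[S1|//]; exact: le_trans (ltW Mt) S1.
  by rewrite MS orbT.
rewrite mulr0 addr0 S2 (le_trans S3) ?lerDl// !andbT.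
by move: S1 => /orP[->//|MS]; rewrite (le_trans Mt MS).
Qed.

(** The increments of V telescope up to the last step below t. The equality in the case M h <= t
    carries the induction. *)
Lemma staircase_lipschitz (R : realDomainType) (h t L : R) (V : R -> R) M : 0 <= h -> 0 <= t ->
  (forall s u, 0 <= s -> 0 <= u -> `|V s - V u| <= L * `|s - u|) -> 0 <= L ->
  (t <= M%:R * h ->
    `|V t - (V 0 + \sum_(j < M) (V (j.+1%:R * h) - V (j%:R * h)) * (j%:R * h < t)%R%:R)| <= L * h)
  /\ (M%:R * h <= t ->
    V (M%:R * h) = V 0 + \sum_(j < M) (V (j.+1%:R * h) - V (j%:R * h)) * (j%:R * h < t)%R%:R).
Proof.
move=> h0 t0 VL L0; elim: M => [|M [IH1 IH2]].
  rewrite mul0r big_ord0 addr0; split=> // t0'.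
  have -> : t = 0 by apply/eqP; rewrite eq_le t0' t0.
  by rewrite subrr normr0 mulr_ge0.
have E : M.+1%:R * h = M%:R * h + h by rewrite -natr1 mulrDl mul1r.
have Mh0 : 0 <= M%:R * h by rewrite mulr_ge0.
rewrite big_ord_recr /= addrA.
case: (ltP (M%:R * h) t) => Mt.
  rewrite mulr1 -IH2 ?(ltW Mt)// addrC subrK; split=> // tM.
  apply: le_trans (VL _ _ _ _) _ => //; first by rewrite E addr_ge0.
  rewrite ler_wpM2l// distrC ger0_norm ?subr_ge0// E; lra.
rewrite mulr0 addr0; split=> [_|]; first exact: IH1.
move=> Mt'; have {}h0 : h = 0 by apply/eqP; rewrite eq_le h0 andbT; move: Mt'; rewrite E; lra.
by rewrite -IH2 h0 ?mulr0//; move: Mt'; rewrite E h0; lra.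
Qed.

Lemma sum_sqr_le (R : realFieldType) M (x : nat -> R) :
  (\sum_(j < M) x j) ^+ 2 <= M%:R * \sum_(j < M) x j ^+ 2.
Proof.
elim: M => [|M IH]; first by rewrite !big_ord0 expr0n mulr0.
rewrite !big_ord_recr /=; move: IH; set S := \sum_(j < M) x j; set Q := \sum_(j < M) _.
have Q0 : 0 <= Q by apply: sumr_ge0 => j _; exact: sqr_ge0.
case: M @S @Q Q0 => [|M] S Q Q0 IH.
  by rewrite /S /Q !big_ord0 !add0r mul1r.
rewrite -natr1; have : 0 < M.+1%:R :> R by rewrite ltr0n.
move: (x M.+1) (M.+1%:R : R) IH => y m IH m0.
rewrite -(ler_pM2l m0); have := sqr_ge0 (S - m * y); rewrite !expr2 in IH *; nra.
Qed.

(** * Green kernels of ultrametrics *)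

Lemma measurable_lt_set {d} {T : measurableType d} {R : realType} (f : T -> R) u :
  measurable_fun setT f -> measurable [set x | f x < u].
Proof.
move=> mf; have := mf measurableT _ (measurable_itv `]-oo, u[); rewrite setTI.
by congr measurable; apply/seteqP; split=> x /=; rewrite in_itv.
Qed.

(* The chordal distance of a nonarchimedean projective line; pt lists its
   classical points, and dl x x need not vanish at the other points. *)
Record ultrametric_kernel (R : realType) (X : ptopologicalType) (A : choiceType) (pt : A -> X)
    (dl : X -> X -> R) : Prop := UltrametricKernel {
  uk_bound : forall x y, 0 <= dl x y <= 1;
  uk_sym : forall x y, dl x y = dl y x;
  uk_tri : forall x y z, dl x y <= Num.max (dl x z) (dl z y);
  uk_pt : forall a y, dl (pt a) y = 0 <-> y = pt a;
  uk_inj : injective pt;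
  uk_dense : exists s : nat -> A, forall x y u, dl x y < u ->
    exists i, dl x (pt (s i)) < u /\ dl (pt (s i)) y < u;
  uk_cont : forall a, continuous (dl (pt a));
  uk_sep : forall x y, x <> y -> exists a, dl (pt a) x <> dl (pt a) y }.

Section ultrametric.
Variables (R : realType) (X : ptopologicalType) (A : choiceType) (pt : A -> X) (dl : X -> X -> R).
Hypotheses (X_compact : compact [set: X]) (uk : ultrametric_kernel pt dl).
Variables (rho : probability (borel X) R) (g : X -> R) (c : R).
Let T : measurableType _ := borel X.
Local Notation eps k := (expR (- (k : nat)%:R) : R).
(** In the application w is the point of a disc about a: truncating dl (pt a) at e^(-k) amounts to
    moving to a hyperbolic point, where the Laplacian equation gives the potential of rho. *)
Hypotheses (g_cont : continuous g)
  (pot : forall a k, exists w, (forall y, dl w y = Num.max (dl (pt a) y) (eps k)) /\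
    \int[rho]_y (- ln (dl w y)) = c - g w).

Definition log_kernel_trunc k (x y : X) : R := - ln (Num.max (dl x y) (eps k)).
Local Notation G := log_kernel_trunc.

Let dl_ge0 x y : 0 <= dl x y. Proof. by case/andP: (uk_bound uk x y). Qed.
Let dl_le1 x y : dl x y <= 1. Proof. by case/andP: (uk_bound uk x y). Qed.
Let dl_same a : dl (pt a) (pt a) = 0. Proof. exact/(uk_pt uk). Qed.
Let pt' : A -> T := pt.

Let mdl a : measurable_fun setT (dl (pt a) : T -> R).
Proof. exact: (@continuous_measurable_borel R X _ (@uk_cont _ _ _ _ _ uk a)). Qed.

Let max_gt0 k x y : 0 < Num.max (dl x y) (eps k).
Proof. by rewrite lt_max expR_gt0 orbT. Qed.

(** The sigma-algebra is the product of the Borel ones, so continuity on the product space would not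
    be enough. The dense sequence and the ultrametric inequality write the sublevel sets as
    countable unions of measurable rectangles. *)
Lemma measurable_ultrametric : measurable_fun setT (fun p : T * T => dl p.1 p.2).
Proof.
have [s sP] := uk_dense uk.
apply: (measurability _ (RGenInftyO.measurableE R)) => // _ [_ [u ->] <-]; rewrite setTI.
rewrite [X in measurable X](_ : _ = \bigcup_i
  ([set p : T * T | dl (pt (s i)) p.1 < u] `&` [set p : T * T | dl (pt (s i)) p.2 < u])).
  apply: bigcupT_measurable => i; apply: measurableI.
    apply: (@measurable_lt_set _ _ _ (fun p : T * T => dl (pt (s i)) p.1)).
    exact: (measurableT_comp (mdl (s i)) measurable_fst).
  apply: (@measurable_lt_set _ _ _ (fun p : T * T => dl (pt (s i)) p.2)).
  exact: (measurableT_comp (mdl (s i)) measurable_snd).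
apply/seteqP; split=> -[x y] /=; rewrite ?in_itv /=.
  by move=> /sP[i [h1 h2]]; exists i => //; split => //=; rewrite (uk_sym uk).
by move=> [i _ [/= h1 h2]]; apply: le_lt_trans (uk_tri uk x y (pt (s i))) _;
  rewrite gt_max (uk_sym uk) h1.
Qed.

Lemma log_kernel_trunc_bound k x y : 0 <= G k x y <= k%:R.
Proof.
rewrite /G oppr_ge0 ln_le0/=; last first.
  by rewrite ge_max dl_le1 -[leRHS]expR0 ler_expR oppr_le0 ler0n.
by rewrite lerNl -[leLHS]expRK ler_ln ?posrE ?expR_gt0// le_max lexx orbT.
Qed.

Let G_ge0 k x y : 0 <= G k x y. Proof. by case/andP: (log_kernel_trunc_bound k x y). Qed.

Lemma log_kernel_trunc_nd x y k l : (k <= l)%N -> G k x y <= G l x y.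
Proof.
move=> kl; rewrite /G lerN2 ler_ln ?posrE// ge_max !le_max lexx /=.
by rewrite ler_expR lerN2 ler_nat kl orbT.
Qed.

Lemma bounded_log_kernel_trunc k : bounded_kernel (T := T) (G k).
Proof.
split; last by exists k%:R => p; rewrite ger0_norm//; case/andP: (log_kernel_trunc_bound k p.1 p.2).
apply: measurableT_comp => //; apply: measurableT_comp; first exact: measurable_ln.
by apply: measurable_maxr => //; exact: measurable_ultrametric.
Qed.

Lemma log_kernel_trunc_lt k t x y : 0 <= t -> t < k%:R ->
  (t < G k x y) = (dl x y < expR (- t)).
Proof.
move=> t0 tk; rewrite /G ltrNr -[ltRHS]expRK ltr_ln ?posrE ?expR_gt0//.
by rewrite gt_max ltr_expR ltrN2 tk andbT.
Qed.

Definition layer (u : R) (x y : X) : R := (dl x y < u)%R%:R.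

Let layer_set u : measurable [set p : T * T | dl p.1 p.2 < u].
Proof.
exact: (measurable_lt_set u measurable_ultrametric).
Qed.

Let layerE u x y : layer u x y = \1_[set p : T * T | dl p.1 p.2 < u] (x, y).
Proof. by rewrite indicE /layer mem_setE. Qed.

Lemma bounded_layer u : bounded_kernel (T := T) (layer u).
Proof.
have := bounded_mfun_indic (layer_set u) (R := R).
by congr bounded_mfun; apply/funext => -[x y]; rewrite layerE.
Qed.

Let ball u a : set T := [set y | dl (pt a) y < u].

Let mball u a : measurable (ball u a).
Proof.
exact: (measurable_lt_set u (mdl a)).
Qed.

Lemma bounded_ball u a : bounded_mfun (T := T) (layer u (pt a)).
Proof.
have := bounded_mfun_indic (mball u a) (R := R).
by congr bounded_mfun; apply/funext => y; rewrite indicE /layer mem_setE.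
Qed.

Section deviation.
Variable F : {fset A}.
Hypothesis F0 : F != fset0.
Local Notation dev := (deviation pt' rho F).
Local Notation qd := (quad pt' rho F).

Let covered u (s : seq A) (x : X) := has (fun a => dl (pt a) x < u) s.
Let part u s x y : R := layer u x y * (covered u s x)%:R.

Let layer_trans u x y z : dl x y < u -> (dl z x < u) = (dl z y < u).
Proof.
move=> xy; apply/idP/idP => h.
  by apply: le_lt_trans (uk_tri uk _ _ x) _; rewrite gt_max h.
by apply: le_lt_trans (uk_tri uk _ _ y) _; rewrite gt_max h /= (uk_sym uk).
Qed.

Let bounded_part u s : bounded_kernel (T := T) (part u s).
Proof.
apply: (bounded_mfunM (bounded_layer u)).
rewrite [X in bounded_mfun X](_ : _ =
  (\1_(\big[setU/set0]_(a <- s) (ball u a `*` setT)) : T * T -> R)); last first.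
  apply/funext => -[x y] /=; rewrite indicE; congr (_%:R); congr nat_of_bool.
  elim: s => [|a s IH]; first by rewrite big_nil in_set0.
  rewrite big_cons in_setU -IH /covered /=; congr (_ || _).
  by apply/idP/idP; [move=> h; apply/mem_set; split | move/set_mem => -[]].
apply: bounded_mfun_indic; elim: s => [|a s IH]; first by rewrite big_nil.
by rewrite big_cons; apply: measurableU => //; apply: measurableX => //; exact: mball.
Qed.

(* The relation dl x y < u is an equivalence on its domain, and its part above
   finitely many classes E is the sum of the kernels 1_E(x) 1_E(y). *)
Let part_cons u a s : part u (a :: s) =
  fun x y => part u s x y + (~~ covered u s (pt a))%:R * (layer u (pt a) x * layer u (pt a) y).
Proof.
apply/funext => x; apply/funext => y; rewrite /part /layer /covered /=.
have [xy|xy] := boolP (dl x y < u); last first.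
  rewrite !mul0r add0r.
  have [ax|] := boolP (dl (pt a) x < u); rewrite ?mul0r ?mulr0//.
  have [ay|] := boolP (dl (pt a) y < u); rewrite ?mul0r ?mulr0//.
  case/negP: xy; apply: le_lt_trans (uk_tri uk _ _ (pt a)) _.
  by rewrite gt_max ay (uk_sym uk) ax.
rewrite !mul1r -(layer_trans (pt a) xy).
have [ax|] := boolP (dl (pt a) x < u); rewrite ?mul0r ?mulr0 ?addr0//= ?mul1r ?mulr1.
have -> : has (fun a0 => dl (pt a0) x < u) s = has (fun a0 => dl (pt a0) (pt a) < u) s by apply: eq_has => b; rewrite (layer_trans (pt b) ax).
by case: has; rewrite ?addr0 ?add0r.
Qed.

Let quad_part_cons u a s : qd (part u (a :: s)) =
  qd (part u s) + (~~ covered u s (pt a))%:R * dev (layer u (pt a)) ^+ 2.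
Proof.
have bb : bounded_kernel (T := T) (fun x y => layer u (pt a) x * layer u (pt a) y).
  have [mb [B Bb]] := bounded_ball u a; split.
    by apply: measurable_funM; [exact: (measurableT_comp mb measurable_fst) |
      exact: (measurableT_comp mb measurable_snd)].
  by exists (B * B) => p; rewrite normrM ler_pM.
rewrite part_cons (quadD pt' rho F (bounded_part u s) (bounded_mfunZ _ bb)).
by rewrite (quadZ pt' rho F _ bb) quad_tensor//; exact: bounded_ball.
Qed.

(** Above the classes met by F and b, the kernel is a sum of rank one kernels, and its form a sum of
    squares containing that of b. The remainder is nonnegative and vanishes on F, so only its
    integral against rho x rho is left, which is nonnegative. *)
Lemma quad_layer u b : 0 < u -> dev (layer u (pt b)) ^+ 2 <= qd (layer u).
Proof.
move=> u0; pose s := enum_fset F ++ [:: b].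
have sP : dev (layer u (pt b)) ^+ 2 <= qd (part u s).
  rewrite /s; elim: (enum_fset F) => [|a t IH] /=; rewrite quad_part_cons.
    rewrite /covered /= mul1r lerDr.
    have -> : part u [::] = fun _ _ => 0 by apply/funext => x; apply/funext => y; rewrite /part mulr0.
    by rewrite quad0.
  by apply: le_trans IH _; rewrite lerDl mulr_ge0// sqr_ge0.
apply: le_trans sP _; rewrite -subr_ge0 -(quadB pt' rho F (bounded_layer u) (bounded_part u s)).
have pos x y : 0 <= layer u x y - part u s x y by rewrite /part -[X in X - _]mulr1 -mulrBr mulr_ge0 ?ler0n// subr_ge0; case: covered; rewrite ?ler01.
have van a y : a \in F -> layer u (pt a) y - part u s (pt a) y = 0.
  move=> aF; rewrite /part; have -> : covered u s (pt a).
    by apply/hasP; exists a; rewrite ?mem_cat ?aF// dl_same.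
  by rewrite mulr1 subrr.
rewrite /quad.
have -> : \sum_(a <- F) \int[rho]_y (layer u (pt' a) y - part u s (pt' a) y) = 0.
  rewrite big_seq big1// => a aF; under eq_Rintegral do rewrite van//.
  exact: (@bm_integral_cst _ _ _ rho (probability_setT rho)).
have -> : \sum_(a <- F) \sum_(b0 <- F) (layer u (pt' a) (pt' b0) - part u s (pt' a) (pt' b0)) = 0 by rewrite big_seq big1// => a aF; rewrite big1// => b0 _; rewrite van.
by rewrite !mulr0 subr0 add0r; apply: Rintegral_ge0 => p _.
Qed.

Section staircase.
Variable N : nat.
Let h : R := N.+1%:R^-1.
Let h0 : 0 < h. Proof. by rewrite invr_gt0 ltr0n. Qed.

Let stair k x y := \sum_(j < k * N.+1) h * layer (expR (- (j%:R * h))) x y.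

Let kN k : (k * N.+1)%:R * h = k%:R.
Proof. by rewrite natrM -mulrA divff ?mulr1// pnatr_eq0. Qed.

Let jh k (j : 'I_(k * N.+1)) : 0 <= j%:R * h < k%:R.
Proof.
by rewrite mulr_ge0 ?(ltW h0)//= -(kN k) ltr_pM2r// ltr_nat.
Qed.

Let stairE k x y : stair k x y = \sum_(j < k * N.+1) h * (j%:R * h < G k x y)%R%:R.
Proof.
by apply: eq_bigr => j _; have /andP[j0 jk] := jh j; rewrite log_kernel_trunc_lt.
Qed.

Let bounded_stair k : bounded_kernel (T := T) (stair k).
Proof. by apply: bounded_kernel_sum => j; apply: bounded_mfunZ; exact: bounded_layer. Qed.

Let quad_stair k : qd (stair k) = \sum_(j < k * N.+1) h * qd (layer (expR (- (j%:R * h)))).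
Proof.
rewrite quad_sum//; last by move=> j; apply: bounded_mfunZ; exact: bounded_layer.
by apply: eq_bigr => j _; rewrite quadZ//; exact: bounded_layer.
Qed.

Let quad_layer_ge0 u : 0 < u -> 0 <= qd (layer u).
Proof.
move=> u0; have /fset0Pn[a _] := F0.
by apply: le_trans (quad_layer a u0); exact: sqr_ge0.
Qed.

Lemma quad_layers_le k0 k : (k0 <= k)%N ->
  \sum_(j < k0 * N.+1) h * qd (layer (expR (- (j%:R * h)))) <= qd (G k) + 4 * h.
Proof.
move=> kk; apply: le_trans (_ : qd (stair k) <= _).
  rewrite quad_stair -(big_mkord xpredT (fun j => h * qd (layer (expR (- (j%:R * h)))))).
  rewrite -(big_mkord xpredT (fun j => h * qd (layer (expR (- (j%:R * h)))))).
  rewrite (@big_cat_nat _ _ _ (k0 * N.+1)%N 0%N (k * N.+1)%N) ?leq_mul2r ?kk ?orbT//= lerDl.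
  by apply: sumr_ge0 => j _; rewrite mulr_ge0 ?(ltW h0)// quad_layer_ge0// expR_gt0.
rewrite -lerBlDl -quadB//; last exact: bounded_log_kernel_trunc.
apply: le_trans (ler_norm _) (quad_norm pt' rho F0 _ _).
  exact: (bounded_mfunB (bounded_stair k) (bounded_log_kernel_trunc k)).
move=> x y; have := staircase_bound (k * N.+1) (ltW h0) (G_ge0 k x y).
rewrite -stairE kN; have /andP[_ Gk] := log_kernel_trunc_bound k x y.
rewrite (min_idPl Gk) le_min => /andP[h1 /andP[h2 _]].
by rewrite ler_norml; apply/andP; split; lra.
Qed.

(** V is replaced by a staircase of indicators of balls about a, whose deviations are bounded by
    [quad_layer]. Increments are at most L h, so Cauchy-Schwarz over the k0 / h layers costs only k0
    L^2, independently of h, which can then tend to 0. *)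
Lemma deviation_radial k0 k L (V : R -> R) a : (k0 <= k)%N -> 0 <= L ->
  (forall s u, 0 <= s -> 0 <= u -> `|V s - V u| <= L * `|s - u|) ->
  bounded_mfun (T := T) (fun y => V (G k0 (pt a) y)) ->
  dev (fun y => V (G k0 (pt a) y)) ^+ 2 <=
    2 * k0%:R * L ^+ 2 * (qd (G k) + 4 * h) + 8 * (L * h) ^+ 2.
Proof.
move=> kk L0 VL bV.
pose dV j := V (j.+1%:R * h) - V (j%:R * h).
pose f j : X -> R := fun y => dV j * layer (expR (- (j%:R * h))) (pt a) y.
have bf j : bounded_mfun (T := T) (f j) by apply: bounded_mfunZ; exact: bounded_ball.
pose S y := \sum_(j < k0 * N.+1) f j y.
have bS : bounded_mfun (T := T) S by apply: bounded_mfun_sum => j; exact: bf.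
have bVS : bounded_mfun (T := T) (fun y => V 0 + S y).
  exact: (bounded_mfunD (bounded_mfun_cst (V 0)) bS).
have close y : `|V (G k0 (pt a) y) - (V 0 + S y)| <= L * h.
  have [H _] := staircase_lipschitz (k0 * N.+1) (ltW h0) (G_ge0 k0 (pt a) y) VL L0.
  have {}H := H _; rewrite kN in H; have /andP[_ Gk] := log_kernel_trunc_bound k0 (pt a) y.
  rewrite [X in V 0 + X](_ : _ = \sum_(j < k0 * N.+1)
    (V (j.+1%:R * h) - V (j%:R * h)) * (j%:R * h < G k0 (pt a) y)%R%:R); first exact: H.
  by apply: eq_bigr => j _; have /andP[j0 jk] := jh j; rewrite log_kernel_trunc_lt.
have bD : bounded_mfun (T := T) (fun y => V (G k0 (pt a) y) - (V 0 + S y)).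
  exact: bounded_mfunB.
have E : dev (fun y => V (G k0 (pt a) y)) =
    dev S + dev (fun y => V (G k0 (pt a) y) - (V 0 + S y)).
  transitivity (dev (fun y => (V 0 + S y) + (V (G k0 (pt a) y) - (V 0 + S y)))).
    by congr (deviation _ _ _); apply/funext => y; rewrite addrC subrK.
  rewrite (deviationD pt' rho F bVS bD); congr (_ + _).
  by rewrite (deviationD pt' rho F (bounded_mfun_cst (V 0)) bS) deviation_cst// add0r.
have d2 := deviation_norm pt' rho F0 bD close.
have dS : dev S = \sum_(j < k0 * N.+1) dV j * dev (layer (expR (- (j%:R * h))) (pt a)).
  rewrite [LHS](deviation_sum pt' rho F0 _ (fun j : 'I_(k0 * N.+1) => bf j)).
  by apply: eq_bigr => j _; rewrite deviationZ//; exact: bounded_ball.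
have dS2 : dev S ^+ 2 <= k0%:R * L ^+ 2 * (qd (G k) + 4 * h).
  rewrite dS; apply: le_trans (sum_sqr_le _ (fun j => dV j * dev (layer (expR (- (j%:R * h))) (pt a)))) _.
  apply: le_trans (_ : (k0 * N.+1)%:R * \sum_(j < k0 * N.+1)
      (L ^+ 2 * h) * (h * qd (layer (expR (- (j%:R * h))))) <= _).
    rewrite ler_wpM2l// ; apply: ler_sum => j _.
    rewrite exprMn [leRHS](_ : _ = (L * h) ^+ 2 * qd (layer (expR (- (j%:R * h))))); last by ring.
    apply: ler_pM; rewrite ?sqr_ge0//; last by apply: quad_layer; exact: expR_gt0.
    rewrite -[leLHS]real_normK ?num_real// lerXn2r ?nnegrE ?mulr_ge0 ?(ltW h0)//.
    apply: le_trans (VL _ _ _ _) _; rewrite ?mulr_ge0 ?(ltW h0)//.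
    by rewrite -mulrBl -natr1 addrAC subrr add0r mul1r ger0_norm ?(ltW h0).
  rewrite -mulr_sumr mulrCA mulrA [X in X * _](_ : _ = k0%:R * L ^+ 2); last first.
    by rewrite -(kN k0); ring.
  by rewrite ler_wpM2l ?mulr_ge0 ?sqr_ge0// quad_layers_le.
rewrite E; move: d2 dS2; set u := dev S; set v := dev _ => d2 dS2.
have v2 : v ^+ 2 <= (2 * (L * h)) ^+ 2 by rewrite -[leLHS]real_normK ?num_real// lerXn2r ?nnegrE ?mulr_ge0 ?(ltW h0).
have := sqr_ge0 (u - v); rewrite !expr2 in v2 dS2 *; nra.
Qed.

End staircase.

Lemma quad_log_kernel_ge0 k : 0 <= qd (G k).
Proof.
apply/ler_addgt0Pr => e e0; pose N := Num.bound (4 / e).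
(* With k0 = 0 no layer is left and the inequality reads 0 <= qd (G k) + 4 h. *)
have := @quad_layers_le N 0 k (leq0n _); rewrite mul0n big_ord0 => H.
apply: le_trans H _; rewrite lerD2l ler_pdivrMr ?ltr0n//.
rewrite -ler_pdivrMl// mulrC; apply: le_trans (ltW (archi_boundP _)) _.
  by rewrite divr_ge0// ltW.
by rewrite ler_nat.
Qed.

End deviation.

Local Notation testable := (testable pt' rho G).

(* Functions of dl (pt a) which do not vary near pt a. *)
Definition radial_profile (U : R -> R) := exists d L, [/\ 0 < d <= 1, 0 <= L,
  forall s, 0 <= s <= 1 -> U s = U (Num.max s d) &
  forall s t, 0 <= s <= 1 -> 0 <= t <= 1 -> `|U s - U t| <= L * `|s - t|].

Inductive radial_sum : (X -> R) -> Prop :=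
| radial_sum_single a U : radial_profile U -> radial_sum (fun y => U (dl (pt a) y))
| radial_sum_add f f' : radial_sum f -> radial_sum f' -> radial_sum (f \+ f').

Let z01 : 0 <= (0 : R) <= 1. Proof. by rewrite lexx ler01. Qed.

Let max01 (s m : R) : 0 <= s <= 1 -> 0 <= m <= 1 -> 0 <= Num.max s m <= 1.
Proof. by move=> /andP[s0 s1] /andP[m0 m1]; rewrite le_max s0 ge_max s1. Qed.

Let max_lipschitz (s t m : R) : `|Num.max s m - Num.max t m| <= `|s - t|.
Proof.
wlog st : s t / s <= t => [H|].
  by have [/H->//|/ltW/H] := leP s t; rewrite distrC (distrC t) => ->.
have h : Num.max s m <= Num.max t m by rewrite ge_max !le_max st lexx orbT.
rewrite distrC (distrC s) !ger0_norm ?subr_ge0//.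
have [td|td] := leP t m; first by rewrite (max_idPr (le_trans st td)) subrr subr_ge0.
by rewrite lerB// le_max lexx.
Qed.

Let eps_small (d : R) : 0 < d -> exists k0, forall k, (k0 <= k)%N -> eps k <= d.
Proof.
move=> d0; exists (Num.bound (- ln d)) => k kk; rewrite -[leRHS]lnK ?posrE// ler_expR lerNl.
apply: le_trans (_ : (Num.bound (- ln d))%:R <= _); last by rewrite ler_nat.
have [l0|/ltW l0] := leP 0 (- ln d); first exact: ltW (archi_boundP l0).
exact: le_trans l0 (ler0n _ _).
Qed.

Let profile_below (U : R -> R) (d d' : R) : (forall s, 0 <= s <= 1 -> U s = U (Num.max s d)) ->
  0 <= d' -> d' <= d -> d <= 1 -> forall s, 0 <= s <= 1 -> U s = U (Num.max s d').
Proof.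
move=> Ud d'0 dd d1 s s01; rewrite Ud// [RHS]Ud; first by rewrite -maxA (max_idPr dd).
by rewrite max01// d'0 (le_trans dd).
Qed.

Let profile_bound U : radial_profile U -> exists B, forall s, 0 <= s <= 1 -> `|U s| <= B.
Proof.
move=> [d [L [_ L0 _ UL]]]; exists (`|U 0| + L) => s s01.
rewrite -[U s](subrK (U 0)) addrC; apply: le_trans (ler_normD _ _) _; rewrite lerD2l.
apply: le_trans (UL _ _ s01 z01) _; rewrite subr0; have /andP[s0 s1] := s01.
by rewrite ger0_norm// ler_piMr.
Qed.

Let profile_cst r : radial_profile (cst r).
Proof. by exists 1, 0; split; rewrite ?ltr01 ?lexx// => u v _ _; rewrite subrr normr0 mul0r. Qed.

Lemma radial_sum_continuous f : radial_sum f -> continuous f.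
Proof.
elim=> [a U rU|f1 f2 _ c1 _ c2] x; last by apply: continuousD; [exact: c1 | exact: c2].
have [_ [L [_ L0 _ UL]]] := rU.
apply/cvgrPdist_lt => e e0; have d0 : 0 < e / (L + 1) by rewrite divr_gt0// ltr_wpDl.
have /cvgrPdist_lt /(_ _ d0) := @uk_cont _ _ _ _ _ uk a x.
apply: filterS => y h; apply: le_lt_trans (UL _ _ (uk_bound uk _ _) (uk_bound uk _ _)) _.
apply: le_lt_trans (_ : (L + 1) * `|dl (pt a) x - dl (pt a) y| < _).
  by rewrite ler_wpM2r// lerDl.
by rewrite mulrC -ltr_pdivlMr// ltr_wpDl.
Qed.

Lemma radial_sum_cst r : radial_sum (cst r).
Proof. by have [s _] := uk_dense uk; apply: (@radial_sum_single (s 0%N) (cst r)); exact: profile_cst. Qed.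

Lemma radial_profileM U V : radial_profile U -> radial_profile V ->
  radial_profile (fun t => U t * V t).
Proof.
move=> rU rV; have [B UB] := profile_bound rU; have [B' VB] := profile_bound rV.
have B0 : 0 <= B by exact: le_trans (normr_ge0 _) (UB _ z01).
have B'0 : 0 <= B' by exact: le_trans (normr_ge0 _) (VB _ z01).
move: rU rV => [d [L [/andP[d0 d1] L0 Ud UL]]] [d' [L' [/andP[d'0 d'1] L'0 Vd VL]]].
exists (Num.min d d'), (B * L' + L * B'); split.
- by rewrite lt_min d0 d'0 ge_min d1.
- by rewrite addr_ge0// mulr_ge0.
- have m0 : 0 <= Num.min d d' by rewrite le_min !ltW.
  by move=> s s01; congr (_ * _); [apply: profile_below Ud _ _ _ _ _ | apply: profile_below Vd _ _ _ _ _];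
    rewrite // ge_min lexx ?orbT.
move=> s t s01 t01.
have -> : U s * V s - U t * V t = U s * (V s - V t) + (U s - U t) * V t by ring.
apply: le_trans (ler_normD _ _) _; rewrite !normrM.
rewrite [leRHS](_ : _ = B * (L' * `|s - t|) + (L * `|s - t|) * B'); last by ring.
by apply: lerD; apply: ler_pM => //; [exact: UB | exact: VL | exact: UL | exact: VB].
Qed.

Let profileD U V : radial_profile U -> radial_profile V -> radial_profile (fun t => U t + V t).
Proof.
move=> [d [L [/andP[d0 d1] L0 Ud UL]]] [d' [L' [/andP[d'0 d'1] L'0 Vd VL]]].
exists (Num.min d d'), (L + L'); split; first by rewrite lt_min d0 d'0 ge_min d1.
- exact: addr_ge0.
- have m0 : 0 <= Num.min d d' by rewrite le_min !ltW.
  by move=> s s01; congr (_ + _); [apply: profile_below Ud _ _ _ _ _ | apply: profile_below Vd _ _ _ _ _];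
    rewrite // ge_min lexx ?orbT.
move=> s t s01 t01; rewrite opprD addrACA; apply: le_trans (ler_normD _ _) _.
by rewrite mulrDl lerD// ?UL ?VL.
Qed.

Let profile_max U m : 0 <= m <= 1 -> radial_profile U -> radial_profile (fun t => U (Num.max t m)).
Proof.
move=> m01 [d [L [d01 L0 Ud UL]]]; exists d, L; split=> // [s s01|s t s01 t01].
  by rewrite Ud ?max01// maxAC.
apply: le_trans (UL _ _ (max01 s01 m01) (max01 t01 m01)) _.
by rewrite ler_wpM2l// max_lipschitz.
Qed.

(* Of the three numbers dl a y, dl b y, dl a b the largest two are equal. *)
Lemma radial_productE a b (U V : R -> R) y : let m := dl (pt a) (pt b) in
  let p := dl (pt a) y in let q := dl (pt b) y in
  U p * V q = (U (Num.max p m) * V (Num.max p m) + (U p - U (Num.max p m)) * V m)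
    + U m * (V q - V (Num.max q m)).
Proof.
move=> m p q; have h1 : p <= Num.max m q by exact: (uk_tri uk).
have h2 : q <= Num.max m p by rewrite /m (uk_sym uk (pt a)); exact: (uk_tri uk).
have h3 : m <= Num.max p q by rewrite /q (uk_sym uk (pt b)); exact: (uk_tri uk).
have [pm|mp] := ltP p m.
  have E : q = m.
    apply/eqP; rewrite eq_le; move: h2 h3; rewrite (max_idPl (ltW pm)) => ->.
    by rewrite le_max leNgt pm.
  by rewrite E maxxx; ring.
have [qm|mq] := ltP q m.
  have E : p = m by apply/eqP; rewrite eq_le mp andbT; move: h1; rewrite (max_idPl (ltW qm)).
  by rewrite E; ring.
have E : p = q.
  by apply/eqP; rewrite eq_le; move: h1 h2; rewrite (max_idPr mq) (max_idPr mp) => -> ->.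
by rewrite E; ring.
Qed.

Lemma radial_sumM f f' : radial_sum f -> radial_sum f' -> radial_sum (f \* f').
Proof.
have single a b U V : radial_profile U -> radial_profile V ->
    radial_sum (fun y => U (dl (pt a) y) * V (dl (pt b) y)).
  move=> rU rV; set m := dl (pt a) (pt b).
  have m01 : 0 <= m <= 1 by exact: (uk_bound uk).
  have sub W : radial_profile W -> radial_profile (fun t => W t - W (Num.max t m)).
    move=> rW; have := profileD rW (radial_profileM (profile_cst (-1)) (profile_max m01 rW)).
    by congr radial_profile; apply/funext => t; rewrite mulN1r.
  have r1 : radial_profile (fun t => U (Num.max t m) * V (Num.max t m) +
      (U t - U (Num.max t m)) * V m).
    apply: profileD; first by apply: radial_profileM; exact: profile_max.
    by apply: radial_profileM; [exact: sub | exact: profile_cst].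
  have r2 : radial_profile (fun t => U m * (V t - V (Num.max t m))) by apply: radial_profileM; [exact: profile_cst | exact: sub].
  have := radial_sum_add (radial_sum_single a r1) (radial_sum_single b r2).
  by congr radial_sum; apply/funext => y; rewrite /= (radial_productE a b U V).
move=> rf; elim: rf f' => [a U rU|f1 f2 _ IH1 _ IH2] f'; last first.
  move=> rf'; have := radial_sum_add (IH1 _ rf') (IH2 _ rf').
  by congr radial_sum; apply/funext => y /=; rewrite mulrDl.
elim=> [b V rV|f1 f2 _ IH1 _ IH2]; first exact: single.
have := radial_sum_add IH1 IH2.
by congr radial_sum; apply/funext => y /=; rewrite mulrDr.
Qed.

Lemma radial_sum_approx f e : continuous f -> 0 < e ->
  exists2 f', radial_sum f' & forall x, `|f x - f' x| <= e.
Proof.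
move=> cf e0; apply: (stone_weierstrass X_compact (A := radial_sum)) => //.
- exact: radial_sum_continuous.
- exact: radial_sum_cst.
- exact: radial_sum_add.
- exact: radial_sumM.
(* Truncating from below at the midpoint d of the two distances keeps the values at x and y apart
   and makes the profile constant near pt a. *)
move=> x y /(uk_sep uk)[a axy]; pose d := (dl (pt a) x + dl (pt a) y) / 2.
have x0 := dl_ge0 (pt a) x; have y0 := dl_ge0 (pt a) y.
exists (fun z => Num.max (dl (pt a) z) d).
  apply: (@radial_sum_single a (fun t => Num.max t d)); exists d, 1; split=> // [|s _|s t _ _].
  - have x1 := dl_le1 (pt a) x; have y1 := dl_le1 (pt a) y; apply/andP; split; last by rewrite /d; lra.
    by rewrite divr_gt0// lt_def addr_ge0// andbT; apply/eqP => h; apply: axy; lra.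
  - by rewrite -maxA maxxx.
  - by rewrite mul1r max_lipschitz.
by move=> /=; rewrite /Num.max; case: ifP => h1; case: ifP => h2; apply/eqP; move: axy h1 h2 => /eqP;
  rewrite neq_lt /d => /orP[] ? ? ?; lra.
Qed.

(** As U is constant on [0, d], a truncation at e^(-k0) <= d is invisible to it: the function
    factors through [G k0], with the profile V t = U (e^(-t)), Lipschitz because e^(-t) is so for t
    >= 0. *)
Lemma radial_sum_testable f : radial_sum f -> testable f.
Proof.
elim=> [a U rU|f1 f2 r1 t1 r2 t2]; last first.
  apply: testableD => //; apply: continuous_bounded_mfun => //;
    exact: radial_sum_continuous.
have bU : bounded_mfun (T := T) (fun y => U (dl (pt a) y)).
  apply: continuous_bounded_mfun => //; apply: radial_sum_continuous.
  exact: radial_sum_single.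
have [d [L [/andP[d0 d1] L0 Ud UL]]] := rU.
pose V t := U (expR (- t)).
have e01 (t : R) : 0 <= t -> 0 <= expR (- t) <= 1 by move=> t0; rewrite expR_ge0 -[leRHS]expR0 ler_expR oppr_le0.
have VL s u : 0 <= s -> 0 <= u -> `|V s - V u| <= L * `|s - u|.
  move=> s0 u0; apply: le_trans (UL _ _ (e01 _ s0) (e01 _ u0)) _; rewrite ler_wpM2l//.
  wlog su : s u s0 u0 / s <= u => [H|].
    by have [/H->//|/ltW/H] := leP s u; rewrite distrC (distrC u) => ->.
  have es : expR (- u) <= expR (- s) by rewrite ler_expR lerN2.
  rewrite ger0_norm ?subr_ge0// distrC ger0_norm ?subr_ge0//.
  have E : expR (- u) = expR (- s) * expR (s - u) by rewrite -expRD; congr expR; ring.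
  have := expR_ge1Dx (s - u); have /andP[p0 p1] := e01 s s0; rewrite E; nra.
have [k0 k0d] := eps_small d0.
have phiE y : U (dl (pt a) y) = V (G k0 (pt a) y).
  rewrite /V /G opprK lnK ?posrE//.
  by apply: (profile_below Ud) => //; [exact: (k0d k0) | exact: (uk_bound uk)].
have bV : bounded_mfun (T := T) (fun y => V (G k0 (pt a) y)).
  by move: bU; congr bounded_mfun; apply/funext => y; rewrite phiE.
move=> eta eta0; pose C := 2 * k0%:R * L ^+ 2.
have C0 : 0 <= C by rewrite !mulr_ge0// sqr_ge0.
exists k0, C => // k F kk F0.
pose N := Num.bound ((4 * C + 8 * L ^+ 2) / eta).
have num0 : 0 <= 4 * C + 8 * L ^+ 2 by rewrite addr_ge0// mulr_ge0// sqr_ge0.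
have := deviation_radial F0 N kk L0 VL bV.
rewrite [X in deviation _ _ _ X](_ : _ = (fun y => U (dl (pt a) y))); last first.
  by apply/funext => y; rewrite phiE.
rewrite -/C => H; apply: le_trans H _.
rewrite mulrDr -addrA lerD2l; set h := _^-1.
have h0 : 0 < h by rewrite invr_gt0 ltr0n.
have h1 : h <= 1 by rewrite invf_le1 ?ler1n// ltr0n.
have hN : (4 * C + 8 * L ^+ 2) * h <= eta.
  rewrite ler_pdivrMr ?ltr0n// -ler_pdivrMl// [leLHS]mulrC.
  apply: le_trans (ltW (archi_boundP _)) _; first by rewrite divr_ge0// ltW.
  by rewrite ler_nat.
rewrite exprMn (expr2 h); nra.
Qed.

Lemma ultrametric_testable f : continuous f -> testable f.
Proof.
move=> cf; apply: testable_approx => [|e e0]; first exact: continuous_bounded_mfun.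
have [f' rf' close] := radial_sum_approx cf e0.
exists f'; split => //; last exact: radial_sum_testable.
by apply: continuous_bounded_mfun => //; exact: radial_sum_continuous.
Qed.

Let potentialE a k : exists2 w, (forall y, dl w y = Num.max (dl (pt a) y) (eps k)) &
  \int[rho]_y G k (pt a) y = c - g w.
Proof.
have [w [wP wI]] := pot a k; exists w => //; rewrite -wI.
by apply: eq_Rintegral => y _; rewrite /G wP.
Qed.

(** The potentials are c - g w with w the disc point of level k. A sum of radial functions
    approximates g; it sees w only through max(dl (pt b) (pt a), e^(-k)), and its profiles do not
    vary below some d, so it is constant in k once e^(-k) <= d, uniformly in a. *)
Let potential_gap e : 0 < e -> exists k0, forall a k l, (k0 <= k)%N -> (k <= l)%N ->
  \int[rho]_y G l (pt a) y - \int[rho]_y G k (pt a) y <= e.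
Proof.
move=> e0; have e2 : 0 < e / 2 by rewrite divr_gt0.
have [f rf close] := radial_sum_approx g_cont e2.
have [k0 k0P] : exists k0, forall a k l w w', (k0 <= k)%N -> (k0 <= l)%N ->
    (forall y, dl w y = Num.max (dl (pt a) y) (eps k)) ->
    (forall y, dl w' y = Num.max (dl (pt a) y) (eps l)) -> f w = f w'.
  elim: rf {close} => [b U [d [L [/andP[d0 _] _ Ud _]]]|f1 f2 _ [k1 H1] _ [k2 H2]]; last first.
    exists (maxn k1 k2) => a k l w w'; rewrite !geq_max => /andP[kk1 kk2] /andP[ll1 ll2] wP w'P /=.
    by congr (_ + _); [exact: (H1 a k l) | exact: (H2 a k l)].
  have [k0 k0d] := eps_small d0; exists k0 => a k l w w' kk ll wP w'P.
  rewrite Ud ?(uk_bound uk)// [RHS]Ud ?(uk_bound uk)// (uk_sym uk _ w) (uk_sym uk _ w') wP w'P -!maxA.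
  by rewrite !(max_idPr (k0d _ _)).
exists k0 => a k l kk kl.
have [w wP ->] := potentialE a k; have [w' w'P ->] := potentialE a l.
have fE := k0P a k l w w' kk (leq_trans kk kl) wP w'P.
move: (close w) (close w'); rewrite fE !ler_norml => /andP[? ?] /andP[? ?]; lra.
Qed.

Let err k : R := sup [set x | exists a l, (k <= l)%N /\
  x = \int[rho]_y G l (pt a) y - \int[rho]_y G k (pt a) y].

Lemma ultrametric_green : exists err K, green_kernel pt' rho dl G (fun k => k%:R) err K.
Proof.
have [B B0 gB] := continuous_bounded X_compact g_cont.
have gap a k l : \int[rho]_y G l (pt a) y - \int[rho]_y G k (pt a) y <= 2 * B.
  have [w wP ->] := potentialE a k; have [w' w'P ->] := potentialE a l.
  move: (gB w) (gB w'); rewrite !ler_norml => /andP[? ?] /andP[? ?]; lra.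
have [s sP] := uk_dense uk.
exists err, (`|c| + B + ln 2); split.
- exact: measurable_ultrametric.
- exact: (uk_bound uk).
- exact: (uk_sym uk).
- exact: (uk_pt uk).
- exact: (uk_inj uk).
- by move=> k; have [] := bounded_log_kernel_trunc k.
- exact: log_kernel_trunc_bound.
- exact: log_kernel_trunc_nd.
- move=> x y xy; have d0 : 0 < dl x y by rewrite lt_def xy dl_ge0.
  apply: (@cvg_near_cst _ R^o) => //.
  have [k0 k0d] := eps_small d0; exists k0 => // k /= kk; rewrite /G; congr (- ln _); apply/max_idPl.
  exact: k0d.
- move=> x y xy b; exists (Num.bound `|b|).
  rewrite /G xy (max_idPr (expR_ge0 _)) expRK opprK.
  by apply: le_trans (ler_norm b) (ltW (archi_boundP _)).
(* [gk_K] concerns every x, while the potential is known at classical points: a classical point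
   within u of x changes the truncated distances by a factor at most 2, whence ln 2. *)
- move=> k x; pose u := 2 * Num.max (dl x x) (eps k).
  have m0 := max_gt0 k x x.
  have xu : dl x x < u by apply: le_lt_trans (_ : Num.max (dl x x) (eps k) < _); rewrite ?le_max ?lexx// /u; lra.
  have [i [xi _]] := sP _ _ _ xu.
  have xx y : dl x x <= dl x y by apply: le_trans (uk_tri uk x x y) _; rewrite (uk_sym uk y) maxxx.
  have le y : G k x y <= G k (pt (s i)) y + ln 2.
    rewrite /G lerNl opprD opprK lerBlDr -lnM ?posrE// ler_ln ?posrE ?mulr_gt0//.
    have mxy : Num.max (dl x x) (eps k) <= Num.max (dl x y) (eps k) by rewrite ge_max !le_max xx lexx orbT.
    have p0 := max_gt0 k x y.
    rewrite mulrC ge_max; apply/andP; split; last first.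
      have : eps k <= Num.max (dl x y) (eps k) by rewrite le_max lexx orbT.
      by move: p0; lra.
    apply: le_trans (uk_tri uk _ _ x) _; rewrite ge_max (uk_sym uk _ x); apply/andP; split.
      by apply: le_trans (ltW xi) _; rewrite /u; lra.
    have : dl x y <= Num.max (dl x y) (eps k) by rewrite le_max lexx.
    by move: p0; lra.
  have b1 := bounded_kernel_slice x (bounded_log_kernel_trunc k).
  have b2 := bounded_kernel_slice (T := T) (pt (s i)) (bounded_log_kernel_trunc k).
  have b3 := bounded_mfunD b2 (bounded_mfun_cst (ln 2)).
  apply: le_trans (_ : \int[rho]_y (G k (pt (s i)) y + ln 2) <= _).
    by apply: le_Rintegral => //; exact: bounded_mfun_integrable.
  rewrite (bm_integralD rho b2 (bounded_mfun_cst (ln 2))) (@bm_integral_cst _ _ _ rho (probability_setT rho)).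
  rewrite lerD2r; have [w _ ->] := potentialE (s i) k.
  have := ler_norm c; move: (gB w); rewrite ler_norml => /andP[? ?]; lra.
- move=> a k l kl; rewrite -lerBlDl; apply: ub_le_sup; last by exists a, l.
  by exists (2 * B) => _ [b [j [_ ->]]]; exact: gap.
apply/cvgrPdist_le => e e0; have [k0 k0P] := potential_gap e0.
exists k0 => // k /= kk; rewrite sub0r normrN ger0_norm.
  apply: ge_sup; last by move=> _ [b [j [kj ->]]]; exact: k0P.
  by exists 0, (s 0%N), k; rewrite subrr.
apply: ub_le_sup; first by exists (2 * B) => _ [b [j [_ ->]]]; exact: gap.
by exists (s 0%N), k; rewrite subrr.
Qed.

Lemma ultrametric_discrepancy_ge0 k F : F != fset0 -> 0 <= discrepancy pt' rho G k F.
Proof. by move=> F0; exact: quad_log_kernel_ge0. Qed.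

End ultrametric.

(** * The chordal distance at a nonarchimedean place *)

(** The Jordan parts of m1 - m2 need not be m1 and m2, but p + m2 = q + m1 as positive measures, and
    the integrals are compared through this equality. *)
Lemma charge_integral_measure_diff {d} {T : measurableType d} {R : realType}
    (m1 m2 : {finite_measure set T -> \bar R}) (f : T -> R) : bounded_mfun f ->
  charge_integral (measure_diff m1 m2) (EFin \o f) = (\int[m1]_x f x - \int[m2]_x f x)%:E.
Proof.
move=> bf; set nu := measure_diff m1 m2.
have int (m : {finite_measure set T -> \bar R}) := bounded_mfun_integrable m bf.
have fin (m : {finite_measure set T -> \bar R}) A : measurable A -> exists r, m A = r%:E by move=> mA; exists (fine (m A)); rewrite fineK// fin_num_measure.
have addE A : measurable A ->
    measure_add (pos_part nu) m2 A = measure_add (neg_part nu) m1 A.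
  move=> mA; suff : (pos_part nu A + m2 A = neg_part nu A + m1 A)%E by rewrite !measure_addE.
  have : (m1 A - m2 A = pos_part nu A + (-1)%:E * neg_part nu A)%E.
    exact: (jordan_decomp (hahnP nu) mA).
  have [p ->] := fin (pos_part nu) A mA; have [q ->] := fin (neg_part nu) A mA.
  have [r ->] := fin m1 A mA; have [t ->] := fin m2 A mA.
  by move=> [E]; congr EFin; lra.
have : (\int[pos_part nu]_x (f x)%:E + \int[m2]_x (f x)%:E =
        \int[neg_part nu]_x (f x)%:E + \int[m1]_x (f x)%:E)%E.
  rewrite -!(integral_measure_add measurableT (int _) (int _)).
  by apply: eq_measure_integral => A mA _; exact: addE.
have F (m : {finite_measure set T -> \bar R}) : exists r, (\int[m]_x (f x)%:E = r%:E)%E by exists (\int[m]_x f x); rewrite /Rintegral fineK//; exact: integrable_fin_num (int m).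
rewrite /charge_integral /Rintegral.
have [p ->] := F (pos_part nu); have [q ->] := F (neg_part nu).
have [r ->] := F m1; have [t ->] := F m2.
by move=> [E]; congr EFin; rewrite /=; lra.
Qed.

Lemma absval_nat (R : realType) (F : fieldType) (v : F -> R) n : is_absval v -> v n%:R <= n%:R.
Proof.
move=> vP; elim: n => [|n IH]; first by rewrite absval0.
rewrite -!natr1; apply: le_trans (absvalD vP _ _) _.
by rewrite (absval1 vP) lerD2r.
Qed.

(** * The algebraic closure of K and its image in C_v *)

Section countable_fields.
Variables (K : fieldExtType rat) (Kbar : fieldType) (iota : {rmorphism K -> Kbar}).
Hypothesis Kbar_closure : is_algebraic_closure iota.

Lemma countable_numfield_poly : countable [set: {poly K}].
Proof.
apply/countable_injP; exists (fun p : {poly K} => choice.pickle (map (fun x : K => VectorInternalTheory.v2r x) p)).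
move=> p q _ _ /(pcan_inj choice.pickleK) /(inj_map (@VectorInternalTheory.v2r_inj _ _)); exact: val_inj.
Qed.

Lemma poly_roots_finite (F : fieldType) (p : {poly F}) : p != 0 -> finite_set [set x | root p x].
Proof.
move=> p0; apply: contrapT => /(infinite_set_fset (size p))[B Bp].
apply/negP; rewrite -ltnNge; apply: max_poly_roots => //; last exact: fset_uniq.
by apply/allP => x xB; exact: Bp.
Qed.

Lemma countable_algebraic_closure : countable [set: Kbar].
Proof.
have -> : [set: Kbar] = \bigcup_(p in [set p : {poly K} | p != 0]) [set x | root (map_poly iota p) x] by apply/seteqP; split=> // x _; have [p p0 px] := Kbar_closure.1 x; exists p.
apply: bigcup_countable; first exact: sub_countable (subset_card_le (@subsetT _ _)) countable_numfield_poly.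
by move=> p /= p0; apply/finite_set_countable/poly_roots_finite; rewrite map_poly_eq0.
Qed.

Lemma closure_split (p : {poly Kbar}) : p != 0 ->
  exists s : seq Kbar, p = lead_coef p *: \prod_(a <- s) ('X - a%:P).
Proof.
move=> p0; have [||||s _ sE] := @split_roots Kbar setT I _ _ _ p _ p0; last by exists s.
all: by move=> // q _ /(Kbar_closure.2 _)[x qx]; exists x.
Qed.

End countable_fields.

Section nonarchimedean_model.
Variables (R : realType) (K : fieldExtType rat) (v : nonarch_place R K) (M : nonarch_model v).
Variables (Kbar : fieldType) (iota : {rmorphism K -> Kbar}).
Hypothesis Kbar_closure : is_algebraic_closure iota.
Variable j : {rmorphism Kbar -> na_field M}.
Hypothesis jP : forall x, j (iota x) = na_emb M x.
Local Notation abs := (@na_abs _ _ _ M).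
Let absP : is_absval abs := na_absP M.

Lemma nonarch_residue : exists2 p, prime p & forall q : rat, val v q%:A = padic_absval R p q.
Proof. by have := valP v; rewrite inE => -[]. Qed.

Lemma padic_nat_le1 p n : padic_absval R p n%:Q <= 1.
Proof.
rewrite /padic_absval; case: ifP => // _; rewrite denq_int logn1 expr0 div1r.
have [->|p0] := posnP p; last by rewrite invf_le1 ?exprn_ege1 ?exprn_gt0 ?ltr0n// ler1n.
by rewrite lognE /= expr0 invr1.
Qed.

Lemma padic_prime p : prime p -> padic_absval R p p%:Q = p%:R^-1.
Proof.
move=> pp; have p0 : p != 0%N by rewrite -lt0n prime_gt0.
by rewrite /padic_absval intr_eq0 eqz_nat (negbTE p0) denq_int numq_int logn1 expr0 div1r absz_nat logn_prime// eqxx expr1.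
Qed.

Lemma na_abs_nat n : abs n%:R <= 1.
Proof.
have [p _ vp] := nonarch_residue.
have -> : n%:R = na_emb M (n%:Q)%:A by rewrite -in_algE !rmorph_nat.
by rewrite na_embP vp padic_nat_le1.
Qed.

Let um : forall x y, abs (x + y) <= Num.max (abs x) (abs y).
Proof.
move=> x y; apply: ultrametric_of_nat; [exact: absval_ge0 | exact: absvalM | exact: absvalD |].
exact: na_abs_nat.
Qed.

(** Density is the point. Suppose y, algebraic over K_v, stays at distance e from the image of Kbar.
    Approximate its monic equation by Q with coefficients in K; the roots of Q lie in the image, so
    |Q(y)| >= e^n, while closeness of the coefficients gives |Q(y)| <= d Y^n = e^n / 2. *)
Lemma na_model_setting : na_setting abs (range j).
Proof.
split => //.
- have [p pp vp] := nonarch_residue; exists (na_emb M (p%:Q)%:A)^-1.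
  rewrite absvalV// na_embP vp padic_prime// invrK ltr1n prime_gt1//.
- move=> x e e0; have := na_dense M; move/seteqP => -[_ /(_ x I) /(_ e e0)[y yalg xy]].
  suff [b yb] : exists b, abs (y - j b) < e.
    exists (j b) => //; have -> : x - j b = (x - y) + (y - j b) by ring.
    by apply: le_lt_trans (um _ _) _; rewrite gt_max xy yb.
  have [P0 [P0K P00 P0y]] := yalg; apply: contrapT => /forallNP far.
  have {}far b : e <= abs (y - j b) by rewrite leNgt; apply/negP/far.
  have l0 : lead_coef P0 != 0 by rewrite lead_coef_eq0.
  pose P := (lead_coef P0)^-1 *: P0; set n := (size P).-1.
  have PK i : absval_closure abs (range (na_emb M)) P`_i.
    rewrite coefZ; apply: (absval_closureM absP) (P0K i).
      by move=> _ _ [a _ <-] [b _ <-]; exists (a * b) => //; rewrite rmorphM.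
    by apply: (absval_closureV absP) (P0K _) => _ [a _ <-]; exists a^-1 => //; rewrite fmorphV.
  have Pm : P`_n = 1 by rewrite -lead_coefE lead_coefZ mulVf.
  have sP : size P = n.+1 by rewrite prednK// size_poly_gt0 scaler_eq0 negb_or invr_eq0 l0.
  have Py : root P y by rewrite rootZ ?invr_eq0.
  pose Y := Num.max 1 (abs y); have Y1 : 1 <= Y by rewrite le_max lexx.
  have Y0 : 0 < Y by exact: lt_le_trans ltr01 Y1.
  have Yn : 0 < Y ^+ n by rewrite exprn_gt0.
  pose d := e ^+ n / (2 * Y ^+ n); have d0 : 0 < d by rewrite divr_gt0 ?mulr_gt0 ?exprn_gt0.
  have qP i : exists c, abs (P`_i - na_emb M c) < d by have [_ [c _ <-] h] := PK i d d0; exists c.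
  pose q := 'X^n + \poly_(i < n) (projT1 (cid (qP i))); pose Q := map_poly j (map_poly iota q).
  have sq : (size (\poly_(i < n) (projT1 (cid (qP i)))) < size ('X^n : {poly K}))%N.
    by rewrite size_polyXn ltnS size_poly.
  have lq : lead_coef q = 1 by rewrite lead_coefDl// lead_coefXn.
  have sQ : size Q = n.+1 by rewrite !size_map_poly size_polyDl// size_polyXn.
  have qE i : (i < n.+1)%N -> abs (Q`_i - P`_i) <= d.
    rewrite ltnS leq_eqVlt => /orP[/eqP ->|ni].
      have -> : Q`_n = lead_coef Q by rewrite lead_coefE sQ.
      by rewrite !lead_coef_map lq !rmorph1 Pm subrr absval0// ltW.
    rewrite !coef_map /= jP coefD coefXn coef_poly ni ltn_eqF// add0r.
    by case: cid => c /= h; rewrite absvalC// ltW.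
  have Qy : abs Q.[y] <= d * Y ^+ n.
    have -> : Q.[y] = \sum_(i < n.+1) (Q`_i - P`_i) * y ^+ i.
      under eq_bigr do rewrite mulrBl; rewrite sumrB -sQ -horner_coef sQ -sP -horner_coef.
      by move/rootP: Py => ->; rewrite subr0.
    elim/big_ind: _ => [|a b ha hb|i _].
    - by rewrite absval0// mulr_ge0 ?ltW.
    - by apply: le_trans (um _ _) _; rewrite ge_max ha.
    rewrite (absvalM absP) (absvalX absP); apply: ler_pM; rewrite ?exprn_ge0 ?(absval_ge0 absP) ?qE//.
    apply: le_trans (_ : Y ^+ i <= _).
      by rewrite lerXn2r ?nnegrE ?(absval_ge0 absP) ?(ltW Y0)// le_max lexx orbT.
    by rewrite ler_weXn2l// -ltnS.
  have q0 : map_poly iota q != 0 by rewrite -lead_coef_eq0 lead_coef_map lq rmorph1 oner_eq0.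
  have [s sE] := closure_split Kbar_closure q0.
  have QsE : Q = \prod_(a <- s) ('X - (j a)%:P).
    rewrite /Q sE lead_coef_map lq rmorph1 scale1r rmorph_prod.
    by apply: eq_bigr => a _; rewrite rmorphB/= map_polyX map_polyC.
  have ss : size s = n.
    have := sQ; rewrite QsE -(big_map j xpredT (fun a => 'X - a%:P)) size_prod_XsubC size_map.
    by case.
  have : e ^+ n <= abs Q.[y].
    rewrite QsE horner_prod (absval_prod absP) -ss.
    elim: (s) => [|a t IH]; first by rewrite big_nil expr0.
    by rewrite big_cons /= exprS ler_pM ?exprn_ge0 ?(ltW e0)// !hornerE.
  move/le_trans => /(_ _ Qy); rewrite /d invfM mulrA mulfVK ?gt_eqF//.
  by have := exprn_gt0 n e0; lra.
- by exists 1; rewrite ?rmorph1.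
- by move=> _ _ [x _ <-] [y _ <-]; rewrite -rmorphB.
- by move=> _ _ [x _ <-] [y _ <-]; rewrite -rmorphM.
- move=> p pD sp; pose q := \poly_(i < size p) (projT1 (cid2 (pD i))).
  have pE : p = map_poly j q.
    apply/polyP => i; rewrite coef_map /= coef_poly; have [h|h] := ltnP i (size p).
      by case: cid2.
    by rewrite rmorph0 nth_default.
  have [|x qx] := Kbar_closure.2 q; first by rewrite pE size_map_poly in sp.
  by exists (j x); rewrite // pE; apply: rmorph_root.
have /countable_injP[f fi] := countable_algebraic_closure Kbar_closure.
apply/countable_injP; exists (fun x => f (xget 0 [set b | j b = x])).
move=> _ _ /set_mem[x _ <-] /set_mem[y _ <-].
have gE z : xget 0 [set b | j b = j z] = z by case: xgetP => [a _ /= E|/(_ z)[]//]; exact: (fmorph_inj j E).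
by rewrite !gE => /fi ->//; rewrite inE.
Qed.

End nonarchimedean_model.

Lemma continuous_prod_cst (R : realType) (T : topologicalType) (f g : T -> R) (c : R) :
  continuous f -> continuous g -> continuous (fun x => f x * g x * c).
Proof. by move=> cf cg x; apply: cvgMr_tmp; apply: cvgM; [exact: cf | exact: cg]. Qed.

(** * The chordal distance on the Berkovich line *)

Section chordal.
Variables (R : realType) (Kbar C : fieldType) (abs : C -> R) (j : {rmorphism Kbar -> C}).
Hypotheses (absP : is_absval abs) (ns : na_setting abs (range j)).
Local Notation X := (fun c : C => 'X - c%:P).
Local Notation can := (gauss_point absP).
Local Notation ev := (eval_point absP).
Implicit Types (S U V W : berkA1 abs) (x y z : berkP1 abs).

Definition height_level U : R := Num.max (snorm U (X 0)) 1.
Local Notation h := height_level.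

Lemma height_level_gt0 U : 0 < h U. Proof. by rewrite lt_max ltr01 orbT. Qed.

Let h1 U : 1 <= h U. Proof. by rewrite le_max lexx orbT. Qed.

(** The usual formula |z - w| / (max(|z|, 1) max(|w|, 1)), with [meet_level] and [height_level]
    extending its terms to the Berkovich line. *)
Definition chordal x y : R :=
  match x, y with
  | Some U, Some V => meet_level U V / (h U * h V)
  | Some U, None | None, Some U => (h U)^-1
  | None, None => 0
  end.

Definition classical_option (a : option Kbar) : berkP1 abs := berk_point (omap ev (omap j a)).
Local Notation pt := classical_option.

Lemma meet_eval c U : meet_level (ev c) U = snorm U (X c).
Proof. by rewrite -(sup_berkE absP ns) (sup_berk_eval absP ns). Qed.

Lemma height_eval c : h (ev c) = Num.max (abs c) 1.
Proof. by rewrite /h snorm_eval subr0. Qed.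

Lemma meet_level_gauss U : meet_level U can = h U.
Proof. by rewrite meet_levelC (gauss_pointE absP ns) meet_ball. Qed.

Let meet_ge0 U V : 0 <= meet_level U V.
Proof. exact: le_trans (diam_ge0 U) (diam_le_meet _ _). Qed.

Let meet_le_h U V : meet_level U V <= Num.max (h U) (h V).
Proof.
apply: le_trans (meet_level_le U V 0) _; rewrite ge_max /h !le_max !lexx /= !orbT//.
Qed.

Let h_le U V : h U <= Num.max (meet_level U V) (h V).
Proof.
rewrite -!meet_level_gauss; exact: (meet_tri absP ns).
Qed.

Lemma chordal_bound x y : 0 <= chordal x y <= 1.
Proof.
case: x y => [U|] [V|]; rewrite /chordal ?lexx ?ler01//; last 2 first.
- by rewrite invr_ge0 invf_le1 ?h1 ?height_level_gt0// ltW// height_level_gt0.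
- by rewrite invr_ge0 invf_le1 ?h1 ?height_level_gt0// ltW// height_level_gt0.
have hU := height_level_gt0 U; have hV := height_level_gt0 V.
rewrite divr_ge0 ?mulr_ge0 ?(ltW hU) ?(ltW hV)//= ler_pdivrMr ?mulr_gt0// mul1r.
apply: le_trans (meet_le_h U V) _; rewrite ge_max; apply/andP; split.
  by rewrite ler_peMr// ltW.
by rewrite ler_peMl// ltW.
Qed.

Lemma chordal_sym x y : chordal x y = chordal y x.
Proof. by case: x y => [U|] [V|] //=; rewrite meet_levelC mulrC mulrC [h U * _]mulrC. Qed.

Lemma chordal_tri x y z : chordal x y <= Num.max (chordal x z) (chordal z y).
Proof.
have hp := height_level_gt0.
(* [L1] treats infinity as the intermediate point, [L2] as an end. *)
have L1 (m u v : R) : 0 < u -> 0 < v -> m <= Num.max u v -> m / (u * v) <= Num.max u^-1 v^-1.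
  move=> u0 v0; rewrite !le_max => /orP[mu|mv]; apply/orP; [right | left];
    rewrite ler_pdivrMr ?mulr_gt0//; last by rewrite mulKf ?gt_eqF.
  by rewrite mulrCA mulVf ?gt_eqF// mulr1.
have L2 (m u w : R) : 0 < u -> 0 < w -> w <= Num.max m u -> u^-1 <= Num.max (m / (u * w)) w^-1.
  move=> u0 w0; rewrite !le_max => /orP[wm|wu]; apply/orP; [left | right].
    by rewrite ler_pdivlMr ?mulr_gt0// mulKf ?gt_eqF.
  by rewrite lef_pV2.
case: x y z => [U|] [V|] [W|] /=.
- have HU := hp U; have HV := hp V; have HW := hp W.
  have t := meet_tri absP ns U V W; have tU := h_le W U; have tV := h_le W V.
  rewrite (meet_levelC W U) in tU.
  have m1 := meet_ge0 U W; have m2 := meet_ge0 W V; have m0 := meet_ge0 U V.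
  have b := meet_le_h U V.
  move: (meet_level U V) (meet_level U W) (meet_level W V) (h U) (h V) (h W) m0 m1 m2 t tU tV b HU HV HW.
  move=> m p q u v w m0 p0 q0 t tU tV b u0 v0 w0.
  have uvw : 0 < u * v * w by rewrite !mulr_gt0.
  rewrite -(ler_pM2r uvw) maxr_pMl ?(ltW uvw)//.
  have -> : m / (u * v) * (u * v * w) = m * w by field; rewrite !gt_eqF.
  have -> : p / (u * w) * (u * v * w) = p * v by field; rewrite !gt_eqF.
  have -> : q / (w * v) * (u * v * w) = q * u by field; rewrite !gt_eqF.
  have [uw|wu] := ltP u w.
    have pw : w <= p by move: tU; rewrite le_max => /orP[//|]; rewrite leNgt uw.
    have [vw|wv] := ltP v w.
      have qw : w <= q by move: tV; rewrite le_max => /orP[//|]; rewrite leNgt vw.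
      by move: b; rewrite !le_max => /orP[] b; apply/orP; [right | left]; nra.
    rewrite le_max; apply/orP; left.
    by move: b; rewrite le_max => /orP[] b; nra.
  have [vw|wv] := ltP v w.
    have qw : w <= q by move: tV; rewrite le_max => /orP[//|]; rewrite leNgt vw.
    by rewrite le_max; apply/orP; right; move: b; rewrite le_max => /orP[] b; nra.
  by move: t; rewrite !le_max => /orP[] t; apply/orP; [left | right]; apply: ler_pM => //; exact: ltW.
- exact: L1 (hp U) (hp V) (meet_le_h U V).
- apply: L2 (hp U) (hp W) _; rewrite meet_levelC; exact: h_le.
- by rewrite le_max lexx.
- by rewrite maxC (mulrC (h W)); apply: L2 (hp V) (hp W) _; exact: h_le.
- by rewrite le_max lexx orbT.
- by rewrite le_max invr_ge0 ltW.
- by rewrite maxxx.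
Qed.

Lemma chordal_pt a y : chordal (pt a) y = 0 <-> y = pt a.
Proof.
have hp U : (h U)^-1 <> 0 by apply/eqP; rewrite invr_eq0 gt_eqF// height_level_gt0.
case: a y => [b|] [U|] /=; split => //; try by [move/hp]; last first.
  case=> ->; rewrite meet_eval snorm_eval subrr absval0// mul0r//.
rewrite meet_eval => /eqP; rewrite mulf_eq0 invr_eq0.
rewrite (gt_eqF (mulr_gt0 (height_level_gt0 _) (height_level_gt0 _))) orbF => /eqP U0.
congr Some; apply: (snorm_lin_inj absP ns) => c; rewrite snorm_eval.
have a1 := snorm_lin absP ns U c (j b); have a2 := abs_snorm_lin absP ns U (j b) c.
rewrite U0 (max_idPr (absval_ge0 absP _)) absvalC// in a1.
rewrite U0 (max_idPr (snorm_ge0 _ _)) in a2.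
by apply/eqP; rewrite eq_le a1 a2.
Qed.

Lemma classical_option_inj : injective pt.
Proof.
move=> a b; case: a b => [a|] [b|]//= E; congr Some.
have /eqP := congr1 (fun o : option (berkA1 abs) => if o is Some U then snorm U (X (j b)) else 0) E.
rewrite /= !snorm_eval subrr (absval0 absP).
by rewrite (absval_eq0 absP) -rmorphB fmorph_eq0 subr_eq0 => /eqP.
Qed.

(** The sequence runs through infinity and the classical points. A centre b common to U and V works
    if its height is at least both of theirs; otherwise U and V are both within u of infinity, which
    is s 0. *)
Lemma chordal_dense : exists s : nat -> option Kbar, forall x y u, chordal x y < u ->
  exists i, chordal x (pt (s i)) < u /\ chordal (pt (s i)) y < u.
Proof.
have /countable_injP[f fi] := ns_countable ns.
pose s n := if n is m.+1 then Some (xget 0 [set b | f (j b) = m]) else None; exists s => x y u; have hp := height_level_gt0; case: x y => [U|] [V|] /=; last 3 first.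
- by move=> Uu; exists 0%N => /=; rewrite Uu (lt_trans _ Uu)// invr_gt0.
- by move=> Uu; exists 0%N => /=; rewrite Uu (lt_trans _ Uu)// invr_gt0.
- by move=> u0; exists 0%N.
rewrite ltr_pdivrMr ?mulr_gt0// => mu.
have t0 : 0 < u * (h U * h V) by exact: le_lt_trans (meet_ge0 U V) mu.
have u0 : 0 < u by rewrite pmulr_lgt0 ?mulr_gt0 in t0.
have [c [Uc Vc]] := meet_level_ltP mu.
have [_ [b _ <-] cb] := ns_dense ns c t0.
have {}Uc : snorm U (X (j b)) < u * (h U * h V) by apply: le_lt_trans (snorm_lin absP ns U (j b) c) _; rewrite gt_max Uc absvalC.
have {}Vc : snorm V (X (j b)) < u * (h U * h V) by apply: le_lt_trans (snorm_lin absP ns V (j b) c) _; rewrite gt_max Vc absvalC.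
pose M := h (ev (j b)).
have M0 : 0 < M by exact: hp.
have big S : M < h S -> snorm S (X (j b)) < u * (h U * h V) -> h S < u * (h U * h V).
  move=> MS Sc; apply: le_lt_trans Sc.
  have := h_le S (ev (j b)); rewrite meet_levelC meet_eval le_max -/M => /orP[//|].
  by rewrite leNgt MS.
have inv_lt S : 1 < u * h S -> (h S)^-1 < u.
  by move=> S1; rewrite -[X in X < _]mul1r ltr_pdivrMr// hp.
have none : 1 < u * h U -> 1 < u * h V -> exists i, chordal (Some U) (pt (s i)) < u /\ chordal (pt (s i)) (Some V) < u.
  by move=> U1 V1; exists 0%N => /=; split; exact: inv_lt.
have [MU|UM] := ltP M (h U).
  have V1 : 1 < u * h V by have := big U MU Uc; rewrite mulrCA -[X in X < _]mulr1 ltr_pM2l.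
  have [MV|VM] := ltP M (h V).
    apply: none => //.
    by have := big V MV Vc; rewrite mulrA -[X in X < _]mul1r ltr_pM2r.
  apply: none => //; apply: lt_le_trans V1 _; rewrite ler_pM2l//.
  exact: le_trans VM (ltW MU).
have [MV|VM] := ltP M (h V).
  have U1 : 1 < u * h U by have := big V MV Vc; rewrite mulrA -[X in X < _]mul1r ltr_pM2r.
  apply: none => //; apply: lt_le_trans U1 _; rewrite ler_pM2l//.
  exact: le_trans UM (ltW MV).
exists (f (j b)).+1 => /=.
have -> : xget 0 [set b0 | f (j b0) = f (j b)] = b.
  case: xgetP => [b' _ /= /fi E|/(_ b)[]//].
  by apply: (fmorph_inj j); apply: E; apply/mem_set; [exists b' | exists b].
rewrite meet_levelC !meet_eval -/M !ltr_pdivrMr ?mulr_gt0//; split.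
  by apply: lt_le_trans Uc _; rewrite ler_pM2l// ler_pM2l.
by apply: lt_le_trans Vc _; rewrite ler_pM2l// ler_pM2r.
Qed.

Lemma chordal_continuous a : continuous (chordal (pt a)).
Proof.
have chh : continuous h.
  rewrite (_ : h = fun S => Num.max 1 (snorm S (X 0))); last by apply/funext => S; rewrite /h maxC.
  by move=> S; apply: cvg_max_cst; [exact: nbhs_filter | exact: (@snorm_continuous _ _ _ (X 0))].
have ch : continuous (fun S => (h S)^-1) by move=> S; have hS : h S != 0; [rewrite gt_eqF// height_level_gt0 | exact: (cvgV hS (chh S))].
apply: (berkP1_continuous absP); case: a => [b|] /=.
- rewrite (_ : (fun S => _) = fun S => snorm S (X (j b)) * (h S)^-1 * (h (ev (j b)))^-1); last first.
    by apply/funext => S; rewrite meet_eval invfM; ring.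
  exact: (continuous_prod_cst (@snorm_continuous _ _ _ (X (j b))) ch).
- exact: ch.
- move=> e e0; exists (Num.max (abs (j b)) 1) => S; rewrite gt_max => /andP[Sb S1].
  have hS : h S = snorm S (X 0) by rewrite /h subr0; apply/max_idPl/ltW.
  have Sjb : snorm S (X (j b)) = h S.
    rewrite hS; apply/le_anti/andP; split.
      apply: le_trans (snorm_lin absP ns S (j b) 0) _.
      by rewrite subr0 ge_max lexx subr0 ltW.
    have := snorm_lin absP ns S 0 (j b).
    by rewrite sub0r absvalN// le_max => /orP[//|]; rewrite subr0 leNgt Sb.
  rewrite meet_eval Sjb invfM mulrCA divff ?gt_eqF ?height_level_gt0// mulr1.
  by rewrite subrr normr0.
move=> e e0; exists e^-1 => S Se.
have hp := height_level_gt0 S.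
rewrite sub0r normrN ger0_norm ?invr_ge0 ?ltW// -[X in _ < X]invrK ltf_pV2 ?posrE ?invr_gt0//.
by rewrite /h lt_max subr0 Se.
Qed.

Lemma chordal_separates x y : x <> y -> exists a, chordal (pt a) x <> chordal (pt a) y.
Proof.
move=> xy; apply: contrapT => /forallNP H; apply: xy.
have {}H a : chordal (pt a) x = chordal (pt a) y by apply: contrapT; exact: H.
have hp U : (h U)^-1 <> 0 by apply/eqP; rewrite invr_eq0 gt_eqF// height_level_gt0.
case: x y H => [U|] [V|] H //; last 2 first.
- by have := H None => /= /hp.
- by have := H None => /= /esym/hp.
have hUV : h U = h V by have := H None => /= /invr_inj.
have E b : snorm U (X (j b)) = snorm V (X (j b)).
  have := H (Some b); rewrite /= !meet_eval hUV; apply: divIf.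
  by rewrite mulf_neq0// gt_eqF// height_level_gt0.
congr Some; apply: (snorm_lin_inj absP ns) => c.
suff le (S T' : berkA1 abs) : (forall b, snorm S (X (j b)) = snorm T' (X (j b))) -> snorm T' (X c) <= snorm S (X c).
  by apply/le_anti/andP; split; apply: le.
move=> ST; rewrite leNgt; apply/negP => lt.
have [_ [b _ <-] cb] := ns_dense ns c (le_lt_trans (snorm_ge0 S _) lt).
have := snorm_lin absP ns T' c (j b); rewrite leNgt gt_max cb andbT -ST => /negP; apply.
by apply: le_lt_trans (snorm_lin absP ns S (j b) c) _; rewrite gt_max lt absvalC.
Qed.

Lemma chordal_kernel : ultrametric_kernel classical_option chordal.
Proof.
split.
- exact: chordal_bound.
- exact: chordal_sym.
- exact: chordal_tri.
- exact: chordal_pt.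
- exact: classical_option_inj.
- exact: chordal_dense.
- exact: chordal_continuous.
- exact: chordal_separates.
Qed.

Let height_ball r (r0 : 0 < r) c : h (ball_point absP ns r0 c) = Num.max (Num.max (abs c) r) 1.
Proof. by rewrite /h snorm_ball subr0. Qed.

(** For a classical b of height A with e A <= 1, the chordal ball of radius e is the disc of radius
    e A^2 about b. In the other cases it contains infinity, and the corresponding point is that of
    the disc of radius 1/e about 0. *)
Lemma chordal_ball a e : 0 < e -> e <= 1 -> exists r (r0 : 0 < r) c,
  forall y, chordal (Some (ball_point absP ns r0 c)) y = Num.max (chordal (pt a) y) e.
Proof.
move=> e0 e1; have hp := height_level_gt0.
have ie : 1 <= e^-1 by rewrite invf_ge1.
have outer b : (if b is Some b' then is_true (1 < e * Num.max (abs (j b')) 1) else True) ->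
    exists r (r0 : 0 < r) c,
    forall y, chordal (Some (ball_point absP ns r0 c)) y = Num.max (chordal (pt b) y) e.
  move=> bP; have ie0 : 0 < e^-1 by rewrite invr_gt0.
  exists e^-1, ie0, 0.
  have hw : h (ball_point absP ns ie0 0) = e^-1 by rewrite height_ball absval0// (max_idPr (ltW ie0)) (max_idPl ie).
  case=> [U|] /=; rewrite ?hw ?invrK; last first.
    case: b bP => [b|_] /=; last by rewrite (max_idPr (ltW e0)).
    rewrite height_eval; set A := Num.max _ _ => bP; apply/esym/max_idPr.
    have A0 : 0 < A by rewrite /A lt_max ltr01 orbT.
    by rewrite -[X in X <= _]mul1r ler_pdivrMr// ltW.
  have HU := hp U.
  have -> : meet_level (ball_point absP ns ie0 0) U / (e^-1 * h U) =
      Num.max (h U)^-1 e.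
    rewrite meet_ball -[LHS](mulfK (lt0r_neq0 HU)) -[RHS](mulfK (lt0r_neq0 HU)); congr (_ / _).
    rewrite [RHS]maxr_pMl ?(ltW HU)// mulVf ?gt_eqF//.
    have -> : Num.max (snorm U (X 0)) e^-1 / (e^-1 * h U) * h U = e * Num.max (snorm U (X 0)) e^-1 by field; rewrite !gt_eqF.
    rewrite maxr_pMr ?ltW// mulfV ?gt_eqF// maxC /h maxr_pMr ?ltW// mulr1.
    by rewrite maxA maxAC; congr Num.max; apply/esym/max_idPl.
  case: b bP => [b|_] //=; rewrite height_eval meet_eval; set A := Num.max _ _ => bP.
  have A0 : 0 < A by rewrite /A lt_max ltr01 orbT.
  have A1 : e^-1 < A by rewrite -[X in X < _]mulr1 ltr_pdivrMl.
  have AE : A = abs (j b) by rewrite /A; apply/max_idPl; rewrite leNgt; apply/negP => b1; move: A1; rewrite /A (max_idPr (ltW b1)) ltNge ie.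
  have [hA|hA] := ltP (h U) A.
    have -> : snorm U (X (j b)) = A.
      have U0A : snorm U (X 0) < A by apply: le_lt_trans hA; rewrite /h le_max lexx.
      apply/le_anti/andP; split.
        apply: le_trans (snorm_lin absP ns U (j b) 0) _.
        by rewrite [j b - 0]subr0 -AE ge_max lexx ltW.
      have := abs_snorm_lin absP ns U (j b) 0; rewrite [j b - 0]subr0 -AE le_max => /orP[//|].
      by rewrite leNgt U0A.
    by rewrite invfM mulrA divff ?gt_eqF// mul1r.
  have hUe : (h U)^-1 <= e by rewrite -[leRHS]invrK lef_pV2 ?posrE ?invr_gt0// (le_trans (ltW A1)).
  rewrite (max_idPr hUe); apply/esym/max_idPr.
  rewrite ler_pdivrMr ?mulr_gt0//; apply: le_trans (_ : h U <= _); last first.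
    by rewrite mulrA ler_peMl ?(ltW HU)// ltW.
  have := snorm_lin absP ns U (j b) 0; rewrite [j b - 0]subr0 -AE => /le_trans; apply.
  by rewrite ge_max hA andbT /h le_max lexx.
case: a => [b|]; last exact: outer.
have [bP|bP] := ltP 1 (e * Num.max (abs (j b)) 1); first exact: outer.
set A := Num.max (abs (j b)) 1 in bP.
have A1 : 1 <= A by rewrite le_max lexx orbT.
have A0 : 0 < A by exact: lt_le_trans ltr01 A1.
have r0 : 0 < e * A * A by rewrite !mulr_gt0.
have rA : e * A * A <= A by rewrite ler_piMl ?(ltW A0).
exists (e * A * A), r0, (j b).
have hw : h (ball_point absP ns r0 (j b)) = A by rewrite height_ball maxAC -/A; apply/max_idPl.
case=> [U|] /=; rewrite hw height_eval -/A; last first.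
  by apply/esym/max_idPl; rewrite -[leRHS]mul1r ler_pdivlMr.
have HU := hp U; rewrite meet_ball meet_eval.
rewrite -[LHS](mulfK (lt0r_neq0 (mulr_gt0 A0 HU))) -[RHS](mulfK (lt0r_neq0 (mulr_gt0 A0 HU))).
have AU0 : 0 < A * h U by exact: mulr_gt0.
congr (_ / _); rewrite [in RHS]maxr_pMl ?(ltW AU0)// !divfK ?(gt_eqF AU0)//.
have bU := abs_snorm_lin absP ns U (j b) 0; have Ub := snorm_lin absP ns U 0 (j b).
rewrite subr0 in bU; rewrite sub0r absvalN// in Ub.
have [hA|hA|hA] := ltgtP (h U) A.
- have U0A : snorm U (X 0) < A by apply: le_lt_trans hA; rewrite /h le_max lexx.
  have Ab : A = abs (j b).
    rewrite /A; apply/max_idPl; rewrite leNgt; apply/negP => b1.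
    by move: hA; rewrite /A (max_idPr (ltW b1)) ltNge h1.
  have AU : A <= snorm U (X (j b)) by move: bU; rewrite -Ab le_max => /orP[//|]; rewrite leNgt U0A.
  rewrite !(max_idPl (le_trans _ AU))//.
  by apply: le_trans rA; rewrite -mulrA ler_pM2l// ler_pM2l// ltW.
- have U0 : h U = snorm U (X 0).
    rewrite /h; apply/max_idPl; rewrite leNgt; apply/negP => b1.
    by move: hA; rewrite /h (max_idPr (ltW b1)) ltNge A1.
  have UU : h U <= snorm U (X (j b)).
    move: Ub; rewrite -U0 le_max => /orP[//|]; rewrite leNgt => /negP[]; apply: le_lt_trans hA.
    by rewrite /A le_max lexx.
  rewrite !(max_idPl (le_trans _ UU))//; last exact: le_trans rA (ltW hA).
  by rewrite mulrA ler_piMl ?(ltW HU).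
by rewrite hA mulrA.
Qed.

Lemma gromov_chordal r (r0 : 0 < r) c y :
  gromov absP (Some (ball_point absP ns r0 c) : berkP1 abs) y =
  (- ln (chordal (Some (ball_point absP ns r0 c)) y))%:E.
Proof.
rewrite gromov_ball; congr EFin; set w := ball_point _ _ _ _.
have hw := height_level_gt0 w; case: y => [U|] /=; rewrite !meet_level_gauss; last by rewrite lnV// opprK.
have hU := height_level_gt0 U.
rewrite ln_div ?posrE ?mulr_gt0//; last by rewrite meet_ball lt_max r0 orbT.
by rewrite lnM ?posrE//; ring.
Qed.

Lemma berkP1_compact : compact [set: berkP1 abs].
Proof. exact: one_point_compactification_compact. Qed.

Section potential.
Variables (rho : probability (borel (berkP1 abs)) R) (g : berkP1 abs -> R).
Hypotheses (g_cont : continuous g) (g_lap : na_laplacian absP g (measure_diff rho (na_lambda absP))).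

(** At a disc point w the pairing <w, y> is -ln dl(w, y), so the Laplacian equation is an equation
    between potentials. The Dirac mass at the Gauss point contributes 0, that point being at
    distance 1 from all. *)
Lemma chordal_potential : exists c, forall a k, exists w,
  (forall y, chordal w y = Num.max (chordal (pt a) y) (expR (- k%:R))) /\
  \int[rho]_y (- ln (chordal w y)) = c - g w.
Proof.
have [_ [c cP]] := g_lap; exists c => a k.
have e1 : expR (- k%:R) <= 1 :> R by rewrite -[leRHS]expR0 ler_expR oppr_le0.
have [r [r0 [b wP]]] := chordal_ball a (expR_gt0 (- k%:R)) e1.
set w := ball_point absP ns r0 b in wP; exists (Some w); split => //.
have hypw : hyperbolic absP w by apply: hyperbolic_diam; rewrite diam_ball.
have := cP w hypw; rewrite (_ : gromov absP _ = EFin \o (fun y => - ln (chordal (Some w) y))); last first.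
  by apply/funext => y; rewrite gromov_chordal.
have bG : bounded_mfun (T := borel (berkP1 abs)) (fun y => - ln (chordal (Some w) y)).
  have := bounded_kernel_slice (T := borel (berkP1 abs)) (pt a)
    (bounded_log_kernel_trunc chordal_kernel k).
  by congr bounded_mfun; apply/funext => y; rewrite /log_kernel_trunc wP.
rewrite charge_integral_measure_diff// -EFinB => -[gE].
suff I0 : \int[na_lambda absP]_x (- ln (chordal (Some w) x)) = 0.
  by move: gE; rewrite I0 subr0 /berk_point => ->; ring.
rewrite /Rintegral integral_dirac//; last by apply/measurable_EFinP; case: bG.
rewrite diracT mul1e /= meet_level_gauss.
have -> : h can = 1 by rewrite -meet_level_gauss meet_levelxx (gauss_pointE absP ns) diam_ball.
by rewrite mulr1 divff ?ln1 ?oppr0// gt_eqF// height_level_gt0.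
Qed.

End potential.

Lemma na_log_chordal x y : na_log (x, y) =
  if (chordal x y == 0) || (chordal None x == 0) || (chordal None y == 0) then 0
  else - ln (chordal None x) - ln (chordal None y) + ln (chordal x y).
Proof.
case: x y => [U|] [V|] //=; rewrite ?eqxx ?orbT//.
have hU := height_level_gt0 U; have hV := height_level_gt0 V.
rewrite (sup_berkE absP ns) mulf_eq0 !invr_eq0 mulf_eq0 !(gt_eqF hU) !(gt_eqF hV) !orbF.
case: eqP => [->|/eqP m0]; first by rewrite ln0.
have m1 : 0 < meet_level U V by rewrite lt_def m0 meet_ge0.
by rewrite !lnV// ln_div ?posrE ?mulr_gt0// lnM ?posrE//; ring.
Qed.

Lemma na_log_offdiag p : ~ na_offdiag absP p -> na_log p = 0.
Proof.
case: p => -[U|] [V|] //= H; have [z [-> ->]] : exists z : C, U = ev z /\ V = ev z.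
  by apply: contrapT => Hz; apply: H; exists U, V.
by rewrite (sup_berkE absP ns) meet_eval snorm_eval subrr absval0// ln0.
Qed.

Lemma chordal_gauss y : chordal (Some can) y = 1.
Proof.
have hc : h can = 1 by rewrite -meet_level_gauss meet_levelxx (gauss_pointE absP ns) diam_ball.
case: y => [U|] /=; rewrite hc ?invr1//.
by rewrite mul1r meet_levelC meet_level_gauss divff// gt_eqF// height_level_gt0.
Qed.

End chordal.

(** * The sphere and smooth functions *)

Section sphere_topology.
Variable R : realType.
Local Notation sphere := (sphere R).

Let normcR (z : R[i]) : `|z| = (Normc.normc z)%:C%C. Proof. by case: z. Qed.

Lemma normc_ge_Re (a b : R) : `|a| <= Normc.normc (a +i* b)%C.
Proof. by rewrite /= -sqrtr_sqr ler_sqrt ?addr_ge0 ?sqr_ge0// lerDl sqr_ge0. Qed.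

Lemma normc_ge_Im (a b : R) : `|b| <= Normc.normc (a +i* b)%C.
Proof. by rewrite /= -sqrtr_sqr ler_sqrt ?addr_ge0 ?sqr_ge0// lerDr sqr_ge0. Qed.

Lemma normc_le (a b : R) : Normc.normc (a +i* b)%C <= `|a| + `|b|.
Proof.
rewrite /= -(ler_pXn2r (n := 2)) ?nnegrE ?sqrtr_ge0 ?addr_ge0// sqr_sqrtr ?addr_ge0 ?sqr_ge0//.
rewrite -[X in X + _ <= _]real_normK ?num_real// -[X in _ + X <= _]real_normK ?num_real//.
by rewrite sqrrD; have := mulr_ge0 (normr_ge0 a) (normr_ge0 b); lra.
Qed.

Definition cplx (p : R * R) : R[i]^o := (p.1 +i* p.2)%C.
Definition cpair (z : R[i]^o) : R * R := (complex.Re z, complex.Im z).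

Lemma cpairK : cancel cpair cplx. Proof. by case. Qed.

Lemma cplx_continuous : continuous cplx.
Proof.
move=> p; apply/(@cvgrPdist_lt _ R[i]^o) => -[e e'].
rewrite ltcE /= => /andP[/eqP -> e0].
near=> q.
rewrite normcR ltcR; apply: le_lt_trans (normc_le _ _) _.
have h1 : `|p.1 - q.1| < e / 2.
  near: q; apply: (cvgr_dist_lt (V := R^o)); last by rewrite divr_gt0.
  exact: cvg_fst.
have h2 : `|p.2 - q.2| < e / 2.
  near: q; apply: (cvgr_dist_lt (V := R^o)); last by rewrite divr_gt0.
  exact: cvg_snd.
by move: h1 h2; rewrite /=; lra.
Unshelve. all: by end_near. Qed.

Let Re_continuous : continuous (fun z : R[i]^o => complex.Re z).
Proof.
move=> z U /nbhs_ballP[e /= e0 eU]; apply/nbhs_ballP; exists (e%:C)%C; first by rewrite /= ltcR.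
move=> w; rewrite /ball/= normcR ltcR => zw; apply: eU; apply: le_lt_trans zw.
by case: (z) (w) => a b [a' b']; exact: normc_ge_Re.
Qed.

Let Im_continuous : continuous (fun z : R[i]^o => complex.Im z).
Proof.
move=> z U /nbhs_ballP[e /= e0 eU]; apply/nbhs_ballP; exists (e%:C)%C; first by rewrite /= ltcR.
move=> w; rewrite /ball/= normcR ltcR => zw; apply: eU; apply: le_lt_trans zw.
by case: (z) (w) => a b [a' b']; exact: normc_ge_Im.
Qed.

Lemma cpair_continuous : continuous cpair.
Proof. by move=> z; exact: (cvg_pair (@Re_continuous z) (@Im_continuous z)). Qed.

Lemma sphere_compact : compact [set: sphere].
Proof. exact: one_point_compactification_compact. Qed.

Lemma square_compact (B : R) :
  compact (cplx @` (`[- B, B] `*` `[- B, B]) : set R[i]^o).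
Proof.
apply: continuous_compact.
  exact/continuous_subspaceT/cplx_continuous.
by apply: compact_setX; exact: segment_compact.
Qed.

Lemma sphere_continuous (f : sphere -> R) : continuous (f \o @chart0 R) ->
  (forall e, 0 < e -> exists B, forall a b, B < `|a| \/ B < `|b| -> `|f None - f (Some (a +i* b)%C)| <= e) ->
  continuous f.
Proof.
move=> cf fo [z|].
  have c1 : {for z, continuous ((f \o @chart0 R) \o cpair)} by apply: continuous_comp; [exact: cpair_continuous | exact: cf].
  move=> U fU; have : nbhs z (((f \o @chart0 R) \o cpair) @^-1` U).
    by apply: c1; rewrite /= /chart0/= -/(cplx (cpair z)) cpairK.
  by apply: filterS => w; rewrite /= /chart0 /= -/(cplx (cpair w)) cpairK.
move=> U /nbhs_ballP[e /= e0 eU]; have e2 : 0 < e / 2 by rewrite divr_gt0.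
have [B HB] := fo _ e2.
exists (cplx @` (`[- B, B] `*` `[- B, B])).
  split; first exact: square_compact.
  apply: compact_closed; last exact: square_compact.
  exact: norm_hausdorff.
move=> y /= [[z zB <-]|->]; last by apply: eU; exact: ballxx.
apply: eU; rewrite /ball/=; apply: (@le_lt_trans _ _ (e / 2)); last by move: e0; lra.
case: z zB => a b zB; apply: HB; apply: contrapT => /not_orP[/negP H1 /negP H2]; apply: zB.
exists (a, b) => //; split; rewrite /= in_itv/= -ler_norml leNgt //.
Qed.

End sphere_topology.

(** * A class of smooth functions closed under differentiation *)

Section smooth_functions.
Variable R : realType.
Implicit Types (f g : R * R -> R) (v p : R * R).

(** A syntactic class containing the regularized Green kernels in both charts; since it is closed
    under directional derivatives, [Cn n] follows for every n, and measurability by induction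
    too. *)
Inductive smooth_fun : (R * R -> R) -> Prop :=
| smooth_cst c : smooth_fun (fun=> c)
| smooth_fst : smooth_fun (fun p => p.1)
| smooth_snd : smooth_fun (fun p => p.2)
| smoothD f g : smooth_fun f -> smooth_fun g -> smooth_fun (fun p => f p + g p)
| smoothM f g : smooth_fun f -> smooth_fun g -> smooth_fun (fun p => f p * g p)
| smoothV f : smooth_fun f -> (forall p, 0 < f p) -> smooth_fun (fun p => (f p)^-1)
| smooth_ln f : smooth_fun f -> (forall p, 0 < f p) -> smooth_fun (fun p => ln (f p)).

Lemma smoothX f n : smooth_fun f -> smooth_fun (fun p => f p ^+ n).
Proof.
move=> sf; elim: n => [|n IH]; first exact: smooth_cst.
under eq_fun do rewrite exprS; exact: smoothM.
Qed.

Lemma smooth_continuous f : smooth_fun f -> continuous f.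
Proof.
elim=> {f} [c|||f g _ cf _ cg|f g _ cf _ cg|f _ cf f0|f _ cf f0] p.
- exact: cvg_cst.
- exact: cvg_fst.
- exact: cvg_snd.
- by apply: (@cvgD _ R^o); [exact: cf | exact: cg].
- by apply: cvgM; [exact: cf | exact: cg].
- by apply: cvgV; [rewrite gt_eqF | exact: cf].
- by apply: (@continuous_comp _ _ _ f (@ln R)); [exact: cf | exact: continuous_ln].
Qed.

Lemma is_derive1P f p v df :
  is_derive (0 : R) 1 (fun h => f (h *: v + p)) df -> is_derive p v f df.
Proof.
move=> [D <-]; apply: DeriveDef; first exact/derivable1P.
rewrite /derive; congr (lim (_ @ 0^')); apply/funext => h /=.
by rewrite addr0 scale0r add0r [_%:A]mulr1.
Qed.

Lemma is_derive_line f p v df :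
  is_derive p v f df -> is_derive (0 : R) 1 (fun h => f (h *: v + p)) df.
Proof.
move=> H; have [D <-] := H; apply: DeriveDef; first exact: (derivable1P _ _ _).1.
rewrite /derive; congr (lim (_ @ 0^')); apply/funext => h /=.
by rewrite addr0 scale0r add0r [_%:A]mulr1.
Qed.

Lemma is_derive_fst p v : is_derive p v (fst : R * R -> R) v.1.
Proof.
apply: is_derive1P; rewrite /=.
have -> : (fun h : R => h *: v.1 + p.1) = (v.1 \*: (@id R)) + cst p.1 by apply/funext => h; rewrite fctE/= -[_ *: _]/(h * v.1) mulrC.
by apply: is_derive_eq; rewrite addr0 [_ *: _]mulr1.
Qed.

Lemma is_derive_snd p v : is_derive p v (snd : R * R -> R) v.2.
Proof.
apply: is_derive1P; rewrite /=.
have -> : (fun h : R => h *: v.2 + p.2) = (v.2 \*: (@id R)) + cst p.2 by apply/funext => h; rewrite fctE/= -[_ *: _]/(h * v.2) mulrC.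
by apply: is_derive_eq; rewrite addr0 [_ *: _]mulr1.
Qed.

Lemma is_derive_comp1 f (F : R -> R) p v (df dF : R) :
  is_derive p v f df -> is_derive (f p) 1 F dF -> is_derive p v (F \o f) (dF * df).
Proof.
move=> /is_derive_line Hf HF; apply: is_derive1P.
apply: (@is_derive1_comp _ F (fun h => f (h *: v + p))).
by rewrite scale0r add0r.
Qed.

Lemma smooth_derivative f v : smooth_fun f ->
  exists2 f', smooth_fun f' & forall p, is_derive p v f (f' p).
Proof.
elim=> {f} [c|||f g sf [f' sf' Df] sg [g' sg' Dg]|f g sf [f' sf' Df] sg [g' sg' Dg]|
  f sf [f' sf' Df] f0|f sf [f' sf' Df] f0].
- by exists (fun=> 0) => [|p]; [exact: smooth_cst | exact: is_derive_cst].
- by exists (fun=> v.1) => [|p]; [exact: smooth_cst | exact: is_derive_fst].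
- by exists (fun=> v.2) => [|p]; [exact: smooth_cst | exact: is_derive_snd].
- by exists (fun p => f' p + g' p) => [|p]; [exact: smoothD | exact: is_deriveD].
- exists (fun p => f p * g' p + g p * f' p) => [|p]; last exact: is_deriveM.
  by apply: smoothD; exact: smoothM.
- exists (fun p => - 1 * (f' p * ((f p)^-1 * (f p)^-1))) => [|p].
    apply: smoothM; first exact: smooth_cst.
    by apply: smoothM => //; apply: smoothM; exact: smoothV.
  have HV := @is_deriveV R id (f p) 1 1 (lt0r_neq0 (f0 p)) (is_derive_id _ _).
  apply: (is_derive_eq (is_derive_comp1 (Df p) HV)).
  by rewrite mulN1r [_ *: _]mulr1 mulNr mulrC -expr2 exprVn.
- exists (fun p => (f p)^-1 * f' p) => [|p]; first by apply: smoothM => //; exact: smoothV.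
  exact: (is_derive_comp1 (Df p) (is_derive1_ln (f0 p))).
Qed.

Lemma smooth_Cn n f : smooth_fun f -> Cn n f.
Proof.
elim: n f => [|n IH] f sf; split=> //; try exact: smooth_continuous.
have [fx sfx Dx] := smooth_derivative (dir_x R) sf.
have [fy sfy Dy] := smooth_derivative (dir_y R) sf.
split.
- by move=> p; have [] := Dx p.
- by move=> p; have [] := Dy p.
- suff -> : 'D_(dir_x R) f = fx by exact: IH.
  by apply/funext => p; exact: (@derive_val _ _ _ _ _ _ _ (Dx p)).
- suff -> : 'D_(dir_y R) f = fy by exact: IH.
  by apply/funext => p; exact: (@derive_val _ _ _ _ _ _ _ (Dy p)).
Qed.

End smooth_functions.

(** * Stereographic coordinates and the spherical distance *)

Section sphere_kernel.
Variable R : realType.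
Local Notation sphere := (sphere R).
Implicit Types (x y : sphere) (p : R * R) (i : 'I_3).

Definition oneDr2 p : R := 1 + (p.1 ^+ 2 + p.2 ^+ 2).

(* The coordinates of the inverse of the stereographic projection. *)
Definition stereo i x : R :=
  match x with
  | Some z => [:: 2 * complex.Re z; 2 * complex.Im z; complex.Re z ^+ 2 + complex.Im z ^+ 2 - 1]`_i
              / oneDr2 (complex.Re z, complex.Im z)
  | None => [:: 0; 0; 1]`_i
  end.

Lemma oneDr2_gt0 p : 0 < oneDr2 p.
Proof. by rewrite /oneDr2 ltr_wpDr ?addr_ge0 ?sqr_ge0. Qed.

Let I3P i : [\/ i = 0%N :> nat, i = 1%N :> nat | i = 2%N :> nat].
Proof. by case: i => [[|[|[|//]]]] H; [apply: Or31|apply: Or32|apply: Or33]. Qed.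

Lemma stereo_chart0 i p :
  stereo i (chart0 p) = [:: 2 * p.1; 2 * p.2; p.1 ^+ 2 + p.2 ^+ 2 - 1]`_i / oneDr2 p.
Proof. by case: p. Qed.

Lemma stereo_chart_oo i p :
  stereo i (chart_oo p) = [:: 2 * p.1; - (2 * p.2); 1 - (p.1 ^+ 2 + p.2 ^+ 2)]`_i / oneDr2 p.
Proof.
case: p => a b; rewrite /chart_oo; have [[-> ->]|ab] := eqVneq (a, b) 0.
  by rewrite /oneDr2/=; case: (I3P i) => -> /=; rewrite ?expr0n/= ?addr0 ?subr0 ?mulr0 ?oppr0 ?mul0r ?divr1.
have r0 : a ^+ 2 + b ^+ 2 != 0.
  apply: contra ab; rewrite paddr_eq0 ?sqr_ge0// !sqrf_eq0 => /andP[/eqP-> /eqP->].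
  by [].
have q0 := lt0r_neq0 (oneDr2_gt0 (a, b)); rewrite /oneDr2/= in q0.
rewrite /= /oneDr2 /= .
have E : (a / (a ^+ 2 + b ^+ 2)) ^+ 2 + (- (b / (a ^+ 2 + b ^+ 2))) ^+ 2 = (a ^+ 2 + b ^+ 2)^-1 by rewrite sqrrN !exprMn -mulrDl exprVn expr2 invfM mulrA divff// mul1r.
rewrite E.
case: (I3P i) => -> /=; field; rewrite ?r0 ?q0//.
Qed.

Lemma smooth_oneDr2 : smooth_fun oneDr2.
Proof.
apply: smoothD; first exact: smooth_cst.
by apply: smoothD; apply: smoothX; [exact: smooth_fst | exact: smooth_snd].
Qed.

Let smooth_r2 : smooth_fun (fun p : R * R => p.1 ^+ 2 + p.2 ^+ 2).
Proof. by apply: smoothD; apply: smoothX; [exact: smooth_fst | exact: smooth_snd]. Qed.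

Let smooth_div f : smooth_fun f -> smooth_fun (fun p => f p / oneDr2 p).
Proof. by move=> sf; apply: smoothM => //; apply: smoothV oneDr2_gt0; exact: smooth_oneDr2. Qed.

Lemma stereo_smooth0 i : smooth_fun (stereo i \o @chart0 R).
Proof.
rewrite (_ : _ \o _ = fun p => [:: 2 * p.1; 2 * p.2; p.1 ^+ 2 + p.2 ^+ 2 - 1]`_i / oneDr2 p); last first.
  by apply/funext => p; exact: stereo_chart0.
apply: smooth_div; case: (I3P i) => -> /=.
- by apply: smoothM; [exact: smooth_cst | exact: smooth_fst].
- by apply: smoothM; [exact: smooth_cst | exact: smooth_snd].
- by apply: smoothD => //; exact: smooth_cst.
Qed.

Lemma stereo_continuous i : continuous (stereo i).
Proof.
apply: sphere_continuous; first exact/smooth_continuous/stereo_smooth0.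
move=> e e0; exists (2 / e + 1) => a b ab.
have [m [am bm mB mm]] : exists m, [/\ `|a| <= m, `|b| <= m, 2 / e + 1 < m & m = `|a| \/ m = `|b|].
  exists (Num.max `|a| `|b|); split; rewrite ?le_max ?lexx ?orbT//.
    by rewrite lt_max; case: ab => ->; rewrite ?orbT.
  by case: leP => _; [right | left].
have e1 : 0 < 2 / e by rewrite divr_gt0.
have m0 : 0 < m by move: mB e1; lra.
have me : 2 <= e * m by rewrite mulrC -ler_pdivrMr//; move: mB; lra.
have q0 := oneDr2_gt0 (a, b).
have m2 : m * m <= oneDr2 (a, b).
  rewrite /oneDr2 /= -(real_normK (num_real a)) -(real_normK (num_real b)) !expr2.
  have na := mulr_ge0 (normr_ge0 a) (normr_ge0 a); have nb := mulr_ge0 (normr_ge0 b) (normr_ge0 b).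
  by case: mm => ->; move: na nb; clear; lra.
have m1 : 1 <= m by move: mB e1; lra.
have E : stereo i None - stereo i (Some (a +i* b)%C) = [:: - (2 * a); - (2 * b); 2]`_i / oneDr2 (a, b).
  have -> : stereo i None = [:: 0; 0; 1]`_i by [].
  rewrite -[Some _]/(chart0 (a, b)) stereo_chart0; case: (I3P i) => -> /=.
  - by rewrite sub0r mulNr.
  - by rewrite sub0r mulNr.
  have {1}-> : a ^+ 2 + b ^+ 2 - 1 = oneDr2 (a, b) - 2 by rewrite /oneDr2/=; clear; ring.
  by have := lt0r_neq0 q0; set Q := oneDr2 _ => Q0; field.
rewrite E normrM normfV (gtr0_norm q0) ler_pdivrMr//.
have N : `|[:: - (2 * a); - (2 * b); 2]`_i| <= 2 * m.
  case: (I3P i) => -> /=; rewrite ?normrN ?normrM ger0_norm//.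
  - by rewrite ler_pM2l.
  - by rewrite ler_pM2l.
  - by rewrite ler_pMr.
apply: le_trans N _; apply: le_trans (_ : e * (m * m) <= _); last by rewrite ler_pM2l.
by rewrite mulrA ler_pM2r.
Qed.

Let i0 : 'I_3 := @Ordinal 3 0 isT.
Let i1 : 'I_3 := @Ordinal 3 1 isT.
Let i2 : 'I_3 := @Ordinal 3 2 isT.

Let sum3 (h : 'I_3 -> R) : \sum_i h i = h i0 + h i1 + h i2.
Proof.
rewrite !big_ord_recl big_ord0 addr0 addrA.
by congr (h _ + h _ + h _); exact/val_inj.
Qed.

Lemma stereo_inj x y : (forall i, stereo i x = stereo i y) -> x = y.
Proof.
have none z : stereo i2 (Some z) <> 1.
  case: z => a b; have q0 := lt0r_neq0 (oneDr2_gt0 (a, b)).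
  rewrite -[Some _]/(chart0 (a, b)) stereo_chart0 [_`_ _]/= => /(congr1 (fun t => t * oneDr2 (a, b))).
  by rewrite divfK// mul1r /oneDr2/=; lra.
case: x y => [z|] [w|] H //; last 2 first.
- by case: (none z); exact: (H i2).
- by case: (none w); rewrite -(H i2).
have H0 := H i0; have H1 := H i1; have H2 := H i2; congr Some.
case: z w {H none} H0 H1 H2 => a b [a' b'].
rewrite -[Some _]/(chart0 (a, b)) -[Some (a' +i* b')%C]/(chart0 (a', b')) !stereo_chart0.
rewrite [X in X / _ = _]/= [X in _ = X / _]/=.
have q0 := oneDr2_gt0 (a, b); have q0' := oneDr2_gt0 (a', b').
have qE : a ^+ 2 + b ^+ 2 - 1 = oneDr2 (a, b) - 2 by rewrite /oneDr2/=; ring.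
have qE' : a' ^+ 2 + b' ^+ 2 - 1 = oneDr2 (a', b') - 2 by rewrite /oneDr2/=; ring.
move=> H0 H1; rewrite [X in X / _ = _]/= [X in _ = X / _]/= qE qE' => H2.
move: (oneDr2 (a, b)) (oneDr2 (a', b')) q0 q0' H0 H1 H2 {qE qE'} => q q' q0 q0'.
rewrite !mulrBl !divff ?gt_eqF// => H0 H1 /(addrI _)/oppr_inj/(mulfI _) H2.
have {}H2 : q = q' by apply: invr_inj; apply: H2; rewrite pnatr_eq0.
rewrite -H2 in H0 H1; have n0 : q^-1 != 0 by rewrite invr_eq0 gt_eqF.
have := mulIf n0 H0; have := mulIf n0 H1; rewrite /= => ? ?.
by congr (_ +i* _)%C; lra.
Qed.

Definition inner x y : R := \sum_i stereo i x * stereo i y.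

Lemma inner3 x y : inner x y =
  stereo i0 x * stereo i0 y + stereo i1 x * stereo i1 y + stereo i2 x * stereo i2 y.
Proof. by rewrite /inner sum3. Qed.

Lemma innerC x y : inner x y = inner y x.
Proof. by rewrite !inner3; congr (_ + _ + _); rewrite mulrC. Qed.

Lemma inner_same x : inner x x = 1.
Proof.
rewrite inner3; case: x => [[a b]|]; last by rewrite /stereo/=; lra.
rewrite -[Some _]/(chart0 (a, b)) !stereo_chart0 [i0]lock [i1]lock [i2]lock /= -!lock.
rewrite [X in X / _ * _ + _ + _]/= [X in _ * (X / _) + _ + _]/=.
have := lt0r_neq0 (oneDr2_gt0 (a, b)); rewrite /oneDr2/= => q0.
by field.
Qed.

(** The square of the chordal distance, scaled so that antipodal points are at distance 1. *)
Definition chord2 x y : R := (1 - inner x y) / 2.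

Lemma chord2E x y : chord2 x y = 4^-1 * \sum_i (stereo i x - stereo i y) ^+ 2.
Proof.
have := inner_same x; have := inner_same y; rewrite /chord2 !inner3 sum3; lra.
Qed.

Lemma chord2_bound x y : 0 <= chord2 x y <= 1.
Proof.
apply/andP; split.
  by rewrite chord2E mulr_ge0 ?invr_ge0// sumr_ge0// => i _; rewrite sqr_ge0.
suff : 0 <= 1 - chord2 x y by lra.
have -> : 1 - chord2 x y = 4^-1 * \sum_i (stereo i x + stereo i y) ^+ 2.
  have := inner_same x; have := inner_same y; rewrite /chord2 !inner3 sum3; lra.
by rewrite mulr_ge0 ?invr_ge0// sumr_ge0// => i _; rewrite sqr_ge0.
Qed.

Lemma chord2_eq0 x y : chord2 x y = 0 <-> y = x.
Proof.
split=> [|->]; last by rewrite /chord2 inner_same subrr mul0r.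
rewrite chord2E => /eqP; rewrite mulf_eq0 invr_eq0 pnatr_eq0/= psumr_eq0; last by move=> i _; rewrite sqr_ge0.
move=> /allP H; apply: stereo_inj => i; apply/esym/eqP; rewrite -subr_eq0 -sqrf_eq0.
by apply: (implyP (H i _)); rewrite ?mem_index_enum.
Qed.

Lemma chord2_continuous x : continuous (chord2 x).
Proof.
move=> y; apply: (@cvgMr_tmp R sphere (nbhs y)); apply: (@cvgB R R^o sphere (nbhs y)); first exact: cvg_cst.
rewrite /continuous_at (_ : inner x = fun y =>
  stereo i0 x * stereo i0 y + stereo i1 x * stereo i1 y + stereo i2 x * stereo i2 y); last first.
  by apply/funext => z; rewrite inner3.
by do 2?apply: (@cvgD R R^o sphere (nbhs y)); apply: (@cvgMl_tmp R sphere (nbhs y)); exact: stereo_continuous.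
Qed.

Lemma inner_norm x y : `|inner x y| <= 1.
Proof. by have := chord2_bound x y; rewrite /chord2 ler_norml => /andP[? ?]; apply/andP; split; lra. Qed.

End sphere_kernel.

(** The mean value theorem on [0, 1] for s |-> ln (1 - s u) plus the partial sum at s u, whose
    derivative collapses by the geometric sum to -u (s u)^N / (1 - s u). *)
Lemma ln_series_bound (R : realType) (t u : R) N : 0 <= t -> t < 1 -> `|u| <= t ->
  `|- ln (1 - u) - \sum_(n < N) u ^+ n.+1 / n.+1%:R| <= t ^+ N / (1 - t).
Proof.
move=> t0 t1 ut.
pose h (s : R) := ln (1 - s * u) + \sum_(n < N) (s * u) ^+ n.+1 / n.+1%:R.
pose dh (s : R) := - u / (1 - s * u) + \sum_(n < N) u * (s * u) ^+ n : R.
have su (s : R) : 0 <= s <= 1 -> `|s * u| <= t.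
  move=> /andP[s0 s1]; rewrite normrM (ger0_norm s0); apply: le_trans ut.
  by rewrite ler_piMl.
have s1 (s : R) : 0 <= s <= 1 -> 0 < 1 - s * u by move=> /su; rewrite ler_norml => /andP[]; lra.
have Dh (s : R) : 0 <= s <= 1 -> is_derive s 1 h (dh s).
  move=> s01; apply: is_deriveD.
    have Dl : is_derive s 1 (fun s : R => 1 - s * u) (- u).
      have -> : (fun s : R => 1 - s * u) = cst 1 - u \*: (@id R) by apply/funext => z; rewrite /= /GRing.scale/= mulrC.
      by apply: is_derive_eq; rewrite sub0r [_ *: _]mulr1.
    rewrite mulrC; exact: (@is_derive1_comp R (@ln R) (fun s => 1 - s * u) s _ _ (is_derive1_ln (s1 _ s01)) Dl).
  clear; elim: N => [|N IH]; first by under eq_fun do rewrite big_ord0; rewrite big_ord0; exact: is_derive_cst.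
  under eq_fun do rewrite big_ord_recr/=; rewrite big_ord_recr/=; apply: is_deriveD => //.
  have -> : (fun z : R => (z * u) ^+ N.+1 / N.+1%:R) = (u ^+ N.+1 / N.+1%:R) \*: ((@id R) ^+ N.+1) by apply/funext => z; rewrite exprfctE /= exprMn /GRing.scale/= [z ^+ _ * _]mulrC mulrAC.
  apply: is_derive_eq; rewrite /GRing.scale/= mulr1 /= exprMn exprS.
  have n0 : N.+1%:R != 0 :> R by rewrite pnatr_eq0.
  by rewrite -[_ *+ N.+1]mulr_natl; move: (s ^+ N) (u ^+ N) N.+1%:R n0 => a b c c0; field.
have [||c c01 E] := @MVT_segment _ h dh 0 1 ler01.
- by move=> x; rewrite in_itv/= => /andP[x0 x1]; apply: Dh; rewrite !ltW.
- apply: derivable_within_continuous => x; rewrite in_itv/= => x01.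
  by have [] := Dh x x01.
have h0 : h 0 = 0.
  rewrite /h mul0r subr0 ln1 add0r big1// => n _.
  by rewrite ?mul0r expr0n/= mul0r.
have h1 : h 1 = ln (1 - u) + \sum_(n < N) u ^+ n.+1 / n.+1%:R by rewrite /h !mul1r.
rewrite -opprD normrN -h1 -[h 1]subr0 -h0 E subr0 mulr1.
rewrite in_itv/= in c01; have cu := su _ c01; have c1 := s1 _ c01.
have -> : dh c = - u * ((c * u) ^+ N / (1 - c * u)).
  have := subrX1 (c * u) N; rewrite /dh -mulr_sumr; set S := \sum_(_ < _) _ => SE.
  have -> : (c * u) ^+ N = 1 - (1 - c * u) * S by move: SE; lra.
  by field; rewrite gt_eqF.
rewrite normrM normrN normrM normfV (gtr0_norm c1) normrX.
apply: le_trans (_ : 1 * (t ^+ N / (1 - t)) <= _); last by rewrite mul1r.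
apply: ler_pM => //; first by rewrite mulr_ge0 ?exprn_ge0// invr_ge0 ltW.
  by apply: le_trans ut _; exact: ltW.
apply: ler_pM => //.
- by rewrite invr_ge0 ltW.
- by rewrite lerXn2r ?nnegrE.
by rewrite lef_pV2 ?posrE ?c1 ?subr_gt0// lerD2l lerN2 (le_trans (ler_norm _) cu).
Qed.

(** * Positivity of the spherical Green kernels *)

Section sphere_green.
Variable R : realType.
Local Notation sphere := (sphere R).
Let T : measurableType _ := borel sphere.
Implicit Types (x y : sphere).
Local Notation eps k := ((k : nat).+1%:R^-1 : R).

Definition sphere_dist x y : R := Num.sqrt (chord2 x y).
(** The factor 1/2 is there because [chord2] is a square; the numerator 1 + eps k makes the kernel
    nonnegative without spoiling monotonicity in k. *)
Definition sphere_green k x y : R := 2^-1 * ln ((1 + eps k) / (chord2 x y + eps k)).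
Local Notation G := sphere_green.

Let c0 x y : 0 <= chord2 x y. Proof. by have /andP[] := chord2_bound x y. Qed.
Let c1 x y : chord2 x y <= 1. Proof. by have /andP[] := chord2_bound x y. Qed.
Let ce k x y : 0 < chord2 x y + eps k. Proof. by rewrite ltr_wpDl. Qed.

Lemma sphere_dist_bound x y : 0 <= sphere_dist x y <= 1.
Proof. rewrite /sphere_dist sqrtr_ge0/=; apply: le_trans (ler_wsqrtr (c1 x y)) _.
by rewrite sqrtr1. Qed.

Lemma sphere_dist_eq0 x y : sphere_dist x y = 0 <-> y = x.
Proof.
rewrite -chord2_eq0 /sphere_dist; split=> [/eqP|->]; last exact: sqrtr0.
by rewrite sqrtr_eq0 => H; apply/eqP; rewrite eq_le H c0.
Qed.

Lemma ln_sphere_dist x y : ln (sphere_dist x y) = 2^-1 * ln (chord2 x y).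
Proof.
rewrite /sphere_dist; have [z|z] := ltP 0 (chord2 x y); last by rewrite ler0_sqrtr// !ln0// mulr0.
rewrite -[in RHS](sqr_sqrtr (ltW z)) lnXn ?sqrtr_gt0// -[X in _ * X]mulr_natl.
by rewrite mulKf.
Qed.

Lemma chord2_measurable : measurable_fun setT (fun p : T * T => chord2 p.1 p.2).
Proof.
apply: measurable_funM => //; apply: measurable_funB => //.
apply: measurable_sum => i; apply: measurable_funM.
  exact: (measurableT_comp (continuous_measurable_borel (@stereo_continuous R i)) measurable_fst).
exact: (measurableT_comp (continuous_measurable_borel (@stereo_continuous R i)) measurable_snd).
Qed.

Lemma sphere_dist_measurable : measurable_fun setT (fun p : T * T => sphere_dist p.1 p.2).
Proof.
exact: (measurableT_comp (continuous_measurable_fun (@sqrt_continuous R)) chord2_measurable).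
Qed.

Lemma sphere_green_bound k x y : 0 <= G k x y <= 2^-1 * ln ((1 + eps k) / eps k).
Proof.
rewrite mulr_ge0 ?invr_ge0 ?ln_ge0//=; last first.
  by rewrite ler_pdivlMr// mul1r lerD2r.
rewrite ler_pM2l ?invr_gt0// ler_ln ?posrE ?divr_gt0 ?ce ?addr_gt0//.
by rewrite ler_pM2l ?addr_gt0// lef_pV2 ?posrE// lerDr.
Qed.

Lemma sphere_green_bounded k : bounded_kernel (T := T) (G k).
Proof.
split; last first.
  exists (2^-1 * ln ((1 + eps k) / eps k)) => p.
  by have /andP[g0 g1] := sphere_green_bound k p.1 p.2; rewrite ger0_norm.
have -> : (fun p => G k p.1 p.2) = (fun p : T * T => 2^-1 * (ln (1 + eps k) - ln (chord2 p.1 p.2 + eps k))) by apply/funext => p; rewrite /G ln_div ?posrE ?ce ?addr_gt0.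
apply: measurable_funM => //; apply: measurable_funB => //; apply: (measurableT_comp (@measurable_ln R)).
by apply: measurable_funD => //; exact: chord2_measurable.
Qed.

Lemma sphere_green_nd x y k l : (k <= l)%N -> G k x y <= G l x y.
Proof.
move=> kl; rewrite ler_pM2l ?invr_gt0// ler_ln ?posrE ?divr_gt0 ?ce ?addr_gt0//.
rewrite ler_pdivrMr// mulrAC ler_pdivlMr//.
have lk : 0 <= eps k - eps l by rewrite subr_ge0 lef_pV2 ?posrE// ler_nat.
have c10 : 0 <= 1 - chord2 x y by rewrite subr_ge0.
by rewrite -subr_ge0; have := mulr_ge0 lk c10; move: (eps k) (eps l) => a b; lra.
Qed.

Lemma sphere_green_eq0 k x y : chord2 x y = 0 -> G k x y = 2^-1 * ln (1 + k.+1%:R).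
Proof. by move=> z; rewrite /G z add0r invrK mulrDl mul1r mulVf// addrC. Qed.

Lemma eps_cvg : eps k @[k --> \oo] --> (0 : R).
Proof. exact: cvg_harmonic. Qed.

Lemma sphere_green_cvg x y : sphere_dist x y != 0 -> G k x y @[k --> \oo] --> - ln (sphere_dist x y).
Proof.
move=> d0; have z0 : 0 < chord2 x y.
  by rewrite lt_neqAle c0 eq_sym andbT; apply: contra_neq d0 => z; rewrite /sphere_dist z sqrtr0.
rewrite ln_sphere_dist -mulrN; apply: cvgMr_tmp || apply: cvgMl_tmp.
rewrite -lnV ?posrE//.
have E : (chord2 x y)^-1 = (1 + 0) / (chord2 x y + 0) by rewrite !addr0 mul1r.
apply: (@cvg_comp _ _ _ (fun k => (1 + eps k) / (chord2 x y + eps k)) (@ln R)); last first.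
  by apply: continuous_ln; rewrite invr_gt0.
rewrite E; apply: cvgM; first by apply: cvgD; [exact: cvg_cst | exact: eps_cvg].
apply: cvgV; first by rewrite addr0 gt_eqF.
by apply: cvgD; [exact: cvg_cst | exact: eps_cvg].
Qed.

Lemma sphere_green_div x y : sphere_dist x y = 0 -> forall B, exists k, B <= G k x y.
Proof.
move=> /sphere_dist_eq0/chord2_eq0 z B; exists (Num.bound (expR (2 * B))).
rewrite sphere_green_eq0// mulrC ler_pdivlMr// mulrC -[leLHS]expRK ler_ln ?posrE ?expR_gt0//.
by apply: le_trans (ltW (archi_boundP (expR_ge0 _))) _; rewrite -natr1; lra.
Qed.

End sphere_green.

Section sphere_positivity.
Variables (R : realType) (A : choiceType) (pt : A -> sphere R).
Local Notation sphere := (sphere R).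
Let T : measurableType _ := borel sphere.
Variable rho : probability T R.
Let pt' : A -> T := pt.
Local Notation eps k := ((k : nat).+1%:R^-1 : R).
Local Notation G := (@sphere_green R).
Let ratio k : R := (1 + 2 * eps k)^-1.

Let ratio_gt0 k : 0 < ratio k.
Proof. by rewrite invr_gt0 addr_gt0// mulr_gt0. Qed.

Let ratio_lt1 k : ratio k < 1.
Proof. by rewrite invf_lt1 ?addr_gt0 ?mulr_gt0// ltrDl mulr_gt0. Qed.

Let ratio_ge k : (1 <= k)%N -> 2^-1 <= ratio k.
Proof.
move=> k1; rewrite lef_pV2 ?posrE ?addr_gt0 ?mulr_gt0//.
have : eps k <= 2^-1 by rewrite lef_pV2 ?posrE// ler_nat.
by move: (eps k) => e; lra.
Qed.

(** Since chord2 + eps k = (1 - r t) / (2 r), with r = ratio k and t the inner product, the kernel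
    is a constant minus ln (1 - r t) / 2, and this has a power series in t with nonnegative
    coefficients. *)
Let green_lnE k x y :
  G k x y = 2^-1 * ln ((1 + eps k) * (2 * ratio k)) + 2^-1 * - ln (1 - ratio k * inner x y).
Proof.
have r0 := ratio_gt0 k; have r1 := ratio_lt1 k.
have s1 : 0 < 1 - ratio k * inner x y.
  have := inner_norm x y; rewrite ler_norml => /andP[_]; nra.
rewrite /sphere_green -mulrDr -ln_div ?posrE ?s1 ?mulr_gt0 ?addr_gt0//.
congr (_ * ln _); rewrite -mulrA; congr (_ * _).
have E : 1 + 2 * eps k = (ratio k)^-1 by rewrite invrK.
have -> : chord2 x y + eps k = ((ratio k)^-1 - inner x y) / 2 by rewrite -E /chord2; move: (eps k) (inner x y) => a b; lra.
by move: s1; move: (ratio k) (inner x y) r0 => a b a0 ab0; field; rewrite !gt_eqF//; nra.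
Qed.

Definition stereo_monomial (s : seq 'I_3) (x : sphere) : R := \prod_(i <- s) stereo i x.

Lemma stereo_monomial_continuous s : continuous (stereo_monomial s).
Proof.
elim: s => [|i s IH] x; rewrite /stereo_monomial.
  by under eq_fun do rewrite big_nil; exact: cst_continuous.
under eq_fun do rewrite big_cons.
by apply: (@cvgM R sphere (nbhs x)); [exact: stereo_continuous | exact: IH].
Qed.

Let monomial_bm s : bounded_mfun (T := T) (stereo_monomial s).
Proof.
by apply: continuous_bounded_mfun; [exact: sphere_compact | exact: stereo_monomial_continuous].
Qed.

Section fixed.
Variables (F : {fset A}) (F0 : F != fset0).
Local Notation dev := (deviation pt' rho F).
Local Notation qd := (quad pt' rho F).

Let power_tensor n x y : inner x y ^+ n =
  \sum_(f : {ffun 'I_n -> 'I_3}) stereo_monomial (codom f) x * stereo_monomial (codom f) y.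
Proof.
rewrite -[n in LHS]card_ord -prodr_const /inner bigA_distr_bigA.
apply: eq_bigr => f _; rewrite big_split /stereo_monomial; congr (_ * _);
  by rewrite codomE big_map big_enum.
Qed.

Let tensor_bk (f : T -> R) : bounded_mfun (T := T) f -> bounded_kernel (T := T) (fun x y => f x * f y).
Proof.
move=> [mf [B fB]]; split; last by exists (B * B) => p; rewrite normrM ler_pM.
by apply: measurable_funM; [exact: (measurableT_comp mf measurable_fst) |
  exact: (measurableT_comp mf measurable_snd)].
Qed.

Let power_bk n : bounded_kernel (T := T) (fun x y => inner x y ^+ n).
Proof.
under eq_fun do under eq_fun do rewrite power_tensor.
by apply: bounded_kernel_sum => f; exact: tensor_bk.
Qed.

(** A power of the inner product expands into a sum of tensor squares of monomials in the
    coordinates. *)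
Lemma quad_inner_power n : qd (fun x y => inner x y ^+ n) =
  \sum_(f : {ffun 'I_n -> 'I_3}) dev (stereo_monomial (codom f)) ^+ 2.
Proof.
under eq_fun do under eq_fun do rewrite power_tensor.
rewrite (quad_sum pt' rho F); last by move=> f; exact: tensor_bk.
by apply: eq_bigr => f _; rewrite quad_tensor.
Qed.

Let series k N x y : R := \sum_(n < N) (ratio k) ^+ n.+1 / n.+1%:R * inner x y ^+ n.+1.

Let series_bk k N : bounded_kernel (T := T) (series k N).
Proof. by apply: bounded_kernel_sum => n; apply: bounded_mfunZ; exact: power_bk. Qed.

Let quad_series k N : qd (series k N) =
  \sum_(n < N) (ratio k) ^+ n.+1 / n.+1%:R * qd (fun x y => inner x y ^+ n.+1).
Proof.
rewrite (quad_sum pt' rho F); last by move=> n; apply: bounded_mfunZ; exact: power_bk.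
by apply: eq_bigr => n _; rewrite quadZ//; exact: power_bk.
Qed.

Let quad_green_series k N :
  `|qd (G k) - 2^-1 * qd (series k N)| <= 2 * (ratio k ^+ N / (1 - ratio k)).
Proof.
pose c : R := 2^-1 * ln ((1 + eps k) * (2 * ratio k)).
have bc : bounded_kernel (T := T) (fun _ _ => c) by exact: bounded_mfun_cst.
have bS := bounded_mfunZ 2^-1 (series_bk k N).
have bG : bounded_kernel (T := T) (G k) by exact: sphere_green_bounded.
have qc : qd (fun _ _ => c) = 0.
  rewrite (_ : (fun _ _ => c) = (fun _ _ => c * (cst (1 : R) (tt : unit) * cst 1 tt))); last first.
    by apply/funext => ?; apply/funext => ?; rewrite /= !mulr1.
  rewrite (quadZ pt' rho F c (tensor_bk (bounded_mfun_cst 1))).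
  rewrite (quad_tensor pt' rho F (bounded_mfun_cst 1)).
  by rewrite deviation_cst// expr0n mulr0.
rewrite -quadZ// -[qd (G k)]subr0 -qc -quadB// -quadB//; last exact: bounded_mfunB.
rewrite (_ : 2 * _ = 4 * (2^-1 * (ratio k ^+ N / (1 - ratio k)))); last first.
  by rewrite mulrA; congr (_ * _); lra.
apply: quad_norm => //; first by apply: bounded_mfunB => //; exact: bounded_mfunB.
move=> x y; rewrite green_lnE -/c [X in X - _]addrC addKr || rewrite green_lnE -/c [c + _]addrC addrK.
rewrite -mulrBr normrM ger0_norm ?invr_ge0// ler_pM2l ?invr_gt0//.
have tu : `|ratio k * inner x y| <= ratio k by rewrite normrM gtr0_norm// ler_piMr ?inner_norm// ltW.
have := ln_series_bound N (ltW (ratio_gt0 k)) (ratio_lt1 k) tu.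
rewrite /series; under eq_bigr do rewrite exprMn mulrAC.
by [].
Qed.

Let quad_power_ge0 n : 0 <= qd (fun x y => inner x y ^+ n).
Proof. by rewrite quad_inner_power sumr_ge0// => f _; rewrite sqr_ge0. Qed.

(** All terms of the series have nonnegative forms, so a single one is a lower bound; the constant
    term has form 0 because [F] - rho has mass 0. *)
Lemma quad_green_ge k n :
  2^-1 * (ratio k ^+ n.+1 / n.+1%:R * qd (fun x y => inner x y ^+ n.+1)) <= qd (G k).
Proof.
apply/ler_addgt0Pr => e e_gt0; have r1 : 0 < 1 - ratio k by rewrite subr_gt0.
have /cvgrPdist_le/(_ (e * (1 - ratio k) / 2)) : ratio k ^+ N @[N --> \oo] --> (0 : R) by apply: cvg_expr; rewrite gtr0_norm.
case; first by rewrite divr_gt0 ?mulr_gt0.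
move=> N0 _ /(_ (maxn n.+1 N0))/=; rewrite leq_maxr sub0r normrN => /(_ isT).
set N := maxn _ _; rewrite ger0_norm ?exprn_ge0 ?(ltW (ratio_gt0 k))// => rN.
have rem : 2 * (ratio k ^+ N / (1 - ratio k)) <= e by rewrite mulrA ler_pdivrMr// mulrC -ler_pdivlMr.
have := le_trans (quad_green_series k N) rem; rewrite ler_norml => /andP[+ _].
rewrite -subr_ge0 opprK addrAC => H; rewrite -subr_ge0; apply: le_trans H _.
rewrite lerD2r || idtac.
have nN : (n < N)%N by rewrite leq_max leqnn.
have : ratio k ^+ n.+1 / n.+1%:R * qd (fun x y => inner x y ^+ n.+1) <= qd (series k N).
  rewrite quad_series (bigD1 (Ordinal nN))//= lerDl sumr_ge0// => i _.
  by rewrite mulr_ge0// divr_ge0 ?exprn_ge0// ltW.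
by rewrite lerD2l lerN2 ler_pM2l ?invr_gt0//.
Qed.

Lemma quad_green_ge0 k : 0 <= qd (G k).
Proof.
apply: le_trans (quad_green_ge k 0); by rewrite !mulr_ge0 ?invr_ge0// exprn_ge0 ?ltW.
Qed.

(** The square is one of those composing the term of degree [size s]. For k >= 1 the ratio is at
    least 1/2, which makes the constant independent of k. *)
Lemma deviation_monomial k s : (1 <= k)%N -> s != [::] ->
  dev (stereo_monomial s) ^+ 2 <= 2 * (size s)%:R * 2 ^+ size s * qd (G k).
Proof.
move=> k1; case: s => // i s _; set n := size s; rewrite -[size _]/n.+1.
have := quad_green_ge k n; rewrite quad_inner_power.
have [f fs] : exists f : {ffun 'I_n.+1 -> 'I_3}, codom f = i :: s :> seq _.
  exists [ffun j => tnth (in_tuple (i :: s)) j].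
  by rewrite codomE -[RHS](map_tnth_enum (in_tuple (i :: s))); apply: eq_map => j; rewrite ffunE.
rewrite (bigD1 f)//= fs; set S := \sum_(_ | _) _.
have S0 : 0 <= S by rewrite sumr_ge0// => j _; rewrite sqr_ge0.
set D := _ ^+ 2; have D0 : 0 <= D by rewrite sqr_ge0.
have : 2^-1 ^+ n.+1 <= ratio k ^+ n.+1 by rewrite lerXn2r ?nnegrE ?ratio_ge// ltW.
set r := ratio k ^+ n.+1 => rn H.
have p2 : 0 < (2 : R) ^+ n.+1 by rewrite exprn_gt0.
have n0 : 0 < n.+1%:R :> R by [].
have : 2^-1 * (2^-1 ^+ n.+1 / n.+1%:R * D) <= qd (G k).
  apply: le_trans H; rewrite ler_pM2l ?invr_gt0//; apply: ler_pM => //.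
  - by rewrite ler_pM2r ?invr_gt0.
  - by rewrite lerDl.
move: (qd (G k)) => Q; rewrite exprVn.
have -> : 2^-1 * (2 ^- n.+1 / n.+1%:R * D) = D / (2 * n.+1%:R * 2 ^+ n.+1) by move: p2 n0; set a := 2 ^+ _; set b := _%:R => a0 b0; field; rewrite ?gt_eqF.
by rewrite ler_pdivrMr ?mulr_gt0// mulrC.
Qed.

End fixed.
Inductive stereo_poly : (sphere -> R) -> Prop :=
| stereo_poly_monomial c s : stereo_poly (fun x => c * stereo_monomial s x)
| stereo_polyD f g : stereo_poly f -> stereo_poly g -> stereo_poly (f \+ g).

Lemma stereo_polyM f g : stereo_poly f -> stereo_poly g -> stereo_poly (f \* g).
Proof.
move=> sf sg; elim: sf => {f} [c s|f f' _ IH _ IH']; last first.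
  rewrite (_ : _ \* _ = (f \* g) \+ (f' \* g)); first exact: stereo_polyD.
  by apply/funext => x /=; rewrite mulrDl.
elim: sg => {g} [c' s'|f f' _ IH _ IH'].
  rewrite (_ : _ \* _ = fun x => (c * c') * stereo_monomial (s ++ s') x); first exact: stereo_poly_monomial.
  by apply/funext => x; rewrite /= mulrACA /stereo_monomial big_cat.
rewrite (_ : _ \* _ = ((fun x => c * stereo_monomial s x) \* f) \+ ((fun x => c * stereo_monomial s x) \* f')).
  exact: stereo_polyD.
by apply/funext => x /=; rewrite mulrDr.
Qed.

Lemma stereo_poly_continuous f : stereo_poly f -> continuous f.
Proof.
elim=> {f} [c s|f g _ cf _ cg] x; last exact: (@cvgD R R^o sphere (nbhs x) _ f g _ _ (cf x) (cg x)).
exact: (@cvgMl_tmp R sphere (nbhs x) _ _ c _ (@stereo_monomial_continuous s x)).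
Qed.

Lemma stereo_poly_approx f e : continuous f -> 0 < e ->
  exists2 g, stereo_poly g & forall x, `|f x - g x| <= e.
Proof.
move=> cf e_gt0; apply: (stone_weierstrass (@sphere_compact R)) => //.
- exact: stereo_poly_continuous.
- move=> c; rewrite (_ : cst c = fun x => c * stereo_monomial [::] x); first exact: stereo_poly_monomial.
  by apply/funext => x; rewrite /stereo_monomial big_nil mulr1.
- exact: stereo_polyD.
- exact: stereo_polyM.
move=> x y xy; apply: contrapT => H; apply: xy; apply: stereo_inj => i; apply: contrapT => /eqP xyi.
apply: H; exists (fun x => 1 * stereo_monomial [:: i] x); first exact: stereo_poly_monomial.
by rewrite !mul1r /stereo_monomial !big_seq1.
Qed.

Lemma sphere_testable f : continuous f -> testable pt' rho G f.
Proof.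
have bm h : continuous h -> bounded_mfun (T := T) h.
  by move=> ch; apply: continuous_bounded_mfun => //; exact: sphere_compact.
move=> cf; apply: testable_approx => [|e e_gt0]; first exact: bm.
have [g sg fg] := stereo_poly_approx cf e_gt0; exists g; split => //.
  by apply: bm; exact: stereo_poly_continuous.
elim: sg => {g fg} [c s|g g' sg tg sg' tg'].
  apply: testableZ => //; have [->|s0] := eqVneq s [::].
    apply: (@testable_quad _ _ _ _ _ _ _ _ 0%N 0) => // k F _ F0.
    rewrite (_ : stereo_monomial _ = cst 1); last by apply/funext => x; rewrite /stereo_monomial big_nil.
    by rewrite deviation_cst// expr0n mul0r.
  apply: (@testable_quad _ _ _ _ _ _ _ _ 1%N (2 * (size s)%:R * 2 ^+ size s)) => [|k F k1 F0].
    by rewrite !mulr_ge0 ?exprn_ge0.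
  exact: deviation_monomial.
by apply: testableD => //; apply: bm; exact: stereo_poly_continuous.
Qed.

End sphere_positivity.

(** * The Laplacian of the logarithm of a circular quadratic polynomial *)

Section planar_quadratic.
Variable R : realType.
Implicit Types (p v : R * R) (a b c d : R).

Definition pquad a b c d p : R := a * (p.1 ^+ 2 + p.2 ^+ 2) - b * p.1 - c * p.2 + d.
Definition dpquad a b c v p : R := 2 * a * (p.1 * v.1 + p.2 * v.2) - b * v.1 - c * v.2.

Lemma pquad_smooth a b c d : smooth_fun (pquad a b c d).
Proof.
have s1 := smooth_fst R; have s2 := smooth_snd R.
have -> : pquad a b c d = fun p => a * (p.1 ^+ 2 + p.2 ^+ 2) + (- b) * p.1 + (- c) * p.2 + d by apply/funext => p; rewrite /pquad !mulNr.
by do ?[apply: smoothD | apply: smoothM | apply: smoothX | exact: smooth_cst].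
Qed.

Lemma is_derive_pquad a b c d p v : is_derive p v (pquad a b c d) (dpquad a b c v p).
Proof.
have d1 := is_derive_fst p v; have d2 := is_derive_snd p v.
have dd := is_deriveD (is_deriveB (is_deriveB (is_deriveZ a (is_deriveD (is_deriveM d1 d1)
  (is_deriveM d2 d2))) (is_deriveZ b d1)) (is_deriveZ c d2)) (is_derive_cst d p v).
by apply: (is_derive_eq dd); rewrite /GRing.scale/= /dpquad; ring.
Qed.

Lemma is_derive_dpquad a b c p v : is_derive p v (dpquad a b c v) (2 * a * (v.1 ^+ 2 + v.2 ^+ 2)).
Proof.
have d1 := is_derive_fst p v; have d2 := is_derive_snd p v.
have -> : dpquad a b c v =
    (2 * a * v.1) *: (@fst R R) + (2 * a * v.2) *: (@snd R R) + cst (- b * v.1 - c * v.2).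
  by apply/funext => z; rewrite /dpquad /= !fctE /= /GRing.scale/=; ring.
have dd := is_deriveD (is_deriveD (is_deriveZ (2 * a * v.1) d1) (is_deriveZ (2 * a * v.2) d2))
  (is_derive_cst (- b * v.1 - c * v.2) p v).
by apply: (is_derive_eq dd); rewrite /GRing.scale/=; ring.
Qed.

Lemma is_derive_ln_pquad a b c d p v : 0 < pquad a b c d p ->
  is_derive p v (fun p => ln (pquad a b c d p)) (dpquad a b c v p / pquad a b c d p).
Proof.
move=> q0; rewrite mulrC.
exact: (is_derive_comp1 (is_derive_pquad a b c d p v) (is_derive1_ln q0)).
Qed.

Lemma is_derive_dln_pquad a b c d p v : 0 < pquad a b c d p ->
  is_derive p v (fun p => dpquad a b c v p / pquad a b c d p)
    ((2 * a * (v.1 ^+ 2 + v.2 ^+ 2) * pquad a b c d p - dpquad a b c v p ^+ 2) / pquad a b c d p ^+ 2).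
Proof.
move=> q0.
have HV := @is_deriveV R id (pquad a b c d p) 1 1 (lt0r_neq0 q0) (is_derive_id _ _).
have H := is_derive_comp1 (is_derive_pquad a b c d p v) HV.
have HM := is_deriveM (is_derive_dpquad a b c p v) H.
apply: (is_derive_eq HM); rewrite /GRing.scale/= mulr1.
by have := lt0r_neq0 q0; set Q := pquad _ _ _ _ _ => Q0; field.
Qed.

(** With E = a d - (b^2 + c^2)/4, the polynomial Q satisfies |grad Q|^2 = 4 a Q - 4 E, so the
    Laplacian of ln Q is 4 E / Q^2. The term of [oneDr2] is the case E = 1. *)
Lemma ddc_ln_pquad (phi : sphere R -> R) C a b c d p : (forall p, 0 < pquad a b c d p) ->
  phi \o @chart0 R = (fun p => C - 2^-1 * ln (pquad a b c d p) + 2^-1 * ln (oneDr2 p)) ->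
  ddc phi p = pi^-1 / oneDr2 p ^+ 2 - (a * d - (b ^+ 2 + c ^+ 2) / 4) / pi / pquad a b c d p ^+ 2.
Proof.
move=> q0 phiE.
have P1 z : oneDr2 z = pquad 1 0 0 1 z by rewrite /pquad /oneDr2; ring.
have p0 z : 0 < pquad 1 0 0 1 z by rewrite -P1 oneDr2_gt0.
have {}phiE : phi \o @chart0 R = cst C + (- 2^-1) *: (fun p => ln (pquad a b c d p)) +
    2^-1 *: (fun p => ln (pquad 1 0 0 1 p)).
  by rewrite phiE; apply/funext => z; rewrite P1 !fctE /GRing.scale/= mulNr.
have D1 v z : is_derive z v (phi \o @chart0 R)
    (- 2^-1 * (dpquad a b c v z / pquad a b c d z) + 2^-1 * (dpquad 1 0 0 v z / pquad 1 0 0 1 z)).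
  have h1 := is_derive_ln_pquad v (q0 z); have h2 := is_derive_ln_pquad v (p0 z).
  have dd := is_deriveD (is_deriveD (is_derive_cst C z v) (is_deriveZ (- 2^-1) h1)) (is_deriveZ 2^-1 h2).
  by rewrite phiE; apply: (is_derive_eq dd); rewrite add0r.
have E1 v : 'D_v (phi \o @chart0 R) = (- 2^-1) *: (fun z => dpquad a b c v z / pquad a b c d z) +
    2^-1 *: (fun z => dpquad 1 0 0 v z / pquad 1 0 0 1 z).
  by apply/funext => z; rewrite (@derive_val _ _ _ _ _ _ _ (D1 v z)) fctE.
have D2 v : 'D_v ('D_v (phi \o @chart0 R)) p =
  - 2^-1 * ((2 * a * (v.1 ^+ 2 + v.2 ^+ 2) * pquad a b c d p - dpquad a b c v p ^+ 2) / pquad a b c d p ^+ 2)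
  + 2^-1 * ((2 * 1 * (v.1 ^+ 2 + v.2 ^+ 2) * pquad 1 0 0 1 p - dpquad 1 0 0 v p ^+ 2) / pquad 1 0 0 1 p ^+ 2).
  rewrite E1; have h1 := is_derive_dln_pquad v (q0 p); have h2 := is_derive_dln_pquad v (p0 p).
  by have dd := is_deriveD (is_deriveZ (- 2^-1) h1) (is_deriveZ 2^-1 h2); exact: (@derive_val _ _ _ _ _ _ _ dd).
rewrite /ddc !D2 P1 /dir_x /dir_y /=.
have pi0 : (pi : R) != 0 by rewrite gt_eqF// pi_gt0.
have H1 : (p.1 ^+ 2 + p.2 ^+ 2) = pquad 1 0 0 1 p - 1 by rewrite /pquad; ring.
have H2 : (2 * a * p.1 - b) ^+ 2 + (2 * a * p.2 - c) ^+ 2 =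
    4 * a * pquad a b c d p - 4 * (a * d - (b ^+ 2 + c ^+ 2) / 4).
  by rewrite /pquad; field.
have -> : dpquad a b c (1, 0) p = 2 * a * p.1 - b by rewrite /dpquad/=; ring.
have -> : dpquad a b c (0, 1) p = 2 * a * p.2 - c by rewrite /dpquad/=; ring.
have -> : dpquad 1 0 0 (1, 0) p = 2 * p.1 by rewrite /dpquad/=; ring.
have -> : dpquad 1 0 0 (0, 1) p = 2 * p.2 by rewrite /dpquad/=; ring.
have := lt0r_neq0 (q0 p); have := lt0r_neq0 (p0 p).
move: H1 H2; set P := pquad 1 0 0 1 p; set Q := pquad a b c d p.
set X := 2 * a * p.1 - b; set Y := 2 * a * p.2 - c; set E := a * d - _.
move=> H1 H2 P0 Q0.
have -> : X ^+ 2 = 4 * a * Q - 4 * E - Y ^+ 2 by rewrite -H2; ring.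
have -> : (2 * p.1) ^+ 2 = 4 * (P - 1) - (2 * p.2) ^+ 2 by rewrite -H1; ring.
move: (pi : R) pi0 (Y) (2 * p.2) => w w0 y z; field; rewrite ?w0 ?P0 ?Q0//.
Qed.

End planar_quadratic.

(** * Planar integrals and the circle *)

Section planar_integral.
Variable R : realType.
Local Notation leb := (@lebesgue_measure R).
Local Notation mu2 := (leb \x leb)%E.
Implicit Types (p : R * R).

Definition round_density p : R := pi^-1 / oneDr2 p ^+ 2.

Lemma ge0_integral_affine (G : R -> R) (s x0 : R) : 0 < s -> continuous G -> (forall x, 0 <= G x) ->
  (\int[leb]_x (s * G (s * (x - x0)))%:E = \int[leb]_x (G x)%:E)%E.
Proof.
move=> s0 cG G0.
pose F := fun x : R => s * (x - x0).
have DF (x : R) : is_derive x 1 F s.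
  have -> : F = s \*: ((@id R) - cst x0) by apply/funext.
  by apply: is_derive_eq; rewrite subr0 [_ *: _]mulr1.
have dF : (F^`())%classic = cst s by apply/funext => x; rewrite derive1E (@derive_val _ _ _ _ _ _ _ (DF x)).
rewrite (@increasing_ge0_integration_by_substitutionT R F G) //.
- by apply: eq_integral => x _; rewrite dF /= fctE mulrC.
- by move=> x y xy; rewrite /F ltr_pM2l// ltrD2r.
- by rewrite dF; exact: cst_continuous.
- by rewrite dF; exact: is_cvg_cst.
- by rewrite dF; exact: is_cvg_cst.
- apply/cvgrNyPle => B; near=> x; rewrite /F -ler_pdivlMl// lerBlDr.
  by near: x; apply: nbhs_ninfty_le; exact: num_real.
- apply/cvgryPge => B; near=> x; rewrite /F -ler_pdivrMl// lerBrDr.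
  by near: x; apply: nbhs_pinfty_ge; exact: num_real.
Unshelve. all: by end_near. Qed.

Lemma smooth_fun_measurable (f : R * R -> R) : smooth_fun f ->
  measurable_fun setT (f : measurableTypeR R * measurableTypeR R -> R).
Proof.
elim=> {f} [c|||f g _ mf _ mg|f g _ mf _ mg|f _ mf f0|f _ mf f0].
- exact: measurable_cst.
- exact: measurable_fst.
- exact: measurable_snd.
- exact: measurable_funD.
- exact: measurable_funM.
- rewrite (_ : (fun p => _) = fun p => expR (- ln (f p))); first by do 3![apply: measurableT_comp => //].
  by apply/funext => p; rewrite expRN lnK// posrE.
- by apply: measurableT_comp.
Qed.

Let M (f : R * R -> R) : smooth_fun f ->
  measurable_fun setT (EFin \o (f : measurableTypeR R * measurableTypeR R -> R)).
Proof. by move=> sf; apply/measurable_EFinP; exact: smooth_fun_measurable. Qed.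

Lemma smooth_affine (f : R * R -> R) (s t x0 y0 : R) : smooth_fun f ->
  smooth_fun (fun p => f (s * (p.1 - x0), t * (p.2 - y0))).
Proof.
have aff (s' : R) u z : smooth_fun u -> smooth_fun (fun p : R * R => s' * (u p - z)) by move=> su; apply: smoothM; [exact: smooth_cst | apply: smoothD => //; exact: smooth_cst].
elim=> {f} [c|||f g _ mf _ mg|f g _ mf _ mg|f _ mf f0|f _ mf f0].
- exact: smooth_cst.
- by apply: aff; exact: smooth_fst.
- by apply: aff; exact: smooth_snd.
- exact: smoothD.
- exact: smoothM.
- exact: smoothV.
- exact: smooth_ln.
Qed.

Lemma ge0_integral_affine2 (f : R * R -> R) (s x0 y0 : R) : 0 < s -> smooth_fun f -> (forall p, 0 <= f p) ->
  (\int[mu2]_p (s ^+ 2 * f (s * (p.1 - x0), s * (p.2 - y0)))%:E = \int[mu2]_p (f p)%:E)%E.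
Proof.
move=> s0 sf f0.
have cf := smooth_continuous sf.
have c1 y : continuous (fun x => f (x, y)).
  move=> x; apply: (@continuous_comp _ _ _ (fun x : R => (x, y)) f); last exact: cf.
  exact: (cvg_pair (@cvg_id _ (nbhs x)) (@cst_continuous R R y x)).
have c2 x : continuous (fun y => f (x, y)).
  move=> y; apply: (@continuous_comp _ _ _ (fun y : R => (x, y)) f); last exact: cf.
  exact: (cvg_pair (@cst_continuous R R x y) (@cvg_id _ (nbhs y))).
have s2 : smooth_fun (fun p => s ^+ 2 * f (s * (p.1 - x0), s * (p.2 - y0))) by apply: smoothM; [exact: smooth_cst | exact: smooth_affine].
have s3 : smooth_fun (fun p => s * f (s * (p.1 - x0), p.2)).
  apply: smoothM; first exact: smooth_cst.
  by have := smooth_affine s 1 x0 0 sf; under eq_fun do rewrite subr0 mul1r.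
rewrite fubini_tonelli1; [|exact: M|by move=> p; rewrite lee_fin mulr_ge0 ?sqr_ge0].
transitivity (\int[leb]_x \int[leb]_y (s * f (s * (x - x0), y))%:E)%E.
  apply: eq_integral => x _; rewrite /fubini_F/=.
  rewrite -(@ge0_integral_affine (fun y => s * f (s * (x - x0), y)) s y0) //.
  - by apply: eq_integral => y _; rewrite mulrA expr2.
  - by move=> y; apply: cvgMl_tmp; exact: c2.
  - by move=> y; rewrite mulr_ge0// ltW.
have FT := @fubini_tonelli _ _ _ _ R leb leb (fun p => (s * f (s * (p.1 - x0), p.2))%:E) (M s3).
rewrite FT.
  rewrite fubini_tonelli2; [|exact: M|by move=> p; rewrite lee_fin].
  by apply: eq_integral => y _; apply: (ge0_integral_affine x0 s0 (c1 y)).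
by move=> p; rewrite lee_fin mulr_ge0// ltW.
Qed.

Lemma round_density_smooth : smooth_fun round_density.
Proof.
apply: smoothM; first exact: smooth_cst.
by apply: smoothV => [|p]; [apply: smoothX; exact: smooth_oneDr2 | rewrite exprn_gt0// oneDr2_gt0].
Qed.

Lemma round_density_ge0 p : 0 <= round_density p.
Proof. by rewrite divr_ge0 ?exprn_ge0 ?invr_ge0 ?(ltW (oneDr2_gt0 _))// ltW// pi_gt0. Qed.

Let integral_oneDsqr : (\int[leb]_x ((oneDsqr x)^-1)%:E = pi%:E)%E.
Proof.
rewrite (@ge0_symfun_integralT R (fun x => (oneDsqr x)^-1)).
- by rewrite -set_itvcy integral0y_oneDsqr -EFinM mulrC divfK.
- by move=> x; rewrite invr_ge0 addr_ge0 ?sqr_ge0.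
- exact: continuous_oneDsqrV.
- by move=> x; rewrite /= /oneDsqr sqrrN.
Qed.

(** Comparison with a product of one-variable densities: (1 + x^2 + y^2)^2 >= (1 + x^2)(1 + y^2). *)
Lemma round_density_fin : (\int[mu2]_p (round_density p)%:E < +oo)%E.
Proof.
have sm (u : R * R -> R) : smooth_fun u -> smooth_fun (fun p => (oneDsqr (u p))^-1).
  move=> su; apply: smoothV => [|p]; last by rewrite ltr_wpDr ?sqr_ge0.
  by apply: smoothD; [exact: smooth_cst | exact: smoothX].
have sW : smooth_fun (fun p : R * R => (oneDsqr p.1)^-1 * (oneDsqr p.2)^-1) by apply: smoothM; apply: sm; [exact: smooth_fst | exact: smooth_snd].
have d0 (x : R) : 0 < oneDsqr x by rewrite ltr_wpDr ?sqr_ge0.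
apply: (@le_lt_trans _ _ (\int[mu2]_p ((oneDsqr p.1)^-1 * (oneDsqr p.2)^-1)%:E)%E).
  apply: ge0_le_integral => //.
  - by move=> p _; rewrite lee_fin round_density_ge0.
  - by apply: M; exact: round_density_smooth.
  - exact: M.
  move=> p _; rewrite lee_fin /round_density -invfM -invfM lef_pV2 ?posrE ?mulr_gt0 ?exprn_gt0 ?oneDr2_gt0 ?pi_gt0//.
  apply: le_trans (_ : 1 * oneDr2 p ^+ 2 <= _); last first.
    by rewrite ler_pM2r ?exprn_gt0 ?oneDr2_gt0//; have := @pi_ge2 R; lra.
  rewrite mul1r /oneDsqr /oneDr2; have := mulr_ge0 (sqr_ge0 p.1) (sqr_ge0 p.2).
  have := sqr_ge0 (p.1 ^+ 2 + p.2 ^+ 2); have := sqr_ge0 p.1; have := sqr_ge0 p.2.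
  have := sqr_ge0 (p.1 ^+ 2); have := sqr_ge0 (p.2 ^+ 2); nra.
rewrite fubini_tonelli1; [|exact: M|by move=> p; rewrite lee_fin mulr_ge0// invr_ge0 ltW].
have moD : measurable_fun setT (fun y : R => ((oneDsqr y)^-1)%:E) by apply/measurable_EFinP; apply: continuous_measurable_fun; exact: continuous_oneDsqrV.
have I (x : R) : fubini_F leb (fun p => ((oneDsqr p.1)^-1 * (oneDsqr p.2)^-1)%:E) x =
    (pi%:E * ((oneDsqr x)^-1)%:E)%E.
  rewrite /fubini_F/=; under eq_integral do rewrite EFinM.
  by rewrite ge0_integralZl_EFin ?invr_ge0 ?(ltW (d0 _))// integral_oneDsqr muleC.
rewrite (_ : integral _ _ _ = \int[leb]_x (pi%:E * ((oneDsqr x)^-1)%:E))%E; last first.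
  by apply: eq_integral => x _; exact: I.
rewrite ge0_integralZl_EFin ?pi_ge0//.
by rewrite integral_oneDsqr -EFinM ltry.
Qed.

End planar_integral.

(** * Uniform convergence of the potentials of the unit circle *)

Section circle_estimate.
Variable R : realType.
Local Notation leb := (@lebesgue_measure R).
Local Notation eps k := ((k : nat).+1%:R^-1 : R).
Local Notation G := (@sphere_green R).

Lemma sin_ge_half (y : R) : 0 <= y <= pi / 4 -> y / 2 <= sin y.
Proof.
move=> /andP[y0 y4].
have [|c] := @MVT_segment _ (@sin R) (@cos R) 0 y y0.
  by apply: continuous_subspaceT => x; exact: continuous_sin.
rewrite in_itv/= => /andP[c0 cy]; rewrite sin0 !subr0 => ->.
rewrite mulrC ler_wpM2r//.
have c1 : 0 <= cos c by apply: cos_ge0_pihalf; apply/andP; split; lra.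
have c2 : 0 <= cos (c *+ 2) by apply: cos_ge0_pihalf; rewrite -[c *+ 2]mulr_natl; apply/andP; split; lra.
have c3 : 1 <= 2 * (cos c * cos c) by move: c2; rewrite cos_mulr2n subr_ge0 -expr2 mulr_natl.
by move: c1 c3; move: (cos c) => z; nra.
Qed.

Definition log_gap (A B s : R) : R := ln (s ^+ 2 + A ^+ 2) - ln (s ^+ 2 + B ^+ 2).

(** A primitive of ln (s^2 + A^2) + 2; the constant 2 cancels in the difference of two of them. *)
Let primitive (A s : R) : R := s * ln (s ^+ 2 + A ^+ 2) + 2 * A * atan (s / A).

Let is_derive_primitive (A s : R) : 0 < A -> is_derive s 1 (primitive A) (ln (s ^+ 2 + A ^+ 2) + 2).
Proof.
move=> A0; have d0 : 0 < s ^+ 2 + A ^+ 2 by rewrite ltr_wpDl ?sqr_ge0 ?exprn_gt0.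
have D1 : is_derive s 1 (fun s : R => s ^+ 2 + A ^+ 2) (2 * s).
  have dd := is_deriveD (is_deriveM (is_derive_id s 1) (is_derive_id s 1)) (is_derive_cst (A ^+ 2) s (1 : R)).
  by apply: (is_derive_eq dd); rewrite /GRing.scale/=; ring.
have D2 := @is_derive1_comp R (@ln R) _ s _ _ (is_derive1_ln d0) D1.
have D3 : is_derive s 1 (fun s : R => s / A) A^-1.
  have -> : (fun s : R => s / A) = A^-1 \*: (@id R) by apply/funext => z; rewrite mulrC.
  by apply: (is_derive_eq (is_deriveZ A^-1 (is_derive_id s (1 : R)))); rewrite /GRing.scale/= mulr1.
have D4 := @is_derive1_comp R (@atan R) _ s _ _ (is_derive1_atan (s / A)) D3.
have dd := is_deriveD (is_deriveM (is_derive_id s (1 : R)) D2) (is_deriveZ (2 * A) D4).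
apply: (is_derive_eq dd); rewrite /GRing.scale/=.
have -> : (1 + (s / A) ^+ 2)^-1 = A ^+ 2 / (s ^+ 2 + A ^+ 2) by move: d0 => /lt0r_neq0 d0; field; rewrite ?(gt_eqF A0) ?d0//= addrC d0.
by move: (ln _) (lt0r_neq0 d0) => u d1; field; rewrite ?(gt_eqF A0) ?d1.
Qed.

(** The logarithmic part contributes 2 A, by ln (1 + x) <= x, and the two arctangents, bounded by 2,
    contribute at most 8 A. *)
Let primitive_gap (A B s : R) : 0 < B -> B <= A ->
  `|primitive A s - primitive B s| <= 10 * A.
Proof.
move=> B0 BA; have A0 := lt_le_trans B0 BA.
have at2 u : `|atan u : R| <= 2.
  have [_ /andP[_ p2]] := (I, (pihalf_02_cos_pihalf R).1).
  by rewrite ler_norml; have := atan_gtNpi2 u; have := atan_ltpi2 u; move=> ? ?; apply/andP; split; lra.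
have sq u : 0 < u -> 0 < s ^+ 2 + u ^+ 2 by move=> u0; rewrite ltr_wpDl ?sqr_ge0 ?exprn_gt0.
have H : `|s * (ln (s ^+ 2 + A ^+ 2) - ln (s ^+ 2 + B ^+ 2))| <= 2 * A.
  have [->|s0] := eqVneq s 0; first by rewrite mul0r normr0 mulr_ge0 ?ltW.
  have ns : 0 < `|s| by rewrite normr_gt0.
  have mono : ln (s ^+ 2 + B ^+ 2) <= ln (s ^+ 2 + A ^+ 2) by rewrite ler_ln ?posrE ?sq// lerD2l lerXn2r ?nnegrE ?(ltW A0) ?(ltW B0).
  rewrite normrM [X in _ * X]ger0_norm ?subr_ge0//.
  have l1 : ln (s ^+ 2 + A ^+ 2) <= 2 * ln (`|s| + A).
    rewrite mulr_natl -lnXn ?addr_gt0// ler_ln ?posrE ?sq ?exprn_gt0 ?addr_gt0//.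
    by rewrite sqrrD real_normK ?num_real// lerD2r lerDl mulrn_wge0// mulr_ge0// ltW.
  have l2 : 2 * ln `|s| <= ln (s ^+ 2 + B ^+ 2).
    rewrite mulr_natl -lnXn// ler_ln ?posrE ?sq ?exprn_gt0// real_normK ?num_real//.
    by rewrite lerDl sqr_ge0.
  have l3 : ln (`|s| + A) - ln `|s| <= A / `|s|.
    rewrite -ln_div ?posrE ?addr_gt0// mulrDl divff ?gt_eqF//.
    by apply: le_ln1Dx; apply: (@lt_trans _ _ 0) => //; rewrite divr_gt0.
  apply: le_trans (_ : `|s| * (2 * (A / `|s|)) <= _); first by rewrite ler_pM2l//; lra.
  by rewrite mulrCA ler_pM2l// mulrC divfK ?gt_eqF.
have -> : primitive A s - primitive B s =
    s * (ln (s ^+ 2 + A ^+ 2) - ln (s ^+ 2 + B ^+ 2)) + (2 * A * atan (s / A) - 2 * B * atan (s / B)).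
  by rewrite /primitive; ring.
have := at2 (s / A); have := at2 (s / B); move: H; rewrite !ler_norml.
move: (s * _) (atan _) (atan _) => u v w /andP[? ?] /andP[? ?] /andP[? ?]; apply/andP; split; nra.
Qed.

Lemma log_gap_ge0 A B s : 0 < B -> B <= A -> 0 <= log_gap A B s.
Proof.
move=> B0 BA; have A0 := lt_le_trans B0 BA.
by rewrite subr_ge0 ler_ln ?posrE ?ltr_wpDl ?sqr_ge0 ?exprn_gt0// lerD2l lerXn2r ?nnegrE ?(ltW A0) ?(ltW B0).
Qed.

Lemma log_gap_continuous A B t0 : 0 < A -> 0 < B -> continuous (fun t : R => log_gap A B (t - t0)).
Proof.
move=> A0 B0 t.
have c u : 0 < u -> {for t, continuous (fun t : R => ln ((t - t0) ^+ 2 + u ^+ 2))}.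
  move=> u0; apply: (@continuous_comp _ _ _ (fun t : R => (t - t0) ^+ 2 + u ^+ 2) (@ln R)).
    have -> : (fun t : R => (t - t0) ^+ 2 + u ^+ 2) = (fun t => (t - t0) * (t - t0) + u ^+ 2) by [].
    apply: (@cvgD _ R^o); last exact: cvg_cst.
    by apply: cvgM; apply: (@cvgB _ R^o); [exact: cvg_id | exact: cvg_cst | exact: cvg_id | exact: cvg_cst].
  by apply: continuous_ln; rewrite ltr_wpDl ?sqr_ge0 ?exprn_gt0.
by apply: (@cvgB _ R^o); apply: c.
Qed.

Lemma log_gap_integral A B p q t0 : 0 < B -> B <= A -> p < q ->
  (\int[leb]_(t in `[p, q]) (log_gap A B (t - t0))%:E <= (20 * A)%:E)%E.
Proof.
move=> B0 BA pq; have A0 := lt_le_trans B0 BA.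
pose P (t : R) := primitive A (t - t0) - primitive B (t - t0).
have DP (t : R) : is_derive t 1 P (log_gap A B (t - t0)).
  have Ds : is_derive t 1 (fun t : R => t - t0) 1 by apply: (is_derive_eq (is_deriveB (is_derive_id t (1 : R)) (is_derive_cst t0 t (1 : R)))); rewrite subr0.
  have d1 := @is_derive1_comp R _ (fun t => t - t0) t _ _ (is_derive_primitive (t - t0) A0) Ds.
  have d2 := @is_derive1_comp R _ (fun t => t - t0) t _ _ (is_derive_primitive (t - t0) B0) Ds.
  by apply: (is_derive_eq (is_deriveB d1 d2)); rewrite !mulr1 /log_gap; ring.
have cP : continuous P.
  move=> t; apply/differentiable_continuous/derivable1_diffP; by have [] := DP t.
rewrite (@continuous_FTC2 R _ P)//.
- rewrite -EFinB lee_fin; have := primitive_gap (q - t0) B0 BA; have := primitive_gap (p - t0) B0 BA.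
  by rewrite /P !ler_norml => /andP[? ?] /andP[? ?]; lra.
- by apply: continuous_subspaceT => t; exact: log_gap_continuous.
- split; first by move=> t _; have [] := DP t.
    by apply: cvg_at_right_filter; exact: cP.
  by apply: cvg_at_left_filter; exact: cP.
by move=> t _; rewrite derive1E; exact: (@derive_val _ _ _ _ _ _ _ (DP t)).
Qed.

Let chord2_circle (t s : R) : chord2 (circle_map t) (circle_map s) = sin ((t - s) / 2) ^+ 2.
Proof.
have q (u : R) : oneDr2 (cos u, sin u) = 2 by rewrite /oneDr2/= cos2Dsin2.
rewrite /chord2 inner3 -[circle_map t]/(chart0 (cos t, sin t)) -[circle_map s]/(chart0 (cos s, sin s)).
rewrite !stereo_chart0 !q /= !cos2Dsin2 subrr mul0r mul0r addr0.
have -> : 2 * cos t / 2 * (2 * cos s / 2) + 2 * sin t / 2 * (2 * sin s / 2) = cos (t - s) by rewrite cosB; field.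
rewrite -[t - s in LHS](divfK (_ : 2 != 0 :> R)) ?pnatr_eq0// mulr_natr cos_mulr2n.
have := cos2Dsin2 ((t - s) / 2); move: (cos _ ^+ 2) (sin _ ^+ 2) => a b /(canRL (addrK _)) ->.
by rewrite -[(1 - b) *+ 2]mulr_natl; field.
Qed.

Let chord2_paral (x y z : sphere R) : chord2 y z <= 2 * (chord2 x y + chord2 x z).
Proof.
rewrite !chord2E -mulrDr mulrCA ler_pM2l ?invr_gt0// -big_split mulr_sumr; apply: ler_sum => i _ /=.
have := sqr_ge0 (stereo i y + stereo i z - 2 * stereo i x); rewrite !expr2; lra.
Qed.

(** Take t0 nearest to x on the quarter of circle starting at p. The parallelogram inequality gives
    chord2(t, t0) <= 4 chord2(x, t), and on a quarter |t - t0| / 2 <= pi/4, where sin y >= y/2;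
    whence 64. *)
Let circle_lower (x : sphere R) p : exists t0, forall t, p <= t <= p + pi / 2 ->
  (t - t0) ^+ 2 <= 64 * chord2 x (circle_map t).
Proof.
have pp : 0 < (pi : R) by exact: pi_gt0.
have [||t0] := @EVT_min R (fun t => chord2 x (circle_map t)) p (p + pi / 2).
- by rewrite lerDl divr_ge0// ltW.
- apply: continuous_subspaceT => t.
  apply: (@continuous_comp _ _ _ (fun t => circle_map t : sphere R) (chord2 x)).
    exact: (continuous_comp (@circle_continuous R t)
      (@one_point_compactification_some_continuous R[i]^o _)).
  exact: chord2_continuous.
rewrite in_itv/= => t0I min; exists t0 => t tI.
have {}min : chord2 x (circle_map t0) <= chord2 x (circle_map t) by apply: min; rewrite in_itv.
have := chord2_paral x (circle_map t) (circle_map t0); rewrite chord2_circle.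
have dle : `|t - t0| / 2 <= pi / 4 by rewrite ler_pdivrMr// ler_norml; move: t0I tI => /andP[? ?] /andP[? ?]; apply/andP; split; lra.
have s0 := sin_ge_half (introT andP (conj (divr_ge0 (normr_ge0 (t - t0)) (ler0n _ 2)) dle)).
have -> : sin ((t - t0) / 2) ^+ 2 = sin (`|t - t0| / 2) ^+ 2 by case: ger0P => // _; rewrite mulNr sinN sqrrN.
have -> : (t - t0) ^+ 2 = `|t - t0| ^+ 2 by rewrite real_normK ?num_real.
have := normr_ge0 (t - t0); move: s0 min.
move: (chord2 x (circle_map t)) (chord2 x (circle_map t0)) (sin (`|t - t0| / 2)) (`|t - t0|).
by move=> a b s d; rewrite !expr2; nra.
Qed.

(** On each quarter of the circle G l - G k is at most half of a log gap centred at tau i, and the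
    sum H of the four log gaps serves everywhere. Each integrates to at most 20 A k = 160 sqrt(eps
    k), and the factor 4 / (4 pi) is at most 1. *)
Lemma circle_potential_gap k l (x : sphere R) : (k <= l)%N ->
  \int[arch_lambda R]_y G l x y <= \int[arch_lambda R]_y G k x y + 160 * Num.sqrt (eps k).
Proof.
move=> kl; pose A n : R := 8 * Num.sqrt (eps n).
have e0 n : 0 < eps n by rewrite invr_gt0.
have A0 n : 0 < A n by rewrite mulr_gt0// sqrtr_gt0.
have A2 n : A n ^+ 2 = 64 * eps n by rewrite exprMn sqr_sqrtr ?(ltW (e0 n))//; ring.
have lk : eps l <= eps k by rewrite lef_pV2 ?posrE// ler_nat.
have AA : A l <= A k by rewrite ler_pM2l// ler_wsqrtr.
have pp : 0 < (pi : R) by exact: pi_gt0.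
have /choice[tau tauP] : forall i : 'I_4, exists t0 : R, forall t, i%:R * (pi / 2) <= t <= i%:R * (pi / 2) + pi / 2 ->
    (t - t0) ^+ 2 <= 64 * chord2 x (circle_map t).
  by move=> i; exact: circle_lower.
pose H (t : R) := \sum_(i < 4) log_gap (A k) (A l) (t - tau i).
have gap t : 0 <= t <= 2 * pi -> G l x (circle_map t) - G k x (circle_map t) <= 2^-1 * H t.
  move=> /andP[t0 t2].
  have [i it] : exists i : 'I_4, i%:R * (pi / 2) <= t <= i%:R * (pi / 2) + pi / 2.
    have [?|?] := leP t (pi / 2); first by exists (inord 0); rewrite inordK//; apply/andP; split; lra.
    have [?|?] := leP t pi; first by exists (inord 1); rewrite inordK//; apply/andP; split; lra.
    have [?|?] := leP t (pi + pi / 2); first by exists (inord 2); rewrite inordK//; apply/andP; split; lra.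
    by exists (inord 3); rewrite inordK//; apply/andP; split; lra.
  have {}it := tauP i t it; set Y := chord2 x (circle_map t) in it *.
  have Y0 : 0 <= Y by have /andP[] := chord2_bound x (circle_map t).
  have ge : log_gap (A k) (A l) (t - tau i) <= H t by rewrite /H (bigD1 i)//= lerDl sumr_ge0// => j _; exact: log_gap_ge0.
  apply: le_trans (_ : 2^-1 * log_gap (A k) (A l) (t - tau i) <= _); last by rewrite ler_pM2l ?invr_gt0.
  rewrite /sphere_green -mulrBr ler_pM2l ?invr_gt0// /log_gap !A2 -/Y.
  move: it (sqr_ge0 (t - tau i)); move: (_ ^+ 2) => S SY S0.
  have pos n : 0 < S + 64 * eps n by rewrite ltr_wpDl ?mulr_gt0.
  have Yp n : 0 < Y + eps n by rewrite ltr_wpDl.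
  rewrite !ln_div ?posrE ?Yp ?addr_gt0//.
  have h1 : ln (1 + eps l) <= ln (1 + eps k) by rewrite ler_ln ?posrE ?addr_gt0// lerD2l.
  have h2 : ln (Y + eps k) + ln (S + 64 * eps l) <= ln (S + 64 * eps k) + ln (Y + eps l).
    rewrite -!lnM ?posrE// ler_ln ?posrE ?mulr_gt0//.
    have := mulr_ge0 (_ : 0 <= 64 * Y - S) (_ : 0 <= eps k - eps l); rewrite !subr_ge0 => /(_ SY lk).
    by move: (eps k) (eps l) => u v; lra.
  lra.
have bG n := bounded_kernel_slice (T := borel (sphere R)) x (sphere_green_bounded R n).
have mG n : measurable_fun setT (G n x : borel (sphere R) -> R) by have [] := bG n.
have D0 y : 0 <= G l x y - G k x y by rewrite subr_ge0 sphere_green_nd.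
have -> : \int[arch_lambda R]_y G l x y =
    \int[arch_lambda R]_y G k x y + \int[arch_lambda R]_y (G l x y - G k x y).
  rewrite -(bm_integralD (arch_lambda R) (bG k) (bounded_mfunB (bG l) (bG k))).
  by apply: eq_Rintegral => y _ /=; rewrite addrC subrK.
rewrite lerD2l.
rewrite /Rintegral -lee_fin fineK; last first.
  apply: integrable_fin_num => //; apply: bounded_mfun_integrable; exact: bounded_mfunB.
rewrite ge0_integral_distribution//; last by apply/measurable_EFinP; apply: measurable_funB.
rewrite integral_uniform; last 2 first.
- apply: measurableT_comp; last exact: measurable_circle_map.
  by apply/measurable_EFinP; apply: measurable_funB.
- by move=> t; rewrite lee_fin.
have p2 : (0 : R) < 2 * pi by rewrite mulr_gt0.
have cH0 : continuous H.
  rewrite /H; elim: (index_enum _) => [|i r IH] t; first by under eq_fun do rewrite big_nil; exact: cvg_cst.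
  under eq_fun do rewrite big_cons.
  by apply: (@cvgD _ R^o); [exact: log_gap_continuous | exact: IH].
have cH : continuous (fun t => 2^-1 * H t) by move=> t; apply: cvgMl_tmp; exact: cH0.
apply: (@le_trans _ _ ((2 * pi - 0)^-1%:E * \int[leb]_(t in `[0%R, (2 * pi)%R]) (2^-1 * H t)%:E)%E).
  apply: lee_wpmul2l; first by rewrite lee_fin invr_ge0 subr0 ltW.
  apply: ge0_le_integral => //.
  - by move=> t _; rewrite lee_fin.
  - apply: measurable_funTS; apply: measurableT_comp; last exact: measurable_circle_map.
    by apply/measurable_EFinP; apply: measurable_funB.
  - by apply: measurable_funTS; apply/measurable_EFinP; exact: continuous_measurable_fun.
rewrite subr0; under eq_integral => t _ do rewrite EFinM.
rewrite ge0_integralZl_EFin ?invr_ge0//; last 2 first.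
- by move=> t _; rewrite lee_fin sumr_ge0// => i _; exact: log_gap_ge0.
- apply: measurable_funTS; apply/measurable_EFinP; exact: continuous_measurable_fun cH0.
under eq_integral => t _ do rewrite /H -sumEFin.
rewrite ge0_integral_sum//; last 2 first.
- by move=> i; apply: measurable_funTS; apply/measurable_EFinP; apply: continuous_measurable_fun; exact: log_gap_continuous.
- by move=> i t _; rewrite lee_fin log_gap_ge0.
apply: (@le_trans _ _ ((2 * pi)^-1%:E * (2^-1%:E * \sum_(i < 4) (20 * A k)%:E))%E).
  do 2! (apply: lee_wpmul2l; first by rewrite lee_fin invr_ge0 ?ltW).
  by apply: lee_sum => i _; exact: log_gap_integral.
rewrite sumEFin sumr_const card_ord -!EFinM lee_fin /A -mulr_natl.
rewrite mulrC ler_pdivrMr//; have := @pi_ge2 R; have := sqrtr_ge0 (eps k); nra.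
Qed.

End circle_estimate.

(** * The Green kernel of an archimedean place *)

Section sphere_laplacian.
Variable R : realType.
Local Notation sphere := (sphere R).
Let T : measurableType _ := borel sphere.
Let T2 : measurableType _ := (measurableTypeR R * measurableTypeR R)%type.
Let mu2 : {measure set T2 -> \bar R} := (@lebesgue_measure R \x @lebesgue_measure R)%E.
Implicit Types (x : sphere) (p : R * R).
Local Notation eps k := ((k : nat).+1%:R^-1 : R).
Local Notation G := (@sphere_green R).
Local Notation i0 := (@Ordinal 3 0 isT).
Local Notation i1 := (@Ordinal 3 1 isT).
Local Notation i2 := (@Ordinal 3 2 isT).

Let e0 k : 0 < eps k. Proof. by rewrite invr_gt0. Qed.
Let c0 x y : 0 <= chord2 x y. Proof. by have /andP[] := chord2_bound x y. Qed.

Definition green_quad k x : R * R -> R :=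
  pquad ((1 + 2 * eps k - stereo i2 x) / 2) (stereo i0 x) (stereo i1 x) ((1 + 2 * eps k + stereo i2 x) / 2).

Let green_quad_oo k x : R * R -> R :=
  pquad ((1 + 2 * eps k + stereo i2 x) / 2) (stereo i0 x) (- stereo i1 x) ((1 + 2 * eps k - stereo i2 x) / 2).

Let P0 p : 0 < oneDr2 p. Proof. exact: oneDr2_gt0. Qed.

Let green_quadE k x p : green_quad k x p = (chord2 x (chart0 p) + eps k) * oneDr2 p.
Proof.
rewrite /chord2 inner3 !stereo_chart0 /=; have := lt0r_neq0 (P0 p).
rewrite /green_quad /pquad; move: (stereo i0 x) (stereo i1 x) (stereo i2 x) (eps k) => a b c e.
have -> : p.1 ^+ 2 + p.2 ^+ 2 = oneDr2 p - 1 by rewrite /oneDr2; ring.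
by move: (oneDr2 p) => P Pn; field.
Qed.

Let green_quad_ooE k x p : green_quad_oo k x p = (chord2 x (chart_oo p) + eps k) * oneDr2 p.
Proof.
rewrite /chord2 inner3 !stereo_chart_oo /=; have := lt0r_neq0 (P0 p).
rewrite /green_quad_oo /pquad; move: (stereo i0 x) (stereo i1 x) (stereo i2 x) (eps k) => a b c e.
have -> : p.1 ^+ 2 + p.2 ^+ 2 = oneDr2 p - 1 by rewrite /oneDr2; ring.
by move: (oneDr2 p) => P Pn; field.
Qed.

Let ce k x y : 0 < chord2 x y + eps k. Proof. by rewrite ltr_wpDl. Qed.

Lemma green_quad_gt0 k x p : 0 < green_quad k x p.
Proof. by rewrite green_quadE mulr_gt0. Qed.

Let green_ln k x y (q P : R) : 0 < P -> q = (chord2 x y + eps k) * P ->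
  G k x y = 2^-1 * ln (1 + eps k) - 2^-1 * ln q + 2^-1 * ln P.
Proof.
move=> Pgt ->; rewrite /sphere_green ln_div ?posrE ?ce ?addr_gt0// lnM ?posrE//; ring.
Qed.

(** In both charts the kernel is a constant plus logarithms of positive quadratic polynomials;
    [G k x] is therefore an admissible test function for the Laplacian. *)
Lemma sphere_green_smooth k x : sphere_smooth (G k x).
Proof.
have sm (q : R * R -> R) : smooth_fun q -> (forall p, 0 < q p) ->
    smooth_fun (fun p => 2^-1 * ln (1 + eps k) - 2^-1 * ln (q p) + 2^-1 * ln (oneDr2 p)).
  move=> sq q0; apply: smoothD.
    apply: smoothD; first exact: smooth_cst.
    by under eq_fun do rewrite -mulNr; apply: smoothM; [exact: smooth_cst | exact: smooth_ln].
  by apply: smoothM; [exact: smooth_cst | apply: smooth_ln; [exact: smooth_oneDr2 |]].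
move=> n; split; apply: smooth_Cn.
  rewrite (_ : _ \o _ = fun p => 2^-1 * ln (1 + eps k) - 2^-1 * ln (green_quad k x p) + 2^-1 * ln (oneDr2 p)).
    by apply: sm; [exact: pquad_smooth | exact: green_quad_gt0].
  by apply/funext => p; exact: green_ln (P0 p) (green_quadE k x p).
rewrite (_ : _ \o _ = fun p => 2^-1 * ln (1 + eps k) - 2^-1 * ln (green_quad_oo k x p) + 2^-1 * ln (oneDr2 p)).
  by apply: sm; [exact: pquad_smooth | move=> p; rewrite green_quad_ooE mulr_gt0].
by apply/funext => p; exact: green_ln (P0 p) (green_quad_ooE k x p).
Qed.

Let disc k : R := eps k * (1 + eps k).

Let disc0 k : 0 < disc k. Proof. by rewrite mulr_gt0// addr_gt0. Qed.

Let stereo_sqr x : stereo i0 x ^+ 2 + stereo i1 x ^+ 2 = 1 - stereo i2 x ^+ 2.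
Proof. by have := inner_same x; rewrite inner3 !expr2; lra. Qed.

Let discE k x : (1 + 2 * eps k - stereo i2 x) / 2 * ((1 + 2 * eps k + stereo i2 x) / 2)
  - (stereo i0 x ^+ 2 + stereo i1 x ^+ 2) / 4 = disc k.
Proof. by rewrite stereo_sqr /disc; move: (stereo _ _) (eps k) => c e; field. Qed.

(* The smoothing of the Dirac mass at x. *)
Definition green_density k x p : R := disc k / pi / green_quad k x p ^+ 2.

Lemma ddc_sphere_green k x p : ddc (G k x) p = round_density p - green_density k x p.
Proof.
rewrite (@ddc_ln_pquad R _ (2^-1 * ln (1 + eps k)) _ _ _ _ p (green_quad_gt0 k x)); last first.
  by apply/funext => z; exact: green_ln (P0 z) (green_quadE k x z).
by rewrite discE.
Qed.

Lemma green_density_smooth k x : smooth_fun (green_density k x).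
Proof.
apply: smoothM; first exact: smooth_cst.
apply: smoothV => [|p]; last by rewrite exprn_gt0// green_quad_gt0.
by apply: smoothX; exact: pquad_smooth.
Qed.

Lemma green_density_ge0 k x p : 0 <= green_density k x p.
Proof. by rewrite !mulr_ge0 ?invr_ge0 ?exprn_ge0 ?pi_ge0 ?(ltW (disc0 k)) ?(ltW (green_quad_gt0 _ _ _)). Qed.

(** After completing the square, [green_quad] is a multiple of [oneDr2] composed with a translation
    and the dilation s; so the density is the round one in affine coordinates. The dilation exists
    because the third coordinate is at most 1, which makes a positive. *)
Lemma green_density_mass k x :
  (\int[mu2]_p (green_density k x p)%:E = \int[mu2]_p (round_density p)%:E)%E.
Proof.
set a : R := (1 + 2 * eps k - stereo i2 x) / 2.
have g1 : stereo i2 x <= 1.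
  by have := stereo_sqr x; have := sqr_ge0 (stereo i0 x); have := sqr_ge0 (stereo i1 x);
    rewrite !expr2; move: (stereo i2 x) => c; nra.
have a0 : 0 < a by rewrite divr_gt0//; have := e0 k; move: (eps k) g1 => e; lra.
pose s := a / Num.sqrt (disc k); have s0 : 0 < s by rewrite divr_gt0// sqrtr_gt0.
rewrite -(@ge0_integral_affine2 R (@round_density R) s (stereo i0 x / (2 * a)) (stereo i1 x / (2 * a)) s0).
- apply: eq_integral => p _; congr EFin.
  have s2 : s ^+ 2 = a ^+ 2 / disc k by rewrite exprMn exprVn sqr_sqrtr// ltW.
  have E : oneDr2 (s * (p.1 - stereo i0 x / (2 * a)), s * (p.2 - stereo i1 x / (2 * a))) =
      a * green_quad k x p / disc k.
    move: s s0 s2 => s s0 s2; rewrite /oneDr2 !exprMn -mulrDr s2 /green_quad /pquad -/a.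
    have -> : (1 + 2 * eps k + stereo i2 x) / 2 =
        (disc k + (stereo i0 x ^+ 2 + stereo i1 x ^+ 2) / 4) / a.
      by rewrite -(discE k x) -/a subrK [a * _]mulrC mulfK// gt_eqF.
    move: (stereo i0 x) (stereo i1 x) (disc k) (lt0r_neq0 (disc0 k)) => u v d dn.
    by have an := lt0r_neq0 a0; field; rewrite ?an ?dn.
  rewrite /round_density E s2 /green_density.
  have := lt0r_neq0 (green_quad_gt0 k x p); have := lt0r_neq0 (@pi_gt0 R); have := lt0r_neq0 (disc0 k).
  have := lt0r_neq0 a0; move: (green_quad k x p) (pi : R) (disc k) => q w d an dn wn qn.
  by field; rewrite ?an ?dn ?wn ?qn.
- exact: round_density_smooth.
- exact: round_density_ge0.
Qed.

Let density_integrable (f : R * R -> R) : smooth_fun f -> (forall p, 0 <= f p) ->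
  (\int[mu2]_p (f p)%:E = \int[mu2]_p (round_density p)%:E)%E ->
  mu2.-integrable setT (EFin \o f).
Proof.
move=> sf f0 If; apply/integrableP; split.
  by apply/measurable_EFinP; exact: smooth_fun_measurable.
under eq_integral => p _ do rewrite /= ger0_norm ?f0//.
by rewrite If; exact: round_density_fin.
Qed.

Let round_int : mu2.-integrable setT (EFin \o @round_density R).
Proof. by apply: density_integrable => //; [exact: round_density_smooth | exact: round_density_ge0]. Qed.

Let green_int k x : mu2.-integrable setT (EFin \o green_density k x).
Proof.
by apply: density_integrable; [exact: green_density_smooth | exact: green_density_ge0 | exact: green_density_mass].
Qed.

Let kappa : R := \int[mu2]_p round_density p.

Let green_kappa k x : \int[mu2]_p green_density k x p = kappa.
Proof. by rewrite /kappa /Rintegral green_density_mass. Qed.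

Let kappa0 : 0 <= kappa.
Proof. by apply: fine_ge0; apply: integral_ge0 => p _; rewrite lee_fin round_density_ge0. Qed.

(** The plane carries the product sigma-algebra; g is a uniform limit of polynomials in the
    stereographic coordinates, which are measurable as smooth functions of the chart. *)
Lemma chart0_measurable (g : sphere -> R) : continuous g ->
  measurable_fun setT (g \o @chart0 R : T2 -> R).
Proof.
move=> cg.
have /choice[f fP] : forall n : nat, exists f, stereo_poly f /\ forall x, `|g x - f x| <= eps n by move=> n; have [f sf gf] := stereo_poly_approx cg (e0 n); exists f.
apply: (@measurable_fun_cvg _ _ _ _ (fun n => f n \o @chart0 R : T2 -> R)) => [n|p _].
  have [sf _] := fP n; elim: sf => {f fP n} [c s|f f' _ mf _ mf']; last exact: measurable_funD.
  apply: measurable_funM => //; apply: smooth_fun_measurable.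
  rewrite /stereo_monomial; elim: s => [|i s IH].
    by under eq_fun do rewrite big_nil; exact: smooth_cst.
  by under eq_fun do rewrite big_cons; apply: smoothM => //; exact: stereo_smooth0.
apply/cvgrPdist_le => e e_gt0; have /cvgrPdist_le/(_ _ e_gt0) := @eps_cvg R.
apply: filterS => n; rewrite sub0r normrN ger0_norm ?(ltW (e0 n))// => ne.
by apply: le_trans ne; have [_] := fP n; exact.
Qed.

Lemma stereo_poly_lipschitz f : stereo_poly f ->
  exists2 L, 0 <= L & forall x y, (f x - f y) ^+ 2 <= L * chord2 x y.
Proof.
have st1 i x : `|stereo i x| <= 1.
  rewrite -(@ler_pXn2r _ 2) ?nnegrE// real_normK ?num_real// expr1n -(inner_same x) /inner.
  by rewrite (bigD1 i)//= expr2 lerDl sumr_ge0// => j _; rewrite -expr2 sqr_ge0.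
have mon1 s x : `|stereo_monomial s x| <= 1.
  rewrite /stereo_monomial; elim: s => [|i s IH]; first by rewrite big_nil normr1.
  by rewrite big_cons normrM mulr_ile1.
have sq1 (u : R) : `|u| <= 1 -> u ^+ 2 <= 1 by move=> u1; rewrite -[leLHS]real_normK ?num_real// exprn_ile1.
elim=> {f} [c s|f g _ [L L0 fL] _ [L' L'0 gL]]; last first.
  exists (2 * (L + L')) => [|x y]; first by rewrite mulr_ge0 ?addr_ge0.
  have := fL x y; have := gL x y; rewrite /= opprD addrACA.
  move: (f x - f y) (g x - g y) (chord2 x y) => u v z.
  by have := sqr_ge0 (u - v); rewrite !expr2; lra.
suff [L L0 H] : exists2 L, 0 <= L & forall x y, (stereo_monomial s x - stereo_monomial s y) ^+ 2 <= L * chord2 x y.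
  exists (c ^+ 2 * L) => [|x y]; first by rewrite mulr_ge0 ?sqr_ge0.
  by rewrite /= -mulrBr exprMn -[leRHS]mulrA ler_wpM2l ?sqr_ge0.
rewrite /stereo_monomial; elim: s => [|i s [L L0 H]].
  by exists 0 => // x y; rewrite !big_nil subrr expr0n mul0r.
exists (8 + 2 * L) => [|x y]; first by rewrite addr_ge0 ?mulr_ge0.
rewrite !big_cons; have := H x y; have := sq1 _ (mon1 s x); have := sq1 _ (st1 i y).
have : (stereo i x - stereo i y) ^+ 2 <= 4 * chord2 x y by rewrite chord2E mulrA divff ?pnatr_eq0// mul1r (bigD1 i)//= lerDl sumr_ge0// => j _; rewrite sqr_ge0.
rewrite /stereo_monomial; have := c0 x y; move: (chord2 x y) (stereo i x) (stereo i y) => z u u'.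
move: (\prod_(_ <- _) _) (\prod_(_ <- _) _) => v' v z0 uu u1 v1 vv.
have h1 : (u - u') ^+ 2 * v ^+ 2 <= 4 * z by apply: le_trans (_ : (u - u') ^+ 2 * 1 <= _); [rewrite ler_wpM2l ?sqr_ge0 | rewrite mulr1].
have h2 : u' ^+ 2 * (v - v') ^+ 2 <= L * z by apply: le_trans (_ : 1 * (v - v') ^+ 2 <= _); [rewrite ler_wpM2r ?sqr_ge0 | rewrite mul1r].
apply: le_trans (_ : 2 * ((u - u') ^+ 2 * v ^+ 2) + 2 * (u' ^+ 2 * (v - v') ^+ 2) <= _); last by lra.
have := sqr_ge0 ((u - u') * v - u' * (v - v')); rewrite !expr2; lra.
Qed.

(** The square of [chord2] is the power that [chord_density] integrates against the smoothed Dirac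
    mass. The constant comes from d (e/4)^3 <= d^4 <= L^2 z^2 when the variation d of the
    approximating polynomial exceeds e/4. *)
Lemma sphere_modulus (g : sphere -> R) (e : R) : continuous g -> 0 < e ->
  exists2 C, 0 <= C & forall x y, `|g x - g y| <= e + C * chord2 x y ^+ 2.
Proof.
move=> cg e_gt0; have e4 : 0 < e / 4 by rewrite divr_gt0.
have [f sf gf] := stereo_poly_approx cg e4; have [L L0 fL] := stereo_poly_lipschitz sf.
exists (L ^+ 2 / (e / 4) ^+ 3) => [|x y]; first by rewrite divr_ge0 ?exprn_ge0 ?(ltW e4).
suff fc : `|f x - f y| <= e / 4 + L ^+ 2 / (e / 4) ^+ 3 * chord2 x y ^+ 2.
  have -> : g x - g y = (g x - f x) + (f x - f y) - (g y - f y) by ring.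
  have := gf x; have := gf y; move: fc; rewrite !ler_norml.
  by move=> /andP[? ?] /andP[? ?] /andP[? ?]; apply/andP; split; lra.
set d := `|_|; set z := chord2 x y; have dz : d ^+ 2 <= L * z by rewrite real_normK ?num_real.
have [de|de] := leP d (e / 4).
  by rewrite (le_trans de)// lerDl mulr_ge0 ?sqr_ge0// divr_ge0 ?sqr_ge0// exprn_ge0 ?ltW.
rewrite ler_wpDl ?(ltW e4)// mulrAC ler_pdivlMr ?exprn_gt0//.
have d0 : 0 <= d := normr_ge0 _.
apply: le_trans (_ : d * d ^+ 3 <= _).
  by rewrite ler_wpM2l// lerXn2r ?nnegrE ?(ltW e4)// ltW.
rewrite -exprS -exprMn (_ : d ^+ 4 = (d ^+ 2) ^+ 2); last by rewrite -exprM.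
by rewrite lerXn2r ?nnegrE ?sqr_ge0// mulr_ge0 ?c0.
Qed.

Variables (A : choiceType) (pt : A -> sphere) (rho : probability T R) (g : sphere -> R).
Hypotheses (pt_inj : injective pt) (g_cont : continuous g)
  (g_lap : arch_laplacian g (measure_diff rho (arch_lambda R))).
Let pt' : A -> T := pt.

Let mul_int (h : T2 -> R) (f : R * R -> R) (B : R) : measurable_fun setT h -> (forall p, `|h p| <= B) ->
  mu2.-integrable setT (EFin \o f) -> mu2.-integrable setT (EFin \o (fun p => h p * f p)).
Proof.
move=> mh hB fi; have [/measurable_EFinP mf _] := integrableP _ _ _ fi.
apply: (@le_integrable _ _ _ mu2 _ measurableT _ (fun p => (B * f p)%:E)).
- by apply/measurable_EFinP; exact: measurable_funM.
- move=> p _ /=; rewrite lee_fin !normrM; apply: ler_wpM2r => //.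
  by apply: le_trans (hB p) _; exact: ler_norm.
by under eq_fun do rewrite EFinM; exact: integrableZl.
Qed.

(** The Laplacian equation tested on [G k x]: the potential of rho is that of the circle, plus a
    constant, minus the integral of g against the smoothed Dirac mass at x. *)
Let potentialE k x : \int[rho]_y G k x y =
  \int[arch_lambda R]_y G k x y + (\int[mu2]_p (g (chart0 p) * round_density p) -
    \int[mu2]_p (g (chart0 p) * green_density k x p)).
Proof.
have [B _ gB] := continuous_bounded (@sphere_compact R) g_cont.
have mg := chart0_measurable g_cont.
have i1' := @mul_int (g \o @chart0 R) (@round_density R) B mg (fun p => gB _) round_int.
have i2' := @mul_int (g \o @chart0 R) (green_density k x) B mg (fun p => gB _) (green_int k x).
rewrite -RintegralB//.
have := g_lap (sphere_green_smooth k x).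
rewrite charge_integral_measure_diff; last first.
  exact: (bounded_kernel_slice (T := T) x (sphere_green_bounded R k)).
move=> [H]; rewrite -[LHS](subrK (\int[arch_lambda R]_y G k x y)) H addrC; congr (_ + _).
by apply: eq_Rintegral => p _; rewrite ddc_sphere_green mulrBr.
Qed.

Let chord_density k x p : chord2 x (chart0 p) ^+ 2 * green_density k x p <= disc k * round_density p.
Proof.
have q0 := green_quad_gt0 k x p; rewrite /green_density /round_density.
have -> : chord2 x (chart0 p) ^+ 2 * (disc k / pi / green_quad k x p ^+ 2) =
  disc k / pi * (chord2 x (chart0 p) ^+ 2 / green_quad k x p ^+ 2) by ring.
rewrite [leRHS]mulrA ler_wpM2l ?divr_ge0 ?pi_ge0 ?(ltW (disc0 k))// ler_pdivrMr ?exprn_gt0//.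
have cP : 0 <= chord2 x (chart0 p) * oneDr2 p := mulr_ge0 (c0 _ _) (ltW (P0 p)).
rewrite mulrC ler_pdivlMr ?exprn_gt0// -exprMn lerXn2r ?nnegrE ?(ltW q0)//.
by rewrite green_quadE ler_wpM2r ?(ltW (P0 p))// lerDl ltW.
Qed.

Let smoothing (e C : R) k x : 0 <= e -> 0 <= C ->
  (forall x y, `|g x - g y| <= e + C * chord2 x y ^+ 2) ->
  `|\int[mu2]_p (g (chart0 p) * green_density k x p) - g x * kappa| <= (e + 2 * C * eps k) * kappa.
Proof.
move=> e_ge0 C_ge0 gm; have [B _ gB] := continuous_bounded (@sphere_compact R) g_cont.
have mg := chart0_measurable g_cont.
have i1' := @mul_int (g \o @chart0 R) (green_density k x) B mg (fun p => gB _) (green_int k x).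
have iz (c : R) f : mu2.-integrable setT (EFin \o f) -> mu2.-integrable setT (EFin \o (fun p => c * f p)) by move=> fi; rewrite /comp; under eq_fun do rewrite EFinM; exact: integrableZl.
have i2' := iz (g x) _ (green_int k x).
have i3' := iz e _ (green_int k x).
have i4' := iz (C * disc k) _ round_int.
rewrite -(green_kappa k x) -(RintegralZl _ measurableT (green_int k x)) -RintegralB//.
apply: le_trans (le_normr_Rintegral measurableT _) _.
  by have := integrableB measurableT i1' i2'; apply: eq_integrable.
apply: le_trans (_ : \int[mu2]_p (e * green_density k x p + C * disc k * round_density p) <= _).
  apply: le_Rintegral => //.
  - have := integrableB measurableT i1' i2'.
    by move=> /integrable_norm; apply: eq_integrable.
  - by have := integrableD measurableT i3' i4'; apply: eq_integrable.
  move=> p _; rewrite -mulrBl normrM (ger0_norm (green_density_ge0 _ _ _)).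
  apply: le_trans (ler_wpM2r (green_density_ge0 k x p) (gm (chart0 p) x)) _.
  rewrite mulrDl lerD2l -[leLHS]mulrA -[leRHS]mulrA; apply: ler_wpM2l => //.
  by rewrite {1}/chord2 innerC; exact: chord_density.
rewrite (RintegralD measurableT i3' i4') (RintegralZl _ measurableT (green_int k x)).
rewrite (RintegralZl _ measurableT round_int) green_kappa -/kappa mulrDl lerD2l ler_wpM2r//.
rewrite [2 * C]mulrC -[leRHS]mulrA; apply: ler_wpM2l => //; rewrite /disc.
have : eps k <= 1 by rewrite invf_le1// ler1n.
by have := e0 k; move: (eps k) => u; nra.
Qed.

(** The gap of the circle takes th/4, and the two smoothing errors at most th/4 + th/8 each, with e
    kappa <= th/4. *)
Let uniform_gap (th : R) : 0 < th -> exists k0, forall k l x, (k0 <= k)%N -> (k <= l)%N ->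
  \int[rho]_y G l x y - \int[rho]_y G k x y <= th.
Proof.
move=> th0; pose e := th / (4 * (kappa + 1)).
have k1 : 0 < kappa + 1 by rewrite ltr_wpDl.
have e_gt0 : 0 < e by rewrite divr_gt0// mulr_gt0.
have [C C_ge0 gm] := sphere_modulus g_cont e_gt0.
have ek : 4 * (e * kappa) <= th by rewrite /e -[leRHS](divfK (lt0r_neq0 (mulr_gt0 (ltr0Sn R 3) k1))) -/e; nra.
pose D := 4 * C * kappa + 1; have D0 : 0 < D by rewrite ltr_wpDl ?mulr_ge0.
have d1 : 0 < th / 4 / D by rewrite !divr_gt0.
have d2 : 0 < (th / 4 / 160) ^+ 2 by rewrite exprn_gt0// !divr_gt0.
have d3 : 0 < Num.min (th / 4 / D) ((th / 4 / 160) ^+ 2) by rewrite lt_min d1.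
have /cvgrPdist_le/(_ _ d3)[k0 _ k0P] := @eps_cvg R.
exists k0 => k l x kk kl.
have := k0P k kk; rewrite /= sub0r normrN ger0_norm ?(ltW (e0 k))// le_min => /andP[h1 h2].
have s1 : 160 * Num.sqrt (eps k) <= th / 4.
  rewrite mulrC -ler_pdivlMr//; apply: le_trans (ler_wsqrtr h2) _.
  by rewrite sqrtr_sqr ger0_norm// !divr_ge0// ltW.
have lk : eps l <= eps k by rewrite lef_pV2 ?posrE// ler_nat.
have s2 : 4 * C * kappa * eps k <= th / 4 by move: h1; rewrite ler_pdivlMr// /D; have := e0 k; move: (eps k) => u; nra.
have s3 : 2 * C * eps l * kappa <= 2 * C * eps k * kappa by rewrite ler_wpM2r// ler_wpM2l// mulr_ge0.
have := circle_potential_gap x kl; have := smoothing k x (ltW e_gt0) C_ge0 gm.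
have := smoothing l x (ltW e_gt0) C_ge0 gm; rewrite !potentialE !ler_norml.
move=> /andP[h3 _] /andP[_ h4] h5.
rewrite mulrDl in h3; rewrite mulrDl in h4.
have s2' : 2 * C * eps k * kappa <= th / 8 by move: s2; move: (eps k) => u; lra.
have h6 := le_trans s3 s2'.
move: h3 h4 h5 s1 s2' h6 ek.
move: (2 * C * _ * kappa) (2 * C * _ * kappa) (e * kappa) (160 * _) => u v w z.
by do 5!move: (Rintegral _ _ _); move: (g x * kappa) => *; lra.
Qed.

Let err k : R := sup [set z | exists x l, (k <= l)%N /\
  z = \int[rho]_y G l x y - \int[rho]_y G k x y].

Theorem sphere_green_kernel : exists err K,
  green_kernel pt' rho (@sphere_dist R) G (fun k => 2^-1 * ln ((1 + eps k) / eps k)) err K.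
Proof.
have bG k x := bounded_kernel_slice (T := T) x (sphere_green_bounded R k).
have U0 k x : 0 <= \int[rho]_y G k x y by apply: fine_ge0; apply: integral_ge0 => y _; rewrite lee_fin; have /andP[] := sphere_green_bound k x y.
have [k0 k0P] := uniform_gap ltr01.
pose K : R := 2^-1 * ln ((1 + eps k0) / eps k0) + 1.
have UK k x : \int[rho]_y G k x y <= K.
  have h l : (l <= k0)%N -> \int[rho]_y G l x y <= 2^-1 * ln ((1 + eps k0) / eps k0).
    move=> lk; apply: (bm_integral_le (probability_setT _) (bG l x)) => y.
    by apply: le_trans (sphere_green_nd x y lk) _; have /andP[] := sphere_green_bound k0 x y.
  have [kk|/ltnW/h] := leqP k0 k; last by rewrite /K; lra.
  by have := k0P k0 k x (leqnn _) kk; have := h k0 (leqnn _); rewrite /K; lra.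
have gap x k l : \int[rho]_y G l x y - \int[rho]_y G k x y <= K by rewrite lerBlDr ler_wpDr.
exists err, K; split.
- exact: sphere_dist_measurable.
- exact: sphere_dist_bound.
- by move=> x y; rewrite /sphere_dist /chord2 innerC.
- by move=> a y; exact: sphere_dist_eq0.
- exact: pt_inj.
- by move=> k; have [] := sphere_green_bounded R k.
- exact: sphere_green_bound.
- exact: sphere_green_nd.
- exact: sphere_green_cvg.
- exact: sphere_green_div.
- exact: UK.
- move=> a k l kl; rewrite -lerBlDl; apply: ub_le_sup; last by exists (pt a), l.
  by exists K => _ [x [j [_ ->]]]; exact: gap.
apply/cvgrPdist_le => e e_gt0; have [k1 k1P] := uniform_gap e_gt0.
exists k1 => // k /= kk; rewrite sub0r normrN ger0_norm.
  apply: ge_sup; last by move=> _ [x [j [kj ->]]]; exact: k1P.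
  by exists 0, None, k; rewrite subrr.
apply: ub_le_sup; first by exists K => _ [x [j [_ ->]]]; exact: gap.
by exists None, k; rewrite subrr.
Qed.

End sphere_laplacian.

(** * Local bounds *)

Section sphere_log.
Variable R : realType.
Local Notation sphere := (sphere R).

Lemma chord2_oo (z : R[i]) : chord2 None (sphere_point (Some z)) = (1 + Normc.normc z ^+ 2)^-1.
Proof.
case: z => a b; rewrite /chord2 inner3 -[sphere_point _]/(chart0 (a, b)) !stereo_chart0 /=.
rewrite sqr_sqrtr ?addr_ge0 ?sqr_ge0// !mul0r !add0r mul1r; have := lt0r_neq0 (oneDr2_gt0 (a, b)).
by rewrite /oneDr2/= => q0; field.
Qed.

Lemma chord2_some (z w : R[i]) : chord2 (sphere_point (Some z)) (sphere_point (Some w)) =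
  Normc.normc (z - w) ^+ 2 * ((1 + Normc.normc z ^+ 2)^-1 * (1 + Normc.normc w ^+ 2)^-1).
Proof.
case: z w => a b [c d]; rewrite /chord2 inner3 -[sphere_point (Some (a +i* b)%C)]/(chart0 (a, b)).
rewrite -[sphere_point _]/(chart0 (c, d)) !stereo_chart0 /= !sqr_sqrtr ?addr_ge0 ?sqr_ge0//.
have := lt0r_neq0 (oneDr2_gt0 (a, b)); have := lt0r_neq0 (oneDr2_gt0 (c, d)).
by rewrite /oneDr2/= => q0 q1; field; rewrite q0 q1.
Qed.

Lemma arch_log_chordal (x y : sphere) : arch_log (x, y) =
  if (sphere_dist x y == 0) || (sphere_dist None x == 0) || (sphere_dist None y == 0) then 0
  else - ln (sphere_dist None x) - ln (sphere_dist None y) + ln (sphere_dist x y).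
Proof.
have same u : sphere_dist u u = 0 by exact/sphere_dist_eq0.
case: x y => [z|] [w|] //; rewrite ?same ?eqxx ?orbT//.
have h (u : R[i]) : 0 < (1 + Normc.normc u ^+ 2)^-1 by rewrite invr_gt0 ltr_wpDr ?sqr_ge0.
have n0 (u : R[i]) : sphere_dist None (Some u) != 0 by rewrite /sphere_dist (chord2_oo u) sqrtr_eq0 -ltNge.
rewrite !(negbTE (n0 _)) !orbF; case: eqP => [/sphere_dist_eq0[->]|/eqP m0].
  by rewrite /= subrr ln0// Normc.normc0.
rewrite !ln_sphere_dist (chord2_oo z) (chord2_oo w) (chord2_some z w).
have nz : 0 < Normc.normc (z - w).
  have n_ge0 : 0 <= Normc.normc (z - w) by case: (z - w) => ? ?; exact: sqrtr_ge0.
  rewrite lt_def n_ge0 andbT; apply: contra m0 => /eqP/Normc.eq0_normc/eqP; rewrite subr_eq0 => /eqP->.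
  by rewrite same.
rewrite /= !lnM ?posrE ?exprn_gt0 ?mulr_gt0//.
by move: (ln (_^-1)) (ln (_^-1)) (ln _) => u v t; field.
Qed.

Lemma arch_log_offdiag (p : sphere * sphere) : ~ arch_offdiag p -> arch_log p = 0.
Proof.
case: p => -[z|] [w|] //= H; have -> : z = w.
  by apply: contrapT => zw; apply: H; exists z, w.
by rewrite subrr Normc.normc0 ln0.
Qed.

End sphere_log.

Section place_bounds.
Context {R : realType} {X : ptopologicalType} {A : choiceType}.
Variables (pt : A -> borel X) (rho : probability (borel X) R).
Implicit Types (F : {fset A}).
Local Notation n F := ((#|` F|)%:R : R).

(** All that the global argument uses of a place, of either kind: E is the local energy, E0 the
    discrepancy, f the local height. *)
Record place_bounds (E E0 : {fset A} -> R) (f : A -> R) : Prop := PlaceBounds {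
  pb_energy : forall F, F != fset0 ->
    E F = E0 F + 2 * ((n F)^-1 * (n F)^-1 * \sum_(a <- F) f a);
  pb_height_ge0 : forall a, 0 <= f a;
  pb_bound : exists C, forall F, F != fset0 -> - C <= E0 F;
  pb_lower : forall eta, 0 < eta -> exists B, forall F, F != fset0 -> - eta - B / n F <= E0 F;
  pb_equidistribution : forall (Fs : nat -> {fset A}) (phi : X -> R), (forall i, Fs i != fset0) ->
    (forall B, \forall i \near \oo, B <= n (Fs i)) ->
    (forall eta, 0 < eta -> \forall i \near \oo, E0 (Fs i) <= eta) -> continuous phi ->
    Rintegral (empirical pt (Fs i) : {finite_measure set (borel X) -> \bar R}) setT phi
      @[i --> \oo] --> Rintegral rho setT phi }.

Lemma green_place_bounds (oo : A) dl G B err K D L :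
  green_kernel pt rho dl G B err K ->
  (forall p, ~ D p -> L p = 0) ->
  (forall x y, L (x, y) = if (dl x y == 0) || (dl (pt oo) x == 0) || (dl (pt oo) y == 0) then 0
    else - ln (dl (pt oo) x) - ln (dl (pt oo) y) + ln (dl x y)) ->
  (forall k F, F != fset0 -> 0 <= discrepancy pt rho G k F) ->
  (forall phi : X -> R, continuous phi -> testable pt rho G phi) ->
  place_bounds
    (fun F => - charge_prod_integral (measure_diff (empirical pt F) rho) (measure_diff (empirical pt F) rho) D L)
    (discrepancy0 pt rho dl) (fun a => - ln (dl (pt oo) (pt a))).
Proof.
move=> gk LD LE Q tst; split.
- move=> F F0; rewrite (@energy_discrepancy _ _ _ _ _ oo _ _ _ _ _ _ gk _ _ LD _ F F0)//.
  by move=> x y; rewrite LE orbA.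
- by move=> a; rewrite oppr_ge0 ln_le0//; have /andP[] := gk_bound gk (pt oo) (pt a).
- by exists (2 * K) => F F0; apply: (discrepancy0_ge gk).
- exact: (discrepancy0_lower gk Q).
move=> Fs phi Fs0 card small cphi.
exact: (discrepancy_equidistribution oo gk Fs0 card small (continuous_measurable_borel cphi) (tst _ cphi)).
Qed.

End place_bounds.

Section local_bounds.
Variables (R : realType) (K : fieldExtType rat) (Kbar : fieldType) (iota : {rmorphism K -> Kbar}).
Hypothesis Kbar_closure : is_algebraic_closure iota.
Local Notation A := (option Kbar).

Lemma omap_inj (U W : Type) (h : U -> W) : injective h -> injective (omap h).
Proof. by move=> hi [x|] [y|] //= [/hi ->]. Qed.

Lemma ln_abs_le_chordal (v : nonarch_place R K) (M : nonarch_model v)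
    (j : {rmorphism Kbar -> na_field M}) x :
  ln (na_abs (j x)) <= - ln (chordal None (classical_option j (na_absP M) (Some x))).
Proof.
rewrite /= height_eval lnV ?posrE ?lt_max ?ltr01 ?orbT// opprK.
have [->|x0] := eqVneq (na_abs (j x)) 0; first by rewrite ln0// ln_ge0// le_max lexx orbT.
have xgt : 0 < na_abs (j x) by rewrite lt_def x0 (absval_ge0 (na_absP M)).
by rewrite ler_ln ?posrE ?lt_max ?xgt// le_max lexx.
Qed.

Theorem local_place_bounds (v : place R K) (M : local_model v) (j : {rmorphism Kbar -> local_field M})
    (rho : probability (borel (P1 M)) R) (pt := fun a : A => classical_point (omap j a) : borel (P1 M)) :
  (forall x, j (iota x) = local_emb M x) ->
  (exists g, continuous g /\ has_laplacian g (measure_diff rho (lambda M))) ->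
  exists E0 f, place_bounds pt rho
    (fun F => energy (measure_diff (empirical pt F) rho) (measure_diff (empirical pt F) rho)) E0 f /\
    forall x, ln (local_abs (j x)) <= f (Some x).
Proof.
case: v M j rho @pt => [v|v] M j rho /= jP [g [gc gl]].
  have ptinj : injective (fun a : A => sphere_point (omap j a)) by exact/omap_inj/fmorph_inj.
  have [err [C gk]] := sphere_green_kernel ptinj gc gl.
  exists (discrepancy0 (fun a : A => sphere_point (omap j a) : borel (sphere R)) rho (@sphere_dist R)).
  exists (fun a => - ln (sphere_dist None (sphere_point (omap j a)))); split.
    apply: (green_place_bounds (oo := None) gk).
    - exact: arch_log_offdiag.
    - exact: arch_log_chordal.
    - by move=> k F F0; exact: quad_green_ge0.
    - exact: sphere_testable.
  move=> x /=; rewrite ln_sphere_dist (chord2_oo (j x)); set r := Normc.normc _.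
  have r0 : 0 <= r by rewrite /r; case: (j x) => ? ?; exact: sqrtr_ge0.
  have p0 : 0 < 1 + r ^+ 2 by rewrite ltr_wpDr ?sqr_ge0.
  rewrite lnV ?posrE// mulrN opprK; have [->|rn] := eqVneq r 0.
    by rewrite ln0// mulr_ge0 ?invr_ge0// ln_ge0// lerDl sqr_ge0.
  have rgt : 0 < r by rewrite lt_def rn.
  rewrite mulrC ler_pdivlMr// mulr_natr -lnXn// ler_ln ?posrE ?exprn_gt0//.
  by rewrite lerDr.
pose absP := na_absP M; have ns := na_model_setting Kbar_closure jP.
have ck := chordal_kernel absP ns.
have [c pot] := chordal_potential ns gl.
have cX : compact [set: berkP1 (@na_abs _ _ _ M)] by exact: berkP1_compact.
have [err [C gk]] := ultrametric_green cX ck gc pot.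
pose pt := classical_option j absP : A -> borel (berkP1 (@na_abs _ _ _ M)).
exists (discrepancy0 pt rho (chordal (abs := @na_abs _ _ _ M))).
exists (fun a => - ln (chordal None (pt a))); split.
  apply: (green_place_bounds (pt := pt) (oo := None) gk).
  - exact: na_log_offdiag ns.
  - exact: na_log_chordal ns.
  - by move=> k F F0; exact: (ultrametric_discrepancy_ge0 ck rho k F0).
  - by move=> phi cphi; exact: (ultrametric_testable cX ck rho cphi).
exact: ln_abs_le_chordal.
Qed.

Section good_place.
Variables (v : nonarch_place R K) (M : nonarch_model v) (j : {rmorphism Kbar -> na_field M}).
Local Notation abs := (@na_abs _ _ _ M).
Let absP : is_absval abs := na_absP M.
Variable rho : probability (borel (berkP1 abs)) R.
Hypotheses (jP : forall x, j (iota x) = na_emb M x)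
  (rhoE : forall U, measurable U -> rho U = na_lambda absP U)
  (rho_lap : exists g, continuous g /\ na_laplacian absP g (measure_diff rho (na_lambda absP))).
Let pt : A -> borel (berkP1 abs) := classical_option j absP.
Let em (F : {fset A}) : {finite_measure set (borel (berkP1 abs)) -> \bar R} := empirical pt F.
Local Notation energyF F := (- charge_prod_integral (measure_diff (em F) rho) (measure_diff (em F) rho)
  (na_offdiag absP) (@na_log R _ abs)).
Local Notation n F := ((#|` F|)%:R : R).

Let chordal_ge0 x y : 0 <= - ln (chordal (abs := abs) x y).
Proof.
have ck := chordal_kernel absP (na_model_setting Kbar_closure jP).
by rewrite oppr_ge0 ln_le0//; have /andP[] := uk_bound ck x y.
Qed.

(** Here rho is the Dirac mass at the Gauss point, which is at chordal distance 1 from every point;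
    all integrals against rho vanish and sums of nonnegative terms over F remain. *)
Lemma good_place_energy F : F != fset0 ->
  energyF F = (n F)^-1 * (n F)^-1 * (\sum_(a <- F) \sum_(b <- F) - ln (chordal (pt a) (pt b)))
  + 2 * ((n F)^-1 * (n F)^-1 * \sum_(a <- F) - ln (chordal (pt None) (pt a))).
Proof.
move=> F0; have [g [gc gl]] := rho_lap; have ns := na_model_setting Kbar_closure jP.
have ck := chordal_kernel absP ns; have [c pot] := chordal_potential ns gl.
have cX : compact [set: berkP1 abs] by exact: berkP1_compact.
have [err [C gk]] := ultrametric_green cX ck gc pot.
rewrite (@energy_discrepancy _ _ _ _ _ None _ _ _ _ _ _ gk _ _ (@na_log_offdiag _ _ _ _ _ _ ns) _ F F0); last first.
  by move=> x y; rewrite (na_log_chordal absP ns) orbA.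
congr (_ + _); rewrite /discrepancy0.
have I0 x : (\int[rho]_y (- ln (chordal x y))%:E = 0)%E.
  rewrite (@eq_measure_integral _ _ _ _ (na_lambda absP)); last by move=> U mU _; exact: rhoE.
  rewrite integral_dirac// ?diracT ?mul1e; last first.
    apply/measurable_EFinP; apply: measurableT_comp => //; apply: measurableT_comp => //.
    exact: (measurableT_comp (gk_meas gk) (measurable_pair1 (x : borel (berkP1 abs)))).
  by rewrite (uk_sym ck) (chordal_gauss absP ns) ln1 oppr0.
have P0 a : pot0 rho (chordal (abs := abs)) (pt a) = 0 := congr1 fine (I0 (pt a)).
rewrite (_ : \sum_(a <- _) pot0 _ _ _ = 0); last by apply: big1_seq => a _; exact: P0.
rewrite (_ : energy0 _ _ = 0) ?mulr0 ?subr0 ?addr0// /energy0 /Rintegral fubini_tonelli1; last 2 first.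
- apply/measurable_EFinP; apply: measurableT_comp => //; apply: measurableT_comp => //.
  exact: gk_meas gk.
- by move=> p; rewrite lee_fin.
by rewrite (_ : integral _ _ _ = 0%E)//; apply: integral0_eq => x _; exact: I0.
Qed.

Lemma good_place_energy_ge0 F : F != fset0 ->
  0 <= energyF F.
Proof.
move=> F0; rewrite good_place_energy// addr_ge0// !mulr_ge0 ?invr_ge0//.
  by apply: sumr_ge0 => a _; apply: sumr_ge0 => b _.
by apply: sumr_ge0 => a _.
Qed.

Lemma good_place_height F x : F != fset0 -> Some x \in F ->
  2 * ((n F)^-1 * (n F)^-1 * ln (abs (j x))) <=
  energyF F.
Proof.
move=> F0 xF; rewrite (good_place_energy F0) -[leLHS]add0r lerD//.
  by rewrite !mulr_ge0 ?invr_ge0//; apply: sumr_ge0 => a _; apply: sumr_ge0 => b _; exact: chordal_ge0.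
rewrite ler_pM2l ?ltr0n// ler_wpM2l ?mulr_ge0 ?invr_ge0//.
apply: le_trans (ln_abs_le_chordal j x) _; rewrite [leRHS](big_fsetD1 (Some x))//= lerDl.
apply: sumr_ge0 => a _; exact: (chordal_ge0 (pt None) (pt a)).
Qed.
Lemma good_place_energy_eq0 F : F != fset0 ->
  (forall x, Some x \in F -> abs (j x) <= 1) ->
  (forall x y, Some x \in F -> Some y \in F -> x != y -> abs (j x - j y) = 1) ->
  energyF F = 0.
Proof.
move=> F0 F1 F2; rewrite good_place_energy//; have ns := na_model_setting Kbar_closure jP.
have ck := chordal_kernel absP ns.
have hE x : Some x \in F -> height_level (eval_point absP (j x)) = 1 by move=> xF; rewrite (height_eval absP); apply/max_idPr/F1.
have L0 a : a \in F -> - ln (chordal (pt None) (pt a)) = 0.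
  case: a => [x|] xF /=; last by rewrite ln0 ?oppr0.
  by rewrite hE// invr1 ln1 oppr0.
rewrite big1_seq ?mulr0 ?add0r; last first.
  move=> a /= aF; rewrite big1_seq// => b /= bF; case: a b aF bF => [x|] [y|] xF yF; last 3 first.
  - by rewrite (uk_sym ck); exact: L0.
  - exact: L0.
  - exact: L0.
  rewrite /= !hE// mulr1 divr1 (meet_eval absP ns) (snorm_eval absP).
  have [->|xy] := eqVneq x y; first by rewrite subrr (absval0 absP) ln0 ?oppr0.
  by rewrite absvalC// F2 ?ln1 ?oppr0// eq_sym.
by rewrite big1_seq ?mulr0// => a /= aF; exact: L0.
Qed.

End good_place.
End local_bounds.

(** * Places of K and integrality outside a finite set *)

Section places.
Variables (R : realType) (K : fieldExtType rat).

Lemma nonarch_placeP (v : nonarch_place R K) : is_absval (\val v) /\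
  exists2 p, prime p & forall q : rat, \val v q%:A = padic_absval R p q.
Proof. by have := valP v; rewrite inE => -[]. Qed.

Lemma arch_placeP (v : arch_place R K) :
  is_absval (\val v) /\ forall q : rat, \val v q%:A = `|ratr q|.
Proof. by have := valP v; rewrite inE. Qed.

Lemma arch_places_finite : finite_set [set: arch_place R K].
Proof.
have fV : finite_set [set v : K -> R | is_absval v /\ forall q : rat, v q%:A = `|ratr q|].
  apply: (@absval_extensions_finite R K (fun q => `|ratr q|)) => [v []//|v q []//|].
  by exists 2^-1; rewrite fmorphV /= ratr_nat ger0_norm ?invr_ge0// invr_gt0 ltr0n invf_lt1// ltr1n.
apply: sub_finite_set (finite_preimage (f := fun w : arch_place R K => \val w) _ fV) => [v _|v w _ _].
  exact: arch_placeP.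
exact: val_inj.
Qed.

Lemma places_above_finite p : prime p ->
  finite_set [set v : nonarch_place R K | forall q : rat, \val v q%:A = padic_absval R p q].
Proof.
move=> pp.
have fV : finite_set [set v : K -> R | is_absval v /\ forall q : rat, v q%:A = padic_absval R p q].
  apply: (@absval_extensions_finite R K (padic_absval R p)) => [v []//|v q []//|].
  by exists p%:Q; rewrite padic_prime// invr_gt0 ltr0n prime_gt0//= invf_lt1 ?ltr0n ?prime_gt0// ltr1n prime_gt1.
apply: sub_finite_set (finite_preimage (f := fun w : nonarch_place R K => \val w) _ fV).
  by move=> v H; split => //; have [] := nonarch_placeP v.
by move=> v w _ _; exact: val_inj.
Qed.

Lemma absval_nat_le1 (v : nonarch_place R K) n : \val v n%:R <= 1.
Proof.
have [vP [p _ vp]] := nonarch_placeP v; have -> : n%:R = (n%:Q)%:A :> K by rewrite -in_algE !rmorph_nat.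
by rewrite vp padic_nat_le1.
Qed.

Lemma nonarch_um (v : nonarch_place R K) x y : \val v (x + y) <= Num.max (\val v x) (\val v y).
Proof.
by have [[v0 _ vM vD] _] := nonarch_placeP v; apply: ultrametric_of_nat => // n; exact: absval_nat_le1.
Qed.

End places.

Section ultrametric_roots.
Variables (R : realType) (F : fieldType) (v : F -> R).
Hypotheses (vP : is_absval v) (um : forall x y, v (x + y) <= Num.max (v x) (v y)).

Lemma um_sum_bound (I : Type) (r : seq I) (P : pred I) (f : I -> F) B : 0 <= B ->
  (forall i, P i -> v (f i) <= B) -> v (\sum_(i <- r | P i) f i) <= B.
Proof.
move=> B0 fB; elim/big_ind: _ => //; first by rewrite (absval0 vP).
by move=> x y xB yB; apply: le_trans (um _ _) _; rewrite ge_max xB.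
Qed.

Lemma root_absval_le1 (p : {poly F}) x : v (lead_coef p) = 1 -> (forall i, v p`_i <= 1) ->
  root p x -> v x <= 1.
Proof.
move=> l1 c1 /eqP px; rewrite leNgt; apply/negP => x1.
have x0 : 0 < v x by exact: lt_trans x1.
have p0 : p != 0 by apply/eqP => E; move: l1; rewrite E lead_coef0 (absval0 vP); lra.
move: px; rewrite horner_coef (polySpred p0) big_ord_recr/= => /eqP; rewrite addrC addr_eq0 => /eqP E.
have := congr1 v E; rewrite (absvalN vP) (absvalM vP) l1 mul1r (absvalX vP).
case n0 : (size p).-1 => [|n].
  by rewrite big_ord0 (absval0 vP) expr0 => /esym/eqP; rewrite eq_sym oner_eq0.
move=> {}E; have : v x ^+ n.+1 <= v x ^+ n.
  rewrite E; apply: um_sum_bound => [|i _]; first by rewrite exprn_ge0// ltW.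
  rewrite (absvalM vP) (absvalX vP); apply: le_trans (_ : 1 * v x ^+ i <= _).
    by rewrite ler_wpM2r// exprn_ge0// ltW.
  by rewrite mul1r ler_eXn2l// -ltnS.
by rewrite leNgt exprS ltr_pMl ?exprn_gt0// x1.
Qed.

End ultrametric_roots.

Section almost_all_places.
Variables (R : realType) (K : fieldExtType rat) (Kbar : fieldType) (iota : {rmorphism K -> Kbar}).
Hypothesis Kbar_closure : is_algebraic_closure iota.

Lemma padic_int_unit p (z : int) : ~~ (p %| `|z|)%N -> padic_absval R p z%:~R = 1.
Proof.
move=> pz; have z0 : z != 0 by apply: contraNneq pz => ->.
rewrite /padic_absval intr_eq0 (negbTE z0) denq_int numq_int.
by rewrite logn1 expr0 div1r lognE (negbTE pz) !andbF expr0 invr1.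
Qed.

Lemma absval_int (v : nonarch_place R K) (z : int) : \val v z%:~R <= 1.
Proof.
case: z => n; first exact: absval_nat_le1.
by rewrite NegzE mulrNz (absvalN (nonarch_placeP v).1) -pmulrn absval_nat_le1.
Qed.

(** At a place above a prime not dividing the lead coefficient of a primitive relation, c is
    integral. Finitely many primes remain, each below finitely many places. *)
Lemma numfield_integral_places (c : K) : finite_set [set v : nonarch_place R K | 1 < \val v c].
Proof.
have [f [f1 fc _ _]] := primitive_minpoly c.
have l0 : (0 < `|lead_coef f|)%N by rewrite absz_gt0 lead_coef_eq0; apply/eqP => E; move: f1; rewrite E zcontents0.
apply: (@sub_finite_set _ _ (\bigcup_(p in [set p | prime p /\ (p %| `|lead_coef f|)%N])
  [set v : nonarch_place R K | forall q : rat, \val v q%:A = padic_absval R p q])); last first.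
  apply: bigcup_finite; last by move=> p [pp _]; exact: places_above_finite.
  apply: (@sub_finite_set _ _ `I_(`|lead_coef f|.+1)) => [p [_ /dvdn_leq]|]; last exact: finite_II.
  by move=> /(_ l0) /=; rewrite ltnS.
move=> v /= cv; have [vP [p pp vp]] := nonarch_placeP v; exists p => //; split => //.
apply: contrapT => /negP pl; move: cv; apply/negP; rewrite -leNgt.
apply: (@root_absval_le1 _ _ (\val v) vP (@nonarch_um _ _ v) (map_poly intr f)) => //; last first.
  by move=> i; rewrite coef_map absval_int.
by rewrite -map_intr_alg lead_coef_map lead_coef_map_inj ?rmorph0//=; [rewrite vp padic_int_unit | exact: intr_inj].
Qed.

Variables (M : forall v : nonarch_place R K, nonarch_model v)
  (j : forall v, {rmorphism Kbar -> na_field (M v)}).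
Hypothesis jP : forall v x, j v (iota x) = na_emb (M v) x.

Let abs v x := na_abs (j v x).

Lemma closure_integral_places (x : Kbar) : finite_set [set v : nonarch_place R K | 1 < abs v x].
Proof.
have [p p0 px] := Kbar_closure.1 x; pose q := (lead_coef p)^-1 *: p.
have l0 : lead_coef p != 0 by rewrite lead_coef_eq0.
have qx : root (map_poly iota q) x by rewrite linearZ /= rootZ ?fmorph_eq0 ?invr_eq0.
have ql : lead_coef q = 1 by rewrite lead_coefZ mulVf.
apply: (@sub_finite_set _ _ (\bigcup_(i in `I_(size q)) [set v : nonarch_place R K | 1 < \val v q`_i])); last first.
  by apply: bigcup_finite; [exact: finite_II | move=> i _; exact: numfield_integral_places].
move=> v /= xv; apply: contrapT => H; move: xv; apply/negP; rewrite -leNgt.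
have vP := na_absP (M v).
apply: (@root_absval_le1 _ _ _ vP (ns_um (na_model_setting Kbar_closure (jP v)))
  (map_poly (j v) (map_poly iota q))).
- by rewrite !lead_coef_map ql !rmorph1 (absval1 vP).
- move=> i; rewrite !coef_map /= jP na_embP leNgt; apply/negP => qi; apply: H.
  exists i => //=; rewrite ltnNge; apply/negP => si.
  by move: qi; rewrite nth_default// (absval0 (nonarch_placeP v).1); lra.
by rewrite fmorph_root.
Qed.

Lemma closure_unit_places (x : Kbar) : x != 0 ->
  finite_set [set v : nonarch_place R K | abs v x != 1].
Proof.
move=> x0; apply: (@sub_finite_set _ _ ([set v : nonarch_place R K | 1 < abs v x] `|`
    [set v | 1 < abs v x^-1])); last first.
  by rewrite finite_setU; split; exact: closure_integral_places.
move=> v /=; have vP := na_absP (M v); rewrite neq_lt => /orP[xv|]; [right | by left].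
by rewrite /abs fmorphV (absvalV vP) invf_gt1// (absval_gt0 vP) fmorph_eq0.
Qed.

End almost_all_places.

(** * Northcott's theorem *)

Section galois_descent.
Variables (K : fieldExtType rat) (Kbar : fieldType) (iota : {rmorphism K -> Kbar}).
Hypothesis Kbar_closure : is_algebraic_closure iota.

Lemma uniq_stable_perm (T : eqType) (h : T -> T) (r : seq T) : injective h -> uniq r ->
  (forall x, x \in r -> h x \in r) -> perm_eq (map h r) r.
Proof.
move=> hi ur hr; have um : uniq (map h r) by rewrite map_inj_uniq.
apply: uniq_perm => //; apply: (uniq_min_size um _ _).2; last by rewrite size_map.
by move=> _ /mapP[x xr ->]; exact: hr.
Qed.

(** An endomorphism fixing K permutes the finitely many roots of each polynomial over K. *)
Lemma closure_endomorphism_bijective (s : {rmorphism Kbar -> Kbar}) :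
  (forall x, s (iota x) = iota x) -> bijective s.
Proof.
move=> sK; have si : injective s by exact: fmorph_inj.
have surj y : exists x, s x = y.
  have [p p0 py] := Kbar_closure.1 y.
  have P0 : map_poly iota p != 0 by rewrite map_poly_eq0.
  have [r rE] := closure_split Kbar_closure P0.
  have mem z : (z \in undup r) = root (map_poly iota p) z by rewrite mem_undup rE rootZ ?lead_coef_eq0// root_prod_XsubC.
  have sp : map_poly s (map_poly iota p) = map_poly iota p by apply/polyP => i; rewrite !coef_map /= sK.
  have pe := @uniq_stable_perm _ s (undup r) si (undup_uniq r).
  have : y \in map s (undup r).
    rewrite (perm_mem (pe _)) ?mem// => x; rewrite !mem => /(rmorph_root s).
    by rewrite sp.
  by move=> /mapP[x _ ->]; exists x.
have /choice[g gP] := surj; exists g => // x; exact/si/gP.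
Qed.

(** Every root of the minimal polynomial is a conjugate of c, hence equals c; in characteristic 0
    the second coefficient, -n c up to the lead coefficient, shows that c comes from K. *)
Lemma galois_fixed_base c :
  (forall s : {rmorphism Kbar -> Kbar}, bijective s -> (forall x, s (iota x) = iota x) -> s c = c) ->
  exists a, iota a = c.
Proof.
move=> fixed; pose Q n := `[< exists p : {poly K}, [/\ p != 0, root (map_poly iota p) c & size p = n] >].
have [p0 p00 p0c] := Kbar_closure.1 c.
have exQ : exists n, Q n by exists (size p0); apply/asboolP; exists p0.
case: (ex_minnP exQ) => m /asboolP[p [pn pc pm]] mmin.
have dvd q : root (map_poly iota q) c -> p %| q.
  move=> qc; apply: contrapT => /negP nd.
  have r0 : q %% p != 0 by rewrite /dvdp in nd.
  have : (m <= size (q %% p)%R)%N.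
    apply: mmin; apply/asboolP; exists (q %% p); split => //.
    move: qc; rewrite {1}(divp_eq q p) rmorphD rmorphM /= !rootE hornerD hornerM.
    by rewrite (eqP pc) mulr0 add0r.
  by rewrite -pm leqNgt ltn_modp pn.
have roots z : root (map_poly iota p) z -> z = c.
  move=> pz; have [q /dvd/dvdpP[h ->]|s [<- sK]] := @hom_extension K Kbar Kbar iota iota
      Kbar_closure.1 Kbar_closure.2 c z.
    by rewrite rmorphM /= rootM pz orbT.
  by apply: fixed => //; exact: closure_endomorphism_bijective.
have P0 : map_poly iota p != 0 by rewrite map_poly_eq0.
have [r rE] := closure_split Kbar_closure P0.
have rc a : a \in r -> a = c by move=> ar; apply: roots; rewrite rE rootZ ?lead_coef_eq0// root_prod_XsubC.
have r0 : (size r != 0)%N by apply/eqP => /size0nil E; move: pc; rewrite rE E big_nil alg_polyC rootC lead_coef_eq0 (negbTE P0).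
have := coefPn_prod_XsubC r0; set n := size r in r0 *.
have -> : \sum_(a <- r) a = n%:R * c.
  rewrite (eq_big_seq (fun=> c)) //.
  by rewrite big_const_seq count_predT iter_addr_0 mulr_natl.
move=> E; exists (- (p`_n.-1 / lead_coef p / n%:R)).
have nn : n%:R != 0 :> Kbar.
  have -> : n%:R = iota (n%:Q)%:A by rewrite -in_algE !rmorph_nat.
  by rewrite fmorph_eq0 scaler_eq0 oner_eq0 orbF intr_eq0 eqz_nat.
rewrite rmorphN /= !fmorph_div /= rmorph_nat -coef_map -lead_coef_map {1}rE coefZ E.
have : lead_coef (map_poly iota p) != 0 by rewrite lead_coef_eq0.
by move: (lead_coef _) n%:R nn => l u un ln; field; rewrite ?ln ?un.
Qed.

Definition finite_points (F : {fset option Kbar}) : seq Kbar := pmap id (enum_fset F).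

Lemma finite_pointsP F x : (x \in finite_points F) = (Some x \in F).
Proof.
rewrite /finite_points mem_pmap; apply/mapP/idP => [[[y|] yF //= [->]]//|xF].
by exists (Some x).
Qed.

Lemma finite_points_uniq F : uniq (finite_points F).
Proof. by apply: pmap_uniq (fset_uniq F) => [[x|]//]; apply: Some_inj. Qed.

Lemma galois_invariant_coefs F i : galois_invariant iota F ->
  exists a, iota a = (\prod_(x <- finite_points F) ('X - x%:P))`_i.
Proof.
move=> FG; apply: galois_fixed_base => s sb sK; rewrite -coef_map rmorph_prod /=.
under eq_bigr do rewrite rmorphB /= map_polyX map_polyC /=.
have -> : \prod_(x <- finite_points F) ('X - (s x)%:P) = \prod_(y <- map s (finite_points F)) ('X - y%:P) by rewrite big_map.
rewrite (perm_big (finite_points F))//=.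
apply: uniq_stable_perm; [exact: fmorph_inj | exact: finite_points_uniq |].
by move=> x; rewrite !finite_pointsP => /(FG s sb sK).
Qed.

End galois_descent.

Lemma normc_absval (R : realType) : is_absval (@Normc.normc R).
Proof.
have nE (z : R[i]) : `|z| = (Normc.normc z)%:C%C by case: z.
split.
- by case=> a b; exact: sqrtr_ge0.
- by move=> z; split => [/Normc.eq0_normc|->]; rewrite ?Normc.normc0.
- exact: Normc.normcM.
by move=> x y; have := ler_normD x y; rewrite !nE -raddfD /= lecR.
Qed.

Section northcott.
Variables (R : realType) (K : fieldExtType rat).
Local Notation d := (\dim {: K}).

Lemma um_max_twice (F : fieldType) (v : F -> R) n (t : 'I_n -> F) : is_absval v ->
  (forall x y, v (x + y) <= Num.max (v x) (v y)) -> \sum_i t i = 0 -> (exists i, t i != 0) ->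
  exists i j : 'I_n, [/\ (i < j)%N, t i != 0, t j != 0 & v (t i) = v (t j)].
Proof.
move=> vP um s0 [i0 ti0]; have [i _ imax] := arg_maxP (fun i => v (t i)) (isT : xpredT i0).
have vi : 0 < v (t i) by apply: lt_le_trans (imax i0 isT); rewrite absval_gt0.
suff [j ji jE] : exists2 j, j != i & v (t j) = v (t i).
  have tn k : v (t k) = v (t i) -> t k != 0 by move=> E; rewrite -(absval_gt0 vP) E.
  have ti := tn i erefl; have tj := tn j jE.
  have [ij|ij|/val_inj E] := ltngtP i j; [by exists i, j | by exists j, i | by rewrite E eqxx in ji].
apply: contrapT => H; have lt j : j != i -> v (t j) < v (t i).
  by move=> ji; rewrite lt_neqAle (imax j isT : v (t j) <= v (t i)) andbT; apply/eqP => E; apply: H; exists j.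
move: s0; rewrite (bigD1 i)//= => /eqP; rewrite addr_eq0 => /eqP E.
have : v (\sum_(j | j != i) t j) < v (t i).
  elim/big_ind: _ => //; first by rewrite (absval0 vP).
  by move=> x y xi yi; rewrite (le_lt_trans (um _ _))// gt_max xi.
by rewrite -(absvalN vP) -E ltxx.
Qed.

Lemma padic_int (p : nat) (z : int) : z != 0 -> padic_absval R p z%:~R = p%:R ^- logn p `|z|.
Proof. by move=> z0; rewrite /padic_absval intr_eq0 (negbTE z0) denq_int numq_int logn1 expr0 div1r. Qed.

(** In an integral relation of c two terms share the largest absolute value, so v(c)^(j - i) is an
    integral power of p; it exceeds 1, and j - i is at most the degree of K. *)
Lemma absval_gt1_ge (v : nonarch_place R K) p c : prime p ->
  (forall q : rat, \val v q%:A = padic_absval R p q) -> 1 < \val v c -> p%:R <= \val v c ^+ d.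
Proof.
move=> pp vp c1; have [vP _] := nonarch_placeP v; have [f [f1 fc fs _]] := primitive_minpoly c.
have c0 : c != 0 by rewrite -(absval_gt0 vP) (lt_trans ltr01).
have f0 : f != 0 by apply/eqP => E; move: f1; rewrite E zcontents0.
have fz (z : int) : z%:~R = (z%:~R : rat)%:A :> K by rewrite -in_algE rmorph_int.
have vz (z : int) : z != 0 -> \val v z%:~R = p%:R ^- logn p `|z| by move=> z0; rewrite fz vp padic_int.
have sz : (size (map_poly intr f : {poly K}) <= size f)%N by exact: size_poly.
have s0 : \sum_(i < size f) (f`_i)%:~R * c ^+ i = 0 :> K by move/eqP: fc; rewrite (horner_coef_wide _ sz) => E; rewrite -[RHS]E; apply: eq_bigr => i _; rewrite coef_map.
have zn (z : int) : (z%:~R != 0 :> K) = (z != 0) by rewrite fz scaler_eq0 oner_eq0 orbF intr_eq0.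
have [|i [j [ij]]] := um_max_twice vP (@nonarch_um _ _ v) s0.
  have l : ((size f).-1 < size f)%N by rewrite prednK// lt0n size_poly_eq0.
  by exists (Ordinal l); rewrite mulf_neq0 ?expf_neq0// zn -lead_coefE lead_coef_eq0.
rewrite !mulf_eq0 !negb_or !zn => /andP[fi _] /andP[fj _]; rewrite !(absvalM vP) !(absvalX vP) !vz//.
have v0 : 0 < \val v c by exact: lt_trans c1.
have p0 : 0 < p%:R :> R by rewrite ltr0n prime_gt0.
set a := logn _ _; set b := logn _ _ => E.
have E2 : p%:R ^- a = p%:R ^- b * \val v c ^+ (j - i).
  apply: (mulIf (expf_neq0 i (lt0r_neq0 v0))).
  by rewrite E -mulrA -exprD subnK// ltnW.
have {}E2 : p%:R ^+ b = p%:R ^+ a * \val v c ^+ (j - i).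
  have pa : p%:R ^+ a != 0 :> R by rewrite expf_neq0// gt_eqF.
  have pb : p%:R ^+ b != 0 :> R by rewrite expf_neq0// gt_eqF.
  by rewrite -[\val v c ^+ _](mulKf (invr_neq0 pb)) invrK -E2 mulrCA divff// mulr1.
have ji : (0 < j - i)%N by rewrite subn_gt0.
have ab : (a < b)%N.
  rewrite -(@ltr_eXn2l R p%:R) ?ltr1n ?prime_gt1// E2 ltr_pMr ?exprn_gt0//.
  by rewrite exprn_egt1// -lt0n.
apply: le_trans (_ : \val v c ^+ (j - i) <= _).
  rewrite -(@ler_pM2l _ (p%:R ^+ a)) ?exprn_gt0// -E2 -exprSr ler_weXn2l//.
  by rewrite ler1n prime_gt0.
rewrite ler_weXn2l// ?ltW//; apply: leq_trans (leq_subr _ _) _.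
by rewrite -ltnS; apply: leq_trans fs.
Qed.

Lemma int_interval_finite (B : nat) : finite_set [set z : int | (`|z| <= B)%N].
Proof.
apply: (@sub_finite_set _ _ ([set Posz n | n in `I_B.+1] `|` [set - Posz n | n in `I_B.+1])).
  by case=> n zB; [left; exists n | right; exists n.+1; rewrite ?NegzE].
by rewrite finite_setU; split; apply: finite_image; exact: finite_II.
Qed.

Lemma finite_poly_over (A : nzRingType) (I : set A) n : finite_set I ->
  finite_set [set f : {poly A} | (size f <= n)%N /\ forall i, I f`_i].
Proof.
move=> fI; elim: n => [|n IH].
  apply: sub_finite_set (finite_set1 0) => f [+ _].
  by rewrite leqn0 size_poly_eq0 => /eqP.
apply: sub_finite_set (finite_image (fun u => cons_poly u.1 u.2) (finite_setX fI IH)) => f [fn fB].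
have E i : (\poly_(i < n) f`_i.+1)`_i = f`_i.+1 by rewrite coef_poly; case: ltnP => // ni; rewrite nth_default// (leq_trans fn).
exists (f`_0, \poly_(i < n) f`_i.+1) => /=.
  by split => //=; split => [|i]; [exact: size_poly | rewrite E].
by apply/polyP => -[|i]; rewrite coef_cons//= E.
Qed.

Lemma absval_prod_XsubC (F : fieldType) (v : F -> R) (E : R) (r : seq F) i : is_absval v -> 0 <= E ->
  (forall b, b \in r -> v b <= E) -> v (\prod_(b <- r) ('X - b%:P))`_i <= (1 + E) ^+ size r.
Proof.
move=> vP E0; elim: r i => [|b r IH] i rE.
  by rewrite big_nil coef1 expr0; case: (i == 0%N); rewrite ?(absval1 vP) ?(absval0 vP).
rewrite big_cons mulrBl coefB coefXM coefCM /= exprS mulrDl mul1r.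
have IH' k := IH k (fun b' b'r => rE b' (mem_behead (s := b :: r) b'r)).
apply: le_trans (absvalB vP _ _) _; apply: lerD.
  by case: (i == 0%N); [rewrite (absval0 vP) exprn_ge0// addr_ge0 | exact: IH'].
rewrite (absvalM vP); apply: ler_pM; rewrite ?(absval_ge0 vP)//.
by apply: rE; exact: mem_head.
Qed.

(** As f divides all integral relations of y, some complex embedding of K sends y to its root b, and
    the modulus induces a place. *)
Lemma conjugate_place (y : K) (f : {poly int}) (b : R[i]) :
  (forall g : {poly int}, root (map_poly intr g) y -> exists h, g = f * h) ->
  root (map_poly intr f) b -> exists v : arch_place R K, \val v y = Normc.normc b.
Proof.
move=> fmin fb; pose ji : {rmorphism rat -> R[i]} := @ratr R[i].
have Kalg (x : K) : algebraicOver (in_alg K) x.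
  have [g [g1 gx _ _]] := primitive_minpoly x.
  exists (map_poly intr g); last by rewrite map_intr_alg.
  rewrite -size_poly_eq0 size_rat_int_poly size_poly_eq0.
  by apply/eqP => E; rewrite E zcontents0 in g1.
have Cclosed (p : {poly R[i]}) : (1 < size p)%N -> exists x, root p x by move=> p1; apply/closed_rootP; rewrite neq_ltn p1 orbT.
have [|s [sy sQ]] := @hom_extension rat K R[i] (in_alg K) ji Kalg Cclosed y b.
  move=> q; have [g [a a0 ->]] := rat_poly_scale q.
  have ra (F : fieldType) (m : {rmorphism rat -> F}) x :
      root (map_poly m (a%:~R^-1 *: map_poly intr g)) x = root (map_poly intr g) x.
    have -> : map_poly m (a%:~R^-1 *: map_poly intr g) = m a%:~R^-1 *: map_poly intr g by apply/polyP => i; rewrite !(coef_map, coefZ) /= rmorphM rmorph_int.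
    by rewrite rootZ// fmorph_eq0 invr_eq0 intr_eq0.
  rewrite !ra => /fmin[h ->]; rewrite rmorphM /= rootM fb //.
have vP := normc_absval R.
have aP : is_absval (fun x : K => Normc.normc (s x)).
  split.
  - by move=> x; exact: (absval_ge0 vP (s x)).
  - move=> x; split => [/eqP|->]; last by rewrite rmorph0 (absval0 vP).
    by rewrite (absval_eq0 vP) fmorph_eq0 => /eqP.
  - by move=> u w; rewrite rmorphM (absvalM vP).
  - by move=> u w; rewrite rmorphD (absvalD vP).
have aQ (q : rat) : Normc.normc (s q%:A) = `|ratr q|.
  rewrite (sQ q : s q%:A = ratr q) -(fmorph_rat (real_complex R)) /=.
  by rewrite expr0n addr0 sqrtr_sqr.
pose V := [set v : K -> R | is_absval v /\ forall q : rat, v q%:A = `|ratr q|].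
have sV : (fun x => Normc.normc (s x)) \in V by exact/mem_set.
by exists (exist (fun w => is_true (w \in V)) _ sV); rewrite /= sy.
Qed.

(** By [nonintegral_place] no prime divides the lead coefficient of the minimal relation f, which is
    thus 1 or -1. Its complex roots have moduli bounded by E through [conjugate_place], so its
    integral coefficients are bounded. *)
Lemma northcott_integral (E : R) : 0 <= E -> finite_set [set y : K |
  (forall v : nonarch_place R K, \val v y <= 1) /\ (forall v : arch_place R K, \val v y <= E)].
Proof.
move=> E0; pose B := Num.bound ((1 + E) ^+ d).
have E1 : 1 <= 1 + E by rewrite lerDl.
have rat0 (f : {poly int}) : f != 0 -> map_poly intr f != 0 :> {poly K}.
  by rewrite -map_intr_alg map_poly_eq0 -!size_poly_eq0 size_rat_int_poly.
apply: (@sub_finite_set _ _ ([set 0] `|` \bigcup_(f in [set f : {poly int} | f != 0] `&`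
    [set f | (size f <= d.+1)%N /\ forall i, (`|(f`_i)%R| <= B)%N]) [set x | root (map_poly intr f : {poly K}) x])); last first.
  rewrite finite_setU; split; first exact: finite_set1.
  apply: bigcup_finite => [|f [/= f0 _]]; last exact/poly_roots_finite/rat0.
  by apply: finite_setIr; apply: (finite_poly_over _ (int_interval_finite B)).
move=> y [yna yar]; have [->|y0] := eqVneq y 0; [by left | right].
have [f [f1 fy fs fmin]] := primitive_minpoly y.
have f0 : f != 0 by apply/eqP => h; move: f1; rewrite h zcontents0.
exists f => //; split => //; split => // i.
have l1 : `|lead_coef f|%N = 1%N.
  apply/eqP; apply: contraT => l1.
  have /pdivP[p pp pl] : (1 < `|lead_coef f|)%N by rewrite ltn_neqAle eq_sym l1 absz_gt0 lead_coef_eq0.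
  have [|v [vP vp vy]] := @nonintegral_place R K p pp y y0.
    by move=> g /fmin[h ->]; rewrite lead_coefM abszM dvdn_mulr.
  pose V := [set v : K -> R | is_absval v /\ exists2 p, prime p & forall q : rat, v q%:A = padic_absval R p q].
  have vV : v \in V by apply/mem_set; split => //; exists p.
  by have := yna (exist (fun w => is_true (w \in V)) _ vV); rewrite /= leNgt vy.
have [r rE] := closed_field_poly_normal (map_poly intr f : {poly R[i]}).
have lE : lead_coef (map_poly intr f : {poly R[i]}) = (lead_coef f)%:~R by rewrite lead_coef_map_inj ?rmorph0//; exact: intr_inj.
have cP := normc_absval R.
have nz (z : int) : Normc.normc (z%:~R : R[i]) = `|z|%N%:R.
  have nn m : Normc.normc (m%:R : R[i]) = m%:R by rewrite -(rmorph_nat (real_complex R)) /= expr0n addr0 sqrtr_sqr ger0_norm.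
  by case: z => m; [exact: (nn m) | rewrite NegzE mulrNz (absvalN cP); exact: (nn m.+1)].
have ln0 : lead_coef (map_poly intr f : {poly R[i]}) != 0 by rewrite lE intr_eq0 lead_coef_eq0.
have rb b : b \in r -> Normc.normc b <= E.
  move=> br; have [|v <-] := conjugate_place fmin (b := b); last exact: yar.
  by rewrite rE rootZ// root_prod_XsubC.
have sr : (size r <= d)%N.
  rewrite -ltnS; apply: leq_trans fs; have := size_poly (size f) (fun i => (f`_i)%:~R : R[i]).
  by rewrite -/(map_poly intr f) rE size_scale// size_prod_XsubC.
have := absval_prod_XsubC i cP E0 rb.
have -> : Normc.normc (\prod_(b <- r) ('X - b%:P))`_i = `|(f`_i)%R|%N%:R.
  rewrite -nz -coef_map rE coefZ (absvalM cP) lE nz l1 mul1r //.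
move=> fB; rewrite -(ler_nat R); apply: le_trans fB _.
apply: le_trans (ler_weXn2l E1 sr) (ltW (archi_boundP _)).
by rewrite exprn_ge0// (le_trans ler01).
Qed.

(** Multiplication by N makes c integral: v c > 1 above p forces p <= v(c)^d < B, so p divides the
    factorial of B, and the power k brings the absolute value of N down to 2^(-k) <= 1/D' at
    most. *)
Theorem northcott_numfield (D : R) : finite_set [set c : K |
  (forall v : nonarch_place R K, \val v c <= D) /\ (forall v : arch_place R K, \val v c <= D)].
Proof.
pose D' := Num.max D 1; have D1 : 1 <= D' by rewrite le_max lexx orbT.
have D0 : 0 <= D' by exact: le_trans ler01 D1.
pose B := Num.bound (D' ^+ d); pose k := Num.bound D'; pose N : nat := (B`! ^ k)%N.
have BD : D' ^+ d < B%:R by apply: archi_boundP; rewrite exprn_ge0.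
have N0 : (0 < N)%N by rewrite expn_gt0 fact_gt0.
have Nn : N%:R = (N%:Q)%:A :> K by rewrite -in_algE !rmorph_nat.
have NK : N%:R != 0 :> K by rewrite Nn scaler_eq0 oner_eq0 orbF intr_eq0 eqz_nat -lt0n.
apply: (@sub_finite_set _ _ ((fun c => N%:R * c) @^-1` [set y : K |
  (forall v : nonarch_place R K, \val v y <= 1) /\ (forall v : arch_place R K, \val v y <= N%:R * D')])); last first.
  apply: finite_preimage; first by move=> x y _ _; exact: (mulfI NK).
  by apply: northcott_integral; rewrite mulr_ge0.
move=> c /= [cna car]; split => v; last first.
  have [vP _] := arch_placeP v; rewrite (absvalM vP); apply: ler_pM; rewrite ?(absval_ge0 vP)//.
    exact: absval_nat.
  by rewrite (le_trans (car v))// le_max lexx.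
have [vP [p pp vp]] := nonarch_placeP v; rewrite (absvalM vP) Nn vp.
have cD : \val v c <= D' by rewrite (le_trans (cna v))// le_max lexx.
have [c1|c1] := leP (\val v c) 1.
  by rewrite mulr_ile1// ?padic_nat_le1// ?(absval_ge0 vP)// -vp (absval_ge0 vP).
have pB : (p <= B)%N.
  rewrite -(ler_nat R); apply: le_trans (absval_gt1_ge pp vp c1) (le_trans _ (ltW BD)).
  by rewrite lerXn2r ?nnegrE ?(absval_ge0 vP).
have kN : (k <= logn p N)%N.
  rewrite lognX -[leqLHS]muln1 leq_mul//.
  by rewrite logn_gt0 mem_primes pp fact_gt0 dvdn_fact// prime_gt0.
rewrite (padic_int p (z := N)) ?eqz_nat -?lt0n// absz_nat mulrC ler_pdivrMr ?exprn_gt0 ?ltr0n ?prime_gt0// mul1r.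
apply: le_trans cD _; apply: le_trans (ltW (archi_boundP D0)) _.
apply: le_trans (_ : (2 ^ k)%:R <= _); first by rewrite ler_nat ltnW// ltn_expl.
rewrite natrX; apply: le_trans (_ : p%:R ^+ k <= _).
  by rewrite lerXn2r ?nnegrE// ler_nat prime_gt1.
by rewrite ler_weXn2l// ler1n prime_gt0.
Qed.

End northcott.

(** * Global assembly *)

Section local_weights.
Variable R : realType.

Lemma normc_complete : absval_complete (@Normc.normc R).
Proof.
move=> u cu.
have part (p : {additive R[i] -> R}) : (forall z, `|p z| <= Normc.normc z) ->
    exists l, forall e, 0 < e -> exists N, forall n, (N <= n)%N -> `|p (u n) - l| < e.
  move=> pn; have /cvg_ex[l /cvgrPdist_lt pl] : cvgn (p \o u).
    apply/cauchy_cvgP/cauchy_exP => e /cu[N NP]; exists (p (u N)); exists N => // n Nn.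
    by rewrite /ball/= -raddfB (le_lt_trans (pn _)) ?NP.
  by exists l => e /pl[N _ NP]; exists N => n Nn; rewrite distrC; exact: NP.
have [|a aP] := part (@complex.Re R); first by case=> c d; exact: normc_ge_Re.
have [|b bP] := part (@complex.Im R); first by case=> c d; exact: normc_ge_Im.
exists (a +i* b)%C => e e0; have e2 : 0 < e / 2 by rewrite divr_gt0.
have [N1 P1] := aP _ e2; have [N2 P2] := bP _ e2; exists (maxn N1 N2) => n.
rewrite geq_max => /andP[/P1 h1 /P2 h2]; case: (u n) h1 h2 => c d /= h1 h2.
by rewrite (le_lt_trans (normc_le _ _))// (splitr e) ltrD.
Qed.

(** The images of a rational basis of K span K_v over Q_v: their span contains K and is closed. *)
Lemma closure_degree_gt0 (K : fieldExtType rat) (F : fieldType) (v : F -> R) (j : {rmorphism K -> F}) :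
  is_absval v -> absval_complete v ->
  (0 < subfield_degree (absval_closure v [set j q%:A | q in @setT rat]) (absval_closure v (range j)))%N.
Proof.
move=> vP vc; set k0 := [set j q%:A | q in @setT rat].
have k0L : k0 `<=` range j by move=> _ [q _ <-]; exists q%:A.
have rg (G : fieldType) (h : {rmorphism G -> F}) : [/\ forall x y, range h x -> range h y -> range h (x - y),
    forall x y, range h x -> range h y -> range h (x * y), forall x, range h x -> range h x^-1 & range h 1].
  split; first by move=> _ _ [q _ <-] [r _ <-]; rewrite -rmorphB; exists (q - r).
  - by move=> _ _ [q _ <-] [r _ <-]; rewrite -rmorphM; exists (q * r).
  - by move=> _ [q _ <-]; rewrite -fmorphV; exists q^-1.
  by exists 1 => //; rewrite rmorph1.
have [kB kM kV k1] := rg rat (j \o in_alg K); have [lB lM _ l1] := rg K j.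
have B' := absval_closureB vP kB; have M' := absval_closureM vP kM.
have V' := absval_closureV vP kV; have k1' := sub_absval_closure vP k1.
apply: (subfield_degree_gt0 vP vc B' M' V' k1' (@absval_closure_closed _ _ _ _ vP)
  (s := [seq j b | b <- vbasis {:K}])).
- exact: sub_absval_closure vP _ l1.
- exact: absval_closureB vP lB.
- exact: absval_closureM vP lM.
- exact: absval_closureS.
- by move=> _ /mapP[b _ ->]; apply: (sub_absval_closure vP); exists b.
apply: absval_closureS => _ [x _ <-].
rewrite (coord_vbasis (memvf x)) rmorph_sum.
elim/big_ind: _ => [|y z|i _].
- exact: (span_of0 B' k1').
- exact: (span_ofD B' M' k1').
rewrite -mulr_algl rmorphM; apply: (span_ofZ M').
  by apply: (sub_absval_closure vP); eexists.
apply: span_of_mem => //.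
by apply/map_f/mem_nth; rewrite size_tuple.
Qed.

(** The bound is uniform in v; through it the global height controls each local energy. *)
Lemma local_weight_ge (K : fieldExtType rat) (v : place R K) (M : local_model v) :
  (\dim {: K})%:R^-1 <= local_weight M.
Proof.
rewrite /local_weight -[leLHS]mul1r ler_wpM2r ?invr_ge0// ler1n.
case: v M => v M /=; apply: closure_degree_gt0.
- exact: normc_absval.
- exact: normc_complete.
- exact: na_absP.
- exact: na_complete.
Qed.

End local_weights.

(** Negative terms occur in S only, and the c u compensate them; a single term is then at most the
    whole. *)
Lemma fsbig_ge_term (R : realType) (P : choiceType) (t c : P -> R) (S : set P) (v : P) :
  finite_set [set u | t u != 0] -> finite_set S -> (forall u, 0 <= c u) ->
  (forall u, S u -> - c u <= t u) -> (forall u, ~ S u -> 0 <= t u) ->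
  t v <= \sum_(u \in [set: P]) t u + \sum_(u \in S) c u.
Proof.
move=> ft fS c0 tS tnS; pose D := fset_set ([set u | t u != 0] `|` S `|` [set v]).
have fD : finite_set ([set u | t u != 0] `|` S `|` [set v]) by rewrite !finite_setU; split.
have inD u : (u \in D) = (u \in ([set u | t u != 0] `|` S `|` [set v])) by rewrite in_fset_set.
have vD : v \in D by rewrite inD; apply/mem_set; right.
have -> : \sum_(u \in [set: P]) t u = \sum_(u <- D) t u.
  apply: (@fsbigTE _ _ _ _ D t) => u; rewrite inD => /negP uD.
  by apply/eqP/negPn/negP => tu; apply: uD; apply/mem_set; left; left.
pose c' u := if u \in S then c u else 0.
have -> : \sum_(u \in S) c u = \sum_(u <- D) c' u.
  rewrite fsbig_mkcond; apply: (@fsbigTE _ _ _ _ D) => u; rewrite inD => /negP uD.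
  by rewrite patchE ifF//; apply/negP => uS; apply: uD; apply/mem_set; left; right; exact: set_mem.
have c'0 u : 0 <= c' u by rewrite /c'; case: ifP.
have tc u : 0 <= t u + c' u.
  rewrite /c'; case: ifPn => [/set_mem /tS|/negP uS]; first by move: (t u) (c u) => a b; lra.
  by rewrite addr0; apply: tnS => Su; apply: uS; exact: mem_set.
rewrite -big_split /= (big_fsetD1 v)//=.
have : 0 <= \sum_(u <- (D `\ v)%fset) (t u + c' u) by apply: sumr_ge0.
by have := c'0 v; lra.
Qed.

Section equidistribution.
Variables (R : realType) (K : fieldExtType rat) (Kbar : fieldType) (iota : {rmorphism K -> Kbar}).
Hypothesis Kbar_closure : is_algebraic_closure iota.
Variables (M : forall v : place R K, local_model v) (e : forall v : place R K, Kembedding M iota v).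
Variables (rho : adelic_family M) (rho_adelic : is_adelic_measure rho).
Local Notation A := (option Kbar).
Local Notation n F := ((#|` F|)%:R : R).
Implicit Types (v : place R K) (F : {fset A}).

Let jv v : {rmorphism Kbar -> local_field (M v)} := Kemb (e v).
Let abs v (x : Kbar) : R := local_abs (jv v x).
Let E v F : R := energy (measure_diff (point_measure e v F) (rho v)) (measure_diff (point_measure e v F) (rho v)).
Let w v : R := local_weight (M v).
Let d : R := (\dim {: K})%:R.

Let d0 : 0 < d. Proof. by rewrite ltr0n adim_gt0. Qed.
Let wd v : d^-1 <= w v. Proof. exact: local_weight_ge. Qed.
Let w0 v : 0 < w v. Proof. by apply: lt_le_trans (wd v); rewrite invr_gt0. Qed.

Let S : set (place R K) := [set v | ~ forall U, measurable U -> rho v U = lambda (M v) U] `|` [set inl v | v in setT].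

Let S_finite : finite_set S.
Proof.
rewrite finite_setU; split; first exact: rho_adelic.1.
by apply: finite_image; exact: arch_places_finite.
Qed.

Let notS v : ~ S v -> exists2 u, v = inr u & forall U, measurable U -> rho v U = lambda (M v) U.
Proof.
move=> vS; have h : forall U, measurable U -> rho v U = lambda (M v) U.
  by apply: contrapT => h; apply: vS; left.
by case: v vS h => [v [] | v _ h]; [right; exists v | exists v].
Qed.

Let good_ge0 v F : F != fset0 -> ~ S v -> 0 <= E v F.
Proof.
move=> F0 /notS[u vE h]; subst v.
exact: (good_place_energy_ge0 Kbar_closure (KembP (e (inr u))) h (rho_adelic.2 (inr u)) F0).
Qed.

Let good_height v F x : F != fset0 -> ~ S v -> Some x \in F ->
  2 * ((n F)^-1 * (n F)^-1 * ln (abs v x)) <= E v F.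
Proof.
move=> F0 /notS[u vE h]; subst v.
exact: (good_place_height Kbar_closure (KembP (e (inr u))) h (rho_adelic.2 (inr u)) F0).
Qed.

(** Off S, a place contributes 0 as soon as the finite points of F are integral there and their
    differences are units. Finiteness of the support matters because the sum over places is 0 by
    default when the support is infinite. *)
Let E_support F : F != fset0 -> finite_set [set v | E v F != 0].
Proof.
move=> F0; pose M' (u : nonarch_place R K) : nonarch_model u := M (inr u).
pose j' (u : nonarch_place R K) : {rmorphism Kbar -> na_field (M' u)} := jv (inr u).
have jP (u : nonarch_place R K) x : j' u (iota x) = na_emb (M' u) x by exact: (KembP (e (inr u))).
pose xs := finite_points F.
pose ds := [seq p.1 - p.2 | p <- [seq (x, y) | x <- xs, y <- xs] & p.1 != p.2].
pose N1 x := [set u : nonarch_place R K | 1 < na_abs (j' u x)].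
pose N2 x := [set u : nonarch_place R K | na_abs (j' u x) != 1].
apply: (@sub_finite_set _ _ (S `|` [set inr u | u in (\bigcup_(x in [set` xs]) N1 x) `|` (\bigcup_(z in [set` ds]) N2 z)])); last first.
  rewrite finite_setU; split; first exact: S_finite.
  apply: finite_image; rewrite finite_setU; split; apply: bigcup_finite; try exact: finite_seq.
    by move=> x _; exact: (closure_integral_places Kbar_closure jP).
  move=> z /= /mapP[[x y]]; rewrite mem_filter /= => /andP[xy _] ->.
  by apply: (closure_unit_places Kbar_closure jP); rewrite subr_eq0.
move=> v /= Ev; have [|vS] := pselect (S v); [by left | right].
have [u vE h] := notS vS; subst v; exists u => //.
apply: contrapT => /not_orP[H1 H2]; move/eqP: Ev; apply.
apply: (good_place_energy_eq0 Kbar_closure (jP u) h (rho_adelic.2 (inr u)) F0).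
  move=> x xF; rewrite leNgt; apply/negP => xu; apply: H1; exists x => //=.
  by rewrite finite_pointsP.
move=> x y xF yF xy; rewrite -rmorphB; apply/eqP/negPn/negP => xyu; apply: H2; exists (x - y) => //=.
apply/mapP; exists (x, y) => //; rewrite mem_filter xy.
by apply/allpairsP; exists (x, y); rewrite !finite_pointsP.
Qed.

Let local_bounds v : exists p : ({fset A} -> R) * (A -> R), place_bounds
  (fun a => classical_point (M := M v) (omap (jv v) a)) (rho v) (E v) p.1 p.2 /\
  forall x, ln (abs v x) <= p.2 (Some x).
Proof.
have [E0 [f [h1 h2]]] := local_place_bounds Kbar_closure (KembP (e v)) (rho_adelic.2 v).
by exists (E0, f).
Qed.

Let E0 v := (projT1 (cid (local_bounds v))).1.
Let f v := (projT1 (cid (local_bounds v))).2.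

Let pb v : place_bounds (fun a => classical_point (M := M v) (omap (jv v) a)) (rho v) (E v) (E0 v) (f v).
Proof. by rewrite /E0 /f; case: cid => p []. Qed.

Let f_ge v x : ln (abs v x) <= f v (Some x).
Proof. by rewrite /f; case: cid => p []. Qed.

Let sumf_ge0 v F : 0 <= 2 * ((n F)^-1 * (n F)^-1 * \sum_(a <- F) f v a).
Proof. by rewrite !mulr_ge0 ?invr_ge0//; apply: sumr_ge0 => a _; exact: pb_height_ge0 (pb v) a. Qed.

Let E0_le v F : F != fset0 -> E0 v F <= E v F.
Proof. by move=> F0; rewrite (pb_energy (pb v) F0) lerDl. Qed.

Let heightE F : 2 * height e rho F = \sum_(v \in [set: place R K]) w v * E v F.
Proof. by rewrite /height mulrA divff ?mul1r// pnatr_eq0. Qed.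

Let term_le (c : place R K -> R) v F : F != fset0 -> (forall u, 0 <= c u) ->
  (forall u, S u -> - c u <= E u F) ->
  E v F <= d * (2 * `|height e rho F| + \sum_(u \in S) w u * c u).
Proof.
move=> F0 c0 cS; set B := (X in d * X).
have B0 : 0 <= B by rewrite addr_ge0 ?mulr_ge0//; apply: fsumr_ge0 => u _; rewrite mulr_ge0 ?(ltW (w0 u)).
(* The lower bound of the weight can be multiplied only by a positive energy. *)
have [E_le0|E_gt0] := leP (E v F) 0; first by apply: le_trans E_le0 (mulr_ge0 (ltW d0) B0).
rewrite mulrC -ler_pdivrMr//; apply: le_trans (_ : w v * E v F <= _).
  by rewrite mulrC ler_wpM2r// ltW.
apply: le_trans (@fsbig_ge_term _ _ (fun u => w u * E u F) (fun u => w u * c u) S v _ S_finite _ _ _) _.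
- apply: sub_finite_set (E_support F0) => u /=; apply: contra => /eqP ->.
  by rewrite mulr0.
- by move=> u; rewrite mulr_ge0 ?(ltW (w0 u)).
- by move=> u Su; rewrite -mulrN ler_pM2l ?cS.
- by move=> u Su; rewrite mulr_ge0 ?(ltW (w0 u)) ?good_ge0.
by rewrite -heightE lerD2r ler_pM2l ?ltr0n// ler_norm.
Qed.

Lemma height_northcott B : finite_set [set F | [/\ F != fset0, galois_invariant iota F,
  (#|` F| <= B)%N & `|height e rho F| <= 1]].
Proof.
have /choice[C HC] : forall v, exists C, forall F, F != fset0 -> - C <= E0 v F by move=> v; exact: pb_bound (pb v).
pose c v : R := `|C v|; pose T := d * (2 + \sum_(u \in S) w u * c u).
have c0 v : 0 <= c v by exact: normr_ge0.
have cE v F : F != fset0 -> - c v <= E0 v F by move=> F0; apply: le_trans (HC v F F0); rewrite lerN2 ler_norm.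
have sc v : S v -> c v <= \sum_(u \in S) c u.
  move=> Sv; rewrite (fsbigD1 v) ?S_finite//= lerDl; exact: fsumr_ge0.
have s0 : 0 <= \sum_(u \in S) c u by exact: fsumr_ge0.
have T0 : 0 <= T.
  apply: mulr_ge0 (ltW d0) _; rewrite addr_ge0//; apply: fsumr_ge0 => u _.
  by rewrite mulr_ge0 ?(ltW (w0 u)).
(* A bound on ln |x| for x in F: energies are at most T, a place of S adds its -E0, at most c, and
   B^2 undoes the factor 1/|F|^2. *)
pose L := B%:R ^+ 2 * (T + \sum_(u \in S) c u).
pose D := (1 + expR L) ^+ B.
have fN := @northcott_numfield R K D; set NK := (X in finite_set X) in fN.
have fP := @finite_poly_over K NK B.+1 fN.
(* F is recovered from the polynomial of its finite points, whose coefficients lie in a finite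
   subset of K, and from whether it contains infinity. *)
pose g (p : {poly K} * bool) : {fset A} := xget fset0 [set F |
  map_poly iota p.1 = \prod_(x <- finite_points F) ('X - x%:P) /\ (None \in F) = p.2].
apply: sub_finite_set (finite_image g (finite_setX fP (@finite_finset _ [set: bool]))) => F [F0 FG FB h1].
have nF : 0 < n F by rewrite ltr0n cardfs_gt0.
have nB : n F <= B%:R by rewrite ler_nat.
have ET v : E v F <= T.
  apply: le_trans (term_le v F0 c0 _) _.
    by move=> u _; apply: le_trans (cE u F F0) (E0_le u F0).
  by rewrite /T ler_pM2l// lerD2r; lra.
have n2 y Y : 2 * ((n F)^-1 * (n F)^-1 * y) <= Y -> 0 <= Y -> y <= B%:R ^+ 2 * Y.
  rewrite -invfM -expr2 mulrCA mulrC ler_pdivrMr ?exprn_gt0// => h Y0.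
  have [y0|y0] := leP y 0; first by apply: le_trans y0 _; rewrite mulr_ge0 ?exprn_ge0.
  apply: le_trans (_ : Y * n F ^+ 2 <= _); first by apply: le_trans h; lra.
  by rewrite mulrC ler_wpM2r// lerXn2r ?nnegrE.
have lnL v x : Some x \in F -> ln (abs v x) <= L.
  move=> xF; have [Sv|Sv] := pselect (S v); last first.
    apply: (n2); last by rewrite addr_ge0.
    apply: le_trans (good_height F0 Sv xF) _; apply: le_trans (ET v) _; by rewrite lerDl.
  apply: le_trans (f_ge v x) _; apply: le_trans (_ : \sum_(a <- F) f v a <= _).
    rewrite (big_fsetD1 (Some x))//= lerDl; apply: sumr_ge0 => a _; exact: pb_height_ge0 (pb v) a.
  apply: n2; last by rewrite addr_ge0.
  have := pb_energy (pb v) F0; have := ET v; have := cE v F F0; have := sc v Sv; lra.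
have absL v x : Some x \in F -> abs v x <= expR L.
  move=> /(lnL v); have [x0|x0] := leP (abs v x) 0; first by move=> _; apply: le_trans x0 (expR_ge0 _).
  by rewrite -ler_expR lnK.
have av v : is_absval (@local_abs _ _ _ (M v)) by rewrite /local_abs; case: v (M v) => v m; [exact: normc_absval | exact: na_absP].
have /choice[a aE] : forall i, exists a, iota a = (\prod_(x <- finite_points F) ('X - x%:P))`_i by move=> i; exact: galois_invariant_coefs.
set P := \prod_(x <- _) _ in aE.
have sF : (size (finite_points F) <= B)%N.
  apply: leq_trans FB; rewrite /finite_points size_pmap; exact: count_size.
have sP : (size P <= B.+1)%N by rewrite size_prod_XsubC ltnS.
pose p := \poly_(i < size P) a i.
have pE : map_poly iota p = P.
  apply/polyP => i; rewrite coef_map coef_poly; case: ltnP => [_|si]; first exact: aE.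
  by rewrite raddf0 nth_default.
have aD v i : local_abs (local_emb (M v) (a i)) <= D.
  rewrite -(KembP (e v)) aE -coef_map rmorph_prod /=.
  under eq_bigr do rewrite rmorphB /= map_polyX map_polyC /=.
  have -> : \prod_(x <- finite_points F) ('X - (jv v x)%:P) = \prod_(y <- map (jv v) (finite_points F)) ('X - y%:P) by rewrite big_map.
  apply: le_trans (absval_prod_XsubC i (av v) (expR_ge0 L) _) _.
    by move=> _ /mapP[x xF ->]; apply: absL; rewrite -finite_pointsP.
  by rewrite size_map ler_weXn2l// lerDl expR_ge0.
have aNK i : NK (a i).
  split=> v; first by have := aD (inr v) i; rewrite /= na_embP.
  by have := aD (inl v) i; rewrite /= arch_embP.
exists (p, None \in F).
  split=> //=; split=> [|i]; first by apply: leq_trans (size_poly _ _) sP.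
  rewrite coef_poly; case: ifP => // _.
  have D0 : 0 <= D by rewrite exprn_ge0// addr_ge0 ?expR_ge0.
  by split => v; [rewrite (absval0 (nonarch_placeP v).1) | rewrite (absval0 (arch_placeP v).1)].
rewrite /g; case: xgetP => [F' _ /= [PE NE]|/(_ F)]; last by case.
apply/fsetP => -[x|]; last exact: NE.
by rewrite -!finite_pointsP -!root_prod_XsubC -PE pE.
Qed.

Lemma energy_equidistribution (F : nat -> {fset A}) v : (forall i, F i != fset0) ->
  (forall B : R, \forall i \near \oo, B <= n (F i)) ->
  height e rho (F i) @[i --> \oo] --> (0 : R) ->
  weak_cvg (fun i => point_measure e v (F i)) (rho v).
Proof.
move=> F0 card hF phi cphi; apply: (pb_equidistribution (pb v)) => // eta eta0.
pose W := \sum_(u \in S) w u; have W0 : 0 <= W by apply: fsumr_ge0 => u _; exact: ltW.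
(* Shares of eta / d: one half for th W, one quarter for Q / n and one quarter for twice the
   height. *)
pose th := eta / d / 2 / (W + 1).
have W1 : 0 < W + 1 by rewrite ltr_wpDl.
have th0 : 0 < th by rewrite !divr_gt0.
have /choice[B HB] : forall u, exists B, forall F, F != fset0 -> - th - B / n F <= E0 u F by move=> u; exact: pb_lower (pb u) _ th0.
pose Q := \sum_(u \in S) w u * `|B u|.
near=> i.
have nF : 0 < n (F i) by rewrite ltr0n cardfs_gt0; exact: F0.
apply: le_trans (E0_le v (F0 i)) _.
apply: le_trans (@term_le (fun u => th + `|B u| / n (F i)) v (F i) (F0 i) _ _) _.
- move=> u; apply: addr_ge0 (ltW th0) _; exact: divr_ge0 (normr_ge0 _) (ltW nF).
- move=> u _; apply: le_trans (E0_le u (F0 i)); apply: le_trans (HB u _ (F0 i)).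
  by rewrite opprD lerD2l lerN2 ler_pM2r ?invr_gt0// ler_norm.
have -> : \sum_(u \in S) w u * (th + `|B u| / n (F i)) = th * W + Q / n (F i).
  rewrite /W /Q mulr_fsumr mulr_fsuml -fsbig_split; last exact: S_finite.
  by apply: eq_fsbigr => u _ /=; ring.
have h1 : `|height e rho (F i)| <= eta / d / 8.
  near: i; have /cvgrPdist_le /(_ (eta / d / 8)) := hF; rewrite !divr_gt0// => /(_ isT).
  by apply: filterS => i; rewrite sub0r normrN.
have h2 : Q / n (F i) <= eta / d / 4.
  rewrite ler_pdivrMr// -ler_pdivrMl ?divr_gt0//; near: i; exact: card.
have h3 : th * W <= eta / d / 2.
  rewrite /th -mulrA ler_piMr ?divr_ge0 ?(ltW eta0) ?(ltW d0)//.
  by rewrite mulrC ler_pdivrMr// mul1r lerDl.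
rewrite mulrC -ler_pdivlMr//.
by move: h1 h2 h3; move: (eta / d) => t; lra.
Unshelve. all: by end_near. Qed.

Lemma small_height_card (F : nat -> {fset A}) : (forall i, F i != fset0) ->
  (forall i j, i <> j -> F i <> F j) -> (forall i, galois_invariant iota (F i)) ->
  height e rho (F i) @[i --> \oo] --> (0 : R) ->
  forall B : R, \forall i \near \oo, B <= n (F i).
Proof.
move=> F0 Fdist FG hF B; pose B' := Num.bound `|B|.
have fI : finite_set (F @^-1` [set F | [/\ F != fset0, galois_invariant iota F,
  (#|` F| <= B')%N & `|height e rho F| <= 1]]).
  apply: finite_preimage (height_northcott B') => i j _ _ Fij.
  by apply: contrapT => /Fdist.
have /finite_seqP[s sE] := fI.
near=> i; rewrite leNgt; apply/negP => nB.
have : (F @^-1` [set F | [/\ F != fset0, galois_invariant iota F,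
  (#|` F| <= B')%N & `|height e rho F| <= 1]]) i.
  split => //; last first.
    near: i; have /cvgrPdist_le /(_ 1 ltr01) := hF.
    by apply: filterS => i; rewrite sub0r normrN.
  rewrite -(ler_nat R); by apply: le_trans (ltW nB) (le_trans (ler_norm _) (ltW (archi_boundP _))).
rewrite sE /= => si.
have : (i <= \max_(k <- s) k)%N by apply: (@leq_bigmax_seq _ s xpredT id i).
by rewrite leqNgt => /negP; apply; near: i; exact: nbhs_infty_gt.
Unshelve. all: by end_near. Qed.

End equidistribution.

Theorem mainTheorem2 (R : realType) (K : fieldExtType rat)
  (Kbar : fieldType) (iota : {rmorphism K -> Kbar})
  (Kbar_closure : is_algebraic_closure iota)
  (M : forall v : place R K, local_model v)
  (e : forall v : place R K, Kembedding M iota v)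
  (rho : adelic_family M) (rho_adelic : is_adelic_measure rho)
  (F : nat -> {fset option Kbar})
  (F_nonempty : forall n, F n != fset0)
  (F_distinct : forall m n, m <> n -> F m <> F n)
  (F_invariant : forall n, galois_invariant iota (F n))
  (F_height : height e rho (F n) @[n --> \oo] --> (0 : R)) :
  forall v : place R K,
    weak_cvg (fun n => point_measure e v (F n)) (rho v).
Proof.
move=> v; apply: (energy_equidistribution Kbar_closure rho_adelic F_nonempty _ F_height).
exact: (small_height_card Kbar_closure rho_adelic F_nonempty F_distinct F_invariant F_height).
Qed.
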